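(* Let $k \geq 2$ be an integer. Assume the Riemann hypothesis, that all nontrivial zeros of $\zeta(s)$ are simple and $J_{-1}(T) := \sum_{0<\gamma\le T} |\zeta'(\rho)|^{-2} \ll T$ for $T \ge 2$, and that there is $\varepsilon>0$ such that $|\zeta'(\rho)|^{-1} \ll |\rho|^{1/2-\varepsilon}$ for every nontrivial zero $\rho$ of $\zeta(s)$. Then the function $\widetilde{R}_{k-1}(y) := e^{-y/2}R_{k-1}(e^y)$ has a limiting distribution: there exists a probability measure $\mu_{k-1}$ on the Borel subsets of $\mathbb{R}$ such that for every bounded continuous function $f:\mathbb{R}\to\mathbb{R}$, \[\lim_{Y\to\infty}\frac{1}{Y}\int_0^Y f\big(e^{-y/2}R_{k-1}(e^y)\big)\,dy = \int_{\mathbb{R}} f(x)\,d\mu_{k-1}(x).\]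
   Context: $\phi$ denotes Euler's totient function. For an integer $k\ge 1$ and real $x\ge 1$, $F_{k-1}(x) := \frac{1}{(k-1)!}\sum_{n\le x}\phi(n)(\log(x/n))^{k-1}$ and $R_{k-1}(x) := F_{k-1}(x) - \frac{3}{2^{k-1}\pi^2}x^2$. Nontrivial zeros of $\zeta$ are written $\rho = \beta+i\gamma$ (under the Riemann hypothesis $\beta = 1/2$). *)

(* Defs.v *)
From HB Require Import structures.
From mathcomp Require Import all_boot all_order all_algebra.
From mathcomp Require Import all_classical all_reals all_analysis.
From mathcomp Require Import complex.

Set Implicit Arguments.
Unset Strict Implicit.
Unset Printing Implicit Defensive.

Import Order.TTheory GRing.Theory Num.Theory.
Import numFieldNormedType.Exports.

Local Open Scope classical_set_scope.
Local Open Scope ring_scope.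
Local Open Scope complex_scope.

(* n ^ (- s) = exp (- s log n), written out in real and imaginary parts. *)
Definition natpowN (R : realType) (n : nat) (s : R[i]) : R[i] :=
  let r := expR (- (complex.Re s * ln n%:R)) in
  let t := - (complex.Im s * ln n%:R) in
  (r * cos t) +i* (r * sin t).

(* The analytic continuation of sum_(n >= 1) n ^ (- s) to the complex plane
   minus 1; by the identity theorem it is unique there. The value at the pole
   1 is unspecified. [derivable] is taken over the scalar field R[i], so it is
   complex differentiability. *)
Definition is_riemann_zeta (R : realType) (zeta : R[i]^o -> R[i]^o) : Prop :=
  (forall s : R[i]^o, s != 1 -> derivable zeta s 1) /\
  (forall s : R[i]^o, 1 < complex.Re s ->
     (fun N : nat => (\sum_(1 <= n < N.+1) natpowN n s : R[i]^o)) @ \oo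
       --> zeta s).

(* The trivial zeros are the negative even integers; 1 is the pole. *)
Definition nontrivial_zero (R : realType) (zeta : R[i]^o -> R[i]^o)
    (rho : R[i]^o) : Prop :=
  [/\ rho != 1, zeta rho = 0 & forall n : nat, rho != - (2 * n.+1)%N%:R].

Definition riemann_hypothesis (R : realType) (zeta : R[i]^o -> R[i]^o) : Prop :=
  forall rho, nontrivial_zero zeta rho -> complex.Re rho = 2^-1.

Definition simple_zeros (R : realType) (zeta : R[i]^o -> R[i]^o) : Prop :=
  forall rho, nontrivial_zero zeta rho -> derive1 zeta rho != 0.

(* MathComp's `|z| lives in R[i]; this is the modulus as an element of R. *)
Definition cabs (R : realType) (z : R[i]) : R := complex.Re `|z|.

(* The unordered sum of nonnegative terms over the zeros with
   0 < gamma <= T, in [0, +oo]. *)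
Definition Jm1 (R : realType) (zeta : R[i]^o -> R[i]^o) (T : R) : \bar R :=
  \esum_(rho in [set rho : R[i]^o | nontrivial_zero zeta rho /\
                   0 < complex.Im rho <= T])
    ((cabs (derive1 zeta rho) ^- 2)%:E).

(* F j and Rem j are the paper's F_j and R_j, for j = k - 1. *)
Definition F (R : realType) (j : nat) (x : R) : R :=
  (j`!%:R)^-1 *
  \sum_(1 <= n < (Num.truncn x).+1) (totient n)%:R * ln (x / n%:R) ^+ j.

Definition Rem (R : realType) (j : nat) (x : R) : R :=
  F j x - 3 / (2 ^+ j * pi ^+ 2) * x ^+ 2.

(* Main.v *)
Require Import Defs.
From HB Require Import structures.
From mathcomp Require Import all_boot all_order all_algebra.
From mathcomp Require Import cyclic.
From mathcomp Require Import all_classical all_reals all_analysis.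
From mathcomp Require Import measurable_realfun complex.
From mathcomp Require Import ring lra zify.
Import Order.TTheory GRing.Theory Num.Theory.
Import numFieldNormedType.Exports.
Set Implicit Arguments.
Unset Strict Implicit.
Unset Printing Implicit Defensive.
Local Open Scope classical_set_scope.
Local Open Scope ring_scope.
Local Open Scope complex_scope.

(* Perron's formula expresses F_j(e^y) through zeta(s - 1) / (zeta(s) s^(j+1)).
   Damped by the Gaussian factor exp(d^2 s^2 / 2) with d = e^(-8 y0), the integral
   can be moved past the critical line along heights where Borel-Caratheodory
   bounds 1 / zeta by e^(C T), and on [y0, y0 + 1] the residues show
   e^(-y/2) R_j(e^y) to be a finite exponential sum over the zeros, up to
   O(e^(-y0/4)). By the functional equation its coefficients are
   O(1 / |rho zeta'(rho)|), so the hypothesis on J_(-1) makes the part with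
   |gamma| > L small in mean square on every unit interval (smooth weight, Schur's
   test, and O(sqrt T) zeros in a unit window). Thus e^(-y/2) R_j(e^y) is an
   averaged L^1 limit of trigonometric polynomials; its compositions with ramp
   functions have mean values, from which the distribution function of the limit
   law is read off. *)

(** The Gaussian factor compensates for a weak input. On good heights only [1 / zeta << e^(C T)] is
    proved, because the number [n] of zeros near height [T] is bounded by O(sqrt T): keeping away
    from them by [1 / (2 (n + 1))] costs [e^(O(n^2)) = e^(O(T))]. The factor [e^(- d^2 T^2 / 2)]
    beats this once [T] is large in terms of [d]. The value [d = e^(-8 y0)] balances the two places
    where the damping does harm: replacing it by 1 on [Re s = 4] costs [e^(4 y) d^(1/2)], and on the
    left edge [Re s = -3/2] it enters as [d^(-1/8)] against [e^(- 3 y / 2)]. The functional equation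
    is derived with the Gamma factor already eliminated: inserting the Fourier series of the
    Bernoulli polynomials B_5 and B_3 into Euler-Maclaurin expresses [zeta s] and [zeta (s + 2)]
    through one and the same sine integral, which cancels. The moduli of the resulting identity on
    [Re s = -1/2, -3/2, -5/2] bound both the coefficients and the left edge. Averaged L^1
    approximability is stable under sums, scalars and absolute values; ramps are combinations of
    absolute values, which is why test functions are approximated by ramps. *)

Section AlmostPeriodic.
Variable R : realType.
Local Notation mu := (@lebesgue_measure R).
Implicit Types (h p q : R -> R) (a b x y Y : R).

(** * Integrals over segments, trigonometric polynomials, and means of the functions they
    approximate *)

Definition rI h a b : R := \int[mu]_(x in `[a, b]) h x.

Lemma cont_integrable h a b : continuous h -> mu.-integrable `[a, b] (EFin \o h).
Proof.
move=> ch; apply: continuous_compact_integrable; first exact: segment_compact.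
exact: continuous_subspaceT.
Qed.

Lemma rI_le h p a b : continuous h -> continuous p ->
  (forall x, a <= x <= b -> h x <= p x) -> rI h a b <= rI p a b.
Proof.
move=> ch cp H; apply: le_Rintegral => //; try exact: cont_integrable.
Qed.

Lemma rI_split h a b c : continuous h -> a <= b -> b <= c ->
  rI h a c = rI h a b + rI h b c.
Proof.
move=> ch ab bc; have ih : mu.-integrable `[a, c] (EFin \o h) by exact: cont_integrable.
have := @Rintegral_itvB _ h (BLeft a) (BRight c) b ih.
rewrite !bnd_simp => /(_ ab bc).
rewrite Rintegral_itv_obnd_cbnd; first by move=> E; rewrite /rI -E addrC subrK.
apply: integrableS ih => // x /=; rewrite !in_itv /= => /andP[/ltW bx ->].
by rewrite (le_trans ab).
Qed.

Lemma rID h p a b : continuous h -> continuous p ->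
  rI (fun x => h x + p x) a b = rI h a b + rI p a b.
Proof. by move=> ch cp; rewrite /rI RintegralD //; exact: cont_integrable. Qed.

Lemma rIB h p a b : continuous h -> continuous p ->
  rI (fun x => h x - p x) a b = rI h a b - rI p a b.
Proof. by move=> ch cp; rewrite /rI RintegralB //; exact: cont_integrable. Qed.

Lemma rIZ h a b c : continuous h -> rI (fun x => c * h x) a b = c * rI h a b.
Proof. by move=> ch; rewrite /rI RintegralZl //; exact: cont_integrable. Qed.

Lemma rI_cst a b c : a <= b -> rI (fun=> c) a b = c * (b - a).
Proof.
move=> ab; rewrite /rI Rintegral_cst //= lebesgue_measure_itv /= lte_fin.
move: ab; rewrite le_eqVlt => /predU1P[->|ab]; first by rewrite ltxx subrr mulr0.
by rewrite ab.
Qed.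

Lemma eq_rI h p a b : (forall x, h x = p x) -> rI h a b = rI p a b.
Proof. by move=> E; apply: eq_Rintegral => x _; exact: E. Qed.

Lemma rI_norm h a b : continuous h -> `|rI h a b| <= rI (fun x => `|h x|) a b.
Proof. by move=> ch; apply: le_normr_Rintegral => //; exact: cont_integrable. Qed.

Lemma rI_ge0 h a b : (forall x, 0 <= h x) -> 0 <= rI h a b.
Proof. by move=> H; apply: Rintegral_ge0 => x _; exact: H. Qed.

Lemma rI_FTC (H h : R -> R) a b : a <= b -> continuous h ->
  (forall x, is_derive x 1 H (h x)) -> rI h a b = H b - H a.
Proof.
rewrite le_eqVlt => /predU1P[<-|ab] ch dH.
  by rewrite /rI set_itv1 Rintegral_set1 subrr.
have cH x : {for x, continuous H}.
  by have [dd _] := dH x; exact/differentiable_continuous/derivable1_diffP.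
rewrite /rI /Rintegral (@continuous_FTC2 _ h H) //.
- exact: continuous_subspaceT.
- split.
  + by move=> x _; case: (dH x).
  + by apply: cvg_at_right_filter; exact: cH.
  + by apply: cvg_at_left_filter; exact: cH.
- by move=> x _; rewrite derive1E; case: (dH x).
Qed.

Lemma continuous_abs h : continuous h -> continuous (fun x => `|h x|).
Proof. by move=> ch x; apply: continuous_comp; [exact: ch | exact: norm_continuous]. Qed.

Lemma contD h p : continuous h -> continuous p -> continuous (fun x => h x + p x).
Proof. by move=> ch cp x; apply: continuousD; [exact: ch|exact: cp]. Qed.
Lemma contB h p : continuous h -> continuous p -> continuous (fun x => h x - p x).
Proof. by move=> ch cp x; apply: continuousB; [exact: ch|exact: cp]. Qed.
Lemma contM h p : continuous h -> continuous p -> continuous (fun x => h x * p x).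
Proof. by move=> ch cp x; apply: continuousM; [exact: ch|exact: cp]. Qed.
Lemma cont_cst (c : R) : continuous (fun _ : R => c).
Proof. by move=> x; exact: cvg_cst. Qed.

(* a trigonometric polynomial is coded by its (amplitude, frequency, phase) list *)
Definition trigp (l : seq (R * R * R)) y := \sum_(t <- l) t.1.1 * cos (t.1.2 * y + t.2).
Definition is_trig p := exists l, forall y, p y = trigp l y.

Lemma trigp_cont l : continuous (trigp l).
Proof.
elim: l => [|t l IH].
  have -> : trigp [::] = fun=> 0 by apply/funext => y; rewrite /trigp big_nil.
  exact: cont_cst.
have -> : trigp (t :: l) = fun y => t.1.1 * cos (t.1.2 * y + t.2) + trigp l y.
  by apply/funext => y; rewrite /trigp big_cons.
apply: contD => //; apply: contM; first exact: cont_cst.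
move=> y; apply: (@continuous_comp _ _ _ (fun y => t.1.2 * y + t.2) cos); last exact: continuous_cos.
apply: continuousD; last exact: cvg_cst.
by apply: continuousM; [exact: cvg_cst|exact: cvg_id].
Qed.

Lemma is_trig_cont p : is_trig p -> continuous p.
Proof.
move=> [l E]; have -> : p = trigp l by apply/funext.
exact: trigp_cont.
Qed.

Lemma is_trig_cst c : is_trig (fun=> c).
Proof.
by exists [:: (c, 0, 0)] => y; rewrite /trigp big_seq1 /= mul0r addr0 cos0 mulr1.
Qed.

Lemma is_trigD p q : is_trig p -> is_trig q -> is_trig (fun y => p y + q y).
Proof. by move=> [l E] [m F]; exists (l ++ m) => y; rewrite /trigp big_cat E F. Qed.

Lemma is_trigZ p c : is_trig p -> is_trig (fun y => c * p y).
Proof.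
move=> [l E]; exists [seq (c * t.1.1, t.1.2, t.2) | t <- l] => y.
by rewrite E /trigp big_map mulr_sumr; apply: eq_bigr => t _; rewrite mulrA.
Qed.

(** The product-to-sum formula for cosines turns each pair of terms into two, with the sum and the
    difference of frequencies and phases and half the product of the amplitudes. *)
Lemma is_trigM p q : is_trig p -> is_trig q -> is_trig (fun y => p y * q y).
Proof.
move=> [l E] [m F].
have -> : (fun y => p y * q y) = (fun y => trigp l y * q y) by apply/funext => y; rewrite E.
elim: l {E} => [|t l IH].
  by exists [::] => y; rewrite /trigp !big_nil mul0r.
have -> : (fun y => trigp (t :: l) y * q y) =
   (fun y => t.1.1 * cos (t.1.2 * y + t.2) * q y + trigp l y * q y).
  by apply/funext => y; rewrite /trigp big_cons mulrDl.
apply: is_trigD => //.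
exists ([seq (t.1.1 * s.1.1 / 2, t.1.2 + s.1.2, t.2 + s.2) | s <- m] ++
   [seq (t.1.1 * s.1.1 / 2, t.1.2 - s.1.2, t.2 - s.2) | s <- m]) => y.
rewrite F /trigp big_cat !big_map /= -big_split mulr_sumr; apply: eq_bigr => s _ /=.
have -> : (t.1.2 + s.1.2) * y + (t.2 + s.2) = (t.1.2 * y + t.2) + (s.1.2 * y + s.2) by ring.
have -> : (t.1.2 - s.1.2) * y + (t.2 - s.2) = (t.1.2 * y + t.2) - (s.1.2 * y + s.2) by ring.
by move: (_ + t.2) (_ + s.2) => u v; rewrite cosB cosD; field.
Qed.

Lemma is_trig_bounded p : is_trig p -> exists2 K : R, 0 < K & forall y, `|p y| <= K.
Proof.
move=> [l E]; exists (1 + \sum_(t <- l) `|t.1.1|).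
  by rewrite ltr_pwDl // sumr_ge0.
move=> y; rewrite E /trigp; apply: (le_trans (ler_norm_sum _ _ _)).
rewrite ler_wpDl //; apply: ler_sum => t _; rewrite normrM ler_piMr //.
by rewrite ler_norml cos_geN1 cos_le1.
Qed.

(** A term of frequency 0 is constant and supplies the mean; any other term has a bounded primitive,
    so the total error stays bounded and disappears after division by [Y]. *)
Lemma is_trig_mean p : is_trig p -> exists m C : R, 0 <= C /\
  forall Y, 0 <= Y -> `|rI p 0 Y - m * Y| <= C.
Proof.
move=> [l E]; have -> : p = trigp l by apply/funext.
elim: l {p E} => [|t l [m [C [C0 IH]]]].
  exists 0, 0; split => // Y Y0.
  have -> : trigp [::] = fun=> 0 by apply/funext => y; rewrite /trigp big_nil.
  by rewrite rI_cst // !mul0r subrr normr0.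
pose c y := cos (t.1.2 * y + t.2).
have cc : continuous c.
  move=> y; apply: (@continuous_comp _ _ _ (fun y => t.1.2 * y + t.2) cos); last exact: continuous_cos.
  apply: continuousD; last exact: cvg_cst.
  by apply: continuousM; [exact: cvg_cst|exact: cvg_id].
have [m1 [C1 [C10 H1]]] : exists m C : R, 0 <= C /\ forall Y, 0 <= Y -> `|rI c 0 Y - m * Y| <= C.
  have [w0|w0] := eqVneq t.1.2 0.
    exists (cos t.2), 0; split=> // Y Y0.
    rewrite (@eq_rI _ (fun=> cos t.2)) ?rI_cst // ?subr0 ?subrr ?normr0 //.
    by move=> y; rewrite /c w0 mul0r add0r.
  exists 0, (2 / `|t.1.2|); split; first by rewrite divr_ge0.
  move=> Y Y0; rewrite mul0r subr0.
  have -> : rI c 0 Y = (t.1.2)^-1 * sin (t.1.2 * Y + t.2) - (t.1.2)^-1 * sin (t.1.2 * 0 + t.2).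
    apply: (@rI_FTC (fun y => (t.1.2)^-1 * sin (t.1.2 * y + t.2))) => // y.
    have dl : is_derive y 1 (fun y => t.1.2 * y + t.2) t.1.2.
      have -> : (fun y => t.1.2 * y + t.2) = (fun y => t.1.2 *: y + t.2) by [].
      by apply: is_derive_eq; rewrite /GRing.scale /= mulr1 addr0.
    have := @is_derive1_comp _ (@sin R) (fun y => t.1.2 * y + t.2) y _ _ (is_derive_sin _) dl.
    move=> /(@is_deriveZ _ _ _ _ (t.1.2)^-1) /(@is_derive_eq _ _ _ _ _ _ _ _); apply.
    by rewrite /GRing.scale /= mulrCA mulVf // mulr1.
  rewrite -mulrBr normrM normfV mulrC ler_pM2r ?invr_gt0 ?normr_gt0 //.
  apply: (le_trans (ler_normB _ _)); rewrite (_ : 2 = 1 + 1) //; apply: lerD.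
    by rewrite ler_norml sin_geN1 sin_le1.
  by rewrite ler_norml sin_geN1 sin_le1.
exists (t.1.1 * m1 + m), (`|t.1.1| * C1 + C); split; first by rewrite addr_ge0 ?mulr_ge0.
move=> Y Y0; rewrite (@eq_rI _ (fun y => t.1.1 * c y + trigp l y)); last first.
  by move=> y; rewrite /trigp big_cons.
rewrite rID ?rIZ //; [|by apply: contM => //; exact: cont_cst|exact: trigp_cont].
have -> : t.1.1 * rI c 0 Y + rI (trigp l) 0 Y - (t.1.1 * m1 + m) * Y =
  t.1.1 * (rI c 0 Y - m1 * Y) + (rI (trigp l) 0 Y - m * Y) by ring.
apply: (le_trans (ler_normD _ _)); apply: lerD; last exact: IH.
by rewrite normrM ler_wpM2l // H1.
Qed.

(* The classical iteration for the square root, giving polynomials in [u]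
   converging to [|u|] uniformly on [-1, 1]. *)
Fixpoint abs_poly n (u : R) : R :=
  if n is n'.+1 then abs_poly n' u + (u ^+ 2 - abs_poly n' u ^+ 2) / 2 else 0.

(** The recursion gives [|u| - P' = (|u| - P) (1 - (|u| + P) / 2)], so the error contracts by at
    least [1 - |u| / 2]. The third clause is an inductive form of the bound
    [|u| / (1 + n |u| / 2) <= 2 / n], which is uniform although the contraction degenerates at 0. *)
Lemma abs_polyP n u : `|u| <= 1 ->
  [/\ 0 <= abs_poly n u, abs_poly n u <= `|u| &
      (`|u| - abs_poly n u) * (1 + n%:R * `|u| / 2) <= `|u|].
Proof.
move=> u1; set x := `|u|.
elim: n => [|n [h1 h2 h3]] /=.
  by rewrite subr0 mul0r mul0r addr0 mulr1 lexx normr_ge0.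
have x0 : 0 <= x by exact: normr_ge0.
rewrite -(real_normK (num_real u)) -/x; set v := abs_poly n u in h1 h2 h3 *.
have n0 : 0 <= n%:R :> R by [].
have x1 : x <= 1 by [].
have xv : 0 <= (x - v) * (1 - (x + v) / 2) by rewrite mulr_ge0; lra.
split; [by move: xv; nra|by move: xv; rewrite !expr2; lra|].
rewrite -[n.+1]addn1 natrD.
have -> : x - (v + (x ^+ 2 - v ^+ 2) / 2) = (x - v) * (1 - (x + v) / 2) by field.
have a1 : 1 - (x + v) / 2 <= 1 - x / 2 by lra.
have a2 : 0 <= x - v by lra.
apply: (@le_trans _ _ ((x - v) * (1 - x / 2) * (1 + (n%:R + 1) * x / 2))).
  apply: ler_wpM2r; first by nra.
  exact: ler_wpM2l.
(* It remains to compare [(1 - x / 2) (1 + (n + 1) x / 2)] with [1 + n x / 2]; the difference is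
   [(n + 1) x^2 / 4]. *)
apply: le_trans h3; rewrite -mulrA; apply: ler_wpM2l => //.
have : 0 <= (n%:R + 1) * x ^+ 2 by rewrite mulr_ge0 ?sqr_ge0 // addr_ge0.
by rewrite expr2; lra.
Qed.

Lemma is_trig_abs_poly n p : is_trig p -> is_trig (fun y => abs_poly n (p y)).
Proof.
move=> tp; elim: n => [|n IH] /=; first exact: is_trig_cst.
have -> : (fun y => abs_poly n (p y) + (p y ^+ 2 - abs_poly n (p y) ^+ 2) / 2) =
  (fun y => abs_poly n (p y) + (2^-1 * (p y * p y) + (- 2^-1) * (abs_poly n (p y) * abs_poly n (p y)))).
  by apply/funext => y; rewrite !expr2; ring.
by apply: is_trigD => //; apply: is_trigD; apply: is_trigZ; exact: is_trigM.
Qed.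

(** Trigonometric polynomials form an algebra of bounded functions, so [abs_poly] applied to [p / K]
    stays in the class; scaling back by [K], the bound of [abs_polyP] gives an error of at most
    [2 K / n]. *)
Lemma is_trig_abs p (e : R) : is_trig p -> 0 < e ->
  exists2 q, is_trig q & forall y, `| `|p y| - q y| <= e.
Proof.
move=> tp e0; have [K K0 HK] := is_trig_bounded tp.
pose n := (Num.truncn (2 * K / e)).+1.
exists (fun y => K * abs_poly n (K^-1 * p y)).
  by apply: is_trigZ; apply: is_trig_abs_poly; exact: is_trigZ.
move=> y; have u1 : `|K^-1 * p y| <= 1.
  by rewrite normrM normfV (gtr0_norm K0) mulrC ler_pdivrMr // mul1r.
have [h1 h2 h3] := abs_polyP n u1.
have -> : `|p y| = K * `|K^-1 * p y|.
  by rewrite normrM normfV (gtr0_norm K0) mulrA divff ?gt_eqF // mul1r.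
rewrite -mulrBr normrM (gtr0_norm K0) ger0_norm ?subr_ge0 //.
set x := `|K^-1 * p y| in h2 h3 *; set v := abs_poly _ _ in h1 h2 h3 *.
have nK : 2 * K / e < n%:R by exact: truncnS_gt.
have n0 : 0 < n%:R :> R by rewrite ltr0n.
have x0 : 0 <= x by exact: normr_ge0.
have d2 : (x - v) * n%:R <= 2.
  move: x0; rewrite le_eqVlt => /predU1P[x0|x0].
    have -> : v = 0 by lra.
    by rewrite -x0 subrr mul0r.
  have : (x - v) * n%:R * (x / 2) <= 2 * (x / 2) by nra.
  by rewrite ler_pM2r // divr_gt0.
have : K * (x - v) * n%:R <= e * n%:R.
  apply: (@le_trans _ _ (2 * K)); first by rewrite -mulrA mulrC; nra.
  by move: nK; rewrite ltr_pdivrMr // (mulrC e) => /ltW.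
by rewrite ler_pM2r.
Qed.

(** Closeness is measured in L^1 on unit windows, and only from some point on. This matches an
    explicit formula valid on [[y0, y0 + 1]] with an error vanishing as [y0] grows, and it still
    determines mean values. *)
Definition AP h := continuous h /\ forall e : R, 0 < e -> exists p, is_trig p /\
  exists2 y1 : R, 0 <= y1 & forall y, y1 <= y -> rI (fun x => `|h x - p x|) y (y + 1) <= e.

Lemma AP_trig p : is_trig p -> AP p.
Proof.
move=> tp; split; first exact: is_trig_cont.
move=> e e0; exists p; split => //; exists 0 => // y _.
rewrite (@eq_rI _ (fun=> 0)) ?rI_cst ?mul0r ?(ltW e0) // ?lerDl //.
by move=> x; rewrite subrr normr0.
Qed.

Lemma APD h k : AP h -> AP k -> AP (fun y => h y + k y).
Proof.
move=> [ch Hh] [ck Hk]; split; first exact: contD.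
move=> e e0; have e2 : 0 < e / 2 by rewrite divr_gt0.
have [p [tp [y1 y10 Hp]]] := Hh _ e2; have [q [tq [y2 y20 Hq]]] := Hk _ e2.
have cp := is_trig_cont tp; have cq := is_trig_cont tq.
exists (fun y => p y + q y); split; first exact: is_trigD.
exists (y1 + y2); first exact: addr_ge0.
move=> y yy; have h1 := Hp y; have h2 := Hq y.
apply: (@le_trans _ _ (rI (fun x => `|h x - p x| + `|k x - q x|) y (y + 1))).
  apply: rI_le.
  - by apply/continuous_abs/contB; exact: contD.
  - by apply: contD; apply/continuous_abs/contB.
  - move=> x _; apply: le_trans (ler_normD _ _).
    by rewrite le_eqVlt; apply/orP; left; apply/eqP; congr (`|_|); ring.
rewrite rID; [|by apply/continuous_abs/contB|by apply/continuous_abs/contB].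
by have := Hp y; have := Hq y; lra.
Qed.

Lemma APZ h c : AP h -> AP (fun y => c * h y).
Proof.
move=> [ch Hh]; split; first by apply: contM => //; exact: cont_cst.
move=> e e0; have e2 : 0 < e / (`|c| + 1) by rewrite divr_gt0 // ltr_wpDl.
have [p [tp [y1 y10 Hp]]] := Hh _ e2; have cp := is_trig_cont tp.
exists (fun y => c * p y); split; first exact: is_trigZ.
exists y1 => // y /Hp H.
rewrite (@eq_rI _ (fun x => `|c| * `|h x - p x|)); last by move=> x; rewrite -mulrBr normrM.
rewrite rIZ; last exact/continuous_abs/contB.
move: H; rewrite ler_pdivlMr ?ltr_wpDl //; apply: le_trans.
rewrite mulrC; apply: ler_wpM2l; last by rewrite lerDl.
by apply: rI_ge0.
Qed.

(** The absolute value is 1-Lipschitz, so it does not increase the window distance between [h] and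
    [p]; the only new error is the uniform one from [is_trig_abs]. *)
Lemma AP_abs h : AP h -> AP (fun y => `|h y|).
Proof.
move=> [ch Hh]; split; first exact: continuous_abs.
move=> e e0; have e2 : 0 < e / 2 by rewrite divr_gt0.
have [p [tp [y1 y10 Hp]]] := Hh _ e2; have [q tq Hq] := is_trig_abs tp e2.
have cp := is_trig_cont tp; have cq := is_trig_cont tq.
exists q; split => //; exists y1 => // y /Hp H.
apply: (@le_trans _ _ (rI (fun x => `|h x - p x| + e / 2) y (y + 1))).
  apply: rI_le.
  - by apply/continuous_abs/contB => //; exact: continuous_abs.
  - by apply: contD; [exact/continuous_abs/contB|exact: cont_cst].
  - move=> x _; have -> : `|h x| - q x = (`|h x| - `|p x|) + (`|p x| - q x) by ring.
    apply: (le_trans (ler_normD _ _)); apply: lerD => //.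
    exact: ler_dist_dist.
rewrite rID; [|exact/continuous_abs/contB|exact: cont_cst].
by rewrite rI_cst ?lerDl //; lra.
Qed.

Definition mean h (m : R) := Y^-1 * rI h 0 Y @[Y --> +oo] --> m.

(** The averages are Cauchy: for large [Y] they are within [e] of the mean of an approximating
    trigonometric polynomial. *)
Lemma AP_mean h : AP h -> exists m, mean h m.
Proof.
move=> [ch Hh].
suff : cvg (Y^-1 * rI h 0 Y @[Y --> +oo]) by move=> /cvg_ex[m Hm]; exists m.
apply/cauchy_cvgP; apply: cauchy_exP => e e0.
have e2 : 0 < e / 4 by rewrite divr_gt0.
have [p [tp [y1 y10 Hp]]] := Hh _ e2; have [m [C [C0 Hm]]] := is_trig_mean tp.
have cp := is_trig_cont tp.
exists m; rewrite /fmap /=.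
pose u x := `|h x - p x|; have cu : continuous u by exact/continuous_abs/contB.
have un n : rI u y1 (y1 + n%:R) <= n%:R * (e / 4).
  elim: n => [|n IH]; first by rewrite addr0 mul0r /rI set_itv1 Rintegral_set1.
  rewrite -[n.+1]addn1 natrD addrA (@rI_split _ _ (y1 + n%:R)) ?lerDl // mulrDl mul1r.
  by apply: lerD => //; apply: Hp; rewrite lerDl.
(* [B] gathers what does not grow with [Y]: the part before [y1], the rounding up to a whole number
   of windows, and the bounded error in the mean of [p]. *)
pose B := rI u 0 y1 + e + C; have B0 : 0 <= B.
  apply: addr_ge0 => //; apply: addr_ge0; last exact: ltW.
  by apply: rI_ge0 => x; exact: normr_ge0.
near=> Y; rewrite /ball /=.
have Y0 : 0 < Y by near: Y; apply: nbhs_pinfty_gt; exact: num_real.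
have Yy1 : y1 <= Y by near: Y; apply: nbhs_pinfty_ge; exact: num_real.
have YB : 4 * B / e < Y by near: Y; apply: nbhs_pinfty_gt; exact: num_real.
have key : rI u 0 Y <= rI u 0 y1 + (Y - y1 + 1) * (e / 4).
  rewrite (@rI_split _ 0 y1) // lerD2l.
  pose n := (Num.truncn (Y - y1)).+1.
  have n1 : Y - y1 < n%:R by exact: truncnS_gt.
  have n2 : n%:R <= Y - y1 + 1.
    by rewrite /n -[_.+1]addn1 natrD lerD2r truncn_le // subr_ge0.
  apply: (@le_trans _ _ (rI u y1 (y1 + n%:R))).
    rewrite (@rI_split _ y1 Y (y1 + n%:R)) //; last lra.
    by rewrite lerDl; apply: rI_ge0 => x; exact: normr_ge0.
  by apply: (le_trans (un n)); rewrite ler_pM2r.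
have D : `|rI h 0 Y - rI p 0 Y| <= rI u 0 Y by rewrite -rIB //; apply: rI_norm; exact: contB.
have E : `|rI h 0 Y - m * Y| < e * Y.
  have -> : rI h 0 Y - m * Y = (rI h 0 Y - rI p 0 Y) + (rI p 0 Y - m * Y) by ring.
  apply: (le_lt_trans (ler_normD _ _)); have := Hm Y (ltW Y0).
  move: YB; rewrite ltr_pdivrMr // /B => YB hm.
  have Ye : 0 < Y * e by rewrite mulr_gt0.
  have : y1 * e >= 0 by rewrite mulr_ge0 // ltW.
  move: key D hm YB; move: (rI u 0 y1) (rI u 0 Y) => A1 A2; lra.
rewrite (_ : m - Y^-1 * rI h 0 Y = - (Y^-1 * (rI h 0 Y - m * Y))); last first.
  by field; rewrite gt_eqF.
by rewrite normrN normrM gtr0_norm ?invr_gt0 // mulrC ltr_pdivrMr.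
Unshelve. all: end_near. Qed.

Lemma mean_le h k m n : continuous h -> continuous k -> (forall x, h x <= k x) ->
  mean h m -> mean k n -> m <= n.
Proof.
move=> ch ck H mh mk; apply: (ler_cvg_to mh mk).
near=> Y; rewrite ler_wpM2l ?invr_ge0 //; exact: rI_le.
Unshelve. all: end_near. Qed.

Lemma mean_cst c : mean (fun=> c) c.
Proof.
apply: cvg_near_cst; near=> Y.
have Y0 : 0 < Y by near: Y; apply: nbhs_pinfty_gt; exact: num_real.
by rewrite rI_cst ?ltW // subr0 mulrCA mulVf ?gt_eqF // mulr1.
Unshelve. all: end_near. Qed.

Lemma meanD h k m n : continuous h -> continuous k -> mean h m -> mean k n ->
  mean (fun x => h x + k x) (m + n).
Proof.
move=> ch ck mh mk; rewrite /mean.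
have -> : (fun Y => Y^-1 * rI (fun x => h x + k x) 0 Y) =
  (fun Y => Y^-1 * rI h 0 Y + Y^-1 * rI k 0 Y).
  by apply/funext => Y; rewrite rID // mulrDr.
exact: cvgD.
Qed.

Lemma meanZ h m c : continuous h -> mean h m -> mean (fun x => c * h x) (c * m).
Proof.
move=> ch mh; rewrite /mean.
have -> : (fun Y => Y^-1 * rI (fun x => c * h x) 0 Y) = (fun Y => c * (Y^-1 * rI h 0 Y)).
  by apply/funext => Y; rewrite rIZ // mulrCA.
by apply: cvgM => //; exact: cvg_cst.
Qed.

End AlmostPeriodic.

(** * The limit law, constructed from mean values of ramps *)

Section LimitingDistribution.
Variable R : realType.
Implicit Types (f g h : R -> R) (a b c e u v x y : R).

(** Heine's theorem by a supremum argument: let [s] be the supremum of the right ends up to which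
    some modulus works; continuity at [s] pushes such a right end beyond [s] unless [b] is
    reached. *)
Lemma unif_cont f a b e : continuous f -> a <= b -> 0 < e ->
  exists2 d : R, 0 < d & forall u v, a <= u <= b -> a <= v <= b -> `|u - v| < d ->
    `|f u - f v| < e.
Proof.
move=> cf ab e0.
pose P c := exists2 d : R, 0 < d & forall u v, a <= u <= c -> a <= v <= c -> `|u - v| < d ->
    `|f u - f v| < e.
pose S := [set c | a <= c <= b /\ P c].
have Sa : S a.
  split; first by rewrite lexx ab.
  by exists 1 => // u v ua va _; (have -> : u = v by lra); rewrite subrr normr0.
have S0 : S !=set0 by exists a.
have Sub : ubound S b by move=> c [/andP[]].
have hS : has_sup S by split=> //; exists b.
pose s := sup S.
have sa : a <= s by apply: ub_le_sup => //; exists b.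
have sb : s <= b by apply: ge_sup.
have [eta eta0 Heta] : exists2 d : R, 0 < d & forall u, `|u - s| < d -> `|f u - f s| < e / 2.
  have /cvgrPdist_lt/(_ _ (divr_gt0 e0 (ltr0Sn R 1))) := cf s.
  move=> /nbhs_ballP[d /= d0 H]; exists d => // u us; rewrite distrC; apply: H.
  by rewrite /ball /= distrC.
have eta2 : 0 < eta / 2 by rewrite divr_gt0.
have [c [/andP[ac cb] [d d0 Hd]] cs] := sup_adherent eta2 hS.
rewrite -/s in cs.
(* A pair of points closer than [eta / 2] either lies below [c] or has both members within [eta] of
   [s]. *)
pose s' := Num.min b (s + eta / 2).
have Ps' : P s'.
  exists (Num.min d (eta / 2)); first by rewrite lt_min d0.
  move=> u v /andP[au us] /andP[av vs]; rewrite lt_min => /andP[uvd uve].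
  have us' : u <= s + eta / 2 by move: us; rewrite /s' le_min => /andP[].
  have vs' : v <= s + eta / 2 by move: vs; rewrite /s' le_min => /andP[].
  have [/andP[uc vc]|] := boolP ((u <= c) && (v <= c)); first by apply: Hd; rewrite ?au ?av.
  rewrite negb_and -!ltNge => uvc.
  have h1 : `|f u - f s| < e / 2.
    by apply: Heta; move: uve; rewrite !ltr_norml; clear -us' vs' cs uvc; case/orP: uvc; lra.
  have h2 : `|f v - f s| < e / 2.
    by apply: Heta; move: uve; rewrite !ltr_norml; clear -us' vs' cs uvc; case/orP: uvc; lra.
  by move: h1 h2; rewrite !ltr_norml; clear; lra.
have [bs|bs] := leP b (s + eta / 2).
  by move: Ps'; rewrite /s' (min_idPl bs).
have : S s'.
  split=> //; rewrite /s' (min_idPr (ltW bs)); apply/andP; split; clear -sa eta2 bs; lra.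
move=> Ss'; have : s' <= s by apply: ub_le_sup => //; exists b.
by rewrite /s' (min_idPr (ltW bs)); lra.
Qed.

(** A continuous stand-in for the indicator of []-oo, x]]: it is 1 up to [x], then linear, and 0
    from [x + e] on. It is written with absolute values so that [AP_abs] applies after composition
    with [g]. *)
Definition ramp x e u : R := 1 / 2 + (`|u - x - e| - `|u - x|) / (2 * e).

Lemma ramp_lo x e u : 0 < e -> u <= x -> ramp x e u = 1.
Proof.
move=> e0 ux; rewrite /ramp !ler0_norm; [|lra|lra].
by field; rewrite gt_eqF.
Qed.

Lemma ramp_hi x e u : 0 < e -> x + e <= u -> ramp x e u = 0.
Proof.
move=> e0 ux; rewrite /ramp !ger0_norm; [|lra|lra].
by field; rewrite gt_eqF.
Qed.

Lemma ramp_mid x e u : 0 < e -> x <= u <= x + e -> ramp x e u = 1 - (u - x) / e.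
Proof.
move=> e0 ux; rewrite /ramp ler0_norm; last lra.
rewrite ger0_norm; last lra.
by field; rewrite gt_eqF.
Qed.

Lemma ramp01 x e u : 0 < e -> 0 <= ramp x e u <= 1.
Proof.
move=> e0; have [h|h] := leP u x; first by rewrite ramp_lo // ler01 lexx.
have [h'|h'] := leP (x + e) u; first by rewrite ramp_hi // ler01 lexx.
rewrite ramp_mid ?(ltW h) ?(ltW h') // subr_ge0 gerBl ler_pdivrMr // divr_ge0 ?subr_ge0 ?ltW //.
by lra.
Qed.

Lemma ramp_le x x' e e' u : 0 < e -> 0 < e' -> x + e <= x' -> ramp x e u <= ramp x' e' u.
Proof.
move=> e0 e'0 xx'; have [h|h] := leP u x'.
  by rewrite (ramp_lo e'0 h); case/andP: (ramp01 x u e0).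
rewrite (@ramp_hi x) //; last lra.
by case/andP: (ramp01 x' u e'0).
Qed.

Lemma ramp_mono x x' e u : 0 < e -> x <= x' -> ramp x e u <= ramp x' e u.
Proof.
move=> e0 xx'; have [h|h] := leP u x'.
  by rewrite (ramp_lo e0 h); case/andP: (ramp01 x u e0).
have [h'|h'] := leP (x + e) u.
  by rewrite (ramp_hi e0 h'); case/andP: (ramp01 x' u e0).
rewrite !ramp_mid //; [|lra|lra].
by rewrite lerD2l lerN2 ler_pM2r ?invr_gt0 //; lra.
Qed.

(** The slope of a ramp is [- 1 / e]. This bound is the source of the right continuity of [dist]. *)
Lemma ramp_shift x x' e u : 0 < e -> x <= x' -> ramp x' e u <= ramp x e u + (x' - x) / e.
Proof.
move=> e0 xx'; have q0 : 0 <= (x' - x) / e by rewrite divr_ge0 ?subr_ge0 // ltW.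
have /andP[p0 p1] := ramp01 x' u e0; have /andP[p2 p3] := ramp01 x u e0.
have [h|h] := leP u x; first by rewrite (ramp_lo e0 h); lra.
have [h'|h'] := leP (x' + e) u; first by rewrite (ramp_hi e0 h'); lra.
have [k|k] := leP (x + e) u.
  rewrite (ramp_hi e0 k) add0r; have [k'|k'] := leP u x'.
    by rewrite ramp_lo // ler_pdivlMr //; lra.
  rewrite ramp_mid //; last lra.
  have -> : 1 - (u - x') / e = (x' - x) / e - (u - x - e) / e by field; rewrite gt_eqF.
  by rewrite gerBl divr_ge0 ?(ltW e0) //; lra.
rewrite (@ramp_mid x) //; last lra.
have -> : 1 - (u - x) / e + (x' - x) / e = 1 - (u - x') / e by field; rewrite gt_eqF.
have [k'|k'] := leP u x'; last by rewrite ramp_mid //; lra.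
rewrite ramp_lo // lerDl oppr_ge0 pmulr_lle0 ?invr_gt0 //; lra.
Qed.

Lemma ramp_cont x e : continuous (ramp x e).
Proof.
apply: contD; first exact: cont_cst.
apply: contM; last exact: cont_cst.
have ci : continuous (fun u : R => u) by move=> u; exact: cvg_id.
by apply: contB; apply: continuous_abs; do ?apply: contB => //; exact: cont_cst.
Qed.

Variable g : R -> R.
Hypothesis APg : AP g.

Let cg : continuous g := APg.1.

Lemma AP_ramp x e : 0 < e -> AP (fun y => ramp x e (g y)).
Proof.
move=> e0.
have aff c : AP (fun y => `|g y - c|).
  by apply: AP_abs; apply: APD => //; exact: AP_trig (is_trig_cst _).
have -> : (fun y => ramp x e (g y)) =
  (fun y => 1 / 2 + (2 * e)^-1 * (`|g y - (x + e)| + (-1) * `|g y - x|)).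
  by apply/funext => y; rewrite /ramp opprD addrA; ring.
apply: APD; first exact: AP_trig (is_trig_cst _).
by apply: APZ; apply: APD => //; exact: APZ.
Qed.

Let rg_cont x e : continuous (fun y => ramp x e (g y)).
Proof. by move=> y; apply: continuous_comp; [exact: cg|exact: ramp_cont]. Qed.

Definition Lam x e : R := lim (Y^-1 * rI (fun y => ramp x e (g y)) 0 Y @[Y --> +oo]).

Lemma LamP x e : 0 < e -> mean (fun y => ramp x e (g y)) (Lam x e).
Proof. by move=> e0; have [m Hm] := AP_mean (AP_ramp x e0); rewrite /Lam (cvg_lim _ Hm). Qed.

Lemma Lam01 x e : 0 < e -> 0 <= Lam x e <= 1.
Proof.
move=> e0; apply/andP; split.
  apply: (@mean_le R (fun=> 0) (fun y => ramp x e (g y))).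
  - exact: cont_cst.
  - exact: rg_cont.
  - by move=> y; case/andP: (ramp01 x (g y) e0).
  - exact: mean_cst.
  - exact: LamP.
apply: (@mean_le R (fun y => ramp x e (g y)) (fun=> 1)).
- exact: rg_cont.
- exact: cont_cst.
- by move=> y; case/andP: (ramp01 x (g y) e0).
- exact: LamP.
- exact: mean_cst.
Qed.

Lemma Lam_le x x' e e' : 0 < e -> 0 < e' -> x + e <= x' -> Lam x e <= Lam x' e'.
Proof.
move=> e0 e'0 h; apply: (@mean_le R (fun y => ramp x e (g y)) (fun y => ramp x' e' (g y))).
- exact: rg_cont.
- exact: rg_cont.
- by move=> y; exact: ramp_le.
- exact: LamP.
- exact: LamP.
Qed.

Lemma Lam_mono x x' e : 0 < e -> x <= x' -> Lam x e <= Lam x' e.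
Proof.
move=> e0 h; apply: (@mean_le R (fun y => ramp x e (g y)) (fun y => ramp x' e (g y))).
- exact: rg_cont.
- exact: rg_cont.
- by move=> y; exact: ramp_mono.
- exact: LamP.
- exact: LamP.
Qed.

Lemma Lam_shift x x' e : 0 < e -> x <= x' -> Lam x' e <= Lam x e + (x' - x) / e.
Proof.
move=> e0 h; apply: (@mean_le R (fun y => ramp x' e (g y)) (fun y => ramp x e (g y) + (x' - x) / e)).
- exact: rg_cont.
- by apply: contD; [exact: rg_cont|exact: cont_cst].
- by move=> y; exact: ramp_shift.
- exact: LamP.
- by apply: meanD; [exact: rg_cont|exact: cont_cst|exact: LamP|exact: mean_cst].
Qed.

(** The future distribution function. Ramps at [x] dominate the indicator of []-oo, x]], so the
    infimum over their widths is an upper mean of that indicator; this choice makes the function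
    continuous from the right. *)
Definition dist x : R := inf [set Lam x e | e in [set e : R | 0 < e]].

Lemma Lam_has_lbound x : has_lbound [set Lam x e | e in [set e : R | 0 < e]].
Proof. by exists 0 => _ [e e0 <-]; case/andP: (Lam01 x e0). Qed.

Lemma Lam_nonempty x : [set Lam x e | e in [set e : R | 0 < e]] !=set0.
Proof. by exists (Lam x 1), 1 => //=. Qed.

Lemma dist_le_Lam x e : 0 < e -> dist x <= Lam x e.
Proof. by move=> e0; apply: (ge_inf (Lam_has_lbound x)); exists e. Qed.

(** Together with [dist_le_Lam] this encloses [Lam x e] between [dist x] and [dist (x + e)], the
    same interval in which [law_ramp] places the integral of the ramp. *)
Lemma Lam_le_dist x x' e : 0 < e -> x + e <= x' -> Lam x e <= dist x'.
Proof.
by move=> e0 h; apply: (lb_le_inf (Lam_nonempty x')) => _ [e' /= e'0 <-]; exact: Lam_le.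
Qed.

Lemma dist_nd : nondecreasing dist.
Proof.
move=> x x' xx'; apply: (lb_le_inf (Lam_nonempty x')) => _ [e /= e0 <-].
exact: le_trans (dist_le_Lam x e0) (Lam_mono e0 xx').
Qed.

Lemma dist_right x eps : 0 < eps -> exists2 d : R, 0 < d &
  forall x', x <= x' -> x' < x + d -> dist x' <= dist x + eps.
Proof.
move=> e0; have e2 : 0 < eps / 2 by rewrite divr_gt0.
have [_ [e /= e'0 <-] He] := inf_adherent e2 (conj (Lam_nonempty x) (Lam_has_lbound x)).
(* Half of [eps] pays for the choice of the width [e], the other half for the shift, which costs
   [(x' - x) / e]. *)
exists (e * (eps / 2)); first exact: mulr_gt0.
move=> x' xx' h; apply: (le_trans (dist_le_Lam x' e'0)).
apply: (le_trans (Lam_shift e'0 xx')); rewrite -/(dist x) in He.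
have : (x' - x) / e <= eps / 2 by rewrite ler_pdivrMr // mulrC; lra.
lra.
Qed.

Lemma dist_rc : right_continuous dist.
Proof.
move=> x; apply/cvgrPdist_le => eps e0; have [d d0 H] := dist_right x e0.
near=> x'; have xx' : x < x' by near: x'; exact: nbhs_right_gt.
have := H x' (ltW xx'); have x'd : x' < x + d by near: x'; apply: nbhs_right_lt; rewrite ltrDl.
move=> /(_ x'd) h; have h' := dist_nd (ltW xx').
by rewrite distrC ger0_norm ?subr_ge0 // lerBlDl.
Unshelve. all: end_near. Qed.

Lemma abs_mean : exists2 K : R, 0 <= K & mean (fun y => `|g y|) K.
Proof.
have [K HK] := AP_mean (AP_abs APg); exists K => //.
apply: (@mean_le R (fun=> 0) (fun y => `|g y|)) => //.
- exact: cont_cst.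
- exact: continuous_abs.
- exact: mean_cst.
Qed.

(** Markov's inequality for the mean [K] of [|g|]: pointwise [1 - |u| / x <= ramp x e u], and
    [K / x <= eps] once [x >= (K + 1) / eps]. With [dist_Ny] this is tightness: no mass escapes to
    infinity. *)
Lemma dist_y eps : 0 < eps -> exists2 A : R, 0 < A & forall x, A <= x -> 1 - eps <= dist x.
Proof.
move=> e0; have [K K0 HK] := abs_mean; exists ((K + 1) / eps); first by rewrite divr_gt0 // ltr_wpDl.
move=> x Ax; have x0 : 0 < x by apply: lt_le_trans Ax; rewrite divr_gt0 // ltr_wpDl.
apply: (lb_le_inf (Lam_nonempty x)) => _ [e /= e'0 <-].
have h : 1 + (- x^-1) * K <= Lam x e.
  apply: (@mean_le R (fun y => 1 + (- x^-1) * `|g y|) (fun y => ramp x e (g y))).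
  - by apply: contD; [exact: cont_cst|apply: contM; [exact: cont_cst|exact: continuous_abs]].
  - exact: rg_cont.
  - move=> y; have [l|l] := leP (g y) x.
      by rewrite (ramp_lo e'0 l) mulNr gerBl mulr_ge0 ?invr_ge0 // ltW.
    have /andP[r0 _] := ramp01 x (g y) e'0; apply: le_trans r0.
    by rewrite mulNr subr_le0 ler_pdivlMl // mulr1 (le_trans (ltW l)) // ler_norm.
  - apply: meanD; [exact: cont_cst| |exact: mean_cst|].
      by apply: contM; [exact: cont_cst|exact: continuous_abs].
    by apply: meanZ => //; exact: continuous_abs.
  - exact: LamP.
apply: le_trans h; rewrite mulNr lerD2l lerN2 mulrC ler_pdivrMr //.
move: Ax; rewrite ler_pdivrMr // mulrC; lra.
Qed.

Lemma dist_Ny eps : 0 < eps -> exists2 A : R, 0 < A & forall x, x <= - A -> 0 <= dist x <= eps.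
Proof.
(* The extra 1 makes room for a ramp of width 1: where it is nonzero,
   [g < x + 1 <= - (K + 1) / eps]. *)
move=> e0; have [K K0 HK] := abs_mean; exists ((K + 1) / eps + 1); first by rewrite ltr_wpDl // divr_ge0 ?ltW // ltr_wpDl.
move=> x Ax; apply/andP; split.
  by apply: (lb_le_inf (Lam_nonempty x)) => _ [e /= e'0 <-]; case/andP: (Lam01 x e'0).
apply: (le_trans (dist_le_Lam x ltr01)).
set A := (K + 1) / eps in Ax; have A0 : 0 < A by rewrite divr_gt0 // ltr_wpDl.
have h : Lam x 1 <= A^-1 * K.
  apply: (@mean_le R (fun y => ramp x 1 (g y)) (fun y => A^-1 * `|g y|)); last 2 first.
  - exact: LamP.
  - by apply: meanZ => //; exact: continuous_abs.
  - exact: rg_cont.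
  - by apply: contM; [exact: cont_cst|exact: continuous_abs].
  move=> y; have [l|l] := leP (x + 1) (g y).
    by rewrite (ramp_hi ltr01 l) mulr_ge0 ?invr_ge0 // ltW.
  have /andP[_ r1] := ramp01 x (g y) (ltr01); apply: (le_trans r1).
  rewrite ler_pdivlMl // mulr1; apply: le_trans (_ : - g y <= _); first lra.
  by rewrite -normrN ler_norm.
apply: (le_trans h); rewrite ler_pdivrMl // /A.
by rewrite divfK ?gt_eqF //; lra.
Qed.

Lemma dist_cvgy : dist x @[x --> +oo] --> (1 : R).
Proof.
apply/cvgrPdist_le => eps /dist_y[A A0 H]; near=> x.
have Ax : A <= x by near: x; apply: nbhs_pinfty_ge; exact: num_real.
have := H x Ax; have : dist x <= 1.
  by apply: (le_trans (dist_le_Lam x ltr01)); case/andP: (Lam01 x (ltr01)).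
by move=> h1 h2; rewrite ler_norml; lra.
Unshelve. all: end_near. Qed.

Lemma dist_cvgNy : dist x @[x --> -oo] --> (0 : R).
Proof.
apply/cvgrPdist_le => eps /dist_Ny[A A0 H]; near=> x.
have Ax : x <= - A by near: x; apply: nbhs_ninfty_le; exact: num_real.
by have /andP[h1 h2] := H x Ax; rewrite ler_norml; lra.
Unshelve. all: end_near. Qed.

HB.instance Definition _ := isCumulative.Build R _ R dist dist_nd dist_rc.
HB.instance Definition _ := isCumulativeBounded.Build R 0 1 dist dist_cvgNy dist_cvgy.

Definition limit_law : probability (measurableTypeR R) R :=
  lebesgue_stieltjes_measure (dist : cumulativeBounded (0 : R) (1 : R)).

Lemma limit_law_ray x : limit_law `]-oo, x]%classic = (dist x)%:E.
Proof.
have := @cdf_lebesgue_stieltjes_id R (dist : cumulativeBounded (0 : R) (1 : R)) x.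
by rewrite /cdf /distribution /pushforward /= preimage_id.
Qed.

Local Notation P := limit_law.

Lemma bounded_integrable h (M : R) : continuous h -> (forall x, `|h x| <= M) ->
  P.-integrable setT (EFin \o h).
Proof.
move=> ch hM; apply: (@le_integrable _ _ _ P _ measurableT _ (EFin \o cst M)).
- by apply/measurable_EFinP; exact: continuous_measurable_fun.
- by move=> x _ /=; rewrite lee_fin (le_trans (hM x)) // ler_norm.
- exact: finite_measure_integrable_cst.
Qed.

(** The ramp lies between the indicators of []-oo, x]] and []-oo, x + e]], whose masses are values
    of [dist]. *)
Lemma law_ramp x e : 0 < e -> dist x <= \int[P]_u ramp x e u <= dist (x + e).
Proof.
move=> e0.
have ir : P.-integrable setT (EFin \o ramp x e).
  apply: (@bounded_integrable _ 1); first exact: ramp_cont.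
  by move=> u; have /andP[? ?] := ramp01 x u e0; rewrite ger0_norm.
have ind y : P.-integrable setT (EFin \o \1_(`]-oo, y]%classic : set R)) /\
    \int[P]_u (\1_(`]-oo, y]%classic : set R) u : R) = dist y.
  split; first exact: integrable_indic.
  rewrite /Rintegral integral_indic // setIT.
  by transitivity (fine (dist y)%:E) => //; congr fine; exact: limit_law_ray.
have [i1 E1] := ind x; have [i2 E2] := ind (x + e).
rewrite -E1 -E2; apply/andP; split; apply: le_Rintegral => // u _.
  rewrite indicE; case: (boolP (u \in _)) => [|_]; last by case/andP: (ramp01 x u e0).
  by rewrite inE /= in_itv /= => ux; rewrite ramp_lo.
rewrite indicE; case: (boolP (u \in _)) => [_|]; first by case/andP: (ramp01 x u e0).
by rewrite notin_setE /= in_itv /= => /negP; rewrite -ltNge => ux; rewrite ramp_hi // ltW.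
Qed.

(** A single ramp width has to serve all nodes of a step function at once. *)
Lemma dist_right_fin (x : nat -> R) n eta : 0 < eta -> exists2 d : R, 0 < d &
  forall i e, (i <= n)%N -> 0 < e -> e < d -> dist (x i + e) <= dist (x i) + eta.
Proof.
move=> eta0; elim: n => [|n [d d0 H]].
  have [d d0 H] := dist_right (x 0%N) eta0; exists d => // i e.
  by rewrite leqn0 => /eqP -> e0 ed; apply: H; rewrite ?lerDl ?(ltW e0) // ltrD2l.
have [d' d'0 H'] := dist_right (x n.+1) eta0; exists (Num.min d d'); first by rewrite lt_min d0.
move=> i e; rewrite leq_eqVlt ltnS lt_min => /predU1P[->|ih] e0 /andP[ed ed'].
  by apply: H'; rewrite ?lerDl ?(ltW e0) // ltrD2l.
exact: H.
Qed.

Section StepRamps.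
Variables (f : R -> R) (x : nat -> R) (e : R).
Hypothesis e0 : 0 < e.
Let I y := \int[P]_u ramp y e u.
(** A step function with nodes [x i], smoothed by ramps: the differences of consecutive ramps act as
    a partition of unity between the nodes, and their means and their integrals are both under
    control. *)
Let s n u := \sum_(0 <= i < n) f (x i.+1) * (ramp (x i.+1) e u - ramp (x i) e u).

Lemma ramps_cont n : continuous (s n).
Proof.
elim: n => [|n IH].
  have -> : s 0 = fun=> 0 by apply/funext => u; rewrite /s big_geq.
  exact: cont_cst.
have -> : s n.+1 = fun u => s n u + f (x n.+1) * (ramp (x n.+1) e u - ramp (x n) e u).
  by apply/funext => u; rewrite /s big_nat_recr.
apply: contD => //; apply: contM; first exact: cont_cst.
by apply: contB; exact: ramp_cont.
Qed.

Lemma ramps_bounded n : exists K : R, forall u, `|s n u| <= K.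
Proof.
exists (\sum_(0 <= i < n) `|f (x i.+1)|) => u.
apply: (le_trans (ler_norm_sum _ _ _)); apply: ler_sum => i _.
rewrite normrM ler_piMr //.
have := ramp01 (x i) u e0; have := ramp01 (x i.+1) u e0.
by rewrite ler_norml; lra.
Qed.

Lemma ramps_mean n : mean (fun y => s n (g y))
  (\sum_(0 <= i < n) f (x i.+1) * (Lam (x i.+1) e - Lam (x i) e)).
Proof.
elim: n => [|n IH].
  have -> : (fun y => s 0 (g y)) = fun=> 0 by apply/funext => u; rewrite /s big_geq.
  by rewrite big_geq //; exact: mean_cst.
rewrite big_nat_recr //=.
have -> : (fun y => s n.+1 (g y)) = fun y => s n (g y) +
    f (x n.+1) * (ramp (x n.+1) e (g y) + (-1) * ramp (x n) e (g y)).
  by apply/funext => u; rewrite /s big_nat_recr //= mulN1r.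
have c1 : continuous (fun y => (-1) * ramp (x n) e (g y)).
  by apply: contM; [exact: cont_cst|exact: rg_cont].
have c2 : continuous (fun y => ramp (x n.+1) e (g y) + (-1) * ramp (x n) e (g y)).
  by apply: contD => //; exact: rg_cont.
apply: meanD => //.
- by move=> y; apply: continuous_comp; [exact: cg|exact: ramps_cont].
- by apply: contM => //; exact: cont_cst.
- rewrite -(mulN1r (Lam (x n) e)); apply: meanZ => //; apply: meanD => //.
  + exact: LamP.
  + by apply: meanZ; [exact: rg_cont|exact: LamP].
Qed.

Let ramp_int y : P.-integrable setT (EFin \o ramp y e).
Proof.
apply: (@bounded_integrable _ 1); first exact: ramp_cont.
by move=> u; have /andP[? ?] := ramp01 y u e0; rewrite ger0_norm.
Qed.

Lemma ramps_int n : \int[P]_u s n u = \sum_(0 <= i < n) f (x i.+1) * (I (x i.+1) - I (x i)).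
Proof.
elim: n => [|n IH].
  have -> : s 0 = fun=> 0 by apply/funext => u; rewrite /s big_geq.
  by rewrite big_geq // Rintegral_cst // mul0r.
rewrite big_nat_recr //= -IH.
have -> : s n.+1 = fun u => s n u + f (x n.+1) * (ramp (x n.+1) e u - ramp (x n) e u).
  by apply/funext => u; rewrite /s big_nat_recr.
have [K HK] := ramps_bounded n.
have iB : P.-integrable setT (EFin \o (fun u => ramp (x n.+1) e u - ramp (x n) e u)).
  by have := integrableB measurableT (ramp_int (x n.+1)) (ramp_int (x n)).
rewrite RintegralD //.
- by rewrite RintegralZl // RintegralB.
- exact: bounded_integrable (@ramps_cont n) HK.
- by have := integrableZl measurableT (f (x n.+1)) iB.
Qed.

(** At each node the mean and the integral of the ramp both lie in [[dist (x i), dist (x i + e)]],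
    so they differ by at most [eta]; each of the [n] summands involves two nodes. *)
Lemma ramps_close n (M eta : R) : (forall y, `|f y| <= M) ->
  (forall i, (i <= n)%N -> dist (x i + e) <= dist (x i) + eta) ->
  `|\sum_(0 <= i < n) f (x i.+1) * (Lam (x i.+1) e - Lam (x i) e) - \int[P]_u s n u| <=
  n%:R * (M * (2 * eta)).
Proof.
move=> fM H; rewrite ramps_int -sumrB.
have close i : (i <= n)%N -> `|Lam (x i) e - I (x i)| <= eta.
  move=> /H h; have := law_ramp (x i) e0; rewrite -/(I (x i)) => hI.
  have := dist_le_Lam (x i) e0; have := Lam_le_dist e0 (lexx (x i + e)) => h1 h2.
  move: h h1 h2 hI; rewrite ler_norml.
  by move: (dist (x i + e)) (dist (x i)) (Lam (x i) e) (I (x i)) => A B C D *; lra.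
apply: (le_trans (ler_norm_sum _ _ _)).
rewrite (_ : n%:R * _ = \sum_(0 <= i < n) M * (2 * eta)); last first.
  by rewrite sumr_const_nat subn0 mulr_natl.
rewrite big_nat [leRHS]big_nat; apply: ler_sum => i /andP[_ ni].
rewrite -mulrBr normrM; apply: ler_pM => //.
have := close i (ltnW ni); have := close i.+1 ni; rewrite !ler_norml.
by move: (Lam (x i) e) (I (x i)) (Lam (x i.+1) e) (I (x i.+1)) => A B C D *; lra.
Qed.

(** Since the ramp differences telescope, [f - s] is [f] times the defect of the partition of unity
    plus a weighted sum of oscillations of [f]. A weight is nonzero only on []x i, x i.+1 + e[],
    where the oscillation is at most [eps]. *)
Lemma ramps_approx n (M eps : R) : 0 <= eps -> (forall y, `|f y| <= M) ->
  (forall i, x i <= x i.+1) ->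
  (forall i u, (i < n)%N -> x i < u -> u < x i.+1 + e -> `|f u - f (x i.+1)| <= eps) ->
  forall u, `|f u - s n u| <= eps + M * (1 - ramp (x n) e u + ramp (x 0%N) e u).
Proof.
move=> eps0 fM xS H u.
have tel : \sum_(0 <= i < n) (ramp (x i.+1) e u - ramp (x i) e u) =
    ramp (x n) e u - ramp (x 0%N) e u by rewrite telescope_sumr.
have mono i : 0 <= ramp (x i.+1) e u - ramp (x i) e u by rewrite subr_ge0 ramp_mono.
have -> : f u - s n u = f u * (1 - ramp (x n) e u + ramp (x 0%N) e u) +
   \sum_(0 <= i < n) (f u - f (x i.+1)) * (ramp (x i.+1) e u - ramp (x i) e u).
  rewrite /s [X in _ = _ + X](eq_bigr (fun i => f u * (ramp (x i.+1) e u - ramp (x i) e u) -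
     f (x i.+1) * (ramp (x i.+1) e u - ramp (x i) e u))); last by move=> i _; rewrite mulrBl.
  by rewrite sumrB -mulr_sumr tel; ring.
have r0 := ramp01 (x 0%N) u e0; have rn := ramp01 (x n) u e0.
apply: (le_trans (ler_normD _ _)); rewrite addrC; apply: lerD.
  apply: (le_trans (ler_norm_sum _ _ _)).
  apply: (@le_trans _ _ (\sum_(0 <= i < n) eps * (ramp (x i.+1) e u - ramp (x i) e u))).
    rewrite big_nat [leRHS]big_nat; apply: ler_sum => i /andP[_ ni].
    rewrite normrM (ger0_norm (mono i)).
    have [ux|ux] := leP u (x i).
      by rewrite !ramp_lo // ?subrr ?mulr0 // (le_trans ux).
    have [ue|ue] := leP (x i.+1 + e) u.
      by rewrite !ramp_hi // ?subrr ?mulr0 // (le_trans _ ue) // lerD2r.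
    by apply: ler_wpM2r; [exact: mono|exact: H].
  rewrite -mulr_sumr tel; have : 0 <= ramp (x n) e u - ramp (x 0%N) e u.
    by rewrite -tel sumr_ge0.
  by move=> ?; rewrite ler_piMr //; lra.
by rewrite normrM; apply: ler_pM => //; rewrite ger0_norm; lra.
Qed.

End StepRamps.

(** The error of [s] is not uniformly small, since nothing is known of [f] near infinity. It is
    dominated by a function [b] whose mean along [g] and whose integral are both small, by
    tightness. *)
Lemma limit_law_approx f (M eps : R) : continuous f -> (forall x, `|f x| <= M) -> 0 < eps ->
  exists s b : R -> R, exists m n : R,
  [/\ [/\ continuous s, continuous b, forall u, `|f u - s u| <= b u &
          exists K : R, forall u, `|s u| <= K /\ `|b u| <= K],
      mean (fun y => s (g y)) m /\ `|m - \int[P]_u s u| <= eps,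
      mean (fun y => b (g y)) n /\ n <= eps & \int[P]_u b u <= eps].
Proof.
move=> cf fM e0; have M0 : 0 <= M by apply: le_trans (fM 0).
(* Chosen so that [e1 + M (e1 + e1) = eps]: a uniform error [e1], plus [M] times the mass at the two
   ends, at most [e1] each. *)
pose e1 := eps / (2 * M + 1); have e10 : 0 < e1 by rewrite divr_gt0 //; lra.
have e1E : e1 + M * (2 * e1) = eps by rewrite /e1; field; rewrite gt_eqF //; lra.
have [B B0 HB] := dist_y e10; have [A A0 HA] := dist_Ny e10.
(* One unit below [- A], so that a ramp at [a] of width less than 1 ends before [- A]. *)
pose a := - A - 1; have aB : a < B by rewrite /a; lra.
have aB1 : a <= B + 1 by lra.
have [d d0 Hd] := unif_cont cf aB1 e10.
pose N := (Num.truncn ((B - a) / d)).+1; have N0 : 0 < N%:R :> R by rewrite ltr0n.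
pose h := (B - a) / N%:R; have h0 : 0 < h by rewrite divr_gt0 // subr_gt0.
have hd : h < d by rewrite /h ltr_pdivrMr // mulrC -ltr_pdivrMr // truncnS_gt.
pose x (i : nat) := a + i%:R * h.
have xS i : x i.+1 = x i + h by rewrite /x -[i.+1]addn1 natrD; ring.
have xN : x N = B by rewrite /x /h; field; rewrite gt_eqF.
have x0 : x 0%N = a by rewrite /x mul0r addr0.
have xmono i : x i <= x i.+1 by rewrite xS lerDl ltW.
have xB i : (i <= N)%N -> a <= x i <= B.
  move=> iN; rewrite -xN -x0 /x; apply/andP; split; rewrite lerD2l ler_pM2r // ler_nat //.
(* [ramps_close] loses [N M (2 eta)], which then equals [eps M / (M + 1)]. *)
pose eta := eps / (2 * N%:R * (M + 1)).
have M1 : 0 < M + 1 by lra.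
have eta0 : 0 < eta by rewrite divr_gt0 // !mulr_gt0.
have [d1 d10 Hd1] := dist_right_fin x N eta0.
pose e := Num.min (Num.min 1 d) d1 / 2.
have [e'0 e'1 e'd e'd1] : [/\ 0 < e, e < 1, e < d & e < d1].
  have m0 : 0 < Num.min (Num.min 1 d) d1 by rewrite !lt_min ltr01 d0.
  have : Num.min (Num.min 1 d) d1 <= 1 /\ Num.min (Num.min 1 d) d1 <= d /\
      Num.min (Num.min 1 d) d1 <= d1 by rewrite !ge_min !lexx !orbT.
  by rewrite /e; move: (Num.min _ _) m0 => w w0 [w1 [w2 w3]]; split; clear -cg rg_cont w0 w1 w2 w3 d0 d10; lra.
pose s n u := \sum_(0 <= i < n) f (x i.+1) * (ramp (x i.+1) e u - ramp (x i) e u).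
pose b u := e1 + M * (1 - ramp B e u + ramp a e u).
have [K HK] := ramps_bounded f x e'0 N.
exists (s N), b, (\sum_(0 <= i < N) f (x i.+1) * (Lam (x i.+1) e - Lam (x i) e)),
  (e1 + M * (1 - Lam B e + Lam a e)).
have rl y : \int[P]_u ramp y e u <= dist (y + e) by case/andP: (law_ramp y e'0).
have rl' y : dist y <= \int[P]_u ramp y e u by case/andP: (law_ramp y e'0).
have cr y : continuous (ramp y e) by exact: ramp_cont.
have cb : continuous b.
  apply: contD; first exact: cont_cst; apply: contM; first exact: cont_cst.
  by apply: contD => //; apply: contB => //; exact: cont_cst.
have bK u : `|b u| <= e1 + M * 2.
  have := ramp01 B u e'0; have := ramp01 a u e'0 => h1 h2.
  have : 0 <= M * (1 - ramp B e u + ramp a e u) by rewrite mulr_ge0 //; clear -cg rg_cont h1 h2; lra.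
  have : M * (1 - ramp B e u + ramp a e u) <= M * 2 by rewrite ler_wpM2l //; clear -cg rg_cont h1 h2; lra.
  by rewrite /b ler_norml; clear -cg rg_cont e10; lra.
split.
- split => //.
  + exact: ramps_cont.
  + rewrite /b -xN -x0; apply: ramps_approx => //; first exact: ltW.
    move=> i u iN xu ux; apply/ltW/Hd.
    * have := xB i (ltnW iN); have := xB i.+1 iN; clear -cg rg_cont xu ux e'1 e'0; lra.
    * have := xB i.+1 iN; clear -cg rg_cont aB; lra.
    * by move: (xS i) => E; rewrite ltr_norml; clear -cg rg_cont E xu ux hd e'd e'0; lra.
  + exists (K + (e1 + M * 2)) => u; have := HK u; have := bK u.
    have := normr_ge0 (b u); rewrite -/(s N u); have := normr_ge0 (s N u); clear -cg rg_cont; lra.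
- split; first exact: ramps_mean.
  apply: le_trans (@ramps_close f x e e'0 N M eta fM _) _.
    by move=> i iN; exact: Hd1.
  rewrite /eta; have -> : N%:R * (M * (2 * (eps / (2 * N%:R * (M + 1))))) = eps * (M / (M + 1)).
    by field; rewrite !gt_eqF.
  by rewrite ler_piMr ?(ltW e0) // ler_pdivrMr // mul1r lerDl.
- split.
    have -> : (fun y => b (g y)) = fun y => e1 + M * ((1 + (-1) * ramp B e (g y)) + ramp a e (g y)).
      by apply/funext => y; rewrite /b mulN1r.
    have c1 : continuous (fun y => (-1) * ramp B e (g y)).
      by apply: contM; [exact: cont_cst|exact: rg_cont].
    have c2 : continuous (fun y => 1 + (-1) * ramp B e (g y)).
      by apply: contD => //; exact: cont_cst.
    have c3 : continuous (fun y => 1 + (-1) * ramp B e (g y) + ramp a e (g y)).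
      by apply: contD => //; exact: rg_cont.
    apply: meanD; [exact: cont_cst| |exact: mean_cst|].
      by apply: contM => //; exact: cont_cst.
    apply: meanZ; first exact: c3.
    apply: meanD; [exact: c2|exact: rg_cont| |exact: LamP].
    rewrite -(mulN1r (Lam B e)); apply: meanD; [exact: cont_cst|exact: c1|exact: mean_cst|].
    by apply: meanZ; [exact: rg_cont|exact: LamP].
  have h1 := dist_le_Lam B e'0.
  have h2 : Lam a e <= dist (- A) by apply: Lam_le_dist => //; rewrite /a -addrA gerDl addrC subr_le0 ltW.
  rewrite -e1E lerD2l ler_wpM2l //.
  have HBB := HB B (lexx _); have /andP[_ HAA] := HA (- A) (lexx _); move: h1 h2 HBB HAA.
  by move: (Lam B e) (Lam a e) (dist B) (dist (- A)) => p q r t; clear -cg rg_cont; lra.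
- have i1 y : P.-integrable setT (EFin \o ramp y e).
    by apply: (@bounded_integrable _ 1) => // u; have /andP[? ?] := ramp01 y u e'0; rewrite ger0_norm.
  have ic c : P.-integrable setT (EFin \o (fun=> c : R)).
    by apply: (@bounded_integrable _ `|c|) => // y; exact: cont_cst.
  have cint c : \int[P]_u (c : R) = c by rewrite Rintegral_cst //= probability_setT /= mulr1.
  have i2 : P.-integrable setT (EFin \o (fun u => 1 - ramp B e u)).
    by have := integrableB measurableT (ic 1) (i1 B).
  have i3 : P.-integrable setT (EFin \o (fun u => 1 - ramp B e u + ramp a e u)).
    by have := integrableD measurableT i2 (i1 a).
  have i4 : P.-integrable setT (EFin \o (fun u => M * (1 - ramp B e u + ramp a e u))).
    by have := integrableZl measurableT M i3.
  rewrite /b RintegralD // cint RintegralZl // RintegralD // RintegralB // cint.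
  have h2 : \int[P]_u ramp a e u <= dist (- A).
    by apply: (le_trans (rl a)); apply: dist_nd; rewrite /a -addrA gerDl addrC subr_le0 ltW.
  have h1 := rl' B.
  rewrite -e1E lerD2l ler_wpM2l //.
  have HBB := HB B (lexx _); have /andP[_ HAA] := HA (- A) (lexx _); move: h1 h2 HBB HAA.
  by move: (\int[P]_u ramp B e u) (\int[P]_u ramp a e u) (dist B) (dist (- A)) => p q r t; clear -cg rg_cont; lra.
Qed.

Theorem limiting_distribution f : continuous f -> (exists M : R, forall x, `|f x| <= M) ->
  Y^-1 * (\int[@lebesgue_measure R]_(y in `[0, Y]) f (g y)) @[Y --> +oo] --> \int[P]_x f x.
Proof.
move=> cf [M fM]; apply/cvgrPdist_le => eps e0.
have e4 : 0 < eps / 4 by rewrite divr_gt0.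
have [s [b [m [n [[cs cb fsb [K HK]] [ms mP] [mb nP] bP]]]]] := limit_law_approx cf fM e4.
have is_ : P.-integrable setT (EFin \o s) by apply: (@bounded_integrable _ K) => // u; case: (HK u).
have ib : P.-integrable setT (EFin \o b) by apply: (@bounded_integrable _ K) => // u; case: (HK u).
have if_ : P.-integrable setT (EFin \o f) by exact: bounded_integrable fM.
have D1 : `|\int[P]_u f u - \int[P]_u s u| <= eps / 4.
  rewrite -RintegralB //; apply: (le_trans (le_normr_Rintegral measurableT _)).
    by have := integrableB measurableT if_ is_.
  apply: le_trans bP; apply: le_Rintegral => //.
    apply: (@bounded_integrable _ K); first exact/continuous_abs/contB.
    move=> u; rewrite normr_id (le_trans (fsb u)) // (le_trans (ler_norm _)) //.
    by case: (HK u).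
have cfg : continuous (fun y => f (g y)) by move=> y; apply: continuous_comp; [exact: cg|exact: cf].
have csg : continuous (fun y => s (g y)) by move=> y; apply: continuous_comp; [exact: cg|exact: cs].
have cbg : continuous (fun y => b (g y)) by move=> y; apply: continuous_comp; [exact: cg|exact: cb].
(* Budget: [eps / 4] each for [f] against [s] under the law, for the mean of [s] against its
   integral, and for the mean of [b]; [eps / 8] twice for the convergence in [Y]. *)
near=> Y.
have Y0 : 0 < Y by near: Y; apply: nbhs_pinfty_gt; exact: num_real.
have h1 : `|m - Y^-1 * rI (fun y => s (g y)) 0 Y| <= eps / 8.
  by near: Y; apply: (cvgrPdist_le _ _).1 ms _ _; rewrite divr_gt0.
have h2 : `|n - Y^-1 * rI (fun y => b (g y)) 0 Y| <= eps / 8.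
  by near: Y; apply: (cvgrPdist_le _ _).1 mb _ _; rewrite divr_gt0.
rewrite -/(rI (fun y => f (g y)) 0 Y).
have h3 : `|Y^-1 * rI (fun y => f (g y)) 0 Y - Y^-1 * rI (fun y => s (g y)) 0 Y| <=
    Y^-1 * rI (fun y => b (g y)) 0 Y.
  rewrite -mulrBr normrM gtr0_norm ?invr_gt0 // ler_pM2l ?invr_gt0 // -rIB //.
  apply: (le_trans (rI_norm _ _ _)); first exact: contB.
  by apply: rI_le => //; exact/continuous_abs/contB.
move: h1 h2 h3 D1 mP nP; rewrite !ler_norml; clear bP.
move: (Y^-1 * rI (fun y => f (g y)) 0 Y) (Y^-1 * rI (fun y => s (g y)) 0 Y) (Y^-1 * rI (fun y => b (g y)) 0 Y).
by move: (\int[P]_u f u) (\int[P]_u s u) => *; lra.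
Unshelve. all: end_near. Qed.

End LimitingDistribution.

Notation ii := (Complex 0 1).
Local Notation rc := (real_complex _).
Local Notation cRe := complex.Re.
Local Notation cIm := complex.Im.

(** * Complex numbers through modulus and coordinates *)

Section Modulus.
Variable R : realType.
Implicit Types (x y : R) (z w : R[i]).

Lemma normC_cabs z : `|z| = (cabs z)%:C.
Proof. by rewrite /cabs normc_def. Qed.

Lemma cabsE z : cabs z = Num.sqrt (cRe z ^+ 2 + cIm z ^+ 2).
Proof. by rewrite /cabs normc_def. Qed.

Lemma sqr_cabs z : cabs z ^+ 2 = cRe z ^+ 2 + cIm z ^+ 2.
Proof. by rewrite cabsE sqr_sqrtr // addr_ge0 ?sqr_ge0. Qed.

Lemma cabs_ge0 z : 0 <= cabs z.
Proof. by rewrite cabsE sqrtr_ge0. Qed.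

Lemma cabsM z w : cabs (z * w) = cabs z * cabs w.
Proof. by apply: complexI; rewrite rmorphM /= -!normC_cabs normrM. Qed.

Lemma cabsD z w : cabs (z + w) <= cabs z + cabs w.
Proof. by rewrite -lecR rmorphD /= -!normC_cabs ler_normD. Qed.

Lemma cabsN z : cabs (- z) = cabs z.
Proof. by apply: complexI; rewrite -!normC_cabs normrN. Qed.

Lemma cabsB z w : cabs (z - w) <= cabs z + cabs w.
Proof. by rewrite -(cabsN w) cabsD. Qed.

Lemma cabsBC z w : cabs (z - w) = cabs (w - z).
Proof. by rewrite -cabsN opprB. Qed.

Lemma cabsV z : cabs z^-1 = (cabs z)^-1.
Proof. by apply: complexI; rewrite fmorphV /= -!normC_cabs normfV. Qed.

Lemma cabsX z n : cabs (z ^+ n) = cabs z ^+ n.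
Proof. by apply: complexI; rewrite rmorphXn /= -!normC_cabs normrX. Qed.

Lemma cabs_real x : cabs x%:C = `|x|.
Proof. by rewrite cabsE /= [0 ^+ 2]mul0r addr0 sqrtr_sqr. Qed.

Lemma cabs0 : cabs (0 : R[i]) = 0.
Proof. by rewrite cabs_real normr0. Qed.

Lemma cabs1 : cabs (1 : R[i]) = 1.
Proof. by rewrite cabs_real normr1. Qed.

Lemma cabs_nat n : cabs (n%:R : R[i]) = n%:R.
Proof. by rewrite -[n%:R](rmorph_nat (real_complex R)) cabs_real normr_nat. Qed.

Lemma cabs_i : cabs (ii : R[i]) = 1.
Proof. by rewrite cabsE /= [0 ^+ 2]mul0r add0r expr1n sqrtr1. Qed.

Lemma cabs_eq0 z : (cabs z == 0) = (z == 0).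
Proof.
apply/eqP/eqP => [h|->]; last exact: cabs0.
by apply/eqP; rewrite -normr_eq0 normC_cabs h.
Qed.

Lemma cabs_gt0 z : (0 < cabs z) = (z != 0).
Proof. by rewrite lt_neqAle cabs_ge0 andbT eq_sym cabs_eq0. Qed.

Lemma Re_le_cabs z : `|cRe z| <= cabs z.
Proof. by rewrite -lecR -normC_cabs normc_ge_Re. Qed.

Lemma Im_le_cabs z : `|cIm z| <= cabs z.
Proof.
rewrite -sqrtr_sqr cabsE ler_sqrt ?addr_ge0 ?sqr_ge0 //.
by rewrite lerDr sqr_ge0.
Qed.

Lemma cabs_le_ReIm z : cabs z <= `|cRe z| + `|cIm z|.
Proof.
rewrite [z in cabs z]complexE; apply: (le_trans (cabsD _ _)).
by rewrite cabsM cabs_i mul1r !cabs_real.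
Qed.

Lemma cabs_sum I (r : seq I) (P : pred I) (f : I -> R[i]) :
  cabs (\sum_(i <- r | P i) f i) <= \sum_(i <- r | P i) cabs (f i).
Proof.
elim/big_rec2: _ => [|i y z _ le_zy]; first by rewrite cabs0.
by apply: (le_trans (cabsD _ _)); rewrite lerD2l.
Qed.

Lemma cabs_prod I (r : seq I) (P : pred I) (f : I -> R[i]) :
  cabs (\prod_(i <- r | P i) f i) = \prod_(i <- r | P i) cabs (f i).
Proof. by elim/big_rec2: _ => [|i y z _ <-]; rewrite ?cabs1 ?cabsM. Qed.

Lemma cabsJ z : cabs z^* = cabs z.
Proof. by rewrite !cabsE; case: z => a b /=; rewrite sqrrN. Qed.

Lemma cabs_sub_ge z w : cabs z - cabs w <= cabs (z - w).
Proof. by rewrite lerBlDr -{1}(subrK w z) cabsD. Qed.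

Lemma cReD z w : cRe (z + w) = cRe z + cRe w.
Proof. by case: z w => ? ? []. Qed.
Lemma cImD z w : cIm (z + w) = cIm z + cIm w.
Proof. by case: z w => ? ? []. Qed.
Lemma cReN z : cRe (- z) = - cRe z.
Proof. by case: z. Qed.
Lemma cImN z : cIm (- z) = - cIm z.
Proof. by case: z. Qed.
Lemma cReM z w : cRe (z * w) =
  cRe z * cRe w - cIm z * cIm w.
Proof. by case: z w => ? ? []. Qed.
Lemma cImM z w : cIm (z * w) =
  cRe z * cIm w + cIm z * cRe w.
Proof. by case: z w => ? ? []. Qed.

Lemma complexP z w : cRe z = cRe w ->
  cIm z = cIm w -> z = w.
Proof. by case: z w => ? ? [? ?] /= -> ->. Qed.

Lemma neq_Re z w : cRe z <> cRe w -> z != w.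
Proof. by move=> h; apply/eqP => E; apply: h; rewrite E. Qed.

Lemma Im_neq (s p : R[i]) : cIm s != 0 -> cIm p = 0 -> s != p.
Proof. by move=> si p0; apply/eqP => E; move: si; rewrite E p0 eqxx. Qed.

Lemma Im_neq1 (s : R[i]) : cIm s != 0 -> s != 1.
Proof. by move=> si; exact: Im_neq. Qed.

End Modulus.

(* [e : T -> R[i]] is either the identity of [R[i]] or the inclusion of [R]:
   both complex differentiability and differentiation along the real line are
   instances.  [hasd] is Caratheodory's form of the derivative. *)
Section Calculus.
Variables (R : realType) (T : Type) (e : T -> R[i]).
Implicit Types (f g : T -> R[i]) (x : T).

Definition cts f x := forall eps : R, 0 < eps -> exists2 d : R, 0 < d &
  forall x', cabs (e x' - e x) < d -> cabs (f x' - f x) < eps.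

Definition hasd f x (d : R[i]) := exists2 phi : T -> R[i],
  cts phi x /\ phi x = d & forall x', f x' = f x + phi x' * (e x' - e x).

Lemma cts_cst (c : R[i]) x : cts (fun=> c) x.
Proof. by move=> eps e0; exists 1 => // x' _; rewrite subrr cabs0. Qed.

Lemma cts_id x : cts e x.
Proof. by move=> eps e0; exists eps. Qed.

Lemma ctsN f x : cts f x -> cts (fun t => - f t) x.
Proof.
move=> cf eps /cf[d d0 H]; exists d => // x' /H.
by rewrite -opprD cabsN.
Qed.

Lemma ctsD f g x : cts f x -> cts g x -> cts (fun t => f t + g t) x.
Proof.
move=> cf cg eps e0; have e2 : 0 < eps / 2 by rewrite divr_gt0.
have [d d0 H] := cf _ e2; have [d' d'0 H'] := cg _ e2.
exists (Num.min d d'); first by rewrite lt_min d0.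
move=> x'; rewrite lt_min => /andP[/H h /H' h'].
rewrite [eps]splitr (_ : _ - _ = (f x' - f x) + (g x' - g x)); last by ring.
by apply: (le_lt_trans (cabsD _ _)); rewrite ltrD.
Qed.

Lemma ctsB f g x : cts f x -> cts g x -> cts (fun t => f t - g t) x.
Proof. by move=> cf cg; apply: ctsD => //; exact: ctsN. Qed.

Lemma cts_subC (c : R[i]) x : cts (fun t => e t - c) x.
Proof. by apply: ctsB; [exact: cts_id|exact: cts_cst]. Qed.

Lemma ctsM f g x : cts f x -> cts g x -> cts (fun t => f t * g t) x.
Proof.
move=> cf cg eps e0.
pose a := cabs (f x) + 1; pose b := cabs (g x) + 1.
have a0 : 0 < a by rewrite ltr_wpDl ?cabs_ge0.
have b0 : 0 < b by rewrite ltr_wpDl ?cabs_ge0.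
have e1 : 0 < Num.min 1 (eps / (2 * b)).
  by rewrite lt_min ltr01 divr_gt0 ?mulr_gt0.
have e2 : 0 < eps / (2 * a) by rewrite divr_gt0 ?mulr_gt0.
have [d d0 H] := cf _ e1; have [d' d'0 H'] := cg _ e2.
exists (Num.min d d'); first by rewrite lt_min d0.
move=> x'; rewrite lt_min => /andP[/H + /H' h'].
rewrite lt_min => /andP[h1 h2].
have -> : f x' * g x' - f x * g x =
    f x' * (g x' - g x) + (f x' - f x) * g x by ring.
apply: (le_lt_trans (cabsD _ _)); rewrite !cabsM.
have fa : cabs (f x') < a.
  rewrite /a -(subrK (f x) (f x')); apply: (le_lt_trans (cabsD _ _)).
  by rewrite [ltRHS]addrC ltrD2r.
have -> : eps = a * (eps / (2 * a)) + (eps / (2 * b)) * b.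
  by field; rewrite !gt_eqF.
apply: ltr_leD.
  apply: (@le_lt_trans _ _ (a * cabs (g x' - g x))).
    by rewrite ler_wpM2r ?cabs_ge0 // ltW.
  by rewrite ltr_pM2l.
by apply: ler_pM; rewrite ?cabs_ge0 ?(ltW h2) // lerDl.
Qed.

Lemma ctsV f x : f x != 0 -> cts f x -> cts (fun t => (f t)^-1) x.
Proof.
move=> fx0 cf eps e0; set m := cabs (f x).
have m0 : 0 < m by rewrite cabs_gt0.
have e1 : 0 < Num.min (m / 2) (eps * m ^+ 2 / 2).
  by rewrite lt_min !divr_gt0 // mulr_gt0 ?exprn_gt0.
have [d d0 H] := cf _ e1; exists d => // x' /H.
rewrite lt_min => /andP[h1 h2].
have fx' : m / 2 < cabs (f x').
  have := cabs_sub_ge (f x) (f x - f x').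
  rewrite [cabs (f x - f x')]cabsBC subKr -/m => h.
  by apply: lt_le_trans h; rewrite -/m in h1 *; lra.
have fx'0 : f x' != 0 by rewrite -cabs_gt0 (lt_trans _ fx') // divr_gt0.
have -> : (f x')^-1 - (f x)^-1 = (f x - f x') * ((f x)^-1 * (f x')^-1).
  by field; apply/andP.
rewrite !cabsM !cabsV -/m cabsBC.
have m'0 : 0 < cabs (f x') by rewrite cabs_gt0.
rewrite -ltr_pdivlMr ?mulr_gt0 ?invr_gt0 //.
apply: (lt_le_trans h2); rewrite invfM !invrK.
have -> : eps * m ^+ 2 / 2 = eps * (m * (m / 2)) by ring.
by rewrite !ler_pM2l // ltW.
Qed.

Lemma ctsX f x n : cts f x -> cts (fun t => f t ^+ n) x.
Proof.
move=> cf; elim: n => [|n IH]; first exact: cts_cst.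
have -> : (fun t => f t ^+ n.+1) = (fun t => f t * f t ^+ n).
  by apply/funext => t; rewrite exprS.
exact: ctsM.
Qed.

Lemma cts_sum (I : Type) (r : seq I) (F : I -> T -> R[i]) x :
  (forall i, cts (F i) x) -> cts (fun t => \sum_(i <- r) F i t) x.
Proof.
move=> cF; elim: r => [|i r IH].
  have -> : (fun t => \sum_(i <- [::]) F i t) = fun=> 0.
    by apply/funext => t; rewrite big_nil.
  exact: cts_cst.
have -> : (fun t => \sum_(i <- i :: r) F i t) =
    fun t => F i t + \sum_(i <- r) F i t.
  by apply/funext => t; rewrite big_cons.
exact: ctsD.
Qed.

Lemma cts_near f g x (d : R) : 0 < d ->
  (forall x', cabs (e x' - e x) < d -> f x' = g x') -> cts f x -> cts g x.
Proof.
move=> d0 H cf eps /cf[d' d'0 H'].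
exists (Num.min d d'); first by rewrite lt_min d0.
move=> x'; rewrite lt_min => /andP[h h'].
by rewrite -!H ?H' // subrr cabs0.
Qed.

Lemma hasd_cts f x d : hasd f x d -> cts f x.
Proof.
case=> phi [cphi _] H.
have -> : f = fun t => f x + phi t * (e t - e x) by apply/funext.
by apply: ctsD (cts_cst _ _) _; apply: ctsM => //; apply: ctsB (cts_id _) (cts_cst _ _).
Qed.

Lemma hasd_cst c x : hasd (fun=> c) x 0.
Proof. by exists (fun=> 0) => [|x']; [split=> //; exact: cts_cst | rewrite mul0r addr0]. Qed.

Lemma hasd_id x : hasd e x 1.
Proof. by exists (fun=> 1) => [|x']; [split=> //; exact: cts_cst | ring]. Qed.

Lemma hasdD f g x a b : hasd f x a -> hasd g x b ->
  hasd (fun t => f t + g t) x (a + b).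
Proof.
move=> [p [cp <-] Hp] [q [cq <-] Hq]; exists (fun t => p t + q t).
  by split=> //; exact: ctsD.
by move=> x'; rewrite Hp Hq; ring.
Qed.

Lemma hasdN f x a : hasd f x a -> hasd (fun t => - f t) x (- a).
Proof.
move=> [p [cp <-] Hp]; exists (fun t => - p t).
  by split=> //; exact: ctsN.
by move=> x'; rewrite Hp; ring.
Qed.

Lemma hasdB f g x a b : hasd f x a -> hasd g x b ->
  hasd (fun t => f t - g t) x (a - b).
Proof. by move=> ? ?; apply: hasdD => //; exact: hasdN. Qed.

Lemma hasdM f g x a b : hasd f x a -> hasd g x b ->
  hasd (fun t => f t * g t) x (a * g x + f x * b).
Proof.
move=> df dg; have cg := hasd_cts dg.
move: df dg => [p [cp <-] Hp] [q [cq <-] Hq].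
exists (fun t => p t * g t + f x * q t).
  by split=> //; apply: ctsD; apply: ctsM => //; exact: cts_cst.
by move=> x'; rewrite Hp Hq; ring.
Qed.

Lemma hasdZ f x a c : hasd f x a -> hasd (fun t => c * f t) x (c * a).
Proof. by move=> df; have := hasdM (hasd_cst c x) df; rewrite mul0r add0r. Qed.

Lemma hasdV f x a : f x != 0 -> hasd f x a ->
  hasd (fun t => (f t)^-1) x (- a / f x ^+ 2).
Proof.
move=> fx0 df; have cf := hasd_cts df; move: df => [p [cp <-] Hp].
have cq : cts (fun t => - p t * ((f x)^-1 * (f t)^-1)) x.
  apply: ctsM; first exact: ctsN.
  by apply: ctsM (cts_cst _ _) _; exact: ctsV.
(* where [f] vanishes the quotient is corrected to satisfy the exact identity *)
exists (fun t => if f t == 0 then - (f x)^-1 / (e t - e x)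
                 else - p t * ((f x)^-1 * (f t)^-1)).
  split; last by rewrite (negbTE fx0) expr2 invfM.
  have m0 : 0 < cabs (f x) by rewrite cabs_gt0.
  have [d d0 H] := cf _ m0.
  apply: (cts_near d0 _ cq) => x' /H; case: eqP => // ->.
  by rewrite sub0r cabsN ltxx.
move=> x'; case: eqP => [f0|/eqP f0].
  have ne : e x' - e x != 0.
    by apply: contraNneq fx0 => ex; have := Hp x'; rewrite ex f0 mulr0 addr0 => <-.
  by rewrite f0 invr0 divfK // subrr.
have -> : - p x' * ((f x)^-1 / f x') * (e x' - e x) =
   - (p x' * (e x' - e x)) * ((f x)^-1 / f x') by ring.
have -> : p x' * (e x' - e x) = f x' - f x by rewrite Hp; ring.
by field; apply/andP.
Qed.

Lemma hasd_div f g x a b : g x != 0 -> hasd f x a -> hasd g x b ->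
  hasd (fun t => f t / g t) x (a / g x - f x * b / g x ^+ 2).
Proof.
move=> gx0 df dg; have := hasdM df (hasdV gx0 dg).
by rewrite mulNr mulrN mulrA.
Qed.

Lemma hasdX f x a n : hasd f x a ->
  hasd (fun t => f t ^+ n) x (n%:R * f x ^+ n.-1 * a).
Proof.
move=> df; elim: n => [|n IH]; first by rewrite !mul0r; exact: hasd_cst.
have -> : (fun t => f t ^+ n.+1) = (fun t => f t * f t ^+ n).
  by apply/funext => t; rewrite exprS.
have -> : n.+1%:R * f x ^+ n.+1.-1 * a =
  a * f x ^+ n + f x * (n%:R * f x ^+ n.-1 * a); last exact: hasdM.
case: n {IH} => [|n] /=; first by rewrite !expr0; ring.
by rewrite exprS -[n.+2]addn1 natrD; ring.
Qed.

Lemma hasd_sum (I : Type) (r : seq I) (F : I -> T -> R[i]) (D : I -> R[i]) x :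
  (forall i, hasd (F i) x (D i)) ->
  hasd (fun t => \sum_(i <- r) F i t) x (\sum_(i <- r) D i).
Proof.
move=> cF; elim: r => [|i r IH].
  have -> : (fun t => \sum_(i <- [::]) F i t) = fun=> 0.
    by apply/funext => t; rewrite big_nil.
  by rewrite big_nil; exact: hasd_cst.
have -> : (fun t => \sum_(i <- i :: r) F i t) =
    fun t => F i t + \sum_(i <- r) F i t.
  by apply/funext => t; rewrite big_cons.
by rewrite big_cons; exact: hasdD.
Qed.

Lemma hasd_near f g x a (d : R) : 0 < d ->
  (forall x', cabs (e x' - e x) < d -> f x' = g x') -> hasd f x a -> hasd g x a.
Proof.
move=> d0 H [p [cp <-] Hp].
have fx : f x = g x by apply: H; rewrite subrr cabs0.
exists (fun t => if cabs (e t - e x) < d then p t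
  else if e t - e x == 0 then 0 else (g t - g x) / (e t - e x)).
  split; last by rewrite subrr cabs0 d0.
  by apply: (cts_near d0 _ cp) => x' ->.
move=> x'; case: ifP => [/H <-|h]; first by rewrite -fx Hp.
case: eqP => [E|/eqP ne]; first by rewrite E cabs0 d0 in h.
by rewrite divfK // addrC subrK.
Qed.

(** From right to left the difference quotient serves as Caratheodory's function, completed by the
    value [a] wherever [e] takes the value [e x]; at such points the estimate forces [f] to equal
    [f x]. *)
Lemma hasdP f x a : hasd f x a <-> forall eps : R, 0 < eps ->
  exists2 d : R, 0 < d & forall x', cabs (e x' - e x) < d ->
    cabs (f x' - f x - a * (e x' - e x)) <= eps * cabs (e x' - e x).
Proof.
split=> [[p [cp <-] Hp] eps /cp[d d0 H]|H].
  exists d => // x' /H /ltW h; rewrite (Hp x').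
  have -> : f x + p x' * (e x' - e x) - f x - p x * (e x' - e x) =
     (p x' - p x) * (e x' - e x) by ring.
  by rewrite cabsM ler_wpM2r ?cabs_ge0.
have fE x' : e x' = e x -> f x' = f x.
  move=> ex; have [d d0 /(_ x')] := H 1 ltr01.
  rewrite ex subrr cabs0 !mulr0 subr0 => /(_ d0) h.
  by apply/eqP; rewrite -subr_eq0 -cabs_eq0 -(le_anti (introT andP (conj h (cabs_ge0 _)))).
exists (fun t => if e t - e x == 0 then a else (f t - f x) / (e t - e x)); last first.
  move=> x'; case: eqP => [/eqP|/eqP ne]; last by rewrite divfK // addrC subrK.
  by rewrite subr_eq0 => /eqP ex; rewrite (fE x') // ex subrr mulr0 addr0.
rewrite subrr eqxx; split => // eps e0.
have [d d0 Hd] := H _ (divr_gt0 e0 (ltr0Sn R 1)).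
exists d => // x' /Hd h; rewrite subrr eqxx; case: eqP => [_|/eqP ne].
  by rewrite subrr cabs0.
have ->: (f x' - f x) / (e x' - e x) - a =
   (f x' - f x - a * (e x' - e x)) / (e x' - e x) by field.
rewrite cabsM cabsV ltr_pdivrMr ?cabs_gt0 //.
apply: (le_lt_trans h); rewrite ltr_pM2r ?cabs_gt0 //.
by rewrite ltr_pdivrMr // ltr_pMr // ltr1n.
Qed.

End Calculus.

Lemma cts_comp (R : realType) (T : Type) (e : T -> R[i]) (g : R[i] -> R[i])
    (f : T -> R[i]) x : cts id g (f x) -> cts e f x -> cts e (g \o f) x.
Proof.
move=> cg cf eps /cg[d d0 H]; have [d' d'0 H'] := cf _ d0.
by exists d' => // x' /H' /H.
Qed.

Lemma hasd_comp (R : realType) (T : Type) (e : T -> R[i]) (g : R[i] -> R[i])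
    (f : T -> R[i]) x a b : hasd id g (f x) a -> hasd e f x b ->
  hasd e (g \o f) x (a * b).
Proof.
move=> [q [cq <-] Hq] df; have cf := hasd_cts df; move: df => [p [cp <-] Hp].
exists (fun t => q (f t) * p t).
  by split=> //; apply: ctsM => //; exact: (@cts_comp _ _ e q f).
by move=> x' /=; rewrite Hq (Hp x'); ring.
Qed.

(** * Passage between real and complex differentiation along the real line *)

Section RealDerivative.
Variable R : realType.

Lemma is_derive_epsP (f : R -> R) (x d : R) : is_derive x 1 f d <->
  forall eps, 0 < eps -> exists2 del, 0 < del &
    forall h, `|h| < del -> `|f (x + h) - f x - d * h| <= eps * `|h|.
Proof.
have E (h : R) : h != 0 -> h^-1 *: (f (h *: 1 + x) - f x) - d =
    h^-1 * (f (x + h) - f x - d * h).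
  by move=> h0; rewrite /GRing.scale /= mulr1 (addrC h); field.
split=> [[df dE] eps e0|H].
  have L : (fun h : R => h^-1 *: (f (h *: 1 + x) - f x)) @ 0^' --> d.
    by rewrite -dE; exact: df.
  have /cvgrPdist_le/(_ _ e0) := L; rewrite near_withinE.
  move=> /nbhs_ballP[del /= del0 H]; exists del => // h hd.
  have [->|h0] := eqVneq h 0; first by rewrite addr0 subrr !mulr0 subr0 normr0 mulr0.
  have := H h; rewrite /ball/= sub0r normrN => /(_ hd h0).
  rewrite distrC E // normrM normfV => h'.
  by rewrite -ler_pdivrMr ?normr_gt0 // mulrC.
have L : (fun h : R => h^-1 *: (f (h *: 1 + x) - f x)) @ 0^' --> d.
  apply/cvgrPdist_le => eps /H[del del0 Hd]; rewrite near_withinE.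
  apply/nbhs_ballP; exists del => //= h; rewrite /ball/= sub0r normrN => /Hd h' h0.
  by rewrite distrC E // normrM normfV mulrC ler_pdivrMr ?normr_gt0.
split; first by apply/cvg_ex; exists d.
exact/cvg_lim.
Qed.


Lemma hasd_real (f : R -> R) (x d : R) :
  is_derive x 1 f d -> hasd rc (fun t => (f t)%:C) x d%:C.
Proof.
move=> /is_derive_epsP df; apply/hasdP => eps /df[del del0 H].
exists del => // x'; rewrite -!(rmorphB, rmorphM) /= !cabs_real => /H.
by rewrite (addrC x) subrK.
Qed.

Lemma hasd_Re (F : R -> R[i]) (x : R) (d : R[i]) : hasd rc F x d ->
  is_derive x 1 (fun t => cRe (F t)) (cRe d).
Proof.
move=> /hasdP dF; apply/is_derive_epsP => eps /dF[del del0 H].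
exists del => // h; have := H (x + h).
have -> : (x + h)%:C - x%:C = h%:C by rewrite -rmorphB /= addrAC subrr add0r.
rewrite cabs_real => H' /H'.
apply: le_trans; apply: le_trans (Re_le_cabs _).
by rewrite !cReD !cReN cReM /= mulr0 subr0.
Qed.

Lemma hasd_Im (F : R -> R[i]) (x : R) (d : R[i]) : hasd rc F x d ->
  is_derive x 1 (fun t => cIm (F t)) (cIm d).
Proof.
move=> /hasdP dF; apply/is_derive_epsP => eps /dF[del del0 H].
exists del => // h; have := H (x + h).
have -> : (x + h)%:C - x%:C = h%:C by rewrite -rmorphB /= addrAC subrr add0r.
rewrite cabs_real => H' /H'.
apply: le_trans; apply: le_trans (Im_le_cabs _).
by rewrite !cImD !cImN cImM /= mulr0 add0r.
Qed.

Lemma cts_realP (f : R -> R) x : {for x, continuous f} <->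
  cts rc (fun t => (f t)%:C) x.
Proof.
split=> [/cvgrPdist_lt H eps /H|H].
  move=> /nbhs_ballP[del /= del0 Hd]; exists del => // x'.
  rewrite -!rmorphB /= !cabs_real => h; rewrite distrC; apply: Hd.
  by rewrite /ball/= distrC.
apply/cvgrPdist_lt => eps /H[del del0 Hd]; apply/nbhs_ballP; exists del => //= x'.
rewrite /ball/= => h; have := Hd x'; rewrite -!rmorphB /= !cabs_real.
by rewrite distrC => /(_ h); rewrite distrC.
Qed.

Lemma cts_Re T (e : T -> R[i]) (F : T -> R[i]) x : cts e F x ->
  cts e (fun t => (cRe (F t))%:C) x.
Proof.
move=> cF eps /cF[d d0 H]; exists d => // x' /H; apply: le_lt_trans.
rewrite -rmorphB /= cabs_real; apply: le_trans (Re_le_cabs _).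
by rewrite cReD cReN.
Qed.

Lemma cts_Im T (e : T -> R[i]) (F : T -> R[i]) x : cts e F x ->
  cts e (fun t => (cIm (F t))%:C) x.
Proof.
move=> cF eps /cF[d d0 H]; exists d => // x' /H; apply: le_lt_trans.
rewrite -rmorphB /= cabs_real; apply: le_trans (Im_le_cabs _).
by rewrite cImD cImN.
Qed.

Lemma cts_cabs T (e : T -> R[i]) (F : T -> R[i]) x : cts e F x ->
  cts e (fun t => (cabs (F t))%:C) x.
Proof.
move=> cF eps /cF[d d0 H]; exists d => // x' /H; apply: le_lt_trans.
rewrite -rmorphB /= cabs_real ler_norml cabs_sub_ge andbT.
by rewrite lerNl opprB cabsBC cabs_sub_ge.
Qed.

End RealDerivative.

(** * The complex exponential *)

Section Exponential.
Variable R : realType.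
Implicit Types z w : R[i].

Definition cexp z : R[i] :=
  (expR (cRe z) * cos (cIm z)) +i*
  (expR (cRe z) * sin (cIm z)).

Lemma cexpD z w : cexp (z + w) = cexp z * cexp w.
Proof.
apply: complexP; rewrite /cexp /= ?cReM ?cImM /= cReD cImD expRD ?cosD ?sinD; ring.
Qed.

Lemma cexp0 : cexp 0 = 1.
Proof. by rewrite /cexp /= expR0 cos0 sin0 mulr1 mulr0. Qed.

Lemma cabs_cexp z : cabs (cexp z) = expR (cRe z).
Proof.
rewrite cabsE /= !exprMn -mulrDr cos2Dsin2 mulr1.
by rewrite sqrtr_sqr ger0_norm // expR_ge0.
Qed.

Lemma cexp_neq0 z : cexp z != 0.
Proof. by rewrite -cabs_gt0 cabs_cexp expR_gt0. Qed.

Lemma cexpN z : cexp (- z) = (cexp z)^-1.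
Proof.
by apply: (mulfI (cexp_neq0 z)); rewrite -cexpD subrr cexp0 divff ?cexp_neq0.
Qed.

Lemma cexpB z w : cexp (z - w) = cexp z / cexp w.
Proof. by rewrite cexpD cexpN. Qed.

Lemma cexp_real (x : R) : cexp x%:C = (expR x)%:C.
Proof. by rewrite /cexp /= cos0 sin0 mulr1 mulr0. Qed.

Lemma cexpJ z : cexp z^* = (cexp z)^*.
Proof. by case: z => a b; rewrite /cexp /= cosN sinN mulrN. Qed.

Let cexp_near0 (eps : R) : 0 < eps -> exists2 d : R, 0 < d &
  forall h, cabs h < d -> cabs (cexp h - 1 - h) <= eps * cabs h.
Proof.
move=> e0.
have [e4 [e40 e4_le1 e4_le]] : exists e4 : R, [/\ 0 < e4, e4 <= 1 & e4 <= eps / 8].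
  exists (Num.min (eps / 8) 1).
  by rewrite lt_min divr_gt0 //= ltr01 !ge_min !lexx orbT.
have [d1 d10 H1] := (is_derive_epsP _ _ _).1 (is_derive_expR (0 : R)) _ e40.
have [d2 d20 H2] := (is_derive_epsP _ _ _).1 (is_derive_cos (0 : R)) _ e40.
have [d3 d30 H3] := (is_derive_epsP _ _ _).1 (is_derive_sin (0 : R)) _ e40.
exists (Num.min e4 (Num.min d1 (Num.min d2 d3))); first by rewrite !lt_min e40 d10 d20 d30.
move=> h; rewrite !lt_min => /and4P[h0 h1 h2 h3].
have ah := Re_le_cabs h; have bh := Im_le_cabs h.
set a := cRe h in ah *; set b := cIm h in bh *.
have {}H1 := H1 a (le_lt_trans ah h1); have {}H2 := H2 b (le_lt_trans bh h2).
have {}H3 := H3 b (le_lt_trans bh h3).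
rewrite !add0r expR0 mul1r in H1; rewrite !add0r cos0 sin0 oppr0 mul0r subr0 in H2.
rewrite !add0r sin0 cos0 mul1r subr0 in H3.
(* With [h = a + i b] the error splits into the error of the real exponential, a mixed term, and the
   first-order errors of cosine and sine. As [e4] also bounds [cabs h], the factor [e^(i b) - 1] of
   the mixed term is at most [3 e4]. *)
have -> : cexp h - 1 - h = (expR a - 1 - a)%:C * cexp (ii * b%:C) +
    a%:C * (cexp (ii * b%:C) - 1) + (cexp (ii * b%:C) - 1 - ii * b%:C).
  have -> : cexp h = (expR a)%:C * cexp (ii * b%:C).
    by rewrite -cexp_real -cexpD -complexE.
  rewrite {1}[h]complexE -/a -/b !rmorphB /=; ring.
have A1 : cabs (cexp (ii * b%:C)) = 1.
  by rewrite cabs_cexp cReM /= mul0r mulr0 subrr expR0.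
have E b' : cexp (ii * b'%:C) = (cos b')%:C + ii * (sin b')%:C.
  by apply: complexP; rewrite /cexp ?cReD ?cImD /=;
    rewrite !(mul0r, mul1r, mulr0, oppr0, add0r, addr0, expR0, mul1r).
have A2 : cabs (cexp (ii * b%:C) - 1 - ii * b%:C) <= 2 * e4 * cabs h.
  have -> : cexp (ii * b%:C) - 1 - ii * b%:C = (cos b - 1)%:C + ii * (sin b - b)%:C.
    by rewrite E !rmorphB /=; ring.
  apply: (le_trans (cabsD _ _)); rewrite cabsM cabs_i mul1r !cabs_real.
  rewrite -mulrA mulrDl mul1r; apply: lerD.
    by apply: (le_trans H2); rewrite ler_wpM2l // ltW.
  by apply: (le_trans H3); rewrite ler_wpM2l // ltW.
have A3 : cabs (cexp (ii * b%:C) - 1) <= 3 * e4.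
  rewrite -(subrK (ii * b%:C) (cexp _ - 1)); apply: (le_trans (cabsD _ _)).
  rewrite cabsM cabs_i mul1r cabs_real.
  have : cabs h <= e4 by rewrite ltW.
  have := cabs_ge0 h.
  by move: A2 bh; set u := cabs (_ - _); nra.
apply: (le_trans (cabsD _ _)).
have L : cabs ((expR a - 1 - a)%:C * cexp (ii * b%:C) + a%:C * (cexp (ii * b%:C) - 1))
     <= 4 * e4 * cabs h.
  apply: (le_trans (cabsD _ _)); rewrite !cabsM A1 mulr1 !cabs_real.
  have -> : 4 * e4 * cabs h = e4 * cabs h + cabs h * (3 * e4) by ring.
  apply: lerD; first by apply: (le_trans H1); rewrite ler_wpM2l // ltW.
  by apply: ler_pM; rewrite ?cabs_ge0.
have M : e4 * cabs h <= eps / 8 * cabs h by rewrite ler_wpM2r ?cabs_ge0.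
apply: (le_trans (lerD L A2)).
have := mulr_ge0 (ltW e0) (cabs_ge0 h); lra.
Qed.

Lemma hasd_cexp z : hasd id cexp z (cexp z).
Proof.
apply/hasdP => eps e0; have E0 : 0 < expR (cRe z) by exact: expR_gt0.
have [d d0 H] := cexp_near0 (divr_gt0 e0 E0); exists d => // w /H h.
have -> : cexp w - cexp z - cexp z * (w - z) = cexp z * (cexp (w - z) - 1 - (w - z)).
  by rewrite !mulrBr mulr1 -cexpD (addrC z) subrK.
rewrite cabsM cabs_cexp; apply: (le_trans (ler_wpM2l (ltW E0) h)).
by rewrite mulrA mulrCA divff ?gt_eqF // mulr1.
Qed.

End Exponential.

(** * Integrals of complex functions of a real variable *)

Section Integral.
Variable R : realType.
Local Notation mu := (@lebesgue_measure R).
Implicit Types (D : set (measurableTypeR R)) (f g : R -> R[i]).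

Definition cint D f : R[i] :=
  (\int[mu]_(x in D) cRe (f x)) +i* (\int[mu]_(x in D) cIm (f x)).

Definition cintegrable D f :=
  mu.-integrable D (EFin \o (fun x => cRe (f x))) /\
  mu.-integrable D (EFin \o (fun x => cIm (f x))).

Lemma eq_cint D f g : (forall x, D x -> f x = g x) -> cint D f = cint D g.
Proof.
by move=> E; congr (_ +i* _); apply: eq_Rintegral => x /set_mem /E ->.
Qed.

Lemma eq_cintegrable D f g : measurable D -> (forall x, D x -> f x = g x) ->
  cintegrable D f -> cintegrable D g.
Proof.
move=> mD E [h1 h2]; split.
  by apply: eq_integrable h1 => // x /set_mem /E /= ->.
by apply: eq_integrable h2 => // x /set_mem /E /= ->.
Qed.

Lemma cintegrableD D f g : measurable D -> cintegrable D f -> cintegrable D g ->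
  cintegrable D (fun x => f x + g x).
Proof.
move=> mD [f1 f2] [g1 g2]; split.
  apply: eq_integrable (integrableD mD f1 g1) => // x _ /=.
  by rewrite cReD EFinD.
apply: eq_integrable (integrableD mD f2 g2) => // x _ /=.
by rewrite cImD EFinD.
Qed.

Lemma cintD D f g : measurable D -> cintegrable D f -> cintegrable D g ->
  cint D (fun x => f x + g x) = cint D f + cint D g.
Proof.
move=> mD [f1 f2] [g1 g2]; rewrite /cint; simpc; congr (_ +i* _).
  by under eq_Rintegral do rewrite cReD; rewrite RintegralD.
by under eq_Rintegral do rewrite cImD; rewrite RintegralD.
Qed.

Let itgZ D (h : R -> R) (a : R) : measurable D ->
  mu.-integrable D (EFin \o h) -> mu.-integrable D (EFin \o (fun x => a * h x)).
Proof.
move=> mD ih; apply: eq_integrable (integrableZl mD a ih) => // x _ /=.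
Qed.

Lemma cintegrableZ D f c : measurable D -> cintegrable D f ->
  cintegrable D (fun x => c * f x).
Proof.
move=> mD [f1 f2]; split.
  apply: eq_integrable (integrableB mD (itgZ (cRe c) mD f1)
    (itgZ (cIm c) mD f2)) => // x _ /=.
  by rewrite cReM.
apply: eq_integrable (integrableD mD (itgZ (cRe c) mD f2)
    (itgZ (cIm c) mD f1)) => // x _ /=.
by rewrite cImM.
Qed.

Lemma cintZ D f c : measurable D -> cintegrable D f ->
  cint D (fun x => c * f x) = c * cint D f.
Proof.
move=> mD [f1 f2]; apply: complexP; rewrite ?cReM ?cImM /=.
  under eq_Rintegral do rewrite cReM.
  by rewrite RintegralB ?RintegralZl //; exact: itgZ.
under eq_Rintegral do rewrite cImM.
by rewrite RintegralD ?RintegralZl //; exact: itgZ.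
Qed.

Lemma cintN D f : measurable D -> cintegrable D f ->
  cint D (fun x => - f x) = - cint D f.
Proof.
move=> mD If; rewrite -mulN1r -cintZ //; apply: eq_cint => x _.
by rewrite mulN1r.
Qed.

Lemma cintegrableN D f : measurable D -> cintegrable D f ->
  cintegrable D (fun x => - f x).
Proof.
move=> mD If; apply: eq_cintegrable (cintegrableZ (-1) mD If) => // x _.
by rewrite mulN1r.
Qed.

Lemma cintB D f g : measurable D -> cintegrable D f -> cintegrable D g ->
  cint D (fun x => f x - g x) = cint D f - cint D g.
Proof.
by move=> mD If Ig; rewrite cintD ?cintN //; exact: cintegrableN.
Qed.

Lemma cintegrableB D f g : measurable D -> cintegrable D f -> cintegrable D g ->
  cintegrable D (fun x => f x - g x).
Proof. by move=> ? ? ?; apply: cintegrableD => //; exact: cintegrableN. Qed.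

(** Real and imaginary parts are estimated separately, which costs the factor 2; it reappears in
    every contour estimate and only affects constants. *)
Lemma cint_le D f (g : R -> R) : measurable D -> cintegrable D f ->
  mu.-integrable D (EFin \o g) -> (forall x, D x -> cabs (f x) <= g x) ->
  cabs (cint D f) <= 2 * \int[mu]_(x in D) g x.
Proof.
move=> mD [f1 f2] ig H; apply: (le_trans (cabs_le_ReIm _)) => /=.
have aux (h : R -> R) : mu.-integrable D (EFin \o h) ->
    (forall x, D x -> `|h x| <= g x) ->
    `|\int[mu]_(x in D) h x| <= \int[mu]_(x in D) g x.
  move=> ih hg; apply: (le_trans (le_normr_Rintegral mD ih)).
  apply: le_Rintegral => //.
  by apply: eq_integrable (integrable_abse ih) => // x _.
rewrite mulrDl mul1r; apply: lerD; apply: aux => // x Dx.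
  exact: le_trans (Re_le_cabs _) (H x Dx).
exact: le_trans (Im_le_cabs _) (H x Dx).
Qed.

Definition cI f a b := cint `[a, b]%classic f.

Lemma cts_within (h : R -> R) a b :
  (forall x, a <= x <= b -> cts rc (fun t => (h t)%:C) x) ->
  {within `[a, b], continuous h}.
Proof.
move=> H; apply: continuous_in_subspaceT => x /set_mem /=.
by rewrite in_itv /= => /H /cts_realP.
Qed.

Lemma cts_integrable f a b : (forall x, a <= x <= b -> cts rc f x) ->
  cintegrable `[a, b]%classic f.
Proof.
move=> H; split; apply: continuous_compact_integrable;
  (try exact: segment_compact); apply: cts_within => x /H cf.
  exact: cts_Re.
exact: cts_Im.
Qed.

Lemma cI_split f a b c : a <= b <= c -> cintegrable `[a, c]%classic f ->
  cI f a c = cI f a b + cI f b c.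
Proof.
move=> /andP[ab bc] [f1 f2]; rewrite /cI /cint; simpc.
have aux (h : R -> R) : mu.-integrable `[a, c] (EFin \o h) ->
    \int[mu]_(x in `[a, c]) h x = \int[mu]_(x in `[a, b]) h x +
      \int[mu]_(x in `[b, c]) h x.
  move=> ih; have := @Rintegral_itvB _ h (BLeft a) (BRight c) b ih.
  rewrite !bnd_simp => /(_ ab bc).
  rewrite Rintegral_itv_obnd_cbnd; first by move=> <-; rewrite addrC subrK.
  apply: integrableS ih => // x /=; rewrite !in_itv /= => /andP[/ltW bx ->].
  by rewrite (le_trans ab).
by congr (_ +i* _); exact: aux.
Qed.

Lemma cI_point f a : cI f a a = 0.
Proof. by rewrite /cI /cint set_itv1 !Rintegral_set1. Qed.

Lemma cI_FTC F f a b : a <= b -> (forall x, a <= x <= b -> cts rc f x) ->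
  (forall x, a <= x <= b -> hasd rc F x (f x)) -> cI f a b = F b - F a.
Proof.
rewrite le_eqVlt => /predU1P[<-|ab] cf dF; first by rewrite cI_point subrr.
have aux (h H : R -> R) : (forall x, a <= x <= b -> cts rc (fun t => (h t)%:C) x) ->
    (forall x, a <= x <= b -> is_derive x 1 H (h x)) ->
    \int[mu]_(x in `[a, b]) h x = H b - H a.
  move=> ch dH.
  have cH x : a <= x <= b -> {for x, continuous H}.
    move=> /dH [dd _]; exact/differentiable_continuous/derivable1_diffP.
  rewrite /Rintegral (@continuous_FTC2 _ h H) //.
  - exact: cts_within.
  - split.
    + by move=> x; rewrite in_itv /= => /andP[/ltW ? /ltW ?];
        case: (dH x) => //; apply/andP.
    + by apply: cvg_at_right_filter; apply: cH; rewrite lexx ltW.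
    + by apply: cvg_at_left_filter; apply: cH; rewrite lexx ltW.
  - move=> x; rewrite in_itv /= => /andP[/ltW ax /ltW xb].
    by rewrite derive1E; case: (dH x) => //; apply/andP.
rewrite /cI /cint.
have -> : \int[mu]_(x in `[a, b]) cRe (f x) = cRe (F b) - cRe (F a).
  apply: (aux (fun t => cRe (f t)) (fun t => cRe (F t))) => x.
    by move=> /cf; exact: cts_Re.
  by move=> /dF; exact: hasd_Re.
have -> : \int[mu]_(x in `[a, b]) cIm (f x) = cIm (F b) - cIm (F a).
  apply: (aux (fun t => cIm (f t)) (fun t => cIm (F t))) => x.
    by move=> /cf; exact: cts_Im.
  by move=> /dF; exact: hasd_Im.
by case: (F a) (F b) => ? ? [? ?]; simpc.
Qed.

Lemma Rint_cst (a b c : R) : a <= b -> \int[mu]_(x in `[a, b]) c = c * (b - a).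
Proof.
move=> ab; rewrite Rintegral_cst //= lebesgue_measure_itv /= lte_fin.
move: ab; rewrite le_eqVlt => /predU1P[->|ab]; first by rewrite ltxx subrr mulr0.
by rewrite ab.
Qed.

Lemma integrable_cst_itv (a b c : R) : mu.-integrable `[a, b] (EFin \o (fun=> c)).
Proof.
apply: continuous_compact_integrable; first exact: segment_compact.
by apply: continuous_subspaceT => x; apply: cvg_cst.
Qed.

Lemma cI_le f a b K : a <= b -> cintegrable `[a, b]%classic f ->
  (forall x, a <= x <= b -> cabs (f x) <= K) -> cabs (cI f a b) <= 2 * K * (b - a).
Proof.
move=> ab If H; rewrite -mulrA -Rint_cst //; apply: cint_le => //.
exact: integrable_cst_itv.
Qed.

End Integral.

(** * Contour integrals over rectangles and the residue theorem *)

Section Rectangle.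
Variable R : realType.
Implicit Types (f g : R[i] -> R[i]) (z p : R[i]) (x y : R).

Definition dble f z := exists d, hasd id f z d.

Lemma dble_cts f z : dble f z -> cts id f z.
Proof. by move=> [d dd]; exact: hasd_cts dd. Qed.

Lemma cts_hor f x y : cts id f (x +i* y) -> cts rc (fun t => f (t +i* y)) x.
Proof.
move=> cf eps /cf[d d0 H]; exists d => // x' h; apply: H; apply: le_lt_trans h.
by have -> : (x' +i* y) - (x +i* y) = x'%:C - x%:C by simpc.
Qed.

Lemma cts_ver f x y : cts id f (x +i* y) -> cts rc (fun t => f (x +i* t)) y.
Proof.
move=> cf eps /cf[d d0 H]; exists d => // y' h; apply: H; apply: le_lt_trans h.
have -> : (x +i* y') - (x +i* y) = ii * (y'%:C - y%:C) by simpc.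
by rewrite cabsM cabs_i mul1r.
Qed.

Lemma hasd_hor f x y d : hasd id f (x +i* y) d -> hasd rc (fun t => f (t +i* y)) x d.
Proof.
move=> /hasdP H; apply/hasdP => eps /H[del del0 Hd]; exists del => // x' h.
have E : (x' +i* y) - (x +i* y) = x'%:C - x%:C by simpc.
by have := Hd (x' +i* y); rewrite E; apply.
Qed.

Lemma hasd_ver f x y d :
  hasd id f (x +i* y) d -> hasd rc (fun t => f (x +i* t)) y (ii * d).
Proof.
move=> /hasdP H; apply/hasdP => eps /H[del del0 Hd]; exists del => // y' h.
have E : (x +i* y') - (x +i* y) = ii * (y'%:C - y%:C) by simpc.
have := Hd (x +i* y'); rewrite E cabsM cabs_i mul1r mulrA (mulrC d); exact.
Qed.

(** The contour integral over the boundary of the rectangle, traversed counterclockwise. *)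
Definition RI f x0 x1 y0 y1 : R[i] :=
  cI (fun t => f (t +i* y0)) x0 x1 - cI (fun t => f (t +i* y1)) x0 x1 +
  ii * (cI (fun t => f (x1 +i* t)) y0 y1 - cI (fun t => f (x0 +i* t)) y0 y1).

Definition inrect x0 x1 y0 y1 z :=
  (x0 <= cRe z <= x1) && (y0 <= cIm z <= y1).

Definition onbd x0 x1 y0 y1 z := inrect x0 x1 y0 y1 z &&
  [|| cRe z == x0, cRe z == x1, cIm z == y0 | cIm z == y1].

Definition ininterior x0 x1 y0 y1 z :=
  (x0 < cRe z < x1) && (y0 < cIm z < y1).

Section Sides.
Variables (x0 x1 y0 y1 : R).
Hypotheses (x01 : x0 <= x1) (y01 : y0 <= y1).

Let sideP (P : R[i] -> Prop) : (forall z, onbd x0 x1 y0 y1 z -> P z) ->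
  [/\ forall x, x0 <= x <= x1 -> P (x +i* y0), forall x, x0 <= x <= x1 -> P (x +i* y1),
      forall y, y0 <= y <= y1 -> P (x1 +i* y) & forall y, y0 <= y <= y1 -> P (x0 +i* y)].
Proof.
move=> H; split=> t ht; apply: H;
  by rewrite /onbd /inrect /= ht !lexx ?x01 ?y01 !eqxx ?orbT.
Qed.

Lemma RI_integrable f : (forall z, onbd x0 x1 y0 y1 z -> cts id f z) ->
  [/\ cintegrable `[x0, x1]%classic (fun t => f (t +i* y0)),
      cintegrable `[x0, x1]%classic (fun t => f (t +i* y1)),
      cintegrable `[y0, y1]%classic (fun t => f (x1 +i* t)) &
      cintegrable `[y0, y1]%classic (fun t => f (x0 +i* t))].
Proof.
move=> /sideP[h1 h2 h3 h4]; split; apply: cts_integrable => t.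
- by move=> /h1; exact: cts_hor.
- by move=> /h2; exact: cts_hor.
- by move=> /h3; exact: cts_ver.
- by move=> /h4; exact: cts_ver.
Qed.

Lemma RI_le f K : (forall z, onbd x0 x1 y0 y1 z -> cts id f z) ->
  (forall z, onbd x0 x1 y0 y1 z -> cabs (f z) <= K) ->
  cabs (RI f x0 x1 y0 y1) <= 4 * K * ((x1 - x0) + (y1 - y0)).
Proof.
move=> /RI_integrable[i1 i2 i3 i4] /sideP[h1 h2 h3 h4].
apply: (le_trans (cabsD _ _)); rewrite cabsM cabs_i mul1r.
have := cI_le x01 i1 h1; have := cI_le x01 i2 h2.
have := cI_le y01 i3 h3; have := cI_le y01 i4 h4.
have := cabsB (cI (fun t => f (t +i* y0)) x0 x1) (cI (fun t => f (t +i* y1)) x0 x1).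
have := cabsB (cI (fun t => f (x1 +i* t)) y0 y1) (cI (fun t => f (x0 +i* t)) y0 y1).
lra.
Qed.

Lemma eq_RI f g : (forall z, onbd x0 x1 y0 y1 z -> f z = g z) ->
  RI f x0 x1 y0 y1 = RI g x0 x1 y0 y1.
Proof.
move=> /sideP[h1 h2 h3 h4]; rewrite /RI /cI.
by congr (_ - _ + _ * (_ - _)); apply: eq_cint => t /=; rewrite in_itv /=;
  [exact: h1 | exact: h2 | exact: h3 | exact: h4].
Qed.

Lemma RID f g : (forall z, onbd x0 x1 y0 y1 z -> cts id f z) ->
  (forall z, onbd x0 x1 y0 y1 z -> cts id g z) ->
  RI (fun z => f z + g z) x0 x1 y0 y1 = RI f x0 x1 y0 y1 + RI g x0 x1 y0 y1.
Proof.
move=> /RI_integrable[i1 i2 i3 i4] /RI_integrable[j1 j2 j3 j4].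
by rewrite /RI /cI !cintD //; ring.
Qed.

Lemma RIZ f c : (forall z, onbd x0 x1 y0 y1 z -> cts id f z) ->
  RI (fun z => c * f z) x0 x1 y0 y1 = c * RI f x0 x1 y0 y1.
Proof.
by move=> /RI_integrable[i1 i2 i3 i4]; rewrite /RI /cI !cintZ //; ring.
Qed.

Lemma RIB f g : (forall z, onbd x0 x1 y0 y1 z -> cts id f z) ->
  (forall z, onbd x0 x1 y0 y1 z -> cts id g z) ->
  RI (fun z => f z - g z) x0 x1 y0 y1 = RI f x0 x1 y0 y1 - RI g x0 x1 y0 y1.
Proof.
move=> /RI_integrable[i1 i2 i3 i4] /RI_integrable[j1 j2 j3 j4].
by rewrite /RI /cI !cintB //; ring.
Qed.

Lemma RI_primitive f F : (forall z, onbd x0 x1 y0 y1 z -> cts id f z) ->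
  (forall z, onbd x0 x1 y0 y1 z -> hasd id F z (f z)) -> RI f x0 x1 y0 y1 = 0.
Proof.
move=> cf; have [i1 i2 i3 i4] := RI_integrable cf.
move: cf => /sideP[c1 c2 c3 c4] /sideP[h1 h2 h3 h4]; rewrite /RI mulrBr.
have Zi (g : R -> R[i]) (a b : R) : cintegrable `[a, b]%classic g ->
  ii * cI g a b = cI (fun t => ii * g t) a b by move=> ig; rewrite /cI cintZ.
rewrite !Zi //.
rewrite (@cI_FTC _ (fun t => F (t +i* y0))) //; last 2 first.
- by move=> x /c1; exact: cts_hor.
- by move=> x /h1; exact: hasd_hor.
rewrite (@cI_FTC _ (fun t => F (t +i* y1))) //; last 2 first.
- by move=> x /c2; exact: cts_hor.
- by move=> x /h2; exact: hasd_hor.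
rewrite (@cI_FTC _ (fun t => F (x1 +i* t))) //; last 2 first.
- by move=> x /c3 /cts_ver cc; apply: ctsM => //; exact: cts_cst.
- by move=> x /h3; exact: hasd_ver.
rewrite (@cI_FTC _ (fun t => F (x0 +i* t))) //; last 2 first.
- by move=> x /c4 /cts_ver cc; apply: ctsM => //; exact: cts_cst.
- by move=> x /h4; exact: hasd_ver.
by ring.
Qed.

End Sides.

Lemma onbd_inrect x0 x1 y0 y1 z : onbd x0 x1 y0 y1 z -> inrect x0 x1 y0 y1 z.
Proof. by case/andP. Qed.

Lemma RI_vcut f x0 m x1 y0 y1 : x0 <= m <= x1 -> y0 <= y1 ->
  (forall z, onbd x0 x1 y0 y1 z -> cts id f z) ->
  RI f x0 x1 y0 y1 = RI f x0 m y0 y1 + RI f m x1 y0 y1.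
Proof.
move=> /andP[x0m mx1] y01 cf.
have [i1 i2 _ _] := RI_integrable (le_trans x0m mx1) y01 cf.
by rewrite /RI (cI_split (introT andP (conj x0m mx1)) i1)
  (cI_split (introT andP (conj x0m mx1)) i2); ring.
Qed.

Lemma RI_hcut f x0 x1 y0 m y1 : x0 <= x1 -> y0 <= m <= y1 ->
  (forall z, onbd x0 x1 y0 y1 z -> cts id f z) ->
  RI f x0 x1 y0 y1 = RI f x0 x1 y0 m + RI f x0 x1 m y1.
Proof.
move=> x01 /andP[y0m my1] cf.
have [_ _ i1 i2] := RI_integrable x01 (le_trans y0m my1) cf.
by rewrite /RI (cI_split (introT andP (conj y0m my1)) i1)
  (cI_split (introT andP (conj y0m my1)) i2); ring.
Qed.

Lemma nested_point (u w : nat -> R) : (forall n, u n <= u n.+1) ->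
  (forall n, u n.+1 + w n.+1 <= u n + w n) -> (forall n, 0 <= w n) ->
  exists p : R, forall n, u n <= p <= u n + w n.
Proof.
move=> up dn w0.
have upm m n : (m <= n)%N -> u m <= u n.
  elim: n => [|n IH]; first by rewrite leqn0 => /eqP ->.
  by rewrite leq_eqVlt => /predU1P[->//|/IH h]; apply: le_trans h (up n).
have dnm m n : (m <= n)%N -> u n + w n <= u m + w m.
  elim: n => [|n IH]; first by rewrite leqn0 => /eqP ->.
  by rewrite leq_eqVlt => /predU1P[->//|/IH h]; apply: le_trans (dn n) h.
have H m n : u m <= u n + w n.
  case: (leqP m n) => h.
    by apply: (le_trans (upm _ _ h)); rewrite lerDl.
  by apply: le_trans (dnm _ _ (ltnW h)); rewrite lerDl.
pose S := range u.
have S0 : S !=set0 by exists (u 0%N), 0%N.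
exists (sup S) => n; apply/andP; split.
  apply: ub_le_sup; last by exists n.
  by exists (u 0%N + w 0%N) => _ [m _ <-].
by apply: ge_sup => // _ [m _ <-].
Qed.

Lemma RI_quarter f a b W H : 0 <= W -> 0 <= H ->
  (forall z, inrect a (a + W + W) b (b + H + H) z -> cts id f z) ->
  RI f a (a + W + W) b (b + H + H) =
  RI f a (a + W) b (b + H) + RI f a (a + W) (b + H) (b + H + H) +
  (RI f (a + W) (a + W + W) b (b + H) + RI f (a + W) (a + W + W) (b + H) (b + H + H)).
Proof.
move=> W0 H0 cc.
have la t : t <= t + W by rewrite lerDl.
have lb t : t <= t + H by rewrite lerDl.
rewrite (@RI_vcut f a (a + W) (a + W + W) b (b + H + H)); first last.
- by move=> z /onbd_inrect /cc.
- exact: le_trans (lb _) (lb _).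
- by rewrite !la.
rewrite (@RI_hcut f a (a + W) b (b + H) (b + H + H)) //; first last.
- move=> z /onbd_inrect /andP[/andP[q1 q2] q3]; apply: cc.
  by rewrite /inrect q3 q1 (le_trans q2).
- by rewrite !lb.
rewrite (@RI_hcut f (a + W) (a + W + W) b (b + H) (b + H + H)) //; last first.
  move=> z /onbd_inrect /andP[/andP[q1 q2] q3]; apply: cc.
  by rewrite /inrect q3 q2 (le_trans _ q1).
by rewrite !lb.
Qed.

Lemma exp2_unbounded (x : R) : exists n, x < 2 ^+ n.
Proof.
exists (Num.truncn x).+1; apply: lt_trans (truncnS_gt _) _.
by rewrite -natrX ltr_nat ltn_expl.
Qed.

Lemma cabs_quarter (q a b c d : R[i]) : q = a + b + (c + d) ->
  cabs a < cabs q / 4 -> cabs b < cabs q / 4 -> cabs c < cabs q / 4 ->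
  cabs d < cabs q / 4 -> False.
Proof.
move=> E; have := cabsD (a + b) (c + d); have := cabsD a b; have := cabsD c d.
rewrite -E; lra.
Qed.

(* Goursat's bisection: the state of step n is the lower left corner of a
   subrectangle whose sides are those of the original one divided by 2^n. *)
Lemma goursat f x0 x1 y0 y1 : x0 <= x1 -> y0 <= y1 ->
  (forall z, inrect x0 x1 y0 y1 z -> dble f z) -> RI f x0 x1 y0 y1 = 0.
Proof.
move=> x01 y01 df; apply/eqP; rewrite -cabs_eq0; apply/eqP/le_anti.
rewrite cabs_ge0 andbT.
pose w n := (x1 - x0) / 2 ^+ n; pose h n := (y1 - y0) / 2 ^+ n.
have w0 n : 0 <= w n by rewrite divr_ge0 ?subr_ge0 ?exprn_ge0.
have h0 n : 0 <= h n by rewrite divr_ge0 ?subr_ge0 ?exprn_ge0.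
have wS n : w n = w n.+1 + w n.+1.
  by rewrite /w exprS; field; rewrite expf_neq0 // pnatr_eq0.
have hS n : h n = h n.+1 + h n.+1.
  by rewrite /h exprS; field; rewrite expf_neq0 // pnatr_eq0.
pose Q n (c : R * R) := RI f c.1 (c.1 + w n) c.2 (c.2 + h n).
(* Keep a quarter whose integral has at least a fourth of the current modulus; the last alternative
   is taken untested, since all four cannot fail at once. *)
pose nxt n (c : R * R) : R * R :=
  if cabs (Q n c) / 4 <= cabs (Q n.+1 c) then c else
  if cabs (Q n c) / 4 <= cabs (Q n.+1 (c.1 + w n.+1, c.2)) then (c.1 + w n.+1, c.2) else
  if cabs (Q n c) / 4 <= cabs (Q n.+1 (c.1, c.2 + h n.+1)) then (c.1, c.2 + h n.+1) else
  (c.1 + w n.+1, c.2 + h n.+1).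
pose fix c n := if n is n'.+1 then nxt n' (c n') else (x0, y0).
have nxtP n (d : R * R) : (d.1 <= (nxt n d).1 <= d.1 + w n.+1) /\
   (d.2 <= (nxt n d).2 <= d.2 + h n.+1).
  by rewrite /nxt; case: ifP => _; [|case: ifP => _; [|case: ifP => _]];
    rewrite /= ?lexx ?lerDl ?w0 ?h0.
have inc n : [/\ x0 <= (c n).1, (c n).1 + w n <= x1, y0 <= (c n).2 & (c n).2 + h n <= y1].
  elim: n => [|n [a1 a2 a3 a4]].
    by rewrite /c /w /h /= expr0 !divr1 !lexx !(addrC _ (_ - _)) !subrK !lexx.
  have [/andP[b1 b2] /andP[b3 b4]] := nxtP n (c n).
  rewrite /=; split; first exact: le_trans b1.
  - by apply: le_trans a2; rewrite (wS n) addrA lerD2r.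
  - exact: le_trans b3.
  - by apply: le_trans a4; rewrite (hS n) addrA lerD2r.
have cin n z : inrect (c n).1 ((c n).1 + w n) (c n).2 ((c n).2 + h n) z ->
    inrect x0 x1 y0 y1 z.
  have [a1 a2 a3 a4] := inc n; move=> /andP[/andP[b1 b2] /andP[b3 b4]].
  by rewrite /inrect (le_trans a1) ?(le_trans b2) ?(le_trans a3) ?(le_trans b4).
have grow n : cabs (RI f x0 x1 y0 y1) / 4 ^+ n <= cabs (Q n (c n)).
  elim: n => [|n IH].
    rewrite /c /Q /w /h /= expr0 !divr1.
    by rewrite !(addrC _ (_ - _)) !subrK.
  have -> : cabs (RI f x0 x1 y0 y1) / 4 ^+ n.+1 = cabs (RI f x0 x1 y0 y1) / 4 ^+ n / 4.
    by rewrite exprS; field; rewrite expf_neq0 // pnatr_eq0.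
  apply: (@le_trans _ _ (cabs (Q n (c n)) / 4)).
    by rewrite ler_pM2r // invr_gt0.
  have cc z : inrect (c n).1 ((c n).1 + w n) (c n).2 ((c n).2 + h n) z -> cts id f z.
    by move=> /cin /df; exact: dble_cts.
  have E : Q n (c n) = Q n.+1 (c n) + Q n.+1 ((c n).1, (c n).2 + h n.+1) +
     (Q n.+1 ((c n).1 + w n.+1, (c n).2) + Q n.+1 ((c n).1 + w n.+1, (c n).2 + h n.+1)).
    by rewrite /Q wS hS !addrA /= RI_quarter //; move: cc; rewrite wS hS !addrA.
  rewrite /= /nxt; case: ifP => // /negbT; rewrite -ltNge => l1.
  case: ifP => // /negbT; rewrite -ltNge => l2.
  case: ifP => // /negbT; rewrite -ltNge => l3.
  by rewrite leNgt; apply/negP => l4; exact: (cabs_quarter E l1 l3 l2 l4).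
have [px Hx] : exists p : R, forall n, (c n).1 <= p <= (c n).1 + w n.
  apply: nested_point => // n; have [/andP[b1 b2] _] := nxtP n (c n) => //=.
  by rewrite (wS n) addrA lerD2r.
have [py Hy] : exists p : R, forall n, (c n).2 <= p <= (c n).2 + h n.
  apply: nested_point => // n; have [_ /andP[b1 b2]] := nxtP n (c n) => //=.
  by rewrite (hS n) addrA lerD2r.
pose p := px +i* py.
have [d dp] : dble f p.
  by apply: df; apply: (cin 0%N); rewrite /inrect [X in X && _]Hx [X in _ && X]Hy.
apply/ler_addgt0Pl => eps e0; rewrite addr0.
pose L := (x1 - x0) + (y1 - y0) + 1.
have L0 : 0 < L by rewrite ltr_wpDl // addr_ge0 ?subr_ge0.
(* [RI_le] yields [4 K (w + h)] with [K = e1 L / 2^n] and [w + h <= L / 2^n], hence [eps / 4^n] for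
   this value of [e1]. *)
have e1 : 0 < eps / (4 * L ^+ 2) by rewrite divr_gt0 ?mulr_gt0 ?exprn_gt0.
have [del del0 Hd] := (hasdP _ _ _ _).1 dp _ e1.
have [n Hn] : exists n, L / 2 ^+ n < del.
  have [N HN] := exp2_unbounded (L / del); exists N.
  by rewrite ltr_pdivrMr ?exprn_gt0 // mulrC -ltr_pdivrMr.
have an0 : 0 < (4 : R) ^+ n by rewrite exprn_gt0.
suff : cabs (Q n (c n)) <= eps / 4 ^+ n.
  by move=> /(le_trans (grow n)); rewrite ler_pM2r ?invr_gt0.
set X0 := (c n).1; set Y0 := (c n).2.
have lw : X0 <= X0 + w n by rewrite lerDl.
have lh : Y0 <= Y0 + h n by rewrite lerDl.
have cf z : onbd X0 (X0 + w n) Y0 (Y0 + h n) z -> cts id f z.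
  by move=> /onbd_inrect /cin /df; exact: dble_cts.
have caff z : cts id (fun z => f p + d * (z - p)) z.
  apply: ctsD (cts_cst _ _ _) _; apply: ctsM (cts_cst _ _ _) _.
  exact: cts_subC.
(* The affine part of [f] at [p] has a primitive, so only the remainder of differentiability is
   integrated. *)
have -> : Q n (c n) = RI (fun z => f z - (f p + d * (z - p))) X0 (X0 + w n) Y0 (Y0 + h n).
  suff P0 : RI (fun z => f p + d * (z - p)) X0 (X0 + w n) Y0 (Y0 + h n) = 0.
    by rewrite RIB // P0 subr0.
  apply: (@RI_primitive _ _ _ _ lw lh _
    (fun z => f p * z + d * ((z - p) ^+ 2 / 2))) => // z _.
  have -> : f p + d * (z - p) = f p * 1 + d * ((2%:R * (z - p) ^+ 2.-1 * (1 - 0)) / 2).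
    by field.
  apply: hasdD; first by apply: hasdZ; exact: hasd_id.
  apply: hasdZ; have := hasdM (hasdX 2 (hasdB (hasd_id id z) (hasd_cst id p z))) (hasd_cst id 2^-1 z).
  by rewrite mulr0 addr0.
have LE z : inrect X0 (X0 + w n) Y0 (Y0 + h n) z -> cabs (z - p) <= L / 2 ^+ n.
  move=> /andP[zx zy]; apply: (le_trans (cabs_le_ReIm _)).
  have := Hx n; have := Hy n; rewrite -/X0 -/Y0 => hy hx.
  rewrite cReD cImD cReN cImN /=.
  have -> : L / 2 ^+ n = w n + h n + 1 / 2 ^+ n by rewrite /w /h /L; ring.
  have q0 : 0 <= 1 / 2 ^+ n :> R by rewrite divr_ge0 ?exprn_ge0.
  have a1 : `|cRe z - px| <= w n by rewrite ler_norml; clear -zx hx; lra.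
  have a2 : `|cIm z - py| <= h n by rewrite ler_norml; clear -zy hy; lra.
  by clear -a1 a2 q0; lra.
have q1 : 0 <= L / 2 ^+ n by rewrite divr_ge0 ?exprn_ge0 // ltW.
apply: (le_trans (@RI_le _ _ _ _ lw lh _ (eps / (4 * L ^+ 2) * (L / 2 ^+ n)) _ _)).
- by move=> z /cf cz; apply: ctsB.
- move=> z /onbd_inrect /LE hz; have := Hd z (le_lt_trans hz Hn).
  rewrite opprD addrA => hh; apply: (le_trans hh).
  by rewrite ler_wpM2l // ltW.
have -> : X0 + w n - X0 + (Y0 + h n - Y0) = w n + h n by ring.
have wh : w n + h n <= L / 2 ^+ n.
  have -> : L / 2 ^+ n = w n + h n + 1 / 2 ^+ n by rewrite /w /h /L; ring.
  by rewrite lerDl divr_ge0 ?exprn_ge0.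
have E : eps / 4 ^+ n = 4 * (eps / (4 * L ^+ 2) * (L / 2 ^+ n)) * (L / 2 ^+ n).
  have -> : (4 : R) = 2 ^+ 2 by rewrite expr2; ring.
  rewrite -exprM mulnC exprM; field.
  by rewrite expf_neq0 ?pnatr_eq0 //= gt_eqF.
by rewrite E ler_wpM2l // mulr_ge0 // mulr_ge0 // ltW.
Qed.

(** The point [p] itself is excluded: a quotient takes the value 0 at its pole by the convention for
    division, and [zeta 1] is arbitrary. *)
Definition limat f p (c : R[i]) := forall eps : R, 0 < eps -> exists2 d : R, 0 < d &
  forall z, z != p -> cabs (z - p) < d -> cabs (f z - c) < eps.

(** The four rectangles surrounding the small square avoid [p] and contribute nothing by [goursat];
    they are cut off one after the other. *)
Lemma RI_shrink f p r x0 x1 y0 y1 : 0 < r ->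
  x0 <= cRe p - r -> cRe p + r <= x1 ->
  y0 <= cIm p - r -> cIm p + r <= y1 ->
  (forall z, inrect x0 x1 y0 y1 z -> z != p -> dble f z) ->
  RI f x0 x1 y0 y1 = RI f (cRe p - r) (cRe p + r)
                          (cIm p - r) (cIm p + r).
Proof.
case: p => px py /= r0 a1 a2 b1 b2 Hf.
have cc (u0 u1 v0 v1 : R) : x0 <= u0 -> u1 <= x1 -> y0 <= v0 -> v1 <= y1 ->
    [|| px < u0, u1 < px, py < v0, v1 < py | [&& u0 < px, px < u1, v0 < py & py < v1]] ->
    forall z, onbd u0 u1 v0 v1 z -> cts id f z.
  move=> h1 h2 h3 h4 h5 [zx zy] /andP[/andP[/= /andP[q1 q2] /andP[q3 q4]] h6].
  apply/dble_cts/Hf; first by rewrite /inrect /=; clear -h1 h2 h3 h4 q1 q2 q3 q4; lra.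
  apply/eqP => -[? ?]; subst zx zy.
  case/or4P: h6 => /eqP h6; move: h5 => /or4P[|||/orP[|/and4P[]]]; clear -h6 r0 q1 q2 q3 q4; lra.
have gg (u0 u1 v0 v1 : R) : u0 <= u1 -> v0 <= v1 ->
    x0 <= u0 -> u1 <= x1 -> y0 <= v0 -> v1 <= y1 ->
    [|| px < u0, u1 < px, py < v0 | v1 < py] -> RI f u0 u1 v0 v1 = 0.
  move=> lu lv h1 h2 h3 h4 h5; apply: goursat => // -[zx zy] /andP[/= /andP[q1 q2] /andP[q3 q4]].
  apply: Hf; first by rewrite /inrect /=; clear -h1 h2 h3 h4 q1 q2 q3 q4; lra.
  by apply/eqP => -[? ?]; subst zx zy; case/or4P: h5; clear -q1 q2 q3 q4; lra.
have ltpm : px - r < px < px + r by apply/andP; split; lra.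
have ltqm : py - r < py < py + r by apply/andP; split; lra.
have g1 : RI f x0 (px - r) y0 y1 = 0.
  by apply: gg; try (by clear -r0 a1 a2 b1 b2; lra); apply/or4P; apply: Or42; clear -r0; lra.
have g2 : RI f (px + r) x1 y0 y1 = 0.
  by apply: gg; try (by clear -r0 a1 a2 b1 b2; lra); apply/or4P; apply: Or41; clear -r0; lra.
have g3 : RI f (px - r) (px + r) y0 (py - r) = 0.
  by apply: gg; try (by clear -r0 a1 a2 b1 b2; lra); apply/or4P; apply: Or44; clear -r0; lra.
have g4 : RI f (px - r) (px + r) (py + r) y1 = 0.
  by apply: gg; try (by clear -r0 a1 a2 b1 b2; lra); apply/or4P; apply: Or43; clear -r0; lra.
have c1 (u0 u1 v0 v1 : R) : x0 <= u0 -> u1 <= x1 -> y0 <= v0 -> v1 <= y1 ->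
    u0 < px -> px < u1 -> v0 < py -> py < v1 -> forall z, onbd u0 u1 v0 v1 z -> cts id f z.
  move=> h1 h2 h3 h4 h5 h6 h7 h8; apply: cc => //.
  by rewrite h5 h6 h7 h8 !orbT.
rewrite (@RI_vcut f x0 (px - r) x1 y0 y1); [|by clear -r0 a1 a2 b1 b2; lra..|by apply: c1; clear -r0 a1 a2 b1 b2; lra].
rewrite g1 add0r (@RI_vcut f (px - r) (px + r) x1 y0 y1); [|by clear -r0 a1 a2 b1 b2; lra..|by apply: c1; clear -r0 a1 a2 b1 b2; lra].
rewrite g2 addr0 (@RI_hcut f (px - r) (px + r) y0 (py - r) y1); [|by clear -r0 a1 a2 b1 b2; lra..|by apply: c1; clear -r0 a1 a2 b1 b2; lra].
rewrite g3 add0r (@RI_hcut f (px - r) (px + r) (py - r) (py + r) y1); [|by clear -r0 a1 a2 b1 b2; lra..|by apply: c1; clear -r0 a1 a2 b1 b2; lra].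
by rewrite g4 addr0.
Qed.

Lemma square_dist p r z : 0 < r ->
  onbd (cRe p - r) (cRe p + r) (cIm p - r) (cIm p + r) z ->
  r <= cabs (z - p) <= 2 * r.
Proof.
case: p z => px py [zx zy] r0 /andP[/andP[/= hx hy] h].
apply/andP; split; last first.
  apply: (le_trans (cabs_le_ReIm _)); rewrite /=.
  have a1 : `|zx - px| <= r by rewrite ler_norml; lra.
  have a2 : `|zy - py| <= r by rewrite ler_norml; lra.
  lra.
have := Re_le_cabs ((zx +i* zy) - (px +i* py)).
have := Im_le_cabs ((zx +i* zy) - (px +i* py)); rewrite /= => i1 i2.
have hn (u : R) : (u = r) \/ (u = - r) -> r <= `|u|.
  by case=> ->; rewrite ?normrN ger0_norm ?lexx // ltW.
case/or4P: h => /eqP h.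
- by apply: le_trans i2; apply: hn; right; rewrite h; ring.
- by apply: le_trans i2; apply: hn; left; rewrite h; ring.
- by apply: le_trans i1; apply: hn; right; rewrite h; ring.
- by apply: le_trans i1; apply: hn; left; rewrite h; ring.
Qed.

Lemma interior_radius x0 x1 y0 y1 p (d : R) : ininterior x0 x1 y0 y1 p -> 0 < d ->
  exists r, [/\ 0 < r < d, x0 <= cRe p - r, cRe p + r <= x1,
    y0 <= cIm p - r & cIm p + r <= y1].
Proof.
move=> /andP[/andP[a1 a2] /andP[a3 a4]] d0.
exists (Num.min (d / 2) (Num.min (Num.min (cRe p - x0) (x1 - cRe p))
   (Num.min (cIm p - y0) (y1 - cIm p)))).
set r := Num.min _ _.
have : r <= d / 2 /\ r <= cRe p - x0 /\ r <= x1 - cRe p /\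
  r <= cIm p - y0 /\ r <= y1 - cIm p.
  by rewrite /r !ge_min !lexx !orbT.
have : 0 < r by rewrite /r !lt_min !subr_gt0 a1 a2 a3 a4 divr_gt0.
move: r => r r0 [? [? [? [? ?]]]]; by split; lra.
Qed.

Lemma RI_removable f p x0 x1 y0 y1 : ininterior x0 x1 y0 y1 p ->
  (forall z, inrect x0 x1 y0 y1 z -> z != p -> dble f z) ->
  limat (fun z => (z - p) * f z) p 0 -> RI f x0 x1 y0 y1 = 0.
Proof.
move=> pin Hf lim; apply/eqP; rewrite -cabs_eq0; apply/eqP/le_anti.
rewrite cabs_ge0 andbT; apply/ler_addgt0Pl => eps e0; rewrite addr0.
have [d d0 Hd] := lim (eps / 16) (divr_gt0 e0 (ltr0Sn _ _)).
have [r [/andP[r0 rd] h1 h2 h3 h4]] := interior_radius pin (divr_gt0 d0 (ltr0Sn R 1)).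
rewrite (RI_shrink r0 h1 h2 h3 h4 Hf).
have bdne z : onbd (cRe p - r) (cRe p + r)
    (cIm p - r) (cIm p + r) z -> z != p.
  move=> /(square_dist r0) /andP[rz _]; apply: contraTneq rz => ->.
  by rewrite subrr cabs0 -ltNge.
have le1 : cRe p - r <= cRe p + r by lra.
have le2 : cIm p - r <= cIm p + r by lra.
(* The integrand is at most [eps / 16 / r] on a square of side [2 r], and [RI_le] multiplies this by
   [4 (2 r + 2 r)]. *)
apply: (le_trans (@RI_le _ _ _ _ le1 le2 _ (eps / 16 / r) _ _)).
- move=> z zb; apply/dble_cts/Hf; last exact: bdne.
  move: zb => /onbd_inrect /andP[/andP[q1 q2] /andP[q3 q4]].
  by rewrite /inrect; clear -q1 q2 q3 q4 h1 h2 h3 h4; lra.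
- move=> z zb; have /andP[rz rz2] := square_dist r0 zb.
  have := Hd z (bdne _ zb); rewrite subr0 cabsM => H.
  have {}H := H (le_lt_trans rz2 _); rewrite ler_pdivlMr //.
  apply: (@le_trans _ _ (cabs (z - p) * cabs (f z))).
    by rewrite mulrC ler_wpM2r ?cabs_ge0.
  by apply/ltW/H; lra.
have -> : 4 * (eps / 16 / r) *
  (cRe p + r - (cRe p - r) + (cIm p + r - (cIm p - r))) = eps.
  by field; rewrite gt_eqF.
by [].
Qed.

Lemma cts_inv p z : z != p -> cts id (fun z => (z - p)^-1) z.
Proof.
move=> zp; apply: ctsV; first by rewrite subr_eq0.
exact: cts_subC.
Qed.

Lemma hasd_subC p z : hasd id (fun z => z - p) z 1.
Proof. by have := hasdB (hasd_id id z) (hasd_cst id p z); rewrite subr0. Qed.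

Lemma dble_inv p z : z != p -> dble (fun z => (z - p)^-1) z.
Proof.
by move=> zp; eexists; apply: hasdV; [rewrite subr_eq0 | exact: hasd_subC].
Qed.

Lemma cts_line (a b t : R) : cts rc (fun t : R => (t - a) +i* b) t.
Proof.
have -> : (fun t : R => (t - a) +i* b) = fun t => t%:C - (a +i* (- b)) by apply/funext => u; simpc.
exact: cts_subC.
Qed.

(** With [x = t - a] and [c^2 = 1] the integrand is [(x - i c r) / (x^2 + r^2)]. Half the logarithm
    of [x^2 + r^2] takes the same value at both ends; the arctangent of [x / r] runs from [- pi / 4]
    to [pi / 4]. *)
Lemma cI_inv (a r c : R) : 0 < r -> (c == 1) || (c == -1) ->
  cI (fun t => ((t - a) +i* (c * r))^-1) (a - r) (a + r) = ii * (- c * pi / 2)%:C.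
Proof.
move=> r0 hc; have c2 : c * c = 1 by case/orP: hc => /eqP ->; ring.
have c0 : c != 0 by apply/eqP => c0; move: c2; rewrite c0; lra.
have ne (t : R) : (t +i* (c * r)) != 0.
  by rewrite eq_complex /= negb_and mulf_neq0 ?orbT // gt_eqF.
have n2 (t : R) : 0 < t ^+ 2 + r ^+ 2 by rewrite ltr_wpDl ?sqr_ge0 ?exprn_gt0.
pose F (t : R) : R[i] := (2^-1 * ln ((t - a) ^+ 2 + r ^+ 2))%:C - ii * (c * atan ((t - a) / r))%:C.
have dF (t : R) : hasd (real_complex R) F t ((t - a) +i* (c * r))^-1.
  have -> : ((t - a) +i* (c * r))^-1 = ((t - a) / ((t - a) ^+ 2 + r ^+ 2))%:C
      - ii * (c * (r / ((t - a) ^+ 2 + r ^+ 2)))%:C.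
    apply: (@mulfI _ ((t - a) +i* (c * r))); first exact: ne.
    rewrite mulfV //; apply: complexP; simpc => /=.
      have -> : c * r * (c * (r / ((t - a) ^+ 2 + r ^+ 2))) =
          (c * c) * (r ^+ 2 / ((t - a) ^+ 2 + r ^+ 2)) by ring.
      by rewrite c2; field; rewrite gt_eqF.
    by field; rewrite gt_eqF.
  have da : is_derive t 1 (fun t : R => t - a) 1.
    by apply: is_derive_eq; rewrite subr0.
  apply: hasdB; last apply: hasdZ; apply: hasd_real.
    have dq : is_derive t 1 (fun t : R => (t - a) ^+ 2 + r ^+ 2) (2 * (t - a)).
      by apply: is_derive_eq; rewrite /GRing.scale /=; ring.
    have -> : (t - a) / ((t - a) ^+ 2 + r ^+ 2) =
        2^-1 * (((t - a) ^+ 2 + r ^+ 2)^-1 * (2 * (t - a))).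
      by field; rewrite gt_eqF.
    have := @is_derive1_comp _ (@ln R) (fun t : R => (t - a) ^+ 2 + r ^+ 2) t _ _
       (is_derive1_ln (n2 (t - a))) dq.
    by move=> /(@is_deriveZ _ _ _ _ 2^-1).
  have dq : is_derive t 1 (fun t : R => (t - a) / r) r^-1.
    have -> : (fun t : R => (t - a) / r) = (fun t : R => r^-1 *: (t - a)).
      by apply/funext => u; rewrite mulrC.
    by apply: is_derive_eq; rewrite /GRing.scale /= mulr1.
  have -> : c * (r / ((t - a) ^+ 2 + r ^+ 2)) = c * ((1 + ((t - a) / r) ^+ 2)^-1 * r^-1).
    rewrite expr_div_n; congr (_ * _); field.
    by rewrite !gt_eqF // addrC.
  have := @is_derive1_comp _ (@atan R) (fun t : R => (t - a) / r) t _ _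
       (is_derive1_atan _) dq.
  by move=> /(@is_deriveZ _ _ _ _ c).
rewrite (@cI_FTC _ F); [ | lra | | by move=> t _; exact: dF]; last first.
  by move=> t _; apply: ctsV => //; exact: cts_line.
rewrite /F.
have -> : a + r - a = r by ring.
have -> : a - r - a = - r by ring.
rewrite sqrrN mulNr divff ?gt_eqF // atanN atan1.
by apply: complexP; simpc => /=; field.
Qed.

(** After shrinking to a square centred at [p], each side is an instance of [cI_inv], the vertical
    ones after division by [i], and contributes [i pi / 2]. *)
Lemma RI_inv p x0 x1 y0 y1 : ininterior x0 x1 y0 y1 p ->
  RI (fun z => (z - p)^-1) x0 x1 y0 y1 = (2 * pi)%:C * ii.
Proof.
move=> pin; have [r [/andP[r0 rd] h1 h2 h3 h4]] := interior_radius pin ltr01.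
rewrite (RI_shrink r0 h1 h2 h3 h4); last by move=> z _; exact: dble_inv.
case: p {pin h1 h2 h3 h4} => px py /=; rewrite /RI.
have -> : (fun t => (t +i* (py - r) - px +i* py)^-1) = (fun t => ((t - px) +i* (-1 * r))^-1).
  by apply/funext => t; congr (_^-1); simpc; congr (_ +i* _); ring.
have -> : (fun t => (t +i* (py + r) - px +i* py)^-1) = (fun t => ((t - px) +i* (1 * r))^-1).
  by apply/funext => t; congr (_^-1); simpc; congr (_ +i* _); ring.
have i0 : ii != 0 :> R[i] by rewrite -cabs_gt0 cabs_i.
have -> : (fun t => ((px + r) +i* t - px +i* py)^-1) = (fun t => ii^-1 * ((t - py) +i* (-1 * r))^-1).
  by apply/funext => t; rewrite -invfM; congr (_^-1); apply: complexP; simpc => /=; ring.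
have -> : (fun t => ((px - r) +i* t - px +i* py)^-1) = (fun t => ii^-1 * ((t - py) +i* (1 * r))^-1).
  by apply/funext => t; rewrite -invfM; congr (_^-1); apply: complexP; simpc => /=; ring.
have ig (c a : R) : c != 0 -> cintegrable `[a - r, a + r]%classic (fun t => ((t - a) +i* (c * r))^-1).
  move=> c0; apply: cts_integrable => t _; apply: ctsV.
    by rewrite eq_complex /= negb_and mulf_neq0 ?orbT // gt_eqF.
  exact: cts_line.
have n1 : (-1 : R) != 0 by rewrite oppr_eq0 oner_eq0.
have Z (g : R -> R[i]) (a b : R) (c : R[i]) : cintegrable `[a, b]%classic g ->
  cI (fun t => c * g t) a b = c * cI g a b by move=> h; rewrite /cI cintZ.
rewrite !Z; [ | exact: ig (oner_neq0 _) | exact: ig].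
rewrite !cI_inv // ?eqxx ?orbT //.
rewrite !(mulKf i0).
by by apply: complexP; simpc => /=; field.
Qed.

Lemma avoid_seq (a b : R) (L : seq R) : a < b -> exists2 m, a < m < b & m \notin L.
Proof.
elim: L a b => [|c L IH] a b ab; first by exists ((a + b) / 2) => //; lra.
have [/andP[ac cb]|h] := boolP (a < c < b).
  have [m mb mL] := IH a c ac; exists m; first lra.
  by rewrite inE negb_or mL andbT; apply/eqP => E; move: mb; rewrite E; lra.
have [m mb mL] := IH a b ab; exists m => //.
by rewrite inE negb_or mL andbT; apply: contraNneq h => <-.
Qed.

(** Induction on the number of singular points. Two distinct ones differ in a coordinate, so a
    vertical or horizontal line separates them and misses all the others; each part then has fewer
    points, and a single one is treated by [RI_removable]. *)
Lemma residue0 f (S : seq R[i]) x0 x1 y0 y1 : x0 <= x1 -> y0 <= y1 -> uniq S ->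
  (forall p, p \in S -> ininterior x0 x1 y0 y1 p) ->
  (forall z, inrect x0 x1 y0 y1 z -> z \notin S -> dble f z) ->
  (forall p, p \in S -> limat (fun z => (z - p) * f z) p 0) -> RI f x0 x1 y0 y1 = 0.
Proof.
move: {2}(size S) (leqnn (size S)) => n.
elim: n S x0 x1 y0 y1 => [|n IH] S x0 x1 y0 y1 Sn x01 y01 uS Sin df lim.
  by apply: goursat => // z /df; apply; case: S Sn {uS Sin df lim}.
case: S Sn uS Sin df lim => [|p [|q S]] Sn uS Sin df lim.
- by apply: goursat => // z /df; exact.
- apply: (@RI_removable _ p); first by apply: Sin; rewrite inE.
    by move=> z /df + zp; apply; rewrite inE.
  by apply: lim; rewrite inE.
set L := [:: p, q & S] in Sn uS Sin df lim.
have pq : p != q by move: uS => /= /andP[]; rewrite inE negb_or => /andP[].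
have pL : p \in L by rewrite !inE eqxx.
have qL : q \in L by rewrite !inE eqxx orbT.
have part (P : pred R[i]) w a0 a1 b0 b1 : w \in L -> ~~ P w -> a0 <= a1 -> b0 <= b1 ->
    (forall z, z \in L -> P z -> ininterior a0 a1 b0 b1 z) ->
    (forall z, inrect a0 a1 b0 b1 z -> inrect x0 x1 y0 y1 z) ->
    (forall z, z \in L -> inrect a0 a1 b0 b1 z -> P z) -> RI f a0 a1 b0 b1 = 0.
  move=> wL nP ha hb inP sub onP; apply: (IH [seq z <- L | P z]) => //.
  - rewrite size_filter -ltnS (leq_trans _ Sn) //.
    rewrite -[X in (_ < X)%N](count_predC P) -[X in (X < _)%N]addn0 ltn_add2l -has_count.
    by apply/hasP; exists w.
  - exact: filter_uniq.
  - by move=> z; rewrite mem_filter => /andP[Pz zL]; exact: inP.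
  - move=> z iz; rewrite mem_filter negb_and => zn; apply: df; first exact: sub.
    by apply/negP => zL; move: zn; rewrite zL orbF (onP z zL iz).
  - by move=> z; rewrite mem_filter => /andP[_ /lim].
have cf z : onbd x0 x1 y0 y1 z -> cts id f z.
  move=> zb; apply/dble_cts/df; first exact: onbd_inrect.
  apply/negP => /Sin; move: zb => /andP[_] /or4P[] /eqP h /andP[/andP[a1 a2] /andP[a3 a4]];
    clear -h a1 a2 a3 a4; lra.
have vcase u v : u \in L -> v \in L -> cRe u < cRe v -> RI f x0 x1 y0 y1 = 0.
  move=> uL vL uv; have [m /andP[um mv] mL] := avoid_seq (map (@complex.Re R) L) uv.
  have /andP[/andP[iu1 _] _] := Sin u uL; have /andP[/andP[_ iv2] _] := Sin v vL.
  have neq z : z \in L -> cRe z != m by move=> zL; apply: contraNneq mL => <-; exact: map_f.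
  have lm : x0 <= m by apply: ltW (lt_trans iu1 um).
  have rm : m <= x1 by apply: ltW (lt_trans mv iv2).
  rewrite (@RI_vcut f x0 m x1 y0 y1) //; last by rewrite lm.
  have -> : RI f x0 m y0 y1 = 0.
    apply: (part (fun z => cRe z < m) v) => //; first by rewrite -leNgt ltW.
    - by move=> z /Sin /andP[/andP[z1 z2] z3] zm; rewrite /ininterior z3 z1 zm.
    - by move=> z /andP[/andP[z1 z2] z3]; rewrite /inrect z3 z1 (le_trans z2).
    - by move=> z zL /andP[/andP[z1 z2] z3]; rewrite lt_neqAle neq.
  have -> : RI f m x1 y0 y1 = 0.
    apply: (part (fun z => m < cRe z) u) => //; first by rewrite -leNgt ltW.
    - by move=> z /Sin /andP[/andP[z1 z2] z3] zm; rewrite /ininterior z3 z2 zm.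
    - by move=> z /andP[/andP[z1 z2] z3]; rewrite /inrect z3 z2 (le_trans lm).
    - by move=> z zL /andP[/andP[z1 z2] z3]; rewrite lt_neqAle eq_sym neq.
  exact: addr0.
have hcase u v : u \in L -> v \in L -> cIm u < cIm v -> RI f x0 x1 y0 y1 = 0.
  move=> uL vL uv; have [m /andP[um mv] mL] := avoid_seq (map (@complex.Im R) L) uv.
  have /andP[_ /andP[iu1 _]] := Sin u uL; have /andP[_ /andP[_ iv2]] := Sin v vL.
  have neq z : z \in L -> cIm z != m by move=> zL; apply: contraNneq mL => <-; exact: map_f.
  have lm : y0 <= m by apply: ltW (lt_trans iu1 um).
  have rm : m <= y1 by apply: ltW (lt_trans mv iv2).
  rewrite (@RI_hcut f x0 x1 y0 m y1) //; last by rewrite lm.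
  have -> : RI f x0 x1 y0 m = 0.
    apply: (part (fun z => cIm z < m) v) => //; first by rewrite -leNgt ltW.
    - by move=> z /Sin /andP[z3 /andP[z1 z2]] zm; rewrite /ininterior z3 z1 zm.
    - by move=> z /andP[z3 /andP[z1 z2]]; rewrite /inrect z3 z1 (le_trans z2).
    - by move=> z zL /andP[z3 /andP[z1 z2]]; rewrite lt_neqAle neq.
  have -> : RI f x0 x1 m y1 = 0.
    apply: (part (fun z => m < cIm z) u) => //; first by rewrite -leNgt ltW.
    - by move=> z /Sin /andP[z3 /andP[z1 z2]] zm; rewrite /ininterior z3 z2 zm.
    - by move=> z /andP[z3 /andP[z1 z2]]; rewrite /inrect z3 z2 (le_trans lm).
    - by move=> z zL /andP[z3 /andP[z1 z2]]; rewrite lt_neqAle eq_sym neq.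
  exact: addr0.
have [h|h|hR] := ltgtP (cRe p) (cRe q); [exact: vcase h|exact: vcase h|].
have [h|h|hI] := ltgtP (cIm p) (cIm q); [exact: hcase h|exact: hcase h|].
by move: pq; rewrite (complexP hR hI) eqxx.
Qed.

Lemma limat_cts f p : cts id f p -> limat f p (f p).
Proof. by move=> cf eps /cf[d d0 H]; exists d => // z _ /H. Qed.

Lemma limat_near f g p c (d : R) : 0 < d ->
  (forall z, z != p -> cabs (z - p) < d -> f z = g z) -> limat f p c -> limat g p c.
Proof.
move=> d0 H lf eps /lf[d' d'0 H']; exists (Num.min d d'); first by rewrite lt_min d0.
by move=> z zp; rewrite lt_min => /andP[h h']; rewrite -H // H'.
Qed.

Lemma eq_limat f g p c : (forall z, z != p -> f z = g z) -> limat f p c -> limat g p c.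
Proof. by move=> H; apply: (@limat_near _ _ _ _ 1) => // z /H. Qed.

Lemma limatB f g p a b : limat f p a -> limat g p b ->
  limat (fun z => f z - g z) p (a - b).
Proof.
move=> lf lg eps e0; have e2 : 0 < eps / 2 by rewrite divr_gt0.
have [d d0 H] := lf _ e2; have [d' d'0 H'] := lg _ e2.
exists (Num.min d d'); first by rewrite lt_min d0.
move=> z zp; rewrite lt_min => /andP[/(H z zp) h /(H' z zp) h'].
rewrite (_ : _ - _ = (f z - a) - (g z - b)); last by ring.
by apply: (le_lt_trans (cabsB _ _)); lra.
Qed.

Lemma limat_mul_cts f g p c : limat f p c -> cts id g p -> limat (fun z => f z * g z) p (c * g p).
Proof.
move=> lf cg; pose f' z := if z == p then c else f z.
have cf' : cts id f' p.
  move=> eps e0; have [d d0 H] := lf eps e0; exists d => // z h; rewrite /f' eqxx.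
  by case: eqP => [_|/eqP zp]; [rewrite subrr cabs0 | exact: H].
have -> : c * g p = f' p * g p by rewrite /f' eqxx.
apply: (@eq_limat (fun z => f' z * g z)); last exact/limat_cts/ctsM.
by move=> z zp; rewrite /f' (negbTE zp).
Qed.

Lemma RI_sum (I : Type) (r : seq I) (F : I -> R[i] -> R[i]) x0 x1 y0 y1 :
  x0 <= x1 -> y0 <= y1 ->
  (forall i z, onbd x0 x1 y0 y1 z -> cts id (F i) z) ->
  RI (fun z => \sum_(i <- r) F i z) x0 x1 y0 y1 = \sum_(i <- r) RI (F i) x0 x1 y0 y1.
Proof.
move=> x01 y01 cF; elim: r => [|i r IH].
  rewrite big_nil (@RI_primitive _ _ _ _ x01 y01 _ (fun=> 0)) // => z _.
    have -> : (fun z => \sum_(i <- [::]) F i z) = fun=> 0.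
      by apply/funext => t; rewrite big_nil.
    exact: cts_cst.
  by rewrite big_nil; exact: hasd_cst.
rewrite big_cons -IH -RID //; [|by move=> z zb; apply: cF|by move=> z zb; apply: cts_sum => j; exact: cF].
by apply: eq_RI => // z _; rewrite big_cons.
Qed.

(** Subtracting [c p / (z - p)] for each [p] leaves singularities to which [residue0] applies; the
    subtracted terms are integrated by [RI_inv]. *)
Theorem residue_thm f (c : R[i] -> R[i]) (S : seq R[i]) x0 x1 y0 y1 :
  x0 <= x1 -> y0 <= y1 -> uniq S ->
  (forall p, p \in S -> ininterior x0 x1 y0 y1 p) ->
  (forall z, inrect x0 x1 y0 y1 z -> z \notin S -> dble f z) ->
  (forall p, p \in S -> limat (fun z => (z - p) * f z) p (c p)) ->
  RI f x0 x1 y0 y1 = (2 * pi)%:C * ii * \sum_(p <- S) c p.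
Proof.
move=> x01 y01 uS Sin df lim.
have bdS z : onbd x0 x1 y0 y1 z -> z \notin S.
  move=> zb; apply/negP => /Sin; move: zb.
  by move=> /andP[_] /or4P[] /eqP h /andP[/andP[a1 a2] /andP[a3 a4]]; lra.
have cf z : onbd x0 x1 y0 y1 z -> cts id f z.
  by move=> zb; apply/dble_cts/df; [exact: onbd_inrect | exact: bdS].
(* Setting the principal part to 0 for [p] outside [S] allows continuity and differentiability to be
   asserted for every [p], as [RI_sum] and [hasd_sum] demand. *)
pose F p z := if p \in S then c p * (z - p)^-1 else 0.
have cF p z : z \notin S -> cts id (F p) z.
  move=> zS; have [pS|/negbTE pS] := boolP (p \in S); rewrite /F pS; last exact: cts_cst.
  apply: ctsM (cts_cst _ _ _) _; apply: cts_inv.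
  by apply: contraNneq zS => ->.
have dF p z : z != p -> dble (F p) z.
  move=> zS; have [pS|/negbTE pS] := boolP (p \in S); rewrite /F pS;
    last by eexists; exact: hasd_cst.
  by have [d dd] := dble_inv zS; eexists; apply: hasdZ; exact: dd.
have RIF p : p \in S -> RI (F p) x0 x1 y0 y1 = (2 * pi)%:C * ii * c p.
  move=> pS; have -> : F p = fun z => c p * (z - p)^-1 by apply/funext => z; rewrite /F pS.
  rewrite RIZ //; first by rewrite RI_inv ?Sin // mulrC.
  move=> z /bdS zS; apply: cts_inv.
  by apply: contraNneq zS => ->.
rewrite mulr_sumr -[RHS](_ : \sum_(p <- S) RI (F p) x0 x1 y0 y1 = _); last first.
  by rewrite big_seq [RHS]big_seq; apply: eq_bigr => p /RIF.
apply/eqP; rewrite -subr_eq0 -RI_sum //; last by move=> p z /bdS; exact: cF.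
rewrite -RIB //; last first.
  by move=> z /bdS zS; apply: cts_sum => p; exact: cF.
apply/eqP; apply: (@residue0 _ S) => //.
  move=> z zin zS; have [d dd] := df z zin zS.
  have [D HD] : exists D, forall p, hasd id (F p) z (D p).
    have H p : exists e, hasd id (F p) z e.
      have [pS|pS] := boolP (p \in S).
        by apply: dF; apply: contraNneq zS => ->.
      by exists 0; rewrite /F (negbTE pS); exact: hasd_cst.
    by exists (fun p => projT1 (cid (H p))) => p; exact: projT2 (cid (H p)).
  by eexists; apply: hasdB; [exact: dd | apply: hasd_sum; exact: HD].
move=> p pS.
have cp : cts id (fun z => c p + (z - p) * \sum_(q <- S | q != p) F q z) p.
  apply: ctsD (cts_cst _ _ _) _; apply: ctsM.
    exact: cts_subC.
  have -> : (fun z => \sum_(q <- S | q != p) F q z) =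
     (fun z => \sum_(q <- [seq q <- S | q != p]) F q z).
    by apply/funext => z; rewrite big_filter.
  rewrite -[p in cts _ _ p]/p; have : p \notin [seq q <- S | q != p].
    by rewrite mem_filter eqxx.
  elim: [seq _ <- _ | _] => [|q r IH].
    have -> : (fun z => \sum_(q <- [::]) F q z) = fun=> 0.
      by apply/funext => t; rewrite big_nil.
    by move=> _; exact: cts_cst.
  rewrite inE negb_or => /andP[pq pr].
  have -> : (fun z => \sum_(q <- q :: r) F q z) = fun z => F q z + \sum_(q <- r) F q z.
    by apply/funext => t; rewrite big_cons.
  by apply: ctsD; [apply/dble_cts/dF | exact: IH].
have := limatB (lim p pS) (limat_cts cp); rewrite subrr mul0r addr0 subrr.
apply: eq_limat => z zp; rewrite (bigD1_seq p) //=.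
have -> : F p z = c p / (z - p) by rewrite /F pS.
by rewrite mulrBr mulrDr; congr (_ - (_ + _)); field; rewrite subr_eq0.
Qed.

End Rectangle.

(** * Cauchy's formula, maximum principle, regularity, identity theorem *)

Section CauchyTheory.
Variable R : realType.
Implicit Types (f g : R[i] -> R[i]) (z p a : R[i]).

(** Bernoulli's inequality [1 + n (x - 1) <= x^n] excludes [x > 1]. *)
Lemma real_power_bounded (x C : R) : (forall n, x ^+ n <= C) -> x <= 1.
Proof.
move=> H; rewrite leNgt; apply/negP => x1.
have B n : 1 + n%:R * (x - 1) <= x ^+ n.
  elim: n => [|n IH]; first by rewrite mul0r addr0 expr0.
  rewrite exprS; have h0 : 0 <= n%:R * (x - 1) ^+ 2 by rewrite mulr_ge0 ?sqr_ge0.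
  apply: (@le_trans _ _ (x * (1 + n%:R * (x - 1)))).
    by rewrite -[n.+1]addn1 natrD; move: h0; rewrite expr2; lra.
  by rewrite ler_wpM2l //; lra.
have x10 : 0 < x - 1 by rewrite subr_gt0.
pose n := (Num.truncn (C / (x - 1))).+1.
have := truncnS_gt (C / (x - 1)); rewrite -/n ltr_pdivrMr // => h.
have := H n; have := B n; lra.
Qed.

Lemma power_lt1_le0 (t C u : R) : 0 <= t < 1 -> (forall n, u <= C * t ^+ n) -> u <= 0.
Proof.
move=> /andP[t0 t1] H; rewrite leNgt; apply/negP => up.
move: t0; rewrite le_eqVlt => /predU1P[t0|t0].
  by have := H 1%N; rewrite expr1 -t0 mulr0 leNgt up.
have : t^-1 <= 1.
  apply: (@real_power_bounded _ (C / u)) => n.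
  by rewrite exprVn ler_pdivlMr // mulrC ler_pdivrMr ?exprn_gt0.
by rewrite invf_le1 // leNgt t1.
Qed.

Lemma bd_dist x0 x1 y0 y1 a : ininterior x0 x1 y0 y1 a ->
  exists2 r, 0 < r & forall z, onbd x0 x1 y0 y1 z -> r <= cabs (z - a).
Proof.
move=> ain; have [r [/andP[r0 _] h1 h2 h3 h4]] := interior_radius ain ltr01.
exists r => // z /andP[zin zb].
have := Re_le_cabs (z - a); have := Im_le_cabs (z - a).
rewrite cReD cImD cReN cImN => i1 i2.
have nn (u : R) : r <= u \/ u <= - r -> r <= `|u|.
  by case=> h; [apply: le_trans h (ler_norm _) | rewrite -normrN; apply: le_trans (ler_norm _); lra].
case/or4P: zb => /eqP h.
- by apply: le_trans i2; apply: nn; right; rewrite h; lra.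
- by apply: le_trans i2; apply: nn; left; rewrite h; lra.
- by apply: le_trans i1; apply: nn; right; rewrite h; lra.
- by apply: le_trans i1; apply: nn; left; rewrite h; lra.
Qed.

Lemma interior_inrect x0 x1 y0 y1 a : ininterior x0 x1 y0 y1 a -> inrect x0 x1 y0 y1 a.
Proof. by move=> /andP[/andP[? ?] /andP[? ?]]; rewrite /inrect !ltW. Qed.

Lemma interior_le x0 x1 y0 y1 a : ininterior x0 x1 y0 y1 a -> x0 <= x1 /\ y0 <= y1.
Proof. by move=> /andP[/andP[? ?] /andP[? ?]]; lra. Qed.

Lemma bd_neq x0 x1 y0 y1 a z : ininterior x0 x1 y0 y1 a -> onbd x0 x1 y0 y1 z -> z != a.
Proof.
move=> /bd_dist[r r0 H] /H; apply: contraTneq => ->.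
by rewrite subrr cabs0 -ltNge.
Qed.

Lemma cts_bounded (f : R -> R[i]) (a b : R) : a <= b ->
  (forall x, a <= x <= b -> cts rc f x) ->
  exists M, forall x, a <= x <= b -> cabs (f x) <= M.
Proof.
move=> ab cf; have cc : {within `[a, b], continuous (fun t => cabs (f t))}.
  by apply: cts_within => x /cf; exact: cts_cabs.
have [c _ Hc] := EVT_max ab cc; exists (cabs (f c)) => x xab.
by apply: Hc; rewrite in_itv.
Qed.

Lemma bd_bounded f x0 x1 y0 y1 : x0 <= x1 -> y0 <= y1 ->
  (forall z, onbd x0 x1 y0 y1 z -> cts id f z) ->
  exists2 M, 0 < M & forall z, onbd x0 x1 y0 y1 z -> cabs (f z) <= M.
Proof.
move=> x01 y01 cf.
have [M1 H1] : exists M, forall x, x0 <= x <= x1 -> cabs (f (x +i* y0)) <= M.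
  apply: cts_bounded => // x hx; apply: cts_hor; apply: cf.
  by rewrite /onbd /inrect /= hx lexx y01 !eqxx ?orbT.
have [M2 H2] : exists M, forall x, x0 <= x <= x1 -> cabs (f (x +i* y1)) <= M.
  apply: cts_bounded => // x hx; apply: cts_hor; apply: cf.
  by rewrite /onbd /inrect /= hx lexx y01 !eqxx ?orbT.
have [M3 H3] : exists M, forall y, y0 <= y <= y1 -> cabs (f (x0 +i* y)) <= M.
  apply: cts_bounded => // x hx; apply: cts_ver; apply: cf.
  by rewrite /onbd /inrect /= hx lexx x01 !eqxx ?orbT.
have [M4 H4] : exists M, forall y, y0 <= y <= y1 -> cabs (f (x1 +i* y)) <= M.
  apply: cts_bounded => // x hx; apply: cts_ver; apply: cf.
  by rewrite /onbd /inrect /= hx lexx x01 !eqxx ?orbT.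
exists (1 + `|M1| + `|M2| + `|M3| + `|M4|).
  by have := normr_ge0 M1; have := normr_ge0 M2; have := normr_ge0 M3; have := normr_ge0 M4; lra.
have := ler_norm M1; have := ler_norm M2; have := ler_norm M3; have := ler_norm M4.
have := normr_ge0 M1; have := normr_ge0 M2; have := normr_ge0 M3; have := normr_ge0 M4.
move=> ? ? ? ? ? ? ? ? [x y] /andP[/andP[/= hx hy]] /or4P[] /eqP h.
- by have := H3 y hy; rewrite -h; lra.
- by have := H4 y hy; rewrite -h; lra.
- by have := H1 x hx; rewrite -h; lra.
- by have := H2 x hx; rewrite -h; lra.
Qed.

Lemma pi2i_neq0 : (2 * pi)%:C * ii != 0 :> R[i].
Proof.
rewrite mulf_neq0 //; last by rewrite -cabs_gt0 cabs_i.
by rewrite -cabs_gt0 cabs_real normr_gt0 mulf_neq0 // gt_eqF // pi_gt0.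
Qed.

Lemma le_cabs_2pii z : cabs z <= cabs ((2 * pi)%:C * ii * z).
Proof.
have p0 : 1 <= 2 * pi :> R by have := pi_ge2 R; lra.
rewrite !cabsM cabs_i mulr1 cabs_real ger0_norm; last lra.
by rewrite ler_peMl // cabs_ge0.
Qed.

Section Formula.
Variables (x0 x1 y0 y1 : R) (S : seq R[i]) (f : R[i] -> R[i]).
Hypotheses (uS : uniq S) (Sin : forall p, p \in S -> ininterior x0 x1 y0 y1 p).
Hypothesis df : forall z, inrect x0 x1 y0 y1 z -> z \notin S -> dble f z.

Lemma bd_notin z : onbd x0 x1 y0 y1 z -> z \notin S.
Proof. by move=> zb; apply/negP => /Sin pin; have := bd_neq pin zb; rewrite eqxx. Qed.

Lemma cauchy_formula a : (forall p, p \in S -> limat (fun z => (z - p) * f z) p 0) ->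
  ininterior x0 x1 y0 y1 a -> a \notin S ->
  RI (fun z => f z / (z - a)) x0 x1 y0 y1 = (2 * pi)%:C * ii * f a.
Proof.
move=> lim ain aS; have [x01 y01] := interior_le ain.
rewrite (@residue_thm _ _ (fun p => if p == a then f a else 0) (a :: S)) //.
- rewrite big_cons eqxx big1_seq ?addr0 // => p /= pS.
  by case: eqP => // E; rewrite E (negbTE aS) in pS.
- by rewrite /= aS.
- by move=> p; rewrite inE => /predU1P[->//|/Sin].
- move=> z zin; rewrite inE negb_or => /andP[za zS].
  have [d dd] := df zin zS; eexists.
  by apply: hasdM; [exact: dd | apply: hasdV; [rewrite subr_eq0|exact: hasd_subC]].
- move=> p; rewrite inE => /predU1P[->|pS].
    rewrite eqxx; apply: (@eq_limat _ f).
      by move=> z za; field; rewrite subr_eq0.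
    by apply/limat_cts/dble_cts/df => //; exact: interior_inrect.
  have pa : p != a by apply: contraNneq aS => <-.
  rewrite (negbTE pa) -(mul0r (p - a)^-1).
  have := limat_mul_cts (lim p pS) (cts_inv pa).
  by apply: eq_limat => z _; rewrite mulrA.
Qed.

End Formula.

(** Cauchy's formula for [f^n] gives [|f a|^n <= C K^n] with [C] independent of [n], and bounded
    powers force the ratio to be at most 1. Points of [S] with a finite limit are harmless, because
    [f^n] also has a limit there. *)
Lemma max_modulus (x0 x1 y0 y1 : R) (S : seq R[i]) f a K : uniq S ->
  (forall p, p \in S -> ininterior x0 x1 y0 y1 p) ->
  (forall z, inrect x0 x1 y0 y1 z -> z \notin S -> dble f z) -> (forall p, p \in S -> exists l, limat f p l) ->
  ininterior x0 x1 y0 y1 a -> a \notin S ->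
  (forall z, onbd x0 x1 y0 y1 z -> cabs (f z) <= K) -> cabs (f a) <= K.
Proof.
move=> uS Sin df lim ain aS HK; have [x01 y01] := interior_le ain.
apply/ler_addgt0Pr => eps e0.
have [r r0 Hr] := bd_dist ain.
have K0 : 0 <= K.
  apply: le_trans (HK (x0 +i* y0) _); first exact: cabs_ge0.
  by rewrite /onbd /inrect /= !lexx x01 y01 eqxx.
have Ke : 0 < K + eps by rewrite ltr_wpDl.
suff : cabs (f a) / (K + eps) <= 1 by rewrite ler_pdivrMr // mul1r.
pose C := 4 * (r^-1) * ((x1 - x0) + (y1 - y0)).
apply: (@real_power_bounded _ C) => n.
rewrite expr_div_n ler_pdivrMr ?exprn_gt0 //.
have cb z : onbd x0 x1 y0 y1 z -> cts id f z.
  by move=> zb; apply/dble_cts/df; [exact: onbd_inrect | exact: bd_notin zb].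
have dn z : inrect x0 x1 y0 y1 z -> z \notin S -> dble (fun z => f z ^+ n) z.
  by move=> zin zS; have [d dd] := df z zin zS; eexists; apply: hasdX; exact: dd.
have limX p (l : R[i]) : limat f p l -> limat (fun z => f z ^+ n) p (l ^+ n).
  move=> lf; pose g z := if z == p then l else f z.
  have cg : cts id g p.
    move=> e' e'0; have [d d0 H] := lf e' e'0; exists d => // z h; rewrite /g eqxx.
    by case: eqP => [_|/eqP zp]; [rewrite subrr cabs0 | exact: H].
  have := limat_cts (ctsX n cg); rewrite {2}/g eqxx.
  by apply: eq_limat => z zp; rewrite /g (negbTE zp).
have lim0 p : p \in S -> limat (fun z => (z - p) * f z ^+ n) p 0.
  move=> /lim[l /limX ll].
  have cz : cts id (fun z => z - p) p by exact: cts_subC.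
  have := limat_mul_cts ll cz; rewrite subrr mulr0.
  by apply: eq_limat => z _; rewrite mulrC.
have CF := cauchy_formula uS Sin dn lim0 ain aS.
have E : cabs (f a) ^+ n <= 4 * (K ^+ n / r) * ((x1 - x0) + (y1 - y0)).
  apply: (@le_trans _ _ (cabs ((2 * pi)%:C * ii * f a ^+ n))).
    by rewrite -cabsX; exact: le_cabs_2pii.
  rewrite -CF; apply: RI_le => //.
    move=> z zb; apply: ctsM; first exact: ctsX (cb z zb).
    by apply: cts_inv; exact: bd_neq zb.
  move=> z zb; rewrite cabsM cabsV cabsX.
  apply: ler_pM; rewrite ?exprn_ge0 ?cabs_ge0 ?invr_ge0 ?cabs_ge0 //.
    by rewrite lerXn2r ?nnegrE ?cabs_ge0 ?HK.
  by rewrite lef_pV2 ?posrE ?Hr // (lt_le_trans r0) ?Hr.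
apply: (le_trans E).
have -> : 4 * (K ^+ n / r) * (x1 - x0 + (y1 - y0)) = C * K ^+ n by rewrite /C; ring.
rewrite ler_wpM2l //.
  by rewrite /C !mulr_ge0 ?invr_ge0 ?(ltW r0) // addr_ge0 ?subr_ge0.
by rewrite lerXn2r ?nnegrE ?(ltW Ke) // lerDl ltW.
Qed.

Section CauchyIntegral.
Variables (x0 x1 y0 y1 : R) (psi : R[i] -> R[i]).
Hypothesis cpsi : forall z, onbd x0 x1 y0 y1 z -> cts id psi z.

Let K n z := RI (fun w => psi w / (w - z) ^+ n) x0 x1 y0 y1.

Let ctsK n a z : ininterior x0 x1 y0 y1 a -> onbd x0 x1 y0 y1 z ->
  cts id (fun w => psi w / (w - a) ^+ n) z.
Proof.
move=> ain zb; apply: ctsM; first exact: cpsi.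
apply: ctsV; first by rewrite expf_neq0 // subr_eq0 (bd_neq ain zb).
by apply/ctsX/cts_subC.
Qed.

Lemma near_interior a : ininterior x0 x1 y0 y1 a -> exists2 r, 0 < r &
  forall z, cabs (z - a) < r -> ininterior x0 x1 y0 y1 z.
Proof.
move=> ain; have [r [/andP[r0 _] h1 h2 h3 h4]] := interior_radius ain ltr01.
exists r => // z zr.
have := le_lt_trans (Re_le_cabs (z - a)) zr; have := le_lt_trans (Im_le_cabs (z - a)) zr.
rewrite cReD cImD cReN cImN !ltr_norml => i1 i2.
by rewrite /inrect /ininterior; lra.
Qed.

(** Exponents up to 2 are those met in the difference quotients of Cauchy's formulas for a function
    and for its derivative. *)
Lemma cauchy_integral_cts n a : (n <= 2)%N -> ininterior x0 x1 y0 y1 a -> cts id (K n) a.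
Proof.
move=> n2 ain; have [x01 y01] := interior_le ain.
have [r r0 Hr] := bd_dist ain; have [r' r'0 Hr'] := near_interior ain.
have [M M0 HM] := bd_bounded x01 y01 cpsi.
pose C := 4 * (M * (2 * (2 / r) * (2 / r ^+ 2) + 2 / r ^+ 2)) * ((x1 - x0) + (y1 - y0)) + 1.
have q0 : 0 <= M * (2 * (2 / r) * (2 / r ^+ 2) + 2 / r ^+ 2).
  by rewrite mulr_ge0 ?(ltW M0) // addr_ge0 ?mulr_ge0 ?invr_ge0 ?exprn_ge0 // ltW.
have C0 : 0 < C.
  apply: ltr_wpDl => //; apply: mulr_ge0; last by rewrite addr_ge0 ?subr_ge0.
  exact: mulr_ge0.
move=> eps e0; pose d := Num.min (Num.min r' (r / 2)) (eps / C).
exists d; first by rewrite !lt_min r'0 !divr_gt0.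
move=> z; rewrite !lt_min => /andP[/andP[zr' zr] ze].
have zin := Hr' z zr'.
have bz w : onbd x0 x1 y0 y1 w -> r / 2 <= cabs (w - z).
  move=> /Hr h; have := cabsD (w - z) (z - a).
  by rewrite addrA subrK; lra.
rewrite /K -RIB //; [|by move=> w; exact: ctsK|by move=> w; exact: ctsK].
have L : cabs (RI (fun w => psi w / (w - z) ^+ n - psi w / (w - a) ^+ n) x0 x1 y0 y1) <=
   4 * (cabs (z - a) * (M * (2 * (2 / r) * (2 / r ^+ 2) + 2 / r ^+ 2))) *
     ((x1 - x0) + (y1 - y0)).
  apply: RI_le => //.
    by move=> w wb; apply: ctsB; exact: ctsK.
  move=> w wb; have wz0 : 0 < cabs (w - z) by rewrite (lt_le_trans _ (bz w wb)) // divr_gt0.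
  have wa0 : 0 < cabs (w - a) by rewrite (lt_le_trans r0 (Hr w wb)).
  have nz : w - z != 0 by rewrite -cabs_gt0.
  have na : w - a != 0 by rewrite -cabs_gt0.
  rewrite -mulrBr cabsM [leRHS]mulrCA.
  apply: ler_pM; rewrite ?cabs_ge0 ?HM //.
  have uv : (w - z)^-1 - (w - a)^-1 = (z - a) * ((w - z)^-1 * (w - a)^-1).
    by field; rewrite nz na.
  have u1 : cabs (w - z)^-1 <= 2 / r.
    rewrite cabsV -[2 / r]invrK lef_pV2 ?posrE ?invr_gt0 ?divr_gt0 // invf_div.
    exact: bz.
  have u2 : cabs (w - a)^-1 <= r^-1 by rewrite cabsV lef_pV2 ?posrE ?Hr.
  have uvle : cabs ((w - z)^-1 - (w - a)^-1) <= cabs (z - a) * (2 / r ^+ 2).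
    rewrite uv !cabsM ler_wpM2l ?cabs_ge0 //.
    have -> : 2 / r ^+ 2 = (2 / r) * r^-1 by field; rewrite gt_eqF.
    by apply: ler_pM; rewrite ?cabs_ge0.
  have ge1 : 0 <= cabs (z - a) * (2 * (2 / r) * (2 / r ^+ 2)).
    by rewrite !mulr_ge0 ?cabs_ge0 ?invr_ge0 ?exprn_ge0 // ltW.
  have ge2 : 0 <= cabs (z - a) * (2 / r ^+ 2).
    by rewrite !mulr_ge0 ?cabs_ge0 ?invr_ge0 ?exprn_ge0 // ltW.
  case: n n2 => [|[|[|//]]] _.
  - by rewrite !expr0 subrr cabs0 mulrDr addr_ge0.
  - by rewrite !expr1 mulrDr; lra.
  rewrite -!exprVn subr_sqr cabsM.
  have s : cabs ((w - z)^-1 + (w - a)^-1) <= 2 * (2 / r).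
    apply: (le_trans (cabsD _ _)).
    have : r^-1 <= 2 / r by rewrite -{1}(mul1r r^-1) ler_pM2r ?invr_gt0 // ler1n.
    lra.
  apply: (@le_trans _ _ (cabs (z - a) * (2 / r ^+ 2) * (2 * (2 / r)))).
    by apply: ler_pM; rewrite ?cabs_ge0.
  by rewrite mulrDr; lra.
apply: (le_lt_trans L).
have -> : 4 * (cabs (z - a) * (M * (2 * (2 / r) * (2 / r ^+ 2) + 2 / r ^+ 2))) *
     (x1 - x0 + (y1 - y0)) = cabs (z - a) * (C - 1) by rewrite /C; ring.
apply: (@le_lt_trans _ _ (cabs (z - a) * C)).
  by rewrite ler_wpM2l ?cabs_ge0 // gerBl.
by rewrite -ltr_pdivlMr.
Qed.

End CauchyIntegral.

Section CauchyDerivative.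
Variables (x0 x1 y0 y1 : R) (psi : R[i] -> R[i]).
Hypothesis cpsi : forall z, onbd x0 x1 y0 y1 z -> cts id psi z.

Let cpsi2 n a z : ininterior x0 x1 y0 y1 a -> onbd x0 x1 y0 y1 z ->
  cts id (fun w => psi w / (w - a) ^+ n) z.
Proof.
move=> ain zb; apply: ctsM; first exact: cpsi.
apply: ctsV; first by rewrite expf_neq0 // subr_eq0 (bd_neq ain zb).
by apply/ctsX/cts_subC.
Qed.

Let cpsi3 n m a b z : ininterior x0 x1 y0 y1 a -> ininterior x0 x1 y0 y1 b ->
  onbd x0 x1 y0 y1 z -> cts id (fun w => psi w / (w - a) ^+ n / (w - b) ^+ m) z.
Proof.
move=> ain bin zb; apply: ctsM; first exact: cpsi2.
apply: ctsV; first by rewrite expf_neq0 // subr_eq0 (bd_neq bin zb).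
by apply/ctsX/cts_subC.
Qed.

Lemma hasd_local f z (phi : R[i] -> R[i]) (r : R) : 0 < r -> cts id phi z ->
  (forall w, cabs (w - z) < r -> f w - f z = phi w * (w - z)) -> hasd id f z (phi z).
Proof.
move=> r0 cphi H; apply: (@hasd_near _ _ _ (fun w => f z + phi w * (w - z)) _ _ _ r) => //.
  by move=> w /H <-; rewrite addrC subrK.
by exists phi => // w; rewrite subrr mulr0 addr0.
Qed.

(** The identity [1 / (w - z) - 1 / (w - a) = (z - a) / ((w - a) (w - z))] exhibits the difference
    quotient as another Cauchy integral, continuous in [z]: this is Caratheodory's form at once. *)
Lemma hasd_cauchy1 a : ininterior x0 x1 y0 y1 a ->
  hasd id (fun z => RI (fun w => psi w / (w - z)) x0 x1 y0 y1) a
    (RI (fun w => psi w / (w - a) ^+ 2) x0 x1 y0 y1).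
Proof.
move=> ain; have [x01 y01] := interior_le ain; have [r r0 Hr] := near_interior ain.
have -> : RI (fun w => psi w / (w - a) ^+ 2) x0 x1 y0 y1 =
    RI (fun w => psi w / (w - a) ^+ 1 / (w - a) ^+ 1) x0 x1 y0 y1.
  by apply: eq_RI => // z zb; rewrite !expr1 expr2 invfM mulrA.
apply: (@hasd_local _ _ (fun z => RI (fun w => psi w / (w - a) ^+ 1 / (w - z) ^+ 1) x0 x1 y0 y1) r) => //.
  by apply: (@cauchy_integral_cts _ _ _ _ (fun w => psi w / (w - a) ^+ 1)) => // z; exact: cpsi2.
move=> z /Hr zin; rewrite mulrC -RIZ //; last by move=> w; exact: cpsi3.
rewrite -RIB //; [|by move=> w wb; exact: (cpsi2 1 zin wb)
  |by move=> w wb; exact: (cpsi2 1 ain wb)].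
apply: eq_RI => // w wb; rewrite !expr1.
by field; rewrite !subr_eq0 (bd_neq ain wb) (bd_neq zin wb).
Qed.

Lemma dble_cauchy2 a : ininterior x0 x1 y0 y1 a ->
  dble (fun z => RI (fun w => psi w / (w - z) ^+ 2) x0 x1 y0 y1) a.
Proof.
move=> ain; have [x01 y01] := interior_le ain; have [r r0 Hr] := near_interior ain.
eexists.
apply: (@hasd_local _ _ (fun z => RI (fun w => psi w / (w - a) ^+ 1 / (w - z) ^+ 2) x0 x1 y0 y1 +
   RI (fun w => psi w / (w - a) ^+ 2 / (w - z) ^+ 1) x0 x1 y0 y1) r) => //.
  apply: ctsD.
    by apply: (@cauchy_integral_cts _ _ _ _ (fun w => psi w / (w - a) ^+ 1)) => // z; exact: cpsi2.
  by apply: (@cauchy_integral_cts _ _ _ _ (fun w => psi w / (w - a) ^+ 2)) => // z; exact: cpsi2.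
move=> z /Hr zin; rewrite -RID //; [|by move=> w; exact: cpsi3|by move=> w; exact: cpsi3].
rewrite mulrC -RIZ //; last by move=> w wb; apply: ctsD; exact: cpsi3.
rewrite -RIB //; [|by move=> w; exact: cpsi2|by move=> w; exact: cpsi2].
apply: eq_RI => // w wb.
by field; rewrite !subr_eq0 (bd_neq ain wb) (bd_neq zin wb).
Qed.

End CauchyDerivative.

(* Riemann's removable singularity theorem, together with the regularity of
   the derivative, both read off Cauchy's formula. *)
Lemma removable (x0 x1 y0 y1 : R) (S : seq R[i]) f : x0 <= x1 -> y0 <= y1 -> uniq S ->
  (forall p, p \in S -> ininterior x0 x1 y0 y1 p) ->
  (forall z, inrect x0 x1 y0 y1 z -> z \notin S -> dble f z) ->
  (forall p, p \in S -> limat (fun z => (z - p) * f z) p 0) ->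
  exists g g' : R[i] -> R[i],
  [/\ forall z, ininterior x0 x1 y0 y1 z -> z \notin S -> g z = f z,
      forall z, ininterior x0 x1 y0 y1 z -> hasd id g z (g' z) &
      forall z, ininterior x0 x1 y0 y1 z -> dble g' z].
Proof.
move=> x01 y01 uS Sin df lim; pose c := ((2 * pi)%:C * ii)^-1 : R[i].
have cf z : onbd x0 x1 y0 y1 z -> cts id f z.
  by move=> zb; apply/dble_cts/df; [exact: onbd_inrect | exact: bd_notin zb].
exists (fun z => c * RI (fun w => f w / (w - z)) x0 x1 y0 y1),
  (fun z => c * RI (fun w => f w / (w - z) ^+ 2) x0 x1 y0 y1); split => z zin.
- by move=> zS; rewrite (cauchy_formula uS Sin df lim zin zS) mulKf // pi2i_neq0.
- by apply: hasdZ; exact: hasd_cauchy1.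
- have [d dd] := dble_cauchy2 cf zin; by eexists; apply: hasdZ; exact: dd.
Qed.

(** As [D] vanishes near [q], the quotient [D / (z - q)^n] is holomorphic for every [n]; Cauchy's
    formula then bounds [D a] by a constant times [(|a - q| / r)^n], which tends to 0. *)
Lemma identity_step D (q : R[i]) (r : R) : 0 < r ->
  (forall z, inrect (cRe q - r) (cRe q + r) (cIm q - r) (cIm q + r) z ->
     dble D z) ->
  (exists2 e : R, 0 < e & forall z, cabs (z - q) < e -> D z = 0) ->
  forall a, cabs (a - q) < r -> D a = 0.
Proof.
move=> r0 dD [e e0 He] a ar.
have [->|aq] := eqVneq a q; first by apply: He; rewrite subrr cabs0.
set x0 := cRe q - r; set x1 := cRe q + r.
set y0 := cIm q - r; set y1 := cIm q + r.
have ain : ininterior x0 x1 y0 y1 a.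
  have := le_lt_trans (Re_le_cabs (a - q)) ar; have := le_lt_trans (Im_le_cabs (a - q)) ar.
  rewrite cReD cImD cReN cImN !ltr_norml => i1 i2.
  by rewrite /inrect /ininterior /x0 /x1 /y0 /y1; lra.
have [x01 y01] := interior_le ain.
have cD z : onbd x0 x1 y0 y1 z -> cts id D z by move=> /onbd_inrect /dD /dble_cts.
have [M M0 HM] := bd_bounded x01 y01 cD.
have [s s0 Hs] := bd_dist ain.
have aq0 : 0 < cabs (a - q) by rewrite cabs_gt0 subr_eq0.
have bq z : onbd x0 x1 y0 y1 z -> r <= cabs (z - q) <= 2 * r by exact: square_dist.
have bq0 z : onbd x0 x1 y0 y1 z -> z != q.
  by move=> /bq /andP[+ _]; apply: contraTneq => ->; rewrite subrr cabs0 -ltNge.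
pose t := cabs (a - q) / r.
apply/eqP; rewrite -cabs_eq0; apply/eqP/le_anti; rewrite cabs_ge0 andbT.
apply: (@power_lt1_le0 t (4 * (M / s) * ((x1 - x0) + (y1 - y0)))).
  by rewrite divr_ge0 ?ltW // ltr_pdivrMr // mul1r.
move=> n; pose g z := D z / (z - q) ^+ n.
have dg z : inrect x0 x1 y0 y1 z -> z \notin [::] -> dble g z.
  move=> zin _; have [->|zq] := eqVneq z q.
    exists 0; apply: (@hasd_near _ _ _ (fun=> 0) _ _ _ e) => //; last exact: hasd_cst.
    by move=> w /He h; rewrite /g h mul0r.
  have [d dd] := dD z zin; eexists; apply: hasdM; first exact: dd.
  apply: hasdV; first by rewrite expf_neq0 // subr_eq0.
  by apply: hasdX; exact: hasd_subC.
have := @cauchy_formula x0 x1 y0 y1 [::] g isT (fun p => ltac:(by [])) dg a (fun p => ltac:(by [])) ain isT.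
move=> CF.
have E : cabs (g a) <= 4 * (M / r ^+ n / s) * ((x1 - x0) + (y1 - y0)).
  apply: (@le_trans _ _ (cabs ((2 * pi)%:C * ii * g a))).
    exact: le_cabs_2pii.
  rewrite -CF; apply: RI_le => //.
    move=> z zb; apply: ctsM; first by apply/dble_cts/dg => //; exact: onbd_inrect.
    by apply: cts_inv; exact: bd_neq zb.
  move=> z zb; rewrite !cabsM !cabsV cabsX.
  have /andP[rz _] := bq z zb.
  have rz0 : 0 < cabs (z - q) by rewrite (lt_le_trans r0).
  apply: ler_pM; rewrite ?mulr_ge0 ?invr_ge0 ?exprn_ge0 ?cabs_ge0 //.
    apply: ler_pM; rewrite ?invr_ge0 ?exprn_ge0 ?cabs_ge0 ?HM //.
    by rewrite lef_pV2 ?posrE ?exprn_gt0 // lerXn2r ?nnegrE ?cabs_ge0 ?(ltW r0).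
  by rewrite lef_pV2 ?posrE ?Hs // (lt_le_trans s0) ?Hs.
move: E; rewrite /g cabsM cabsV cabsX ler_pdivrMr ?exprn_gt0 // => E.
apply: (le_trans E); rewrite /t expr_div_n le_eqVlt; apply/orP; left; apply/eqP.
by field; rewrite !gt_eqF ?exprn_gt0.
Qed.

(** Vanishing is propagated along the horizontal line by [identity_step], in [n] steps shorter than
    [r] leading from [c] to [x]. *)
Lemma identity_strip D (x0 x1 y rho c : R) : 0 < rho ->
  (forall z, x0 < cRe z < x1 -> `|cIm z - y| <= rho -> dble D z) ->
  x0 < c < x1 -> (exists2 e : R, 0 < e & forall z, cabs (z - (c +i* y)) < e -> D z = 0) ->
  forall x, x0 < x < x1 -> D (x +i* y) = 0.
Proof.
move=> rho0 dD cx good0 x xx.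
pose good u := exists2 e : R, 0 < e & forall z, cabs (z - (u +i* y)) < e -> D z = 0.
have step (u v r : R) : 0 < r -> r <= rho -> x0 < u - r -> u + r < x1 -> good u ->
    `|v - u| < r -> good v.
  move=> r0 rr h1 h2 gu uv; exists (r - `|v - u|); first by rewrite subr_gt0.
  move=> z hz; apply: (@identity_step D (u +i* y) r) => //.
    move=> w /andP[/= w1 w2]; apply: dD; first lra.
    by rewrite ler_norml; lra.
  have -> : z - (u +i* y) = (z - (v +i* y)) + (v - u)%:C.
    by case: z {hz} => a b; simpc; congr (_ +i* _); ring.
  by apply: (le_lt_trans (cabsD _ _)); rewrite cabs_real; lra.
(* [m] keeps the squares around all intermediate points inside the domain, whichever of [c] and [x]
   lies further right. *)
have [m [m0 m1 m2 m3 [m4 m5]]] : exists m : R, [/\ 0 < m, m <= rho, m <= c - x0,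
    m <= x - x0 & (m <= x1 - c /\ m <= x1 - x)].
  exists (Num.min rho (Num.min (Num.min (c - x0) (x - x0)) (Num.min (x1 - c) (x1 - x)))).
  rewrite !lt_min rho0 !subr_gt0 !ge_min !lexx !orbT.
  by case/andP: cx => -> ->; case/andP: xx => -> ->.
pose r := m / 2; have r0 : 0 < r by rewrite divr_gt0.
have rm : 2 * r = m by rewrite /r; field.
pose n := (Num.truncn (`|x - c| / r)).+1.
have nr : `|x - c| / n%:R < r.
  by rewrite ltr_pdivrMr ?ltr0n // mulrC -ltr_pdivrMr // truncnS_gt.
have gj j : (j <= n)%N -> good (c + j%:R * ((x - c) / n%:R)).
  elim: j => [|j IH] jn; first by rewrite mul0r addr0.
  have n0 : n%:R != 0 :> R by rewrite pnatr_eq0.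
  have bd (k : nat) : (k <= n)%N -> Num.min c x <= c + k%:R * ((x - c) / n%:R) <= Num.max c x.
    move=> mn; have f0 : 0 <= k%:R / n%:R :> R by rewrite divr_ge0.
    have f1 : k%:R / n%:R <= 1 :> R by rewrite ler_pdivrMr ?ltr0n // mul1r ler_nat.
    have -> : k%:R * ((x - c) / n%:R) = (k%:R / n%:R) * (x - c) by field.
    by move: (k%:R / n%:R) f0 f1 => f f0 f1; clear -f0 f1; case: (leP c x) => h; apply/andP; split; nra.
  apply: (step (c + j%:R * ((x - c) / n%:R)) _ r) => //; first lra.
  - have /andP[+ _] := bd j (ltnW jn); case: (leP c x) => h; clear -h cx xx rm m0 m2 m3 m4 m5; lra.
  - have /andP[_] := bd j (ltnW jn); case: (leP c x) => h; clear -h cx xx rm m0 m2 m3 m4 m5; lra.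
  - exact: IH (ltnW jn).
  - have -> : c + j.+1%:R * ((x - c) / n%:R) - (c + j%:R * ((x - c) / n%:R)) = (x - c) / n%:R.
      by rewrite -[j.+1]addn1 natrD; ring.
    by rewrite normrM normfV normr_nat.
have [e e0] := gj n (leqnn n).
have -> : c + n%:R * ((x - c) / n%:R) = x by field; rewrite pnatr_eq0.
by apply; rewrite subrr cabs0.
Qed.

End CauchyTheory.

(** * Primitives, logarithms and the Borel-Caratheodory inequality *)

Section Logarithm.
Variable R : realType.
Implicit Types (f q : R[i] -> R[i]) (g : R -> R[i]) (z a : R[i]).

Lemma hasd_cexp_comp T (e : T -> R[i]) (f : T -> R[i]) x d : hasd e f x d ->
  hasd e (fun t => cexp (f t)) x (cexp (f x) * d).
Proof. by move=> df; apply: (@hasd_comp _ _ e (@cexp R) f) => //; exact: hasd_cexp. Qed.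

(** With reversed bounds [cI] is an integral over the empty set, so the orientation has to be
    restored. *)
Definition sI g (a b : R) := if a <= b then cI g a b else - cI g b a.

Lemma sI_diff g x0 u v : x0 <= u -> x0 <= v ->
  (forall t, x0 <= t -> (t <= u) || (t <= v) -> cts rc g t) ->
  cI g x0 v - cI g x0 u = sI g u v.
Proof.
move=> xu xv cg; rewrite /sI; case: leP => uv.
  rewrite (@cI_split _ g x0 u v) ?xu //; first by rewrite addrAC subrr add0r.
  by apply: cts_integrable => t /andP[h1 h2]; apply: cg; rewrite ?h2 ?orbT.
rewrite (@cI_split _ g x0 v u) ?xv ?(ltW uv) //; first by ring.
by apply: cts_integrable => t /andP[h1 h2]; apply: cg; rewrite ?h2.
Qed.

Lemma cI_cst (c : R[i]) (a b : R) : a <= b -> cI (fun=> c) a b = c * (b - a)%:C.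
Proof.
move=> ab; rewrite (@cI_FTC _ (fun t => c * t%:C)) //.
- by rewrite rmorphB /= mulrBr.
- by move=> t _; exact: cts_cst.
- by move=> t _; have := hasdZ c (hasd_id rc t); rewrite mulr1.
Qed.

Lemma sI_le g (c : R[i]) (u v e : R) :
  (forall t, Num.min u v <= t <= Num.max u v -> cts rc g t) ->
  (forall t, Num.min u v <= t <= Num.max u v -> cabs (g t - c) <= e) ->
  cabs (sI g u v - c * (v - u)%:C) <= 2 * e * `|v - u|.
Proof.
have aux (a b : R) : a <= b -> (forall t, a <= t <= b -> cts rc g t) ->
    (forall t, a <= t <= b -> cabs (g t - c) <= e) ->
    cabs (cI g a b - c * (b - a)%:C) <= 2 * e * (b - a).
  move=> ab cg H; have ig := cts_integrable cg.
  have ic : cintegrable `[a, b]%classic (fun=> c) by apply: cts_integrable => t _; exact: cts_cst.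
  rewrite -cI_cst // /cI -cintB //; apply: cI_le => //; exact: cintegrableB.
rewrite /sI; case: (leP u v) => uv cg H.
  by rewrite ger0_norm ?subr_ge0 //; exact: aux.
rewrite ler0_norm ?subr_le0 ?(ltW uv) // opprB.
have -> : - cI g v u - c * (v - u)%:C = - (cI g v u - c * (u - v)%:C).
  by rewrite !rmorphB /=; ring.
by rewrite cabsN; apply: aux => //; exact: ltW.
Qed.

Lemma primitive_exists q (x0 x1 y0 y1 : R) :
  (forall z, inrect x0 x1 y0 y1 z -> dble q z) ->
  exists P, forall z, ininterior x0 x1 y0 y1 z -> hasd id P z (q z).
Proof.
move=> dq; have cq z : inrect x0 x1 y0 y1 z -> cts id q z by move=> /dq /dble_cts.
(* Integrate along the bottom side, then upwards. By [goursat] the path along the left side and then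
   across gives the same value ([P2]), so that each partial increment is an integral over one
   segment. *)
pose P z := cI (fun t => q (t +i* y0)) x0 (cRe z) +
  ii * cI (fun t => q (cRe z +i* t)) y0 (cIm z).
exists P => z zin; apply/hasdP => eps e0.
have [r r0 Hr] := near_interior zin.
have e4 : 0 < eps / 4 by rewrite divr_gt0.
have [d d0 Hd] := cq z (interior_inrect zin) _ e4.
exists (Num.min r (d / 2)); first by rewrite lt_min r0 divr_gt0.
move=> z' /=; rewrite lt_min => /andP[/Hr z'in zd].
have P2 w : ininterior x0 x1 y0 y1 w -> P w =
    cI (fun t => q (t +i* cIm w)) x0 (cRe w) +
    ii * cI (fun t => q (x0 +i* t)) y0 (cIm w).
  move=> /andP[/andP[w1 w2] /andP[w3 w4]].
  have : RI q x0 (cRe w) y0 (cIm w) = 0.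
    apply: goursat; [lra|lra|] => u /andP[/andP[u1 u2] /andP[u3 u4]]; apply: dq.
    by rewrite /inrect /ininterior; lra.
  by rewrite /RI /P => E; apply/eqP; rewrite -subr_eq0 -E; apply/eqP; ring.
clear r r0 Hr; case: z z' zin z'in zd Hd => x y [x' y'] zin z'in zd Hd.
have /andP[/andP[/= a1 a2] /andP[/= a3 a4]] := zin.
have /andP[/andP[/= b1 b2] /andP[/= b3 b4]] := z'in.
have Ex : x'%:C - x%:C = (x' - x)%:C by rewrite rmorphB.
have dx : `|x' - x| <= cabs ((x' +i* y') - (x +i* y)) by exact: (Re_le_cabs ((x' +i* y') - (x +i* y))).
have dy : `|y' - y| <= cabs ((x' +i* y') - (x +i* y)) by exact: (Im_le_cabs ((x' +i* y') - (x +i* y))).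
have mid : ininterior x0 x1 y0 y1 (x +i* y') by rewrite /ininterior /= a1 a2 b3 b4.
have E1 : P (x' +i* y') - P (x +i* y') = sI (fun t => q (t +i* y')) x x'.
  rewrite !P2 // /= -(@sI_diff _ x0) ?ltW //; first by ring.
  move=> t h1 h2; apply: cts_hor; apply: cq; rewrite /inrect /=; clear -h1 h2 a1 a2 a3 a4 b1 b2 b3 b4; lra.
have E2 : P (x +i* y') - P (x +i* y) = ii * sI (fun t => q (x +i* t)) y y'.
  rewrite /P /= -(@sI_diff _ y0) ?ltW //; first by ring.
  move=> t h1 h2; apply: cts_ver; apply: cq; rewrite /inrect /=; clear -h1 h2 a1 a2 a3 a4 b1 b2 b3 b4; lra.
have -> : P (x' +i* y') - P (x +i* y) - q (x +i* y) * ((x' +i* y') - (x +i* y)) =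
    (sI (fun t => q (t +i* y')) x x' - q (x +i* y) * (x' - x)%:C) +
    ii * (sI (fun t => q (x +i* t)) y y' - q (x +i* y) * (y' - y)%:C).
  have -> : (x' +i* y') - (x +i* y) = (x' - x)%:C + ii * (y' - y)%:C by simpc.
  by rewrite mulrBr -E2 mulrDr -E1; ring.
apply: (le_trans (cabsD _ _)); rewrite cabsM cabs_i mul1r.
have close (u v : R) : `|u - x| <= `|x' - x| -> `|v - y| <= `|y' - y| ->
   cabs (q (u +i* v) - q (x +i* y)) <= eps / 4.
  move=> hu hv; apply/ltW/Hd; apply: (le_lt_trans (cabs_le_ReIm _)) => /=; lra.
have btw (u v t : R) : Num.min u v <= t <= Num.max u v -> `|t - u| <= `|v - u|.
  case: (leP u v) => uv h; first by rewrite !ger0_norm; clear -uv h; lra.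
  by rewrite !ler0_norm; clear -uv h; lra.
have minin (u v t lo hi : R) : lo < u < hi -> lo < v < hi -> Num.min u v <= t <= Num.max u v -> lo <= t <= hi.
  by case: (leP u v) => uv h1 h2 h3; clear -uv h1 h2 h3; lra.
have L1 : cabs (sI (fun t => q (t +i* y')) x x' - q (x +i* y) * (x' - x)%:C) <=
    2 * (eps / 4) * `|x' - x|.
  apply: sI_le => t ht.
    apply: cts_hor; apply: cq; rewrite /inrect /= (minin _ _ _ _ _ _ _ ht) ?a1 ?b1 //=.
    by rewrite !ltW.
  by apply: close => //; exact: btw.
have L2 : cabs (sI (fun t => q (x +i* t)) y y' - q (x +i* y) * (y' - y)%:C) <=
    2 * (eps / 4) * `|y' - y|.
  apply: sI_le => t ht.
    apply: cts_ver; apply: cq; rewrite /inrect /= (minin _ _ _ _ _ _ _ ht) ?a3 ?b3 //=.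
    by rewrite !ltW.
  by apply: close; [rewrite subrr normr0|exact: btw].
apply: (le_trans (lerD L1 L2)); nra.
Qed.

Lemma const_of_hasd0 f (x0 x1 y0 y1 : R) z a :
  (forall w, ininterior x0 x1 y0 y1 w -> hasd id f w 0) ->
  ininterior x0 x1 y0 y1 z -> ininterior x0 x1 y0 y1 a -> f z = f a.
Proof.
move=> d0.
have seg (h : R -> R[i]) (u v : R) : u <= v -> (forall t, u <= t <= v -> hasd rc h t 0) -> h v = h u.
  move=> uv dh; apply/eqP; rewrite -subr_eq0 -(@cI_FTC _ h (fun=> 0)) //.
    by rewrite cI_cst // mul0r.
  by move=> t _; exact: cts_cst.
have hor (u v y : R) : u <= v -> ininterior x0 x1 y0 y1 (u +i* y) ->
    ininterior x0 x1 y0 y1 (v +i* y) -> f (v +i* y) = f (u +i* y).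
  move=> uv /andP[/andP[/= h1 h2] h3] /andP[/andP[/= h4 h5] h6].
  apply: (seg (fun t => f (t +i* y))) => // t ht; apply: hasd_hor; apply: d0.
  by rewrite /ininterior /= h3 andbT; lra.
have ver (u v x : R) : u <= v -> ininterior x0 x1 y0 y1 (x +i* u) ->
    ininterior x0 x1 y0 y1 (x +i* v) -> f (x +i* v) = f (x +i* u).
  move=> uv /andP[h3 /andP[/= h1 h2]] /andP[h6 /andP[/= h4 h5]].
  apply: (seg (fun t => f (x +i* t))) => // t ht; rewrite -(mulr0 ii).
  apply: hasd_ver; apply: d0; rewrite /ininterior /= h3 /=; lra.
case: z a => [x y] [x' y'] zin ain.
have mid : ininterior x0 x1 y0 y1 (x' +i* y).
  by move: zin ain => /andP[_ h] /andP[h' _]; apply/andP.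
transitivity (f (x' +i* y)).
  by case: (leP x x') => h; [rewrite [RHS](hor x)|rewrite (hor x')] => //; exact: ltW.
by case: (leP y y') => h; [rewrite [RHS](ver y)|rewrite (ver y')] => //; exact: ltW.
Qed.

(** With [P] a primitive of [f' / f], the product [f e^(- P)] has derivative 0 and is constant.
    Keeping the factor [f a] spares the choice of a logarithm for that value. *)
Lemma log_exists f f' (x0 x1 y0 y1 : R) a :
  (forall z, inrect x0 x1 y0 y1 z -> hasd id f z (f' z)) ->
  (forall z, inrect x0 x1 y0 y1 z -> dble f' z) ->
  (forall z, inrect x0 x1 y0 y1 z -> f z != 0) -> ininterior x0 x1 y0 y1 a ->
  exists L, [/\ forall z, ininterior x0 x1 y0 y1 z -> dble L z, L a = 0 &
    forall z, ininterior x0 x1 y0 y1 z -> f z = f a * cexp (L z)].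
Proof.
move=> df df' f0 ain.
have [|P HP] := @primitive_exists (fun z => f' z / f z) x0 x1 y0 y1.
  move=> z zin; have [d dd] := df' z zin; eexists.
  by apply: hasd_div; [exact: f0|exact: dd|exact: df].
exists (fun z => P z - P a); split.
- by move=> z /HP dP; eexists; apply: hasdB; [exact: dP|exact: hasd_cst].
- by rewrite subrr.
move=> z zin; have E : f z * cexp (- P z) = f a * cexp (- P a).
  apply: (@const_of_hasd0 (fun z => f z * cexp (- P z)) x0 x1 y0 y1) => // w win.
  have wi := interior_inrect win.
  have := hasdM (df w wi) (hasd_cexp_comp (hasdN (HP w win))).
  by rewrite (_ : _ + _ = 0) //; field; exact: f0.
rewrite cexpB mulrA -(mulrAC _ (cexp (P a))^-1) -cexpN -E -mulrA -cexpD.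
by rewrite addNr cexp0 mulr1.
Qed.

(** The map [psi = L / (2 A - L)] sends the half plane [Re L <= A] into the unit disc and fixes 0.
    The maximum principle for [psi / (z - a)] on the square, whose boundary is at distance at least
    [r] from [a], is a Schwarz lemma giving [|psi b| <= th]; solving for [L b] ends the proof. *)
Lemma borel_caratheodory L a (r A th : R) b : 0 < r -> 0 < A -> 0 < th < 1 ->
  (forall z, inrect (cRe a - r) (cRe a + r) (cIm a - r) (cIm a + r) z ->
     dble L z) -> L a = 0 ->
  (forall z, inrect (cRe a - r) (cRe a + r) (cIm a - r) (cIm a + r) z ->
     cRe (L z) <= A) ->
  cabs (b - a) <= th * r -> cabs (L b) <= 2 * A * th / (1 - th).
Proof.
move=> r0 A0 /andP[th0 th1] dL La ReL ba.
have t10 : 0 < 1 - th by rewrite subr_gt0.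
have [->|bna] := eqVneq b a.
  by rewrite La cabs0 !mulr_ge0 ?invr_ge0 ?(ltW A0) ?(ltW th0) ?(ltW t10).
set x0 := cRe a - r; set x1 := cRe a + r.
set y0 := cIm a - r; set y1 := cIm a + r.
have ain : ininterior x0 x1 y0 y1 a.
  by rewrite /inrect /ininterior /x0 /x1 /y0 /y1; lra.
have bin : ininterior x0 x1 y0 y1 b.
  have br : cabs (b - a) < r by apply: le_lt_trans ba _; rewrite gtr_pMl.
  have := le_lt_trans (Re_le_cabs (b - a)) br; have := le_lt_trans (Im_le_cabs (b - a)) br.
  rewrite cReD cImD cReN cImN !ltr_norml => i1 i2.
  by rewrite /inrect /ininterior /x0 /x1 /y0 /y1; lra.
pose c := (2 * A)%:C : R[i].
have ReB z : inrect x0 x1 y0 y1 z -> A <= cRe (c - L z).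
  by move=> /ReL h; rewrite cReD cReN /=; lra.
have nz z : inrect x0 x1 y0 y1 z -> c - L z != 0.
  move=> /ReB h; rewrite -cabs_gt0; apply: lt_le_trans (Re_le_cabs _).
  by rewrite (lt_le_trans A0) // (le_trans h) // ler_norm.
have le1 z : inrect x0 x1 y0 y1 z -> cabs (L z) <= cabs (c - L z).
  move=> zin; rewrite !cabsE ler_sqrt ?addr_ge0 ?sqr_ge0 //.
  rewrite cReD cImD cReN cImN /= sub0r sqrrN lerD2r.
  have := ReL z zin; set u := cRe (L z) => uA.
  rewrite -subr_ge0 (_ : _ - _ = 4 * A * (A - u)); last by ring.
  by rewrite !mulr_ge0 ?(ltW A0) ?subr_ge0.
pose psi z := L z / (c - L z).
have dpsi z : inrect x0 x1 y0 y1 z -> dble psi z.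
  move=> zin; have [d dd] := dL z zin; eexists.
  by apply: hasd_div; [exact: nz|exact: dd|apply: hasdB; [exact: hasd_cst|exact: dd]].
have psia : psi a = 0 by rewrite /psi La mul0r.
have M : cabs (psi b / (b - a)) <= r^-1.
  apply: (@max_modulus _ x0 x1 y0 y1 [:: a] (fun z => psi z / (z - a))) => //.
  - by move=> p; rewrite inE => /eqP ->.
  - move=> z zin; rewrite inE => za; have [d dd] := dpsi z zin; eexists.
    by apply: hasdM; [exact: dd|apply: hasdV; [rewrite subr_eq0|exact: hasd_subC]].
  - move=> p; rewrite inE => /eqP ->.
    have [d [phi [cphi pa] Hphi]] := dpsi a (interior_inrect ain).
    exists d; rewrite -pa; apply: eq_limat (limat_cts cphi) => z za.
    by rewrite Hphi psia add0r mulfK // subr_eq0.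
  - by rewrite inE.
  - move=> z zb; have zin := onbd_inrect zb; rewrite cabsM cabsV -[leRHS]mul1r.
    have /andP[rz _] := square_dist r0 zb.
    apply: ler_pM; rewrite ?cabs_ge0 ?invr_ge0 ?cabs_ge0 //.
      rewrite /psi cabsM cabsV ler_pdivrMr ?cabs_gt0 ?nz // mul1r; exact: le1.
    by rewrite lef_pV2 ?posrE // (lt_le_trans r0).
have psib : cabs (psi b) <= th.
  move: M; rewrite cabsM cabsV ler_pdivrMr ?cabs_gt0 ?subr_eq0 // => M.
  by apply: (le_trans M); rewrite mulrC ler_pdivrMr.
have Lb : cabs (L b) <= th * (2 * A + cabs (L b)).
  have bi := interior_inrect bin.
  have {1}-> : L b = psi b * (c - L b) by rewrite /psi divfK ?nz.
  rewrite cabsM; apply: ler_pM; rewrite ?cabs_ge0 //.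
  by apply: (le_trans (cabsB _ _)); rewrite cabs_real ger0_norm ?mulr_ge0 // ltW.
by rewrite ler_pdivlMr //; move: Lb; lra.
Qed.

End Logarithm.

(** * The Fourier series of the Bernoulli polynomial B_3, and the sum of the inverse squares *)

Section FourierB3.
Variable R : realType.
Implicit Types (x t : R) (N n : nat).

Lemma MVT_le (f : R -> R) (df : R -> R) (a b C : R) : a <= b ->
  (forall t, a <= t <= b -> is_derive t 1 f (df t)) ->
  (forall t, a <= t <= b -> `|df t| <= C) -> `|f b - f a| <= C * (b - a).
Proof.
move=> ab dfa dC; have cf : {within `[a, b], continuous f}.
  apply: continuous_in_subspaceT => x /set_mem /=; rewrite in_itv /= => /dfa [dd _].
  exact/differentiable_continuous/derivable1_diffP.
have [|c ch ->] := @MVT_segment R f df a b ab _ cf.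
  by move=> x; rewrite in_itv /= => /andP[/ltW h1 /ltW h2]; apply: dfa; rewrite h1.
rewrite normrM (ger0_norm (_ : 0 <= b - a)) ?subr_ge0 //.
by rewrite ler_wpM2r ?subr_ge0 // dC //; move: ch; rewrite in_itv.
Qed.

Lemma sin_norm_le (u : R) : `|sin u| <= `|u|.
Proof.
have aux (v : R) : 0 <= v -> `|sin v| <= v.
  move=> v0; have h1 t : 0 <= t <= v -> is_derive t 1 (@sin R) (cos t) by move=> _; exact: is_derive_sin.
  have h2 t : 0 <= t <= v -> `|cos t| <= 1 by rewrite ler_norml cos_geN1 cos_le1.
  by have := MVT_le v0 h1 h2; rewrite sin0 !subr0 mul1r.
have [u0|u0] := leP 0 u; first by rewrite (ger0_norm u0) aux.
by rewrite -normrN -sinN -[in leRHS]normrN (ger0_norm (_ : 0 <= - u)) ?oppr_ge0 ?aux // ?oppr_ge0 ltW.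
Qed.

Definition B3 x := x ^+ 3 - 3 / 2 * x ^+ 2 + x / 2.
Definition w n : R := 2 * pi * n%:R.
Definition S3 N x := \sum_(1 <= n < N.+1) 12 / w n ^+ 3 * sin (w n * x).
Let S2 N x := \sum_(1 <= n < N.+1) 12 / w n ^+ 2 * cos (w n * x).
Let S1 N x := \sum_(1 <= n < N.+1) 12 / w n * sin (w n * x).
Let S0 N x := \sum_(1 <= n < N.+1) 12 * cos (w n * x).

Lemma w_gt0 n : (0 < n)%N -> 0 < w n.
Proof. by move=> n0; rewrite /w !mulr_gt0 ?pi_gt0 ?ltr0n. Qed.

Lemma dlin (c x : R) : is_derive x 1 (fun t => c * t) c.
Proof.
have -> : (fun t : R => c * t) = (fun t => c *: t) by [].
by apply: is_derive_eq; rewrite /GRing.scale /= mulr1.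
Qed.

Lemma dsum N (F F' : nat -> R -> R) x : (forall n, (0 < n)%N -> is_derive x 1 (F n) (F' n x)) ->
  is_derive x 1 (fun t => \sum_(1 <= n < N.+1) F n t) (\sum_(1 <= n < N.+1) F' n x).
Proof.
move=> H; elim: N => [|N IH].
  have -> : (fun t => \sum_(1 <= n < 1) F n t) = fun=> 0 by apply/funext => t; rewrite big_geq.
  by rewrite big_geq //; exact: is_derive_cst.
have -> : (fun t => \sum_(1 <= n < N.+2) F n t) =
   (fun t => (\sum_(1 <= n < N.+1) F n t) + F N.+1 t).
  by apply/funext => t; rewrite big_nat_recr.
by rewrite big_nat_recr //=; apply: is_deriveD; exact: H.
Qed.

Lemma dcos (c k x : R) : is_derive x 1 (fun t => c * cos (k * t)) (- (c * k) * sin (k * x)).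
Proof.
have := @is_derive1_comp _ (@cos R) (fun t => k * t) x _ _ (is_derive_cos _) (dlin k x).
move=> h; apply: (is_derive_eq (@is_deriveZ _ _ _ _ c _ _ _ h)).
by rewrite /GRing.scale /=; ring.
Qed.

Lemma dsin (c k x : R) : is_derive x 1 (fun t => c * sin (k * t)) (c * k * cos (k * x)).
Proof.
have := @is_derive1_comp _ (@sin R) (fun t => k * t) x _ _ (is_derive_sin _) (dlin k x).
move=> h; apply: (is_derive_eq (@is_deriveZ _ _ _ _ c _ _ _ h)).
by rewrite /GRing.scale /=; ring.
Qed.

(** The remainder of the Fourier series and its first two derivatives; the third, [6 + S0], is a
    multiple of the Dirichlet kernel. *)
Let r N x := B3 x - S3 N x.
Let r1 N x := 3 * x ^+ 2 - 3 * x + 2^-1 - S2 N x.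
Let r2 N x := 6 * x - 3 + S1 N x.

Let dr N x : is_derive x 1 (r N) (r1 N x).
Proof.
apply: is_deriveB.
  by apply: is_derive_eq; rewrite /GRing.scale /=; field.
rewrite /S2; apply: (@dsum N (fun n t => 12 / w n ^+ 3 * sin (w n * t))
  (fun n t => 12 / w n ^+ 2 * cos (w n * t))) => n n0.
have := dsin (12 / w n ^+ 3) (w n) x; rewrite (_ : 12 / w n ^+ 3 * w n = 12 / w n ^+ 2) //.
by field; rewrite gt_eqF // w_gt0.
Qed.

Let dr1 N x : is_derive x 1 (r1 N) (r2 N x).
Proof.
rewrite /r2 -[S1 N x]opprK; apply: is_deriveB.
  by apply: is_derive_eq; rewrite /GRing.scale /=; field.
rewrite /S1 -sumrN; apply: (@dsum N (fun n t => 12 / w n ^+ 2 * cos (w n * t))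
  (fun n t => - (12 / w n * sin (w n * t)))) => n n0.
have := dcos (12 / w n ^+ 2) (w n) x; rewrite mulNr (_ : 12 / w n ^+ 2 * w n = 12 / w n) //.
by field; rewrite gt_eqF // w_gt0.
Qed.

Let dr2 N x : is_derive x 1 (r2 N) (6 + S0 N x).
Proof.
apply: is_deriveD.
  by apply: is_derive_eq; rewrite /GRing.scale /=; ring.
rewrite /S0; apply: (@dsum N (fun n t => 12 / w n * sin (w n * t))
  (fun n t => 12 * cos (w n * t))) => n n0.
have := dsin (12 / w n) (w n) x; rewrite (_ : 12 / w n * w n = 12) //.
by rewrite divfK // gt_eqF // w_gt0.
Qed.

Let dirichlet N x : (6 + S0 N x) * sin (pi * x) = 6 * sin ((2 * N%:R + 1) * pi * x).
Proof.
elim: N => [|N IH]; first by rewrite /S0 big_geq // mulr0 addr0 add0r mul1r.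
rewrite /S0 big_nat_recr //= -/(S0 N x) addrA mulrDl IH.
have -> : (2 * N%:R + 1) * pi * x = w N.+1 * x - pi * x.
  by rewrite /w -[N.+1]addn1 natrD; ring.
have -> : (2 * N.+1%:R + 1) * pi * x = w N.+1 * x + pi * x by rewrite /w; ring.
by rewrite sinB sinD; ring.
Qed.

Let sin_min (x : R) : 0 < x -> x <= 1 / 2 -> exists2 m : R, 0 < m &
  forall t, x <= t <= 1 / 2 -> m <= sin (pi * t).
Proof.
move=> x0 x2; have cs : {within `[x, 1 / 2], continuous (fun t : R => sin (pi * t))}.
  apply: continuous_in_subspaceT => t _.
  apply: (@continuous_comp _ _ _ (fun t : R => pi * t) sin); last exact: continuous_sin.
  by apply: continuousM; [exact: cvg_cst|exact: cvg_id].
have [c hc Hc] := EVT_min x2 cs; exists (sin (pi * c)); last first.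
  by move=> t ht; apply: Hc; rewrite in_itv.
move: hc; rewrite in_itv /= => /andP[xc c2]; have p0 := pi_gt0 R.
by apply: sin_gt0_pi; apply/andP; split; nra.
Qed.

(** Taylor's formula at [1/2], where [r] and its second derivative vanish: the remainder is an
    integral of the Dirichlet kernel against [(t - x)^2], which is O(1 / N) after one integration by
    parts. The first-order term is kept until [alpha_cvg] disposes of it. *)
Let taylor x : 0 < x <= 1 / 2 -> exists2 C : R, 0 <= C &
  forall N, `|r N x - r1 N (1 / 2) * (x - 1 / 2)| <= C / (2 * N%:R + 1).
Proof.
move=> /andP[x0 x2]; have [m m0 Hm] := sin_min x0 x2.
have p0 := pi_gt0 R.
pose H t := (t - x) ^+ 2 / sin (pi * t).
pose H' t := 2 * (t - x) / sin (pi * t) - (t - x) ^+ 2 * (pi * cos (pi * t)) / sin (pi * t) ^+ 2.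
have sp t : x <= t <= 1 / 2 -> 0 < sin (pi * t) by move=> /Hm; exact: lt_le_trans.
have dH t : x <= t <= 1 / 2 -> is_derive t 1 H (H' t).
  move=> ht; have s0 : sin (pi * t) != 0 by rewrite gt_eqF // sp.
  have ds : is_derive t 1 (fun t => sin (pi * t)) (pi * cos (pi * t)).
    by have := dsin 1 pi t; rewrite mul1r (_ : (fun t => 1 * sin (pi * t)) = fun t => sin (pi * t)) //;
      apply/funext => u; rewrite mul1r.
  have dv := @is_deriveV _ (fun t => sin (pi * t)) t _ 1 s0 ds.
  have dq : is_derive t 1 (fun t => (t - x) ^+ 2) (2 * (t - x)).
    by apply: is_derive_eq; rewrite /GRing.scale /=; ring.
  apply: (is_derive_eq (is_deriveM dq dv)).
  by rewrite /H' /GRing.scale /=; field.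
pose C := 2 / m + pi / m ^+ 2.
have C0 : 0 <= C by rewrite addr_ge0 // divr_ge0 ?exprn_ge0 // ltW.
have H'C t : x <= t <= 1 / 2 -> `|H' t| <= C.
  move=> ht; have mt := Hm t ht; have s0 := sp t ht.
  have tx : `|t - x| <= 1 by rewrite ler_norml; lra.
  apply: (le_trans (ler_normB _ _)); apply: lerD.
    rewrite normrM normfV (gtr0_norm s0); apply: ler_pM => //; first by rewrite invr_ge0 ltW.
      by rewrite normrM ger0_norm // ler_piMr.
    by rewrite lef_pV2 ?posrE.
  rewrite normrM normfV normrX (gtr0_norm s0); apply: ler_pM => //.
  - by rewrite invr_ge0 exprn_ge0 // ltW.
  - rewrite !normrM (gtr0_norm p0) -[leRHS]mul1r; apply: ler_pM => //.
      by rewrite mulr_ge0 // ltW.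
      by rewrite mulr_ile1.
    by rewrite ler_piMr ?(ltW p0) // ler_norml cos_geN1 cos_le1.
  - by rewrite lef_pV2 ?posrE ?exprn_gt0 // lerXn2r ?nnegrE ?(ltW m0) ?(ltW s0).
exists (3 * C + 3 * `|H (1 / 2)|); first by rewrite addr_ge0 ?mulr_ge0.
move=> N; pose om : R := (2 * N%:R + 1) * pi.
have N1 : 0 < 2 * N%:R + 1 :> R by rewrite ltr_wpDl // mulr_ge0.
have om0 : 0 < om by rewrite mulr_gt0.
pose G t := r N t + r1 N t * (x - t) + r2 N t * ((x - t) ^+ 2 / 2).
(* The derivative of [G] reduces to [3 H(t) sin (om t)]. The added term performs the integration by
   parts: it cancels this and leaves [H'(t) cos (om t)] with the factor [3 / om]. *)
pose K t := G t + 3 / om * (H t * cos (om * t)).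
have dK t : x <= t <= 1 / 2 -> is_derive t 1 K (3 / om * (H' t * cos (om * t))).
  move=> ht; have s0 : sin (pi * t) != 0 by rewrite gt_eqF // sp.
  have dxt : is_derive t 1 (fun t => x - t) (-1).
    by apply: is_derive_eq; rewrite /GRing.scale /=; ring.
  have dxt2 : is_derive t 1 (fun t => (x - t) ^+ 2 / 2) (- (x - t)).
    by apply: is_derive_eq; rewrite /GRing.scale /=; field.
  have dc : is_derive t 1 (fun t => cos (om * t)) (- om * sin (om * t)).
    by have := dcos 1 om t; rewrite mul1r (_ : (fun t => 1 * cos (om * t)) = fun t => cos (om * t)) //;
      apply/funext => u; rewrite mul1r.
  have dG := is_deriveD (is_deriveD (dr N t) (is_deriveM (dr1 N t) dxt)) (is_deriveM (dr2 N t) dxt2).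
  have dHc := is_deriveM (dH t ht) dc.
  have := is_deriveD dG (@is_deriveZ _ _ _ _ (3 / om) _ _ _ dHc).
  move=> h; apply: (is_derive_eq h); rewrite /GRing.scale /=.
  have := dirichlet N t; rewrite -/om => E.
  have E2 : 6 + S0 N t = 6 * sin (om * t) / sin (pi * t) by rewrite -E mulfK.
  by rewrite E2 /H; field; rewrite s0 gt_eqF.
have B : `|K (1 / 2) - K x| <= 3 * C / om * (1 / 2 - x).
  apply: (MVT_le x2 dK) => t ht; rewrite !normrM normfV (gtr0_norm om0) ger0_norm //.
  rewrite [leRHS]mulrAC ler_wpM2l ?divr_ge0 ?(ltW om0) // -[leRHS]mulr1.
  by apply: ler_pM => //; [exact: H'C|rewrite ler_norml cos_geN1 cos_le1].
have sinpin n : sin (w n * (1 / 2)) = 0.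
  have -> : w n * (1 / 2) = n%:R * pi by rewrite /w; field.
  elim: n => [|n IH]; first by rewrite mul0r sin0.
  by rewrite -[n.+1]addn1 natrD mulrDl mul1r sinDpi IH oppr0.
have r0 : r N (1 / 2) = 0.
  rewrite /r /S3 big1 ?subr0; last by move=> n _; rewrite sinpin mulr0.
  by rewrite /B3; field.
have r20 : r2 N (1 / 2) = 0.
  rewrite /r2 /S1 big1 ?addr0; last by move=> n _; rewrite sinpin mulr0.
  by field.
have Hx : H x = 0 by rewrite /H subrr expr0n mul0r.
have Kx : K x = r N x by rewrite /K /G Hx subrr expr0n /= mul0r !mulr0 mul0r mulr0 !addr0.
have K2 : K (1 / 2) = r1 N (1 / 2) * (x - 1 / 2) + 3 / om * (H (1 / 2) * cos (om * (1 / 2))).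
  by rewrite /K /G r0 r20; ring.
move: B; rewrite Kx K2 => B.
have -> : r N x - r1 N (1 / 2) * (x - 1 / 2) =
   - (r1 N (1 / 2) * (x - 1 / 2) + 3 / om * (H (1 / 2) * cos (om * (1 / 2))) - r N x) +
   3 / om * (H (1 / 2) * cos (om * (1 / 2))) by ring.
apply: (le_trans (ler_normD _ _)); rewrite normrN [leRHS]mulrDl.
have omN : om^-1 <= (2 * N%:R + 1)^-1.
  by rewrite lef_pV2 ?posrE // /om ler_peMr ?(ltW N1) //; have := pi_ge2 R; lra.
apply: lerD.
  apply: (le_trans B); rewrite -mulrA -[leRHS]mulr1 -[leRHS]mulrA ler_wpM2l ?mulr_ge0 //.
  by apply: ler_pM; rewrite ?invr_ge0 ?(ltW om0) //; lra.
rewrite !normrM normfV (gtr0_norm om0) ger0_norm // mulrAC.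
apply: ler_pM; rewrite ?invr_ge0 ?mulr_ge0 ?(ltW om0) ?pi_ge0 //.
by rewrite ler_wpM2l // ler_piMr // ler_norml cos_geN1 cos_le1.
Qed.

Let pi2ge (n : nat) : (0 < n)%N -> 12 / w n ^+ 2 <= n%:R ^- 2 :> R.
Proof.
move=> n0; have p2 := pi_ge2 R; have n0' : 0 < n%:R :> R by rewrite ltr0n.
rewrite ler_pdivrMr ?exprn_gt0 ?w_gt0 // /w !exprMn mulrCA mulVf ?mulr1 ?expf_neq0 ?gt_eqF //.
by rewrite expr2; nra.
Qed.

Lemma inv_sqr_tail m n : (0 < m)%N -> (m <= n)%N ->
  \sum_(m.+1 <= k < n.+1) (k%:R ^- 2 : R) <= m%:R^-1 - n%:R^-1.
Proof.
move=> m0; elim: n => [|n IH]; first by rewrite leqn0 => /eqP E; rewrite E in m0.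
rewrite leq_eqVlt => /predU1P[->|]; first by rewrite big_geq // subrr.
rewrite ltnS => mn; rewrite big_nat_recr //=.
have n0 : 0 < n%:R :> R by rewrite ltr0n (leq_trans m0).
have h := IH mn; apply: (le_trans (lerD h (lexx _))).
have -> : n.+1%:R = n%:R + 1 :> R by rewrite -natr1.
have q : (n%:R + 1) ^- 2 <= n%:R^-1 - (n%:R + 1)^-1 :> R.
  have -> : n%:R^-1 - (n%:R + 1)^-1 = (n%:R * (n%:R + 1))^-1 :> R.
    by field; rewrite !gt_eqF // ltr_wpDl // ltW.
  by rewrite lef_pV2 ?posrE ?exprn_gt0 ?mulr_gt0 // ?ltr_wpDl // ?(ltW n0) //; rewrite expr2; nra.
lra.
Qed.

Let term_le n x : (0 < n)%N -> 0 <= x -> `|12 / w n ^+ 3 * sin (w n * x)| <= x * n%:R ^- 2.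
Proof.
move=> n0 x0; have wn := w_gt0 n0.
rewrite normrM ger0_norm ?divr_ge0 ?exprn_ge0 ?(ltW wn) //.
apply: (@le_trans _ _ (12 / w n ^+ 3 * (w n * x))).
  rewrite ler_wpM2l ?divr_ge0 ?exprn_ge0 ?(ltW wn) //.
  by apply: (le_trans (sin_norm_le _)); rewrite ger0_norm // mulr_ge0 // ltW.
have -> : 12 / w n ^+ 3 * (w n * x) = x * (12 / w n ^+ 2) by field; rewrite gt_eqF.
by rewrite ler_wpM2l // pi2ge.
Qed.

Let S3_tail M N x : 0 <= x -> (0 < N)%N -> (N <= M)%N -> `|S3 M x - S3 N x| <= x / N%:R.
Proof.
move=> x0 N0 NM; rewrite /S3 (@big_cat_nat _ _ _ N.+1) //= addrAC subrr add0r.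
apply: (le_trans (ler_norm_sum _ _ _)).
apply: (@le_trans _ _ (\sum_(N.+1 <= k < M.+1) x * k%:R ^- 2)).
  rewrite big_nat [leRHS]big_nat; apply: ler_sum => k /andP[Nk _].
  by apply: term_le => //; exact: leq_trans Nk.
rewrite -mulr_sumr ler_wpM2l //; apply: (le_trans (inv_sqr_tail N0 NM)).
by rewrite gerBl invr_ge0.
Qed.

Let r_small N x : 0 <= x <= 1 -> `|r N x| <= 5 * x.
Proof.
move=> /andP[x0 x1]; rewrite /r.
have b3 : `|B3 x| <= 3 * x by rewrite /B3 ler_norml; apply/andP; split; nra.
have s3 : `|S3 N x| <= 2 * x.
  case: N => [|N]; first by rewrite /S3 big_geq // normr0; lra.
  have h1 := @S3_tail N.+1 1 x x0 isT isT.
  have h2 : `|S3 1 x| <= x.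
    by rewrite /S3 big_nat1 (le_trans (@term_le 1 x isT x0)) // expr1n invr1 mulr1.
  have := ler_normD (S3 N.+1 x - S3 1 x) (S3 1 x); rewrite subrK divr1 in h1 *.
  lra.
have := ler_normB (B3 x) (S3 N x); lra.
Qed.

(** Evaluate the Taylor formula at a small fixed [x]: there [|r| <= 5 x] for every [N], while
    [|x - 1/2| >= 1/4], so the derivative of [r] at [1/2] cannot remain large. *)
Let alpha_cvg (e : R) : 0 < e -> exists N0, forall N, (N0 <= N)%N -> `|r1 N (1 / 2)| <= e.
Proof.
move=> e0; pose x := Num.min (1 / 4) (e / 80).
have x0 : 0 < x by rewrite lt_min !divr_gt0.
have x4 : x <= 1 / 4 by rewrite ge_min lexx.
have xe : x <= e / 80 by rewrite ge_min lexx orbT.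
have [|C C0 HC] := @taylor x; first by rewrite x0 /=; lra.
exists (Num.truncn (8 * C / e)).+1 => N hN.
have N1 : 8 * C / e < N%:R by apply: lt_le_trans (truncnS_gt _) _; rewrite ler_nat.
have h := HC N; have h2 : `|r N x| <= 5 * x by apply: r_small; lra.
have q : C / (2 * N%:R + 1) <= e / 8.
  have n0 : 0 <= N%:R :> R by [].
  rewrite ler_pdivrMr; last by lra.
  by move: N1; rewrite ltr_pdivrMr //; nra.
have : `|r1 N (1 / 2) * (x - 1 / 2)| <= 5 * x + e / 8.
  have -> : r1 N (1 / 2) * (x - 1 / 2) = r N x - (r N x - r1 N (1 / 2) * (x - 1 / 2)) by ring.
  by apply: (le_trans (ler_normB _ _)); lra.
rewrite normrM (ler0_norm (_ : x - 1 / 2 <= 0)); last lra.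
move: (normr_ge0 (r1 N (1 / 2))); nra.
Qed.

Let r_cvg_half x (e : R) : 0 <= x <= 1 / 2 -> 0 < e -> exists N0, forall N, (N0 <= N)%N -> `|r N x| <= e.
Proof.
move=> /andP[]; rewrite le_eqVlt => /predU1P[<- _ e0|x0 x2 e0].
  exists 0%N => N _; have := @r_small N 0; rewrite lexx ler01 mulr0 => /(_ isT) h.
  exact: le_trans h (ltW e0).
have e2 : 0 < e / 2 by rewrite divr_gt0.
have [N1 H1] := alpha_cvg e2; have [|C C0 HC] := @taylor x; first by rewrite x0.
exists (maxn N1 (Num.truncn (2 * C / e)).+1) => N; rewrite geq_max => /andP[/H1 h1 hN].
have N2 : 2 * C / e < N%:R by apply: lt_le_trans (truncnS_gt _) _; rewrite ler_nat.
have q : C / (2 * N%:R + 1) <= e / 2.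
  have n0 : 0 <= N%:R :> R by [].
  rewrite ler_pdivrMr; last by lra.
  by move: N2; rewrite ltr_pdivrMr //; nra.
have h := HC N; have : `|r1 N (1 / 2) * (x - 1 / 2)| <= e / 2.
  rewrite normrM (ler0_norm (_ : x - 1 / 2 <= 0)); last lra.
  by move: (normr_ge0 (r1 N (1 / 2))); nra.
have := ler_normD (r N x - r1 N (1 / 2) * (x - 1 / 2)) (r1 N (1 / 2) * (x - 1 / 2)).
rewrite subrK; lra.
Qed.

Let r_odd N x : r N (1 - x) = - r N x.
Proof.
have E n : sin (w n * (1 - x)) = - sin (w n * x).
  have -> : w n * (1 - x) = n%:R * (pi *+ 2) - w n * x by rewrite /w; ring.
  have c n' : cos (n'%:R * (pi *+ 2)) = 1 :> R /\ sin (n'%:R * (pi *+ 2)) = 0 :> R.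
    elim: n' => [|n' [c1 s1]]; first by rewrite mul0r cos0 sin0.
    have s2 : sin (pi *+ 2) = 0 :> R by rewrite mulr2n sinDpi sinpi oppr0.
    rewrite -[n'.+1]addn1 natrD mulrDl mul1r (cosD (n'%:R * _)) (sinD (n'%:R * _)).
    by rewrite c1 s1 cos2pi s2 !mulr0 mul0r mulr1 subr0 addr0.
  by have [c1 s1] := c n; rewrite sinB c1 s1 mul0r mul1r sub0r.
rewrite /r (_ : B3 (1 - x) = - B3 x); last by rewrite /B3; field.
rewrite (_ : S3 N (1 - x) = - S3 N x); first by rewrite opprB opprK addrC.
by rewrite /S3 -sumrN; apply: eq_bigr => n _; rewrite E mulrN.
Qed.

(** Pointwise convergence, carried from [[0, 1/2]] to [[0, 1]] by the symmetry [x -> 1 - x],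
    combines with the absolutely convergent tail; [|sin u| <= |u|] supplies the factor [x]. *)
Lemma fourier_B3 N x : (0 < N)%N -> 0 <= x <= 1 -> `|B3 x - S3 N x| <= x / N%:R.
Proof.
move=> N0 /andP[x0 x1]; apply/ler_addgt0Pr => e e0.
have [N1 H1] : exists N1, forall M, (N1 <= M)%N -> `|r M x| <= e.
  have [x2|x2] := leP x (1 / 2); first by apply: r_cvg_half => //; rewrite x0.
  have [|N1 H1] := @r_cvg_half (1 - x) e _ e0; first lra.
  by exists N1 => M /H1; rewrite r_odd normrN.
pose M := maxn N N1; have h1 := H1 M (leq_maxr _ _).
have h2 := S3_tail x0 N0 (leq_maxl N N1 : (N <= M)%N).
have -> : B3 x - S3 N x = r M x + (S3 M x - S3 N x) by rewrite /r; ring.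
by apply: (le_trans (ler_normD _ _)); lra.
Qed.

(** The convergence in [alpha_cvg] says that the alternating sum [b] tends to [- pi^2 / 12].
    Splitting off the even terms gives [b (2 N) = - a (2 N) + a N / 2], whose limit is minus half
    the limit of [a]. *)
Lemma basel : (fun N => \sum_(1 <= n < N.+1) (n%:R ^- 2 : R)) @ \oo --> (pi ^+ 2 / 6 : R).
Proof.
pose a N := \sum_(1 <= n < N.+1) (n%:R ^- 2 : R).
pose b N := \sum_(1 <= n < N.+1) ((-1) ^+ n * n%:R ^- 2 : R).
have p0 := pi_gt0 R.
have cospin n : cos (w n * (1 / 2)) = (-1) ^+ n.
  have -> : w n * (1 / 2) = n%:R * pi by rewrite /w; field.
  elim: n => [|n IH]; first by rewrite mul0r cos0 expr0.
  by rewrite -[n.+1]addn1 natrD mulrDl mul1r cosDpi IH exprD expr1 mulrN1.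
have rb N : r1 N (1 / 2) = - (1 / 4) - 3 / pi ^+ 2 * b N.
  rewrite /r1 /S2 /b mulr_sumr (_ : \sum_(_ <= _ < _) _ = \sum_(1 <= n < N.+1) 3 / pi ^+ 2 * ((-1) ^+ n * n%:R ^- 2)).
    by congr (_ - _); field.
  apply: eq_big_nat => n /andP[n0 _]; rewrite cospin /w.
  have n1 : n%:R != 0 :> R by rewrite pnatr_eq0 -lt0n.
  have p1 : pi != 0 :> R by rewrite gt_eqF.
  move: ((-1) ^+ n) => u; move: (n%:R : R) n1 => v v0; move: (pi : R) p1 => P P0.
  by field; rewrite v0 P0.
have bS N : b N.+1 = b N + (-1) ^+ N.+1 * N.+1%:R ^- 2 by rewrite /b big_nat_recr.
have aS N : a N.+1 = a N + N.+1%:R ^- 2 by rewrite /a big_nat_recr.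
have ba N : b (2 * N)%N = - a (2 * N)%N + a N / 2.
  rewrite mul2n; elim: N => [|N IH]; first by rewrite /b /a !big_geq //; field.
  rewrite doubleS !bS !aS IH.
  have sg1 : (-1) ^+ N.*2.+1 = -1 :> R by rewrite exprS -signr_odd odd_double expr0 mulr1.
  have sg2 : (-1) ^+ N.*2.+2 = 1 :> R by rewrite exprS sg1 mulrNN mulr1.
  rewrite sg1 sg2.
  have -> : N.*2.+2%:R = 2 * N.+1%:R :> R by rewrite -doubleS -mul2n natrM.
  have h1 : N.*2.+1%:R != 0 :> R by rewrite pnatr_eq0.
  have h2 : N.+1%:R != 0 :> R by rewrite pnatr_eq0.
  move: (N.*2.+1%:R : R) (N.+1%:R : R) h1 h2 (a N.*2) (a N) => x y x0 y0 p q.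
  by field; rewrite x0 y0.
have and_ : nondecreasing_seq a.
  apply/nondecreasing_seqP => N; rewrite /a [leRHS]big_nat_recr //= lerDl.
  by rewrite invr_ge0 exprn_ge0.
have a2 N : a N <= 2.
  case: N => [|N]; first by rewrite /a big_geq.
  rewrite /a big_ltn // expr1n invr1 -[leRHS]/(1 + 1) lerD2l.
  apply: (le_trans (@inv_sqr_tail 1 N.+1 isT isT)).
  by rewrite invr1 gerBl invr_ge0.
have ca : cvgn a by apply: nondecreasing_is_cvgn => //; exists 2 => _ [N _ <-].
have [z Hz] : exists z : R, a @ \oo --> z by exists (limn a).
suff <- : z = pi ^+ 2 / 6 by [].
apply/eqP; rewrite -subr_eq0 -normr_le0; apply/ler_addgt0Pr => e e0; rewrite add0r.
have e1 : 0 < e / 100 by rewrite divr_gt0.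
have [N1 _ H1] : \forall N \near \oo, `|z - a N| <= e / 100 by apply: (cvgrPdist_le _ _).1 Hz _ e1.
have [N2 H2] := alpha_cvg e1.
pose N := maxn N1 N2.
have h1 := H1 N (leq_maxl _ _ : (N1 <= N)%N).
have h2 := H1 (2 * N)%N (leq_trans (leq_maxl _ _) (leq_pmull N (isT : (0 < 2)%N)) : (N1 <= 2 * N)%N).
have h3 := H2 (2 * N)%N (leq_trans (leq_maxr _ _) (leq_pmull N (isT : (0 < 2)%N))).
rewrite rb ba in h3.
have p4 : pi <= 4 :> R by by have := pihalf_lt2 R; lra.
have pp : 0 < pi ^+ 2 :> R by rewrite exprn_gt0.
have pp16 : pi ^+ 2 <= 16 :> R by rewrite expr2; nra.
have h4 : `| - (pi ^+ 2 / 12) - (- a (2 * N)%N + a N / 2)| <= 16 / 3 * (e / 100).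
  have -> : - (pi ^+ 2 / 12) - (- a (2 * N)%N + a N / 2) =
     pi ^+ 2 / 3 * (- (1 / 4) - 3 / pi ^+ 2 * (- a (2 * N)%N + a N / 2)).
    have gen (P u v : R) : P != 0 -> - (P ^+ 2 / 12) - (- u + v / 2) =
      P ^+ 2 / 3 * (- (1 / 4) - 3 / P ^+ 2 * (- u + v / 2)) by move=> P0; field.
    by apply: gen; rewrite gt_eqF.
  by rewrite normrM ger0_norm ?divr_ge0 ?(ltW pp) //; apply: ler_pM => //; lra.
move: h1 h2 h4; rewrite !ler_norml; lra.
Qed.

End FourierB3.

(** * Complex sequences and uniform limits of holomorphic functions *)

Section Sequences.
Variable R : realType.
Implicit Types (u v : nat -> R[i]) (l : R[i]).

Definition cseq u l := forall eps : R, 0 < eps ->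
  exists N0, forall N, (N0 <= N)%N -> cabs (u N - l) <= eps.

Lemma cseq_uniq u l l' : cseq u l -> cseq u l' -> l = l'.
Proof.
move=> h h'; apply/eqP; rewrite -subr_eq0 -cabs_eq0 eq_le cabs_ge0 andbT.
apply/ler_addgt0Pr => e e0; rewrite add0r; have e2 : 0 < e / 2 by rewrite divr_gt0.
have [N H] := h _ e2; have [N' H'] := h' _ e2; pose M := maxn N N'.
have := H M (leq_maxl _ _); have := H' M (leq_maxr _ _).
have -> : l - l' = (u M - l') - (u M - l) by ring.
have := cabsB (u M - l') (u M - l); lra.
Qed.

Lemma eq_cseq u v l : (exists N0, forall N, (N0 <= N)%N -> u N = v N) -> cseq u l -> cseq v l.
Proof.
move=> [N0 E] h e /h [N1 H]; exists (maxn N0 N1) => N; rewrite geq_max => /andP[h0 h1].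
by rewrite -E // H.
Qed.

Lemma cseq_cst l : cseq (fun=> l) l.
Proof. by move=> e e0; exists 0%N => N _; rewrite subrr cabs0 ltW. Qed.

Lemma cseqD u v l l' : cseq u l -> cseq v l' -> cseq (fun N => u N + v N) (l + l').
Proof.
move=> h h' e e0; have e2 : 0 < e / 2 by rewrite divr_gt0.
have [N H] := h _ e2; have [N' H'] := h' _ e2; exists (maxn N N') => M.
rewrite geq_max => /andP[/H h1 /H' h2].
have -> : u M + v M - (l + l') = (u M - l) + (v M - l') by ring.
have := cabsD (u M - l) (v M - l'); lra.
Qed.

Lemma cseqZ u l c : cseq u l -> cseq (fun N => c * u N) (c * l).
Proof.
move=> h e e0; have c1 : 0 < cabs c + 1 by rewrite ltr_wpDl // cabs_ge0.
have [N H] := h _ (divr_gt0 e0 c1); exists N => M /H h1.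
rewrite -mulrBr cabsM; have := cabs_ge0 c; have := cabs_ge0 (u M - l).
move: h1; rewrite ler_pdivlMr //; nra.
Qed.

Lemma cseqN u l : cseq u l -> cseq (fun N => - u N) (- l).
Proof. by move=> /(@cseqZ _ _ (-1)) h; apply: eq_cseq (_ : cseq _ _); last (rewrite mulN1r in h; exact: h); exists 0%N => N _; rewrite mulN1r. Qed.

Lemma cseqB u v l l' : cseq u l -> cseq v l' -> cseq (fun N => u N - v N) (l - l').
Proof. by move=> h h'; apply: cseqD => //; exact: cseqN. Qed.

Lemma cseq_le u l (K : R) : cseq u l -> (exists N0, forall N, (N0 <= N)%N -> cabs (u N) <= K) ->
  cabs l <= K.
Proof.
move=> h [N0 H]; apply/ler_addgt0Pr => e /h [N1 H1]; pose M := maxn N0 N1.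
have := H M (leq_maxl _ _); have := H1 M (leq_maxr _ _).
have -> : l = u M - (u M - l) by ring.
have := cabsB (u M) (u M - l); rewrite opprB addrCA subrr addr0; lra.
Qed.

Lemma cseq_cauchy u : (forall eps : R, 0 < eps -> exists N0, forall N, (N0 <= N)%N ->
  cabs (u N - u N0) <= eps) -> exists l, cseq u l.
Proof.
move=> h; have aux (f : R[i] -> R) : (forall a b, `|f a - f b| <= cabs (a - b)) ->
    exists l : R, forall eps : R, 0 < eps -> exists N0, forall N, (N0 <= N)%N -> `|f (u N) - l| <= eps.
  move=> Hf; have cv : cvg ((fun N => f (u N)) @ \oo).
    apply: cauchy_cvg; apply: cauchy_exP => e e0.
    have [N0 H0] := h _ (divr_gt0 e0 (ltr0n R 2)).
    exists (f (u N0)); exists N0 => // N /= /H0 hN.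
    rewrite /ball /= distrC; apply: (le_lt_trans (Hf _ _)); lra.
  exists (lim ((fun N => f (u N)) @ \oo)) => e e0.
  have [N0 _ H] := (cvgrPdist_le _ _).1 cv _ e0.
  by exists N0 => N hN; rewrite distrC; exact: H.
have [|a Ha] := aux (@complex.Re R).
  by move=> a b; apply: le_trans (Re_le_cabs _); rewrite cReD cReN.
have [|b Hb] := aux (@complex.Im R).
  by move=> c d; apply: le_trans (Im_le_cabs _); rewrite cImD cImN.
exists (a +i* b) => e e0; have e2 : 0 < e / 2 by rewrite divr_gt0.
have [N1 H1] := Ha _ e2; have [N2 H2] := Hb _ e2; exists (maxn N1 N2) => N.
rewrite geq_max => /andP[/H1 h1 /H2 h2]; apply: (le_trans (cabs_le_ReIm _)).
rewrite cReD cReN cImD cImN /=; lra.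
Qed.

(** Weierstrass's theorem: Cauchy's formula on a square passes to the uniform limit, and a Cauchy
    integral of a continuous function is differentiable. *)
Lemma dble_ulim (F : nat -> R[i] -> R[i]) f a (r : R) : 0 < r ->
  (forall N z, cabs (z - a) < r -> dble (F N) z) ->
  (forall eps : R, 0 < eps -> exists N0, forall N, (N0 <= N)%N -> forall z, cabs (z - a) < r ->
     cabs (F N z - f z) <= eps) -> dble f a.
Proof.
move=> r0 dF uF.
have cf z : cabs (z - a) < r -> cts id f z.
  move=> za e e0; have e4 : 0 < e / 4 by rewrite divr_gt0.
  have [N0 H] := uF _ e4; have h := H N0 (leqnn _).
  have [d d0 Hd] := dble_cts (dF N0 z za) e4.
  have rz : 0 < r - cabs (z - a) by rewrite subr_gt0.
  exists (Num.min d (r - cabs (z - a))); first by rewrite lt_min d0.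
  move=> w; rewrite lt_min => /andP[/Hd wd wr].
  have wa : cabs (w - a) < r.
    have -> : w - a = (w - z) + (z - a) by ring.
    by have := cabsD (w - z) (z - a); lra.
  have h1 := h w wa; have h2 := h z za.
  have -> : f w - f z = (F N0 w - F N0 z) - (F N0 w - f w) + (F N0 z - f z) by ring.
  have := cabsD (F N0 w - F N0 z - (F N0 w - f w)) (F N0 z - f z).
  have := cabsB (F N0 w - F N0 z) (F N0 w - f w); lra.
pose q := r / 3; have q0 : 0 < q by rewrite divr_gt0.
pose x0 := cRe a - q; pose x1 := cRe a + q.
pose y0 := cIm a - q; pose y1 := cIm a + q.
have x01 : x0 <= x1 by rewrite /x0 /x1; lra.
have y01 : y0 <= y1 by rewrite /y0 /y1; lra.
have inr z : inrect x0 x1 y0 y1 z -> cabs (z - a) < r.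
  rewrite /inrect /x0 /x1 /y0 /y1 => h; apply: (le_lt_trans (cabs_le_ReIm _)).
  rewrite cReD cReN cImD cImN.
  have h1 : `|cRe z - cRe a| <= q by rewrite ler_norml; lra.
  have h2 : `|cIm z - cIm a| <= q by rewrite ler_norml; lra.
  by rewrite /q in h1 h2; lra.
have ina : ininterior x0 x1 y0 y1 a by rewrite /ininterior /x0 /x1 /y0 /y1; lra.
have E z : ininterior x0 x1 y0 y1 z ->
    RI (fun w => f w / (w - z)) x0 x1 y0 y1 = (2 * pi)%:C * ii * f z.
  move=> iz; have [d d0 Hd] := bd_dist iz.
  apply/eqP; rewrite -subr_eq0 -cabs_eq0 eq_le cabs_ge0 andbT.
  apply/ler_addgt0Pr => e e0; rewrite add0r.
  pose C : R := 4 * ((x1 - x0) + (y1 - y0)) / d + 8.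
  have C0 : 0 < C.
    by rewrite /C ltr_wpDl // mulr_ge0 ?invr_ge0 ?(ltW d0) // mulr_ge0 // addr_ge0 ?subr_ge0.
  have [N0 H] := uF _ (divr_gt0 e0 C0); have h := H N0 (leqnn _).
  have cq g w : onbd x0 x1 y0 y1 w -> cts id g w -> cts id (fun w => g w / (w - z)) w.
    by move=> bw cg; apply: ctsM => //; apply: cts_inv; apply: bd_neq bw.
  have cF w : onbd x0 x1 y0 y1 w -> cts id (F N0) w.
    by move=> bw; apply: dble_cts; apply: dF; apply: inr; exact: onbd_inrect.
  have cf' w : onbd x0 x1 y0 y1 w -> cts id f w.
    by move=> bw; apply: cf; apply: inr; exact: onbd_inrect.
  have EF : RI (fun w => F N0 w / (w - z)) x0 x1 y0 y1 = (2 * pi)%:C * ii * F N0 z.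
    apply: (@cauchy_formula _ x0 x1 y0 y1 [::]) => //.
    by move=> w /inr wr _; exact: dF.
  have -> : RI (fun w => f w / (w - z)) x0 x1 y0 y1 - (2 * pi)%:C * ii * f z =
     - (RI (fun w => F N0 w / (w - z)) x0 x1 y0 y1 - RI (fun w => f w / (w - z)) x0 x1 y0 y1)
     + (2 * pi)%:C * ii * (F N0 z - f z) by rewrite EF; ring.
  apply: (le_trans (cabsD _ _)); rewrite cabsN -RIB //; last 2 first.
  - by move=> w bw; apply: cq => //; exact: cF.
  - by move=> w bw; apply: cq => //; exact: cf'.
  have b1 : cabs (RI (fun w => F N0 w / (w - z) - f w / (w - z)) x0 x1 y0 y1) <=
      4 * (e / C / d) * ((x1 - x0) + (y1 - y0)).
    apply: RI_le => //.
      by move=> w bw; apply: ctsB; apply: cq => //; [exact: cF|exact: cf'].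
    move=> w bw; rewrite -mulrBl cabsM cabsV; apply: ler_pM; rewrite ?cabs_ge0 ?invr_ge0 ?cabs_ge0 //.
      by apply: h; apply: inr; exact: onbd_inrect.
    by rewrite lef_pV2 ?posrE ?Hd // (lt_le_trans d0) // Hd.
  have b2 : cabs ((2 * pi)%:C * ii * (F N0 z - f z)) <= 8 * (e / C).
    rewrite !cabsM cabs_i mulr1 cabs_real ger0_norm ?mulr_ge0 ?pi_ge0 //.
    apply: ler_pM; rewrite ?cabs_ge0 ?mulr_ge0 ?pi_ge0 //.
      by have := pihalf_lt2 R; lra.
    by apply: h; apply: inr; exact: interior_inrect.
  apply: (le_trans (lerD b1 b2)).
  have -> : 4 * (e / C / d) * (x1 - x0 + (y1 - y0)) + 8 * (e / C) = e / C * C.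
    rewrite [RHS](_ : _ = e / C * (4 * ((x1 - x0) + (y1 - y0)) / d + 8)) //; move: (e / C) => v; ring.
  by rewrite divfK ?gt_eqF.
have cbd w : onbd x0 x1 y0 y1 w -> cts id f w.
  by move=> bw; apply: cf; apply: inr; exact: onbd_inrect.
have hc := hasdZ ((2 * pi)%:C * ii)^-1 (hasd_cauchy1 cbd ina).
have [rr rr0 Hr] := near_interior ina.
exists (((2 * pi)%:C * ii)^-1 * RI (fun w => f w / (w - a) ^+ 2) x0 x1 y0 y1).
apply: (hasd_near rr0 _ hc) => z /= zr; rewrite E; last exact: Hr.
by rewrite mulKf // pi2i_neq0.
Qed.

(** With a majorant of known primitive the estimate ends in boundary values, which then telescope or
    are dropped. *)
Lemma cI_le_prim (f : R -> R[i]) (g G : R -> R) a b : a <= b ->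
  (forall x, a <= x <= b -> cts rc f x) ->
  (forall x, a <= x <= b -> cts rc (fun t => (g t)%:C) x) ->
  (forall x, a <= x <= b -> hasd rc (fun t => (G t)%:C) x (g x)%:C) ->
  (forall x, a <= x <= b -> cabs (f x) <= g x) -> cabs (cI f a b) <= 2 * (G b - G a).
Proof.
move=> ab cf cg dG fg.
have [ig _] := cts_integrable cg.
have -> : G b - G a = \int[lebesgue_measure]_(x in `[a, b]) g x.
  have := cI_FTC ab cg dG; rewrite -rmorphB /= => /(congr1 (@complex.Re R)) /= <-.
  by [].
by apply: cint_le => //; exact: cts_integrable.
Qed.

End Sequences.

(** * Powers of positive numbers with complex and real exponents *)

Section Powers.
Variable R : realType.
Implicit Types (x y : R) (s : R[i]).

Definition cpw x s : R[i] := cexp (s * (ln x)%:C).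
Definition rpw x (a : R) : R := expR (a * ln x).

Lemma cabs_cpw x s : cabs (cpw x s) = rpw x (cRe s).
Proof. by rewrite /cpw cabs_cexp cReM /= mulr0 subr0. Qed.

Lemma cpwD x s (t : R[i]) : cpw x (s + t) = cpw x s * cpw x t.
Proof. by rewrite /cpw mulrDl cexpD. Qed.

Lemma cpw_neq0 x s : cpw x s != 0. Proof. exact: cexp_neq0. Qed.

Lemma cpwM x y s : 0 < x -> 0 < y -> cpw (x * y) s = cpw x s * cpw y s.
Proof. by move=> x0 y0; rewrite /cpw lnM ?posrE // rmorphD /= mulrDr cexpD. Qed.

Lemma cpw1 s : cpw 1 s = 1. Proof. by rewrite /cpw ln1 mulr0 cexp0. Qed.

Lemma cpwx0 x : cpw x 0 = 1. Proof. by rewrite /cpw mul0r cexp0. Qed.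

Lemma cpwx1 x : 0 < x -> cpw x 1 = x%:C.
Proof. by move=> x0; rewrite /cpw mul1r cexp_real lnK. Qed.

Lemma cpw_natS x s n : 0 < x -> cpw x (s + n%:R) = cpw x s * (x ^+ n)%:C.
Proof.
move=> x0; elim: n => [|n IH]; first by rewrite addr0 expr0 mulr1.
by rewrite -natr1 addrA cpwD IH cpwx1 // exprSr [in RHS]rmorphM mulrA.
Qed.

Lemma cpwN x s : cpw x (- s) = (cpw x s)^-1.
Proof. by rewrite /cpw mulNr cexpN. Qed.

Lemma cpwJ x s : cpw x s^* = (cpw x s)^*.
Proof. rewrite /cpw -cexpJ; congr cexp; apply: complexP; rewrite ?cReM ?cImM; case: s => a b /=; rewrite ?cReM ?cImM /=; ring. Qed.

Lemma natpowNE n s : natpowN n s = cpw n%:R (- s).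
Proof. by rewrite /natpowN /cpw /cexp cReM cImM cReN cImN /= !mulr0 subr0 add0r !mulNr. Qed.

Lemma rpw_gt0 x a : 0 < rpw x a. Proof. exact: expR_gt0. Qed.
Lemma rpw_ge0 x a : 0 <= rpw x a. Proof. exact: expR_ge0. Qed.
Lemma rpwD x a b : rpw x (a + b) = rpw x a * rpw x b.
Proof. by rewrite /rpw mulrDl expRD. Qed.
Lemma rpw1 a : rpw 1 a = 1. Proof. by rewrite /rpw ln1 mulr0 expR0. Qed.
Lemma rpwx1 x : 0 < x -> rpw x 1 = x. Proof. by move=> x0; rewrite /rpw mul1r lnK. Qed.
Lemma rpwx0 x : rpw x 0 = 1. Proof. by rewrite /rpw mul0r expR0. Qed.
Lemma rpw_nat x n : 0 < x -> rpw x n%:R = x ^+ n.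
Proof.
move=> x0; elim: n => [|n IH]; first by rewrite rpwx0 expr0.
by rewrite -natr1 rpwD IH rpwx1 // exprSr.
Qed.
Lemma rpwN x a : rpw x (- a) = (rpw x a)^-1.
Proof. by rewrite /rpw mulNr expRN. Qed.
Lemma rpwV x a : 0 < x -> rpw x^-1 a = rpw x (- a).
Proof. by move=> x0; rewrite /rpw lnV ?posrE // mulrN mulNr. Qed.

Lemma rpw_leW x a b : 1 <= x -> a <= b -> rpw x a <= rpw x b.
Proof. by move=> x1 ab; rewrite ler_expR ler_wpM2r // ln_ge0. Qed.

Lemma cpw_real x a : cpw x a%:C = (rpw x a)%:C.
Proof. by rewrite /cpw -rmorphM cexp_real. Qed.

Lemma hasd_ln x : 0 < x -> hasd rc (fun t => (ln t)%:C) x (x^-1)%:C.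
Proof. by move=> x0; apply: hasd_real; exact: is_derive1_ln. Qed.

Lemma hasd_cpw x s : 0 < x -> hasd rc (fun t => cpw t s) x (s * cpw x (s - 1)).
Proof.
move=> x0; have := hasd_cexp_comp (hasdZ s (hasd_ln x0)); rewrite /= -/(cpw x s).
rewrite (_ : s * cpw x (s - 1) = cpw x s * (s * (x^-1)%:C)) //.
rewrite cpwD cpwN cpwx1 // -fmorphV /=; ring.
Qed.

Lemma cts_cpw x s : 0 < x -> cts rc (fun t => cpw t s) x.
Proof. by move=> x0; exact: hasd_cts (hasd_cpw s x0). Qed.

Lemma hasd_cpws x s : hasd id (cpw x) s ((ln x)%:C * cpw x s).
Proof.
have h := hasdZ (ln x)%:C (@hasd_id _ _ id s).
have := hasd_cexp_comp h; rewrite mulr1 mulrC => h2.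
rewrite /cpw [s * _]mulrC; apply: (@hasd_near _ _ _ _ _ _ _ 1 ltr01 _ h2) => z _ /=.
by rewrite mulrC.
Qed.

Lemma hasd_rpw x a : 0 < x -> hasd rc (fun t => (rpw t a)%:C) x (a * rpw x (a - 1))%:C.
Proof.
move=> x0; have := @hasd_cpw x a%:C x0; rewrite -[1]/(1%:C) -rmorphB /= cpw_real rmorphM /=.
by apply: (@hasd_near _ _ _ _ _ _ _ 1 ltr01) => t _; rewrite cpw_real.
Qed.

Lemma cts_rpw x a : 0 < x -> cts rc (fun t => (rpw t a)%:C) x.
Proof. by move=> x0; exact: hasd_cts (hasd_rpw a x0). Qed.

Lemma rpw_small (a eps : R) : 0 < a -> 0 < eps ->
  exists N0, (0 < N0)%N /\ forall N, (N0 <= N)%N -> rpw N%:R (- a) <= eps.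
Proof.
move=> a0 e0; pose X := expR (- ln eps / a).
exists (Num.truncn X).+1; split=> // N hN.
have XN : X <= N%:R by apply: ltW; apply: lt_le_trans (truncnS_gt _) _; rewrite ler_nat.
have N0 : 0 < N%:R :> R by exact: lt_le_trans (expR_gt0 _) XN.
rewrite -[leRHS]lnK // ler_expR mulNr lerNl.
have : ln X <= ln N%:R by rewrite ler_ln ?posrE // expR_gt0.
by rewrite expRK ler_pdivrMr // mulrC.
Qed.

End Powers.

(** * The hypotheses on zeta in terms of [hasd] and [cseq] *)

Section ZetaBridge.
Variable R : realType.
Variable zeta : R[i]^o -> R[i]^o.
Hypothesis zP : is_riemann_zeta zeta.

(** The library derivative over the field [R[i]] has radii in [R[i]]; a positive element there is
    real, which brings the estimate back to radii in [R]. *)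
Lemma hasd_zeta (s : R[i]) : s != 1 -> hasd id zeta s (derive1 zeta s).
Proof.
move=> s1; have h := (proj1 zP) s s1.
apply/hasdP => e e0; move: h; rewrite /derivable /derive1.
set f := (fun h : R[i]^o => _) => cf.
have Ef : f = (fun h : R[i]^o => h^-1 *: (zeta (h + s) - zeta s)).
  by apply/funext => h; rewrite /f /= /GRing.scale /= mulr1.
rewrite -/derive1 in cf; rewrite Ef in cf.
have eC : 0 < e%:C by rewrite ltcR.
move/cvgrPdist_lt: cf => /(_ _ eC).
rewrite near_withinE => /(nbhs_ballP _ _)[d /= d0 Hd].
have dd : d = (cRe d)%:C.
  by move: d0; rewrite ltcE /= => /andP[/eqP di _]; case: d di {Hd} => a b /= ->.
exists (cRe d); first by move: d0; rewrite ltcE => /andP[_].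
move=> z; have [->|zs] := eqVneq z s; first by rewrite !subrr mulr0 subr0 cabs0 mulr0.
move=> zd; have := Hd (z - s); rewrite /ball /= sub0r normrN normC_cabs dd ltcR zd.
move=> /(_ isT); rewrite subr_eq0 zs subrK => /(_ isT).
rewrite normC_cabs ltcR /GRing.scale /= => H; apply/ltW.
have zs0 : z - s != 0 by rewrite subr_eq0.
set D := lim _ in H *.
have -> : zeta z - zeta s - D * (z - s) = - (D - (z - s)^-1 * (zeta z - zeta s)) * (z - s).
  move: (D : R[i]) (zeta z : R[i]) (zeta s : R[i]) => D' a b.
  by rewrite opprB mulrBl mulrAC mulVf // mul1r.
by rewrite cabsM cabsN ltr_pM2r // cabs_gt0.
Qed.

Lemma dble_zeta (s : R[i]) : s != 1 -> dble (zeta : R[i] -> R[i]) s.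
Proof. by move=> /hasd_zeta h; exists (derive1 zeta s). Qed.

Lemma zeta_cseq (s : R[i]) : 1 < cRe s ->
  cseq (fun N => \sum_(1 <= n < N.+1) cpw n%:R (- s)) (zeta s).
Proof.
move=> s1 e e0; have h := (proj2 zP) s s1.
have eC : 0 < e%:C by rewrite ltcR.
have [N0 _ H] := (cvgrPdist_lt _ _).1 h _ eC.
exists N0 => N hN; have := H N hN; rewrite /= normC_cabs ltcR cabsBC => /ltW.
by under eq_bigr do rewrite natpowNE.
Qed.

End ZetaBridge.

(** * Euler-Maclaurin summation *)

Section EulerMaclaurin.
Variable R : realType.
Implicit Types (x : R) (s : R[i]) (m n N j : nat).

(** The Bernoulli polynomials B_0 to B_5. Every index above 4 returns B_5, so the derivative rule is
    restricted to [j < 5]. *)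
Definition Bp j x : R :=
  match j with
  | 0 => 1
  | 1 => x - 1 / 2
  | 2 => x ^+ 2 - x + 1 / 6
  | 3 => x ^+ 3 - 3 / 2 * x ^+ 2 + x / 2
  | 4 => x ^+ 4 - 2 * x ^+ 3 + x ^+ 2 - 1 / 30
  | _ => x ^+ 5 - 5 / 2 * x ^+ 4 + 5 / 3 * x ^+ 3 - x / 6
  end.

Lemma dBp j x (a : R) : (j < 5)%N ->
  is_derive x 1 (fun t => Bp j.+1 (t - a)) (j.+1%:R * Bp j (x - a)).
Proof.
case: j => [|[|[|[|[|]]]]] //= _;
  by apply: is_derive_eq; rewrite /GRing.scale /=; field.
Qed.

Lemma Bp_le j x : 0 <= x <= 1 -> `|Bp j x| <= 1.
Proof.
move=> /andP[x0 x1]; have y0 : 0 <= x * (1 - x) by rewrite mulr_ge0 // subr_ge0.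
have y1 : x * (1 - x) <= 1 / 4 by have := sqr_ge0 (x - 1 / 2); rewrite expr2; lra.
have z : `|x - 1 / 2| <= 1 / 2 by rewrite ler_norml; lra.
case: j => [|[|[|[|[|j]]]]] /=.
- by rewrite normr1.
- by lra.
- have -> : x ^+ 2 - x + 1 / 6 = 1 / 6 - x * (1 - x) by ring.
  by rewrite ler_norml; lra.
- have -> : x ^+ 3 - 3 / 2 * x ^+ 2 + x / 2 = - (x * (1 - x)) * (x - 1 / 2) by field.
  by rewrite normrM normrN (ger0_norm y0); move: (normr_ge0 (x - 1 / 2)); nra.
- have -> : x ^+ 4 - 2 * x ^+ 3 + x ^+ 2 - 1 / 30 = (x * (1 - x)) ^+ 2 - 1 / 30 by field.
  by rewrite ler_norml; nra.
- have -> : x ^+ 5 - 5 / 2 * x ^+ 4 + 5 / 3 * x ^+ 3 - x / 6 =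
    (x * (1 - x)) * (x - 1 / 2) * (x * (1 - x) + 1 / 3) by field.
  rewrite 2!normrM (ger0_norm y0) (ger0_norm (_ : 0 <= x * (1 - x) + 1 / 3)); last lra.
  have : x * (1 - x) * `|x - 1 / 2| <= 1 / 8 by move: (normr_ge0 (x - 1 / 2)); nra.
  have : 0 <= x * (1 - x) * `|x - 1 / 2| by rewrite mulr_ge0.
  by move: (x * (1 - x) * _) => v; nra.
Qed.

Lemma Bp01 j : (1 < j)%N -> Bp j 1 = Bp j 0.
Proof. by case: j => [|[|[|[|[|j]]]]] //= _; field. Qed.

Definition poch s n : R[i] := \prod_(i < n) (s + i%:R).

Lemma pochS s n : poch s n.+1 = poch s n * (s + n%:R).
Proof. by rewrite /poch big_ord_recr. Qed.

(** On the cell starting at [n], [emT j] is the integrand of order [j], [emU j] the boundary term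
    produced by integrating it by parts, and [emF m] a primitive of [emT m]. *)
Definition emU j n s x : R[i] :=
  (Bp j.+1 (x - n%:R) / j.+1`!%:R)%:C * poch s j * cpw x (- s - j%:R).
Definition emT j n s x : R[i] :=
  (Bp j (x - n%:R) / j`!%:R)%:C * poch s j * cpw x (- s - j%:R).
Definition emF m n s x : R[i] := cpw x (1 - s) / (1 - s) - \sum_(j < m) emU j n s x.

Lemma hasd_Bp j x (a : R) : (j < 5)%N ->
  hasd rc (fun t => (Bp j.+1 (t - a))%:C) x (j.+1%:R * Bp j (x - a))%:C.
Proof. by move=> j5; apply: hasd_real; exact: dBp. Qed.

Lemma hasd_emU j n s x : 0 < x -> (j < 5)%N ->
  hasd rc (emU j n s) x (emT j n s x - emT j.+1 n s x).
Proof.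
move=> x0 j5.
have h1 := hasdM (hasdZ ((j.+1`!%:R : R)^-1)%:C (@hasd_Bp j x n%:R j5))
   (hasdZ (poch s j) (hasd_cpw (- s - j%:R) x0)).
have f0 : (j`!%:R : R) != 0 by rewrite pnatr_eq0 -lt0n fact_gt0.
have f1 : (j.+1`!%:R : R) != 0 by rewrite pnatr_eq0 -lt0n fact_gt0.
have j0 : (j.+1%:R : R) != 0 by rewrite pnatr_eq0.
have -> : emT j n s x - emT j.+1 n s x =
  (j.+1`!%:R^-1)%:C * (j.+1%:R * Bp j (x - n%:R))%:C * (poch s j * cpw x (- s - j%:R)) +
  (j.+1`!%:R^-1)%:C * (Bp j.+1 (x - n%:R))%:C *
   (poch s j * ((- s - j%:R) * cpw x (- s - j%:R - 1))).
  rewrite /emT pochS (_ : - s - j.+1%:R = - s - j%:R - 1); last by rewrite -natr1; ring.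
  have -> : Bp j (x - n%:R) / j`!%:R = j.+1`!%:R^-1 * (j.+1%:R * Bp j (x - n%:R)).
    by rewrite factS natrM invfM mulrACA mulVf // mul1r mulrC.
  by rewrite ![in LHS]rmorphM ![in RHS]rmorphM /=; ring.
apply: (@hasd_near _ _ _ _ _ _ _ 1 ltr01 _ h1) => t _ /=.
by rewrite /emU [in RHS]rmorphM /=; ring.
Qed.

Lemma hasd_emF m n s x : 0 < x -> (m <= 5)%N -> s != 1 ->
  hasd rc (emF m n s) x (emT m n s x).
Proof.
move=> x0 m5 s1; have s1' : 1 - s != 0 by rewrite subr_eq0 eq_sym.
have hs : hasd rc (fun x => \sum_(j < m) emU j n s x) x (emT 0 n s x - emT m n s x).
  elim: m m5 => [_|m IH m5].
    apply: (@hasd_near _ _ _ (fun=> 0) _ _ _ 1 ltr01); first by move=> t _; rewrite big_ord0.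
    by rewrite subrr; exact: hasd_cst.
  have := hasdD (IH (ltnW m5)) (hasd_emU n s x0 m5).
  rewrite addrA subrK => h; apply: (@hasd_near _ _ _ _ _ _ _ 1 ltr01 _ h) => t _.
  by rewrite /= big_ord_recr.
have h1 := hasdB (hasdZ (1 - s)^-1 (hasd_cpw (1 - s) x0)) hs.
have E : (1 - s)^-1 * ((1 - s) * cpw x (1 - s - 1)) - (emT 0 n s x - emT m n s x) = emT m n s x.
  rewrite mulKf // /emT /= fact0 divr1 /poch big_ord0 mulr1 mul1r subr0.
  by rewrite (_ : 1 - s - 1 = - s) ?subKr //; ring.
rewrite -[X in hasd _ _ _ X]E; apply: (@hasd_near _ _ _ _ _ _ _ 1 ltr01 _ h1) => t _ /=.
by rewrite /emF mulrC.
Qed.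

Lemma cts_emT m n s x : 0 < x -> (m <= 5)%N -> cts rc (emT m n s) x.
Proof.
move=> x0 m5; apply: ctsM; last exact: cts_cpw.
apply: ctsM; last exact: cts_cst.
case: m m5 => [|m] m5; first by rewrite /=; exact: cts_cst.
apply: (@cts_near _ _ _ (fun t => (Bp m.+1 (t - n%:R))%:C * (m.+1`!%:R^-1)%:C) _ _ 1 ltr01).
  by move=> t _; rewrite -rmorphM.
by apply: ctsM; [exact: hasd_cts (hasd_Bp x n%:R m5)|exact: cts_cst].
Qed.

Lemma emT_int m n s (a b : R) : 0 < a -> a <= b -> (m <= 5)%N -> s != 1 ->
  cI (emT m n s) a b = emF m n s b - emF m n s a.
Proof.
move=> a0 ab m5 s1; apply: cI_FTC => // x /andP[ax _].
  by apply: cts_emT => //; exact: lt_le_trans ax.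
by apply: hasd_emF => //; exact: lt_le_trans ax.
Qed.

Lemma emT_le m n s x : 0 < x -> 0 <= x - n%:R <= 1 ->
  cabs (emT m n s x) <= cabs (poch s m) * rpw x (- cRe s - m%:R).
Proof.
move=> x0 xn; rewrite /emT !cabsM cabs_cpw cReD cReN cReN.
have -> : cRe (m%:R : R[i]) = m%:R by rewrite -(rmorph_nat (real_complex R)).
rewrite ler_wpM2r ?rpw_ge0 // ler_piMl ?cabs_ge0 // cabs_real normrM normfV.
rewrite ler_pdivrMr ?normr_gt0 ?pnatr_eq0 -?lt0n ?fact_gt0 // mul1r normr_nat.
by apply: (le_trans (Bp_le _ xn)); rewrite ler1n fact_gt0.
Qed.

(** The Euler-Maclaurin approximation to [zeta s]. Its increments are integrals of [emT m], so it
    converges already for [Re s > 1 - m]. *)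
Definition emG m N s : R[i] := \sum_(1 <= n < N.+1) cpw n%:R (- s) - emF m N s N%:R.

(** On passing an integer only B_1 jumps, from [1/2] to [- 1/2]; this jump reproduces exactly the
    new term of the Dirichlet series. *)
Lemma emF_jump m N s : (0 < m)%N ->
  emF m N.+1 s N.+1%:R - emF m N s N.+1%:R = cpw N.+1%:R (- s).
Proof.
case: m => // m _; rewrite /emF !big_ord_recl.
have -> : \sum_(i < m) emU (lift ord0 i) N.+1 s N.+1%:R = \sum_(i < m) emU (lift ord0 i) N s N.+1%:R.
  apply: eq_bigr => i _; rewrite /emU subrr (_ : N.+1%:R - N%:R = 1); last by rewrite -natr1; ring.
  by rewrite Bp01.
rewrite /emU /= subrr (_ : N.+1%:R - N%:R = 1 :> R); last by rewrite -natr1; ring.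
rewrite factS fact0 /poch !big_ord0 !mulr1 subr0.
set A := cpw _ _ / _; set B := \sum_(i < m) _; set C := cpw _ _.
have -> : ((0 - 1 / 2) / (1 * 1)%N%:R : R) = - (1 / 2) by field.
have -> : ((1 - 1 / 2) / (1 * 1)%N%:R : R) = 1 / 2 by field.
have h : (1 / 2 : R)%:C + (1 / 2)%:C = 1 by rewrite -rmorphD /= (_ : 1 / 2 + 1 / 2 = 1 :> R) //; field.
by rewrite -[RHS]mul1r -h rmorphN /=; ring.
Qed.

Lemma emG_step m N s : (0 < N)%N -> (0 < m <= 5)%N -> s != 1 ->
  emG m N.+1 s - emG m N s = - cI (emT m N s) N%:R N.+1%:R.
Proof.
move=> N0 /andP[m0 m5] s1; rewrite emT_int ?ltr0n ?ler_nat //.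
rewrite /emG big_nat_recr //= -(emF_jump N s m0); ring.
Qed.

Lemma emG1 m s : (0 < m)%N -> emG m 1 s = - emF m 0 s 1.
Proof.
move=> m0; have := emF_jump 0 s m0; rewrite /emG big_nat1 => <-; ring.
Qed.

(** On each cell the increment is controlled by the integral of [x^(- ka - 1)] with
    [ka = Re s + m - 1]; the values of the primitive telescope over the cells. *)
Lemma emG_tail m N N' s : (0 < N)%N -> (N <= N')%N -> (0 < m <= 5)%N -> s != 1 ->
  1 - m%:R < cRe s ->
  cabs (emG m N' s - emG m N s) <=
  2 * cabs (poch s m) / (cRe s + m%:R - 1) *
  (rpw N%:R (- (cRe s + m%:R - 1)) - rpw N'%:R (- (cRe s + m%:R - 1))).
Proof.
move=> N0 NN' m5 s1 sm; set ka := cRe s + m%:R - 1.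
have ka0 : 0 < ka by rewrite /ka; lra.
elim: N' NN' => [|M IH]; first by rewrite leqn0 => /eqP E; rewrite E in N0.
rewrite leq_eqVlt => /predU1P[->|]; first by rewrite !subrr cabs0 mulr0.
rewrite ltnS => NM; have M0 : (0 < M)%N by exact: leq_trans NM.
have -> : emG m M.+1 s - emG m N s = (emG m M.+1 s - emG m M s) + (emG m M s - emG m N s) by ring.
apply: (le_trans (cabsD _ _)); rewrite emG_step // cabsN.
have b : cabs (cI (emT m M s) M%:R M.+1%:R) <=
   2 * (cabs (poch s m) / ka * (rpw M%:R (- ka) - rpw M.+1%:R (- ka))).
  pose P := cabs (poch s m).
  pose g x := P * rpw x (- ka - 1); pose G x := - (P / ka) * rpw x (- ka).
  have -> : cabs (poch s m) / ka * (rpw M%:R (- ka) - rpw M.+1%:R (- ka)) = G M.+1%:R - G M%:R.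
    by rewrite /G /P; ring.
  have xM x : M%:R <= x <= M.+1%:R -> 0 < x.
    by move=> /andP[h _]; apply: lt_le_trans h; rewrite ltr0n.
  apply: (cI_le_prim (g := g)); first by rewrite ler_nat.
  - by move=> x /xM x0; apply: cts_emT => //; case/andP: m5.
  - move=> x /xM x0; apply: (@cts_near _ _ _ (fun t => P%:C * (rpw t (- ka - 1))%:C) _ _ 1 ltr01).
      by move=> t _; rewrite -rmorphM.
    by apply: ctsM; [exact: cts_cst|exact: cts_rpw].
  - move=> x /xM x0; have := hasdZ (- (P / ka))%:C (hasd_rpw (- ka) x0).
    rewrite -rmorphM /= (_ : - (P / ka) * (- ka * rpw x (- ka - 1)) = g x).
      by move=> h; apply: (@hasd_near _ _ _ _ _ _ _ 1 ltr01 _ h) => t _ /=; rewrite -rmorphM.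
    by rewrite /g; field; rewrite gt_eqF.
  - move=> x xx; have x0 := xM x xx; rewrite /g (_ : - ka - 1 = - cRe s - m%:R); last by rewrite /ka; ring.
    by apply: emT_le => //; move: xx; rewrite -natr1; lra.
apply: (le_trans (lerD b (IH NM))); rewrite le_eqVlt; apply/orP; left; apply/eqP.
by clearbody ka; field; rewrite gt_eqF.
Qed.

Lemma emG_tail' m N N' s : (0 < N)%N -> (N <= N')%N -> (0 < m <= 5)%N -> s != 1 ->
  1 - m%:R < cRe s ->
  cabs (emG m N' s - emG m N s) <=
  2 * cabs (poch s m) / (cRe s + m%:R - 1) * rpw N%:R (- (cRe s + m%:R - 1)).
Proof.
move=> N0 NN' m5 s1 sm; apply: (le_trans (emG_tail N0 NN' m5 s1 sm)).
rewrite ler_wpM2l //; last by rewrite gerBl rpw_ge0.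
by rewrite mulr_ge0 ?invr_ge0 ?mulr_ge0 ?cabs_ge0 //; lra.
Qed.

Lemma poch_le s n : cabs (poch s n) <= (cabs s + n%:R) ^+ n.
Proof.
rewrite /poch cabs_prod -[n in leRHS]card_ord -prodr_const; apply: ler_prod => i _.
rewrite cabs_ge0 /=; apply: (le_trans (cabsD _ _)); rewrite cabs_nat lerD2l ler_nat.
by rewrite card_ord ltnW.
Qed.

Lemma dble_poch s n : dble (poch^~ n) s.
Proof.
elim: n => [|n [d IH]].
  exists 0; apply: (@hasd_near _ _ _ (fun=> 1) _ _ _ 1 ltr01); last exact: hasd_cst.
  by move=> t _; rewrite /poch big_ord0.
have := hasdM IH (hasdD (hasd_id id s) (hasd_cst id n%:R s)) => h.
eexists; apply: (@hasd_near _ _ _ _ _ _ _ 1 ltr01 _ h) => t _ /=.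
by rewrite pochS.
Qed.

Lemma dbleD (f g : R[i] -> R[i]) s : dble f s -> dble g s -> dble (fun z => f z + g z) s.
Proof. by move=> [a ha] [b hb]; eexists; apply: hasdD; eassumption. Qed.
Lemma dbleN (f : R[i] -> R[i]) s : dble f s -> dble (fun z => - f z) s.
Proof. by move=> [a ha]; eexists; apply: hasdN; eassumption. Qed.
Lemma dbleB (f g : R[i] -> R[i]) s : dble f s -> dble g s -> dble (fun z => f z - g z) s.
Proof. by move=> hf hg; apply: dbleD => //; exact: dbleN. Qed.
Lemma dbleM (f g : R[i] -> R[i]) s : dble f s -> dble g s -> dble (fun z => f z * g z) s.
Proof. by move=> [a ha] [b hb]; eexists; apply: hasdM; eassumption. Qed.
Lemma dble_cst (c : R[i]) s : dble (fun=> c) s.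
Proof. by exists 0; exact: hasd_cst. Qed.
Lemma dble_id s : dble id s.
Proof. by exists 1; exact: hasd_id. Qed.
Lemma dble_div (f g : R[i] -> R[i]) s : g s != 0 -> dble f s -> dble g s -> dble (fun z => f z / g z) s.
Proof. by move=> g0 [a ha] [b hb]; eexists; apply: hasd_div; eassumption. Qed.
Lemma dble_sum (I : Type) (r : seq I) (F : I -> R[i] -> R[i]) s :
  (forall i, dble (F i) s) -> dble (fun z => \sum_(i <- r) F i z) s.
Proof. by move=> /choice [D HD]; eexists; apply: hasd_sum; exact: HD. Qed.
Lemma dble_comp (f g : R[i] -> R[i]) s : dble f (g s) -> dble g s -> dble (fun z => f (g z)) s.
Proof. by move=> [a ha] [b hb]; exists (a * b); exact: (hasd_comp ha hb). Qed.
Lemma dble_cpw x s : dble (cpw x) s.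
Proof. by eexists; exact: hasd_cpws. Qed.

Lemma dble_emG m N s : s != 1 -> dble (emG m N) s.
Proof.
move=> s1; apply: dbleB.
  apply: dble_sum => n; apply: (@dble_comp (cpw n%:R)); first exact: dble_cpw.
  by apply: dbleN; exact: dble_id.
apply: dbleB.
  apply: dble_div; first by rewrite subr_eq0 eq_sym.
    apply: (@dble_comp (cpw _)); first exact: dble_cpw.
    by apply: dbleB; [exact: dble_cst|exact: dble_id].
  by apply: dbleB; [exact: dble_cst|exact: dble_id].
apply: dble_sum => j; apply: dbleM.
  by apply: dbleM; [exact: dble_cst|exact: dble_poch].
apply: (@dble_comp (cpw _)); first exact: dble_cpw.
by apply: dbleB; [apply: dbleN; exact: dble_id|exact: dble_cst].
Qed.

(** Near a point other than 1 the exponent [ka] is bounded below and [poch] above, so convergence is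
    locally uniform and the limit is holomorphic. *)
Lemma emG_lim m : (0 < m <= 5)%N -> exists2 g : R[i] -> R[i],
  forall s, s != 1 -> 1 - m%:R < cRe s -> cseq (emG m ^~ s) (g s) &
  forall s, s != 1 -> 1 - m%:R < cRe s -> dble g s.
Proof.
move=> m5.
have ex s : exists l, s != 1 -> 1 - m%:R < cRe s -> cseq (emG m ^~ s) l.
  have [s1|s1] := eqVneq s 1; first by exists 0.
  have [sm|sm] := ltP (1 - m%:R) (cRe s); last by exists 0.
  suff [l hl] : exists l, cseq (emG m ^~ s) l by exists l.
  apply: cseq_cauchy => e e0; set ka := cRe s + m%:R - 1.
  have ka0 : 0 < ka by rewrite /ka; lra.
  pose C := 2 * cabs (poch s m) / ka + 1.
  have C0 : 0 < C by rewrite ltr_wpDl // mulr_ge0 ?invr_ge0 ?mulr_ge0 ?cabs_ge0 ?(ltW ka0).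
  have [N0 [N00 H]] := rpw_small ka0 (divr_gt0 e0 C0).
  exists N0 => N hN; apply: (le_trans (emG_tail' N00 hN m5 s1 sm)).
  rewrite -/ka; apply: (@le_trans _ _ (C * (e / C))).
    by apply: ler_pM; rewrite ?rpw_ge0 ?mulr_ge0 ?invr_ge0 ?mulr_ge0 ?cabs_ge0 ?(ltW ka0) ?lerDl ?H.
  by rewrite mulrC divfK // gt_eqF.
have [g Hg] := choice ex; exists g => // s s1 sm.
set ka := (cRe s + m%:R - 1) / 2; have ka0 : 0 < ka by rewrite /ka; lra.
pose r := Num.min ka (cabs (s - 1)).
have r0 : 0 < r by rewrite lt_min ka0 cabs_gt0 subr_eq0.
have near z : cabs (z - s) < r -> [/\ z != 1, ka <= cRe z + m%:R - 1 &
   cabs z <= cabs s + ka].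
  rewrite lt_min => /andP[h1 h2]; split.
  - by apply/eqP => E; move: h2; rewrite E cabsBC ltxx.
  - have := Re_le_cabs (z - s); rewrite cReD cReN ler_norml => h.
    by rewrite /ka in h1 *; lra.
  - by have := cabsD (z - s) s; rewrite subrK; lra.
apply: (@dble_ulim _ (emG m) _ _ _ r0) => [N z /near[z1 _ _]|e e0]; first exact: dble_emG.
pose C := 2 * (cabs s + ka + m%:R) ^+ m / ka + 1.
have P0 : 0 <= (cabs s + ka + m%:R) ^+ m by rewrite exprn_ge0 // !addr_ge0 ?cabs_ge0 // ltW.
have C0 : 0 < C by rewrite ltr_wpDl // mulr_ge0 ?invr_ge0 ?(ltW ka0) // mulr_ge0.
have [N0 [N00 H]] := rpw_small ka0 (divr_gt0 e0 C0).
exists N0 => N hN z /near[z1 zka zs].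
have zm : 1 - m%:R < cRe z by lra.
have cs : cseq (fun N' => emG m N z - emG m N' z) (emG m N z - g z).
  by apply: cseqB; [exact: cseq_cst|exact: Hg].
apply: (cseq_le cs); exists N => N' NN'; rewrite cabsBC.
have N0' : (0 < N)%N by exact: leq_trans hN.
apply: (le_trans (emG_tail' N0' NN' m5 z1 zm)); set kz := cRe z + m%:R - 1.
apply: (@le_trans _ _ (C * (e / C))); last by rewrite mulrC divfK // gt_eqF.
have kz0 : 0 < kz by rewrite /kz; lra.
apply: ler_pM; rewrite ?rpw_ge0 ?mulr_ge0 ?invr_ge0 ?mulr_ge0 ?cabs_ge0 ?(ltW kz0) //.
  apply: (@le_trans _ _ (2 * (cabs s + ka + m%:R) ^+ m / ka)); last by rewrite lerDl.
  apply: ler_pM; rewrite ?invr_ge0 ?mulr_ge0 ?cabs_ge0 ?(ltW kz0) //.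
    rewrite ler_pM2l //; apply: (le_trans (poch_le _ _)).
    by rewrite lerXn2r ?nnegrE ?addr_ge0 ?cabs_ge0 ?(ltW ka0) // lerD2r.
  by rewrite lef_pV2 ?posrE.
apply: (le_trans _ (H N hN)); apply: rpw_leW; first by rewrite ler1n.
by rewrite lerN2.
Qed.

End EulerMaclaurin.

(** * Continuation of zeta by Euler-Maclaurin *)

Section ZetaEM.
Variable R : realType.
Variable zeta : R[i]^o -> R[i]^o.
Hypothesis zP : is_riemann_zeta zeta.
Implicit Types (s : R[i]).

Lemma cpw_cseq0 (s : R[i]) : cRe s < 0 -> cseq (fun N => cpw (N%:R : R) s) 0.
Proof.
move=> s0 e e0; have [|N0 [_ H]] := @rpw_small R (- cRe s) e _ e0; first lra.
by exists N0 => N hN; rewrite subr0 cabs_cpw -[cRe s]opprK H.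
Qed.

Lemma cseq_sum (I : Type) (r : seq I) (F : I -> nat -> R[i]) (l : I -> R[i]) :
  (forall i, cseq (F i) (l i)) -> cseq (fun N => \sum_(i <- r) F i N) (\sum_(i <- r) l i).
Proof.
move=> h; elim: r => [|i r IH].
  rewrite big_nil; apply: eq_cseq (cseq_cst 0); exists 0%N => N _; by rewrite big_nil.
rewrite big_cons; apply: eq_cseq (cseqD (h i) IH); exists 0%N => N _.
by rewrite big_cons.
Qed.

Lemma Re_nat (n : nat) : cRe (n%:R : R[i]) = n%:R.
Proof. by rewrite -(rmorph_nat (real_complex R)). Qed.

Lemma emG_cvg1 m s : 1 < cRe s -> cseq (emG m ^~ s) (zeta s).
Proof.
move=> s1; rewrite -[zeta s](subr0 (zeta s : R[i])); apply: cseqB; first exact: zeta_cseq.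
rewrite -[0](subr0 (0 : R[i])); apply: cseqB.
  rewrite -[0](mulr0 (1 - s)^-1).
  apply: eq_cseq (cseqZ (1 - s)^-1 (@cpw_cseq0 (1 - s) _)).
    by exists 0%N => N _; rewrite mulrC.
  by rewrite cReD cReN /=; lra.
rewrite [X in cseq _ X](_ : _ = \sum_(j < m) (0 : R[i])); last by rewrite big1.
apply: cseq_sum => j.
pose c : R[i] := (Bp j.+1 (0 : R) / j.+1`!%:R)%:C * poch s j.
rewrite -[0](mulr0 c); apply: eq_cseq (cseqZ c (@cpw_cseq0 (- s - j%:R) _)).
  by exists 0%N => N _; rewrite /emU subrr.
by rewrite cReD !cReN Re_nat; have : 0 <= j%:R :> R by []; lra.
Qed.

Lemma cts_eq_seq (f g : R[i] -> R[i]) s : cts id f s -> cts id g s ->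
  (forall e : R, 0 < e -> exists z, cabs (z - s) < e /\ f z = g z) -> f s = g s.
Proof.
move=> cf cg H; apply/eqP; rewrite -subr_eq0 -cabs_eq0 eq_le cabs_ge0 andbT.
apply/ler_addgt0Pr => e e0; rewrite add0r.
have e2 : 0 < e / 2 by rewrite divr_gt0.
have [d d0 Hd] := cf _ e2; have [d' d0' Hd'] := cg _ e2.
have [|z [zs E]] := H (Num.min d d'); first by rewrite lt_min d0.
move: zs; rewrite lt_min => /andP[/Hd h1 /Hd' h2].
have -> : f s - g s = (g z - g s) - (f z - f s) by rewrite E; ring.
have := cabsB (g z - g s) (f z - f s); lra.
Qed.

(** For [Re s > 1] both limits agree. Off the real axis the identity theorem carries this along
    horizontal strips, which miss the pole; points of the axis are reached by continuity from
    above. *)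
Lemma zeta_emG m s : (0 < m <= 5)%N -> s != 1 -> 1 - m%:R < cRe s ->
  cseq (emG m ^~ s) (zeta s).
Proof.
move=> m5 s1 sm; have [g Hg dg] := emG_lim R m5.
suff -> : zeta s = g s by exact: Hg.
have E1 z : z != 1 -> 1 < cRe z -> zeta z = g z.
  move=> z1 zr; apply: (cseq_uniq (emG_cvg1 m zr)); apply: Hg => //.
  by have : 1 <= m%:R :> R; [rewrite ler1n; case/andP: m5|lra].
have E2 z : cIm z != 0 -> 1 - m%:R < cRe z -> zeta z = g z.
  move=> zi zr; apply/eqP; rewrite -subr_eq0; apply/eqP.
  pose y := cIm z; pose rho := `|y| / 2.
  have rho0 : 0 < rho by rewrite divr_gt0 // normr_gt0.
  pose D (w : R[i]) : R[i] := zeta w - g w.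
  have m1 : 1 <= m%:R :> R by rewrite ler1n; case/andP: m5.
  have : D (cRe z +i* y) = 0.
    apply: (@identity_strip R D (1 - m%:R) (Num.max (cRe z) 4 + 1) y rho 3) => //.
    - move=> w /andP[h1 _] h2; have wi : cIm w != 0.
        apply/eqP => wi; move: h2; rewrite wi sub0r normrN /rho.
        by have := normr_gt0 y; rewrite zi; lra.
      have w1 : w != 1 by apply/eqP => w1; move: wi; rewrite w1 /= eqxx.
      by apply: dbleB; [exact: dble_zeta|exact: dg].
    - by rewrite (_ : 1 - m%:R < 3) /=; [|lra]; rewrite ltr_pwDr // le_max; apply/orP; right; lra.
    - exists 1 => // w hw; rewrite /D E1 ?subrr //.
        apply/eqP => w1; move: hw; rewrite w1; have := Re_le_cabs (1 - (3 +i* y)).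
        by rewrite cReD cReN /= ler_norml; lra.
      by have := Re_le_cabs (w - (3 +i* y)); rewrite cReD cReN /= ler_norml; lra.
    - by rewrite zr /= ltr_pwDr // le_max lexx.
  by rewrite /D /y; case: z {zi zr y rho rho0 D} => a b.
have [si|si] := eqVneq (cIm s) 0; last exact: E2.
apply: cts_eq_seq.
- exact/dble_cts/dble_zeta.
- exact/dble_cts/dg.
- move=> e e0; exists (cRe s +i* (e / 2)); split; last by apply: E2 => //=; rewrite gt_eqF ?divr_gt0.
  apply: (le_lt_trans (cabs_le_ReIm _)); rewrite cReD cReN cImD cImN /= si subrr subr0 normr0 add0r.
  by rewrite gtr0_norm; lra.
Qed.

Lemma zeta_emG_dist m s : (0 < m <= 5)%N -> s != 1 -> 1 - m%:R < cRe s ->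
  cabs (zeta s - emG m 1 s) <= 2 * cabs (poch s m) / (cRe s + m%:R - 1).
Proof.
move=> m5 s1 sm; have h := zeta_emG m5 s1 sm.
apply: (cseq_le (cseqB h (cseq_cst (emG m 1 s)))); exists 1%N => N N1.
by have := emG_tail' (isT : (0 < 1)%N) N1 m5 s1 sm; rewrite rpw1 mulr1.
Qed.

End ZetaEM.

(** * Fourier series of B_3 and B_5, and the sine integral *)

Section FourierB.
Variable R : realType.
Implicit Types (x : R) (s z : R[i]) (m n N M j : nat).

(** The coefficients of [sin (w n x)] in B_3 and B_5 are [12 / (w n)^3] and [- 240 / (w n)^5]; the
    second constant is also the default for all other indices. *)
Definition fc0 m : R := if m == 3%N then 12 else - 240.
Definition fS m M x : R := \sum_(1 <= n < M.+1) fc0 m / w R n ^+ m * sin (w R n * x).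

Lemma sin_per (u : R) n : sin (u + 2 * pi * n%:R) = sin u.
Proof.
elim: n => [|n IH]; first by rewrite mulr0 addr0.
have -> : u + 2 * pi * n.+1%:R = u + 2 * pi * n%:R + pi + pi by rewrite -natr1; ring.
by rewrite !sinDpi opprK.
Qed.

Lemma fS_per m M n x : fS m M (x + n%:R) = fS m M x.
Proof.
apply: eq_bigr => k _; congr (_ * _).
have -> : w R k * (x + n%:R) = w R k * x + 2 * pi * (k * n)%N%:R by rewrite /w natrM; ring.
exact: sin_per.
Qed.

Lemma fS0 m M : fS m M 0 = 0.
Proof. by rewrite /fS big1 // => n _; rewrite mulr0 sin0 mulr0. Qed.

(** For B_5 the estimate for B_3 is integrated twice. The difference [f] vanishes at 0 and 1, so by
    Rolle its derivative has a zero, from which the first integration starts; the second starts at 0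
    and yields the factor [x]. *)
Lemma fourier_Bp m M x : (m == 3%N) || (m == 5%N) -> (0 < M)%N -> 0 <= x <= 1 ->
  `|Bp m x - fS m M x| <= 20 / M%:R * x.
Proof.
move=> /orP[/eqP ->|/eqP ->] M0 xx; have M1 : 0 < M%:R^-1 :> R by rewrite invr_gt0 ltr0n.
  have h := fourier_B3 M0 xx; apply: (le_trans h).
  by rewrite mulrC; case/andP: xx => x0 _; nra.
pose f (t : R) := Bp 5 t - fS 5 M t.
pose f1 (t : R) := 5 * Bp 4 t - \sum_(1 <= n < M.+1) - 240 / w R n ^+ 4 * cos (w R n * t).
pose f2 (t : R) := 20 * (B3 t - S3 M t).
have df (t : R) : is_derive t 1 f (f1 t).
  apply: is_deriveB.
    have := @dBp R 4 t 0 isT; rewrite subr0.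
    by rewrite (_ : (fun t : R => Bp 5 (t - 0)) = Bp 5) //; apply/funext => u; rewrite subr0.
  apply: (@dsum R M (fun n t => fc0 5 / w R n ^+ 5 * sin (w R n * t))
    (fun n t => - 240 / w R n ^+ 4 * cos (w R n * t))) => n n0.
  have := dsin (fc0 5 / w R n ^+ 5) (w R n) t.
  rewrite (_ : fc0 5 / w R n ^+ 5 * w R n = - 240 / w R n ^+ 4) //.
  by rewrite /fc0 /=; field; rewrite gt_eqF // w_gt0.
have df1 (t : R) : is_derive t 1 f1 (f2 t).
  rewrite /f2 mulrBr /S3; apply: is_deriveB.
    have := @dBp R 3 t 0 isT; rewrite subr0 => h.
    rewrite (_ : (fun t : R => Bp 4 (t - 0)) = Bp 4) in h; last by apply/funext => u; rewrite subr0.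
    apply: (is_derive_eq (@is_deriveZ _ _ _ _ 5 _ _ _ h)).
    by rewrite /GRing.scale /= /B3; ring.
  rewrite mulr_sumr; apply: (@dsum R M (fun n t => - 240 / w R n ^+ 4 * cos (w R n * t))
    (fun n t => 20 * (12 / w R n ^+ 3 * sin (w R n * t)))) => n n0.
  have := dcos (- 240 / w R n ^+ 4) (w R n) t.
  rewrite (_ : - (- 240 / w R n ^+ 4 * w R n) * sin (w R n * t) = 20 * (12 / w R n ^+ 3 * sin (w R n * t))) //.
  by field; rewrite gt_eqF // w_gt0.
have f2b (t : R) : 0 <= t <= 1 -> `|f2 t| <= 20 / M%:R.
  move=> tt; rewrite /f2 normrM ger0_norm // ler_pM2l //.
  apply: (le_trans (fourier_B3 M0 tt)); rewrite ler_pdivrMr ?ltr0n //.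
  by rewrite mulVf ?pnatr_eq0 -?lt0n //; lra.
have f00 : f 0 = 0 by rewrite /f fS0 /=; ring.
have f01 : f 1 = 0.
  by rewrite /f -[X in fS _ _ X]add0r -[X in 0 + X]/(1%:R) fS_per fS0 /=; field.
have cf : {within `[0, 1], continuous f}.
  apply: continuous_in_subspaceT => t _; have [dd _] := df t.
  exact/differentiable_continuous/derivable1_diffP.
have [c cc /(@derive_val _ _ _ _ _ _ _) ] : exists2 c : R, c \in `]0, 1[%R & is_derive c 1 f 0.
  by apply: (@Rolle R f 0 1 ltr01 _ cf) => [t _|]; [have [] := df t|rewrite f00 f01].
rewrite (derive_val (is_derive := df c)) => f1c.
move: cc; rewrite in_itv /= => /andP[c0 c1].
have f1b (t : R) : 0 <= t <= 1 -> `|f1 t| <= 20 / M%:R.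
  move=> /andP[t0 t1]; have M20 : 0 <= 20 / M%:R :> R by rewrite divr_ge0.
  have [tc|tc] := leP t c.
    have := @MVT_le R f1 f2 t c (20 / M%:R) tc (fun u _ => df1 u).
    rewrite f1c sub0r normrN => h; apply: (le_trans (h _)); first by move=> u ?; apply: f2b; lra.
    by rewrite ler_piMr //; lra.
  have := @MVT_le R f1 f2 c t (20 / M%:R) (ltW tc) (fun u _ => df1 u).
  rewrite f1c subr0 => h; apply: (le_trans (h _)); first by move=> u ?; apply: f2b; lra.
  by rewrite ler_piMr //; lra.
case/andP: xx => x0 x1.
have := @MVT_le R f f1 0 x (20 / M%:R) x0 (fun u _ => df u).
by rewrite f00 !subr0; apply => u ?; apply: f1b; lra.
Qed.

Lemma fourier_Bp_per m M n x : (m == 3%N) || (m == 5%N) -> (0 < M)%N -> n%:R <= x <= n.+1%:R ->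
  `|Bp m (x - n%:R) - fS m M x| <= 20 / M%:R.
Proof.
move=> m35 M0; rewrite -natr1 => xx; have h : 0 <= x - n%:R <= 1 by lra.
have := fourier_Bp m35 M0 h; rewrite -(fS_per m M n) subrK => /le_trans; apply.
by rewrite ler_piMr ?divr_ge0 //; lra.
Qed.

Lemma hasd_scale (P : R -> R[i]) (c x : R) d : 0 < c -> hasd rc P (c * x) d ->
  hasd rc (fun t => P (c * t)) x (d * c%:C).
Proof.
move=> c0 [phi [cphi <-] E]; exists (fun t => phi (c * t) * c%:C); first split => //.
  apply: ctsM; last exact: cts_cst.
  move=> e /cphi[r r0 Hr]; exists (r / c); first exact: divr_gt0.
  move=> t; rewrite -rmorphB /= cabs_real => tr; apply: Hr.
  by rewrite -rmorphB /= cabs_real -mulrBr normrM gtr0_norm // mulrC -ltr_pdivlMr.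
by move=> t; rewrite E !rmorphM /=; ring.
Qed.

Lemma cts_scale (P : R -> R[i]) (c x : R) : 0 < c -> cts rc P (c * x) -> cts rc (fun t => P (c * t)) x.
Proof.
move=> c0 cP e /cP[r r0 Hr]; exists (r / c); first exact: divr_gt0.
move=> t; rewrite -rmorphB /= cabs_real => tr; apply: Hr.
by rewrite -rmorphB /= cabs_real -mulrBr normrM gtr0_norm // mulrC -ltr_pdivlMr.
Qed.

Lemma hasd_prim (f : R -> R[i]) (x0 t : R) : x0 < t -> (forall u, x0 <= u -> cts rc f u) ->
  hasd rc (fun t => cI f x0 t) t (f t).
Proof.
move=> xt cf; apply/hasdP => e e0; have e2 : 0 < e / 2 by rewrite divr_gt0.
have [d d0 Hd] := cf t (ltW xt) _ e2.
exists (Num.min d (t - x0)); first by rewrite lt_min d0 subr_gt0.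
move=> t'; rewrite -rmorphB /= cabs_real lt_min => /andP[h1 h2].
have tt' : x0 <= t' by move: h2; rewrite ltr_norml; lra.
rewrite (sI_diff (ltW xt) tt'); last by move=> u xu _; exact: cf.
have mn : x0 <= Num.min t t' by rewrite le_min (ltW xt).
have := @sI_le R f (f t) t t' (e / 2); rewrite (_ : 2 * (e / 2) = e); last by field.
apply.
- by move=> u /andP[hu _]; apply: cf; exact: le_trans hu.
- move=> u /andP[hu1 hu2]; apply/ltW/Hd; rewrite -rmorphB /= cabs_real.
  apply: le_lt_trans h1; move: hu1 hu2; rewrite ge_min le_max.
  move=> /orP[a|a] /orP[b|b]; rewrite ler_norml; have := ler_norm (t' - t); have := ler_norm (t - t');
    rewrite distrC; lra.
Qed.

Lemma cI_scale (f : R -> R[i]) (c a b : R) : 0 < c -> 0 < a -> a <= b ->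
  (forall u, 0 < u -> cts rc f u) -> cI (fun t => f (c * t)) a b = c^-1%:C * cI f (c * a) (c * b).
Proof.
move=> c0 a0 ab cf; pose x0 := c * a / 2.
have ca : 0 < c * a by rewrite mulr_gt0.
have x00 : 0 < x0 by rewrite /x0; lra.
have cf' u : x0 <= u -> cts rc f u by move=> h; apply: cf; exact: lt_le_trans h.
have xa : x0 < c * a by rewrite /x0; lra.
have cab : c * a <= c * b by rewrite ler_pM2l.
pose P t := cI f x0 t.
have -> : cI f (c * a) (c * b) = P (c * b) - P (c * a).
  rewrite /P (@cI_split R f x0 (c * a) (c * b)); first by ring.
    by rewrite (ltW xa).
  by apply: cts_integrable => u /andP[h _]; exact: cf'.
rewrite mulrBr; apply: (cI_FTC (F := fun t => c^-1%:C * P (c * t))) => // x /andP[ax xb].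
  by apply: cts_scale => //; apply: cf; rewrite mulr_gt0 // (lt_le_trans a0).
have h : hasd rc P (c * x) (f (c * x)).
  by apply: hasd_prim => //; apply: (lt_le_trans xa); rewrite ler_pM2l.
have := hasdZ c^-1%:C (hasd_scale c0 h).
rewrite (_ : c^-1%:C * (f (c * x) * c%:C) = f (c * x)) //.
by rewrite mulrCA -rmorphM mulVf ?gt_eqF // mulr1.
Qed.

(** A truncated Mellin transform of the sine. Its limit over the half line enters the functional
    equation only as a number that cancels. *)
Definition sW z (a b : R) : R[i] := cI (fun u => (sin u)%:C * cpw u z) a b.

Lemma cts_sinpw z (u : R) : 0 < u -> cts rc (fun u => (sin u)%:C * cpw u z) u.
Proof.
move=> u0; apply: ctsM; last exact: cts_cpw.
by apply/cts_realP; exact: continuous_sin.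
Qed.

Lemma cI_pow_le (f : R -> R[i]) (K a b q : R) : 0 < a -> a <= b -> q != 0 -> 0 <= K ->
  (forall u, a <= u <= b -> cts rc f u) ->
  (forall u, a <= u <= b -> cabs (f u) <= K * rpw u (q - 1)) ->
  cabs (cI f a b) <= 2 * K / q * (rpw b q - rpw a q).
Proof.
move=> a0 ab q0 K0 cf fK.
have -> : 2 * K / q * (rpw b q - rpw a q) = 2 * (K / q * rpw b q - K / q * rpw a q) by ring.
have pos x : a <= x <= b -> 0 < x by move=> /andP[h _]; exact: lt_le_trans h.
apply: (cI_le_prim (g := fun u => K * rpw u (q - 1)) (G := fun u => K / q * rpw u q)) => //.
- move=> x /pos x0; apply: (@cts_near _ _ _ (fun t => K%:C * (rpw t (q - 1))%:C) _ _ 1 ltr01).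
    by move=> t _; rewrite -rmorphM.
  by apply: ctsM; [exact: cts_cst|exact: cts_rpw].
- move=> x /pos x0; have := hasdZ (K / q)%:C (hasd_rpw q x0).
  rewrite -rmorphM /= (_ : K / q * (q * rpw x (q - 1)) = K * rpw x (q - 1)); last by field.
  by move=> h; apply: (@hasd_near _ _ _ _ _ _ _ 1 ltr01 _ h) => t _ /=; rewrite -rmorphM.
Qed.

Lemma sW_le_inf z (a b : R) : 0 < a -> a <= b -> cRe z < -1 ->
  cabs (sW z a b) <= 2 / (- 1 - cRe z) * rpw a (cRe z + 1).
Proof.
move=> a0 ab zr; have := @cI_pow_le (fun u => (sin u)%:C * cpw u z) 1 a b (cRe z + 1) a0 ab.
move=> /(_ _ ler01 _ _) h; apply: (le_trans (h _ _ _)).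
- by apply/eqP; lra.
- by move=> u /andP[au _]; apply: cts_sinpw; exact: lt_le_trans au.
- move=> u _; rewrite addrK cabsM cabs_cpw cabs_real ler_wpM2r ?rpw_ge0 //.
  by rewrite ler_norml sin_geN1 sin_le1.
- rewrite mulr1; have h1 : cRe z + 1 < 0 by lra.
  have -> : 2 / (cRe z + 1) * (rpw b (cRe z + 1) - rpw a (cRe z + 1)) =
    2 / (- 1 - cRe z) * (rpw a (cRe z + 1) - rpw b (cRe z + 1)).
    by field; apply/andP; split; apply/eqP; lra.
  by rewrite ler_wpM2l ?divr_ge0 //; [lra|rewrite gerBl rpw_ge0].
Qed.

Lemma sW_le_0 z (a b : R) : 0 < a -> a <= b -> -2 < cRe z ->
  cabs (sW z a b) <= 2 / (cRe z + 2) * rpw b (cRe z + 2).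
Proof.
move=> a0 ab zr; have := @cI_pow_le (fun u => (sin u)%:C * cpw u z) 1 a b (cRe z + 2) a0 ab.
move=> /(_ _ ler01 _ _) h; apply: (le_trans (h _ _ _)).
- by apply/eqP; lra.
- by move=> u /andP[au _]; apply: cts_sinpw; exact: lt_le_trans au.
- move=> u /andP[au _]; have u0 := lt_le_trans a0 au.
  rewrite (_ : cRe z + 2 - 1 = cRe z + 1); last ring.
  rewrite cabsM cabs_cpw cabs_real rpwD rpwx1 // mul1r mulrC ler_wpM2l ?rpw_ge0 //.
  by apply: (le_trans (sin_norm_le _)); rewrite gtr0_norm.
- rewrite mulr1 ler_wpM2l ?divr_ge0 //; [lra|by rewrite gerBl rpw_ge0].
Qed.

Lemma sW_split z (a b c : R) : 0 < a -> a <= b -> b <= c -> sW z a c = sW z a b + sW z b c.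
Proof.
move=> a0 ab bc; apply: cI_split; first by rewrite ab.
by apply: cts_integrable => u /andP[au _]; apply: cts_sinpw; exact: lt_le_trans au.
Qed.

(** Near 0 the bound [|sin u| <= u] and near infinity the decay of [u^z] make both ends negligible,
    so the limit is independent of [c]. The freedom in [c] absorbs the rescaling by each frequency
    [w n]. *)
Lemma sW_lim z : -2 < cRe z < -1 -> exists Mz, forall c : R, 1 <= c ->
  cseq (fun N => sW z (c / N%:R) (c * N%:R)) Mz.
Proof.
move=> /andP[z2 z1].
set p := -1 - cRe z; set q := cRe z + 2.
have p0 : 0 < p by rewrite /p; lra.
have q0 : 0 < q by rewrite /q; lra.
have small c e : 0 < c -> 0 < e -> exists N0, (0 < N0)%N /\ forall N, (N0 <= N)%N ->
    [/\ 2 / p * rpw N%:R (cRe z + 1) <= e / 2 , 2 / q * rpw (c / N%:R) q <= e / 2 & c <= N%:R].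
  move=> c0 e0; have [|N1 [N10 H1]] := @rpw_small R p (e / 2 * p / 2) p0; first by rewrite !divr_gt0 ?mulr_gt0 ?divr_gt0.
  have [|N2 [_ H2]] := @rpw_small R q (e / 2 * q / 2 / rpw c q) q0.
    by rewrite !divr_gt0 ?mulr_gt0 ?divr_gt0 ?rpw_gt0.
  pose N3 := (Num.truncn c).+1.
  exists (maxn N1 (maxn N2 N3)); split; first by rewrite leq_max N10.
  move=> N; rewrite !geq_max => /and3P[h1 h2 h3]; have N0 : 0 < N%:R :> R by rewrite ltr0n (leq_trans N10).
  split.
  - rewrite (_ : cRe z + 1 = - p); last by rewrite /p; ring.
    apply: (@le_trans _ _ (2 / p * (e / 2 * p / 2))); first by rewrite ler_wpM2l ?divr_ge0 ?(ltW p0) ?H1.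
    by rewrite le_eqVlt; apply/orP; left; apply/eqP; field; rewrite gt_eqF.
  - have -> : rpw (c / N%:R) q = rpw c q * rpw N%:R (- q).
      by rewrite /rpw lnM ?posrE ?invr_gt0 // lnV ?posrE // mulrDr expRD mulrN mulNr.
    apply: (@le_trans _ _ (2 / q * (rpw c q * (e / 2 * q / 2 / rpw c q)))).
      by rewrite ler_wpM2l ?divr_ge0 ?(ltW q0) // ler_wpM2l ?rpw_ge0 // H2.
    rewrite le_eqVlt; apply/orP; left; apply/eqP; field.
    by rewrite !gt_eqF // rpw_gt0.
  - by apply: ltW; apply: lt_le_trans (truncnS_gt _) _; rewrite ler_nat.
have [Mz HM] : exists Mz, cseq (fun N => sW z (N%:R^-1) N%:R) Mz.
  apply: cseq_cauchy => e e0; have [N0 [N00 H]] := small 1 e ltr01 e0; exists N0 => N hN.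
  have [h1 h2 h3] := H N0 (leqnn _); have n0 : 0 < N0%:R :> R by rewrite ltr0n.
  have NN : N0%:R <= N%:R :> R by rewrite ler_nat.
  have n1 : 0 < N%:R :> R by exact: lt_le_trans NN.
  have iN : N%:R^-1 <= N0%:R^-1 :> R by rewrite lef_pV2 ?posrE.
  have i0 : N0%:R^-1 <= N0%:R :> R by rewrite (le_trans _ h3) // invf_le1.
  have -> : sW z N%:R^-1 N%:R - sW z N0%:R^-1 N0%:R = sW z N%:R^-1 N0%:R^-1 + sW z N0%:R N%:R.
    rewrite (@sW_split _ N%:R^-1 N0%:R^-1 N%:R) ?invr_gt0 // ?(le_trans i0) //.
    by rewrite (@sW_split _ N0%:R^-1 N0%:R N%:R) ?invr_gt0 //; ring.
  have b1 : cabs (sW z N%:R^-1 N0%:R^-1) <= e / 2.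
    by apply: le_trans h2; rewrite div1r; apply: sW_le_0; rewrite ?invr_gt0.
  have b2 : cabs (sW z N0%:R N%:R) <= e / 2 by apply: le_trans h1; apply: sW_le_inf.
  by apply: (le_trans (cabsD _ _)); rewrite [leRHS]splitr lerD.
exists Mz => c c1; rewrite -[Mz]addr0.
have c0 : 0 < c by lra.
have E : cseq (fun N => sW z (c / N%:R) (c * N%:R) - sW z N%:R^-1 N%:R) 0.
  move=> e e0; have [N0 [N00 H]] := small c e c0 e0; exists N0 => N hN.
  have [h1 h2 h3] := H N hN; have n0 : 0 < N%:R :> R by rewrite ltr0n (leq_trans N00).
  have l1 : N%:R^-1 <= c / N%:R by rewrite ler_peMl ?invr_ge0 ?(ltW n0).
  have l2 : c / N%:R <= N%:R.
    by rewrite ler_pdivrMr //; apply: (le_trans h3); rewrite ler_peMr ?(ltW n0) //; lra.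
  have l3 : N%:R <= c * N%:R by rewrite ler_peMl ?(ltW n0).
  have cN : 0 < c / N%:R by rewrite divr_gt0.
  have -> : sW z (c / N%:R) (c * N%:R) - sW z N%:R^-1 N%:R - 0 =
     sW z N%:R (c * N%:R) - sW z N%:R^-1 (c / N%:R).
    rewrite (@sW_split _ (c / N%:R) N%:R) // (@sW_split _ N%:R^-1 (c / N%:R)) ?invr_gt0 //; ring.
  have b1 : cabs (sW z N%:R^-1 (c / N%:R)) <= e / 2.
    by apply: le_trans h2; apply: sW_le_0; rewrite ?invr_gt0.
  have b2 : cabs (sW z N%:R (c * N%:R)) <= e / 2 by apply: le_trans h1; apply: sW_le_inf.
  by apply: (le_trans (cabsB _ _)); rewrite [leRHS]splitr lerD.
by apply: eq_cseq (cseqD HM E); exists 0%N => N _; ring.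
Qed.

End FourierB.

(** * The functional equation *)

Section FunctionalEquation.
Variable R : realType.
Implicit Types (x : R) (s z : R[i]) (m n N M j : nat).

Lemma Bp_le_lin m x : (m == 3%N) || (m == 5%N) -> 0 <= x <= 1 -> `|Bp m x| <= x.
Proof.
move=> m35 /andP[x0 x1].
have z : `|x - 1 / 2| <= 1 / 2 by rewrite ler_norml; lra.
have u0 : 0 <= 1 - x by lra.
case/orP: m35 => /eqP -> /=.
  have -> : x ^+ 3 - 3 / 2 * x ^+ 2 + x / 2 = - x * ((1 - x) * (x - 1 / 2)) by field.
  rewrite normrM normrN (ger0_norm x0) ler_piMr // normrM (ger0_norm u0).
  by move: (normr_ge0 (x - 1 / 2)); nra.
have -> : x ^+ 5 - 5 / 2 * x ^+ 4 + 5 / 3 * x ^+ 3 - x / 6 =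
    x * ((1 - x) * (x - 1 / 2) * (x * (1 - x) + 1 / 3)) by field.
rewrite normrM (ger0_norm x0) ler_piMr // 2!normrM (ger0_norm u0) (ger0_norm (_ : 0 <= x * (1 - x) + 1 / 3)); last nra.
have h1 : (1 - x) * `|x - 1 / 2| <= 1 / 2 by move: (normr_ge0 (x - 1 / 2)); nra.
have h2 : 0 <= (1 - x) * `|x - 1 / 2| by rewrite mulr_ge0.
have h3 : x * (1 - x) <= 1 by nra.
have h4 : 0 <= x * (1 - x) by nra.
by move: ((1 - x) * `|_|) (x * (1 - x)) h1 h2 h3 h4 => a b; nra.
Qed.

Lemma rpw_le1W x (a b : R) : 0 < x <= 1 -> a <= b -> rpw x b <= rpw x a.
Proof.
move=> /andP[x0 x1] ab; rewrite ler_expR ler_wnM2r //.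
by rewrite ln_le0.
Qed.

(** As [x] tends to 0, every power of [x] in [emF m 0] has a positive exponent except possibly the
    last, [x^(- s - m + 1)], whose exponent exceeds [-1] and which is rescued by [|B_m x| <= x]. *)
Lemma emF_small m s : (m == 3%N) || (m == 5%N) -> s != 1 -> cRe s < 2 - m%:R ->
  cseq (fun N => emF m 0 s N%:R^-1) 0.
Proof.
move=> m35 s1 sm; set q := 2 - m%:R - cRe s.
have q0 : 0 < q by rewrite /q; lra.
have m1 : 1 <= m%:R :> R by rewrite ler1n; case/orP: m35 => /eqP ->.
pose C : R := cabs (1 - s)^-1 + \sum_(j < m) cabs (poch s j).
have C0 : 0 <= C by rewrite addr_ge0 ?cabs_ge0 // sumr_ge0 // => j _; exact: cabs_ge0.
have b x : 0 < x <= 1 -> cabs (emF m 0 s x) <= C * rpw x q.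
  move=> x01; have /andP[x0 x1] := x01; apply: (le_trans (cabsB _ _)); rewrite mulrDl; apply: lerD.
    rewrite cabsM mulrC ler_wpM2l ?cabs_ge0 // cabs_cpw cReD cReN /=.
    by apply: rpw_le1W => //; rewrite /q; lra.
  apply: (le_trans (cabs_sum _ _ _)); rewrite mulr_suml; apply: ler_sum => j _.
  rewrite /emU subr0 !cabsM cabs_cpw cabs_real cReD !cReN Re_nat mulrAC [leRHS]mulrC.
  rewrite ler_wpM2r ?cabs_ge0 // normrM normfV normr_nat.
  have f1 : (j.+1`!%:R^-1 : R) <= 1 by rewrite invf_le1 ?ltr0n ?fact_gt0 // ler1n fact_gt0.
  have f0 : 0 <= (j.+1`!%:R^-1 : R) by rewrite invr_ge0.
  have [jm|jm] := eqVneq j.+1 m.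
    have hB : `|Bp j.+1 x| <= x by rewrite jm; apply: Bp_le_lin => //; lra.
    have -> : rpw x q = x * rpw x (- cRe s - j%:R).
      rewrite -{2}(rpwx1 x0) -rpwD; congr rpw.
      by rewrite /q (congr1 (fun k => k%:R : R) (esym jm)) -natr1; ring.
    rewrite ler_wpM2r ?rpw_ge0 // -[leRHS]mulr1; apply: ler_pM => //.
  have jm' : (j.+2 <= m)%N by rewrite ltn_neqAle jm /= ltn_ord.
  rewrite -[leRHS]mul1r; apply: ler_pM; rewrite ?mulr_ge0 ?rpw_ge0 //.
    by rewrite -[leRHS]mulr1; apply: ler_pM => //; apply: Bp_le; lra.
  apply: rpw_le1W => //; have : j.+2%:R <= m%:R :> R by rewrite ler_nat.
  by rewrite /q -!natr1; lra.
move=> e e0; have C1 : 0 < C + 1 by lra.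
have [N0 [N00 H]] := rpw_small q0 (divr_gt0 e0 C1); exists N0 => N hN.
have n0 : 0 < N%:R :> R by rewrite ltr0n (leq_trans N00).
rewrite subr0; apply: (le_trans (b _ _)).
  by rewrite invr_gt0 n0 invf_le1 // ler1n (leq_trans N00).
rewrite rpwV //; have := H N hN; rewrite ler_pdivlMr // => h.
by have := rpw_ge0 N%:R (- q); nra.
Qed.

Lemma cI_sum (I : Type) (r : seq I) (F : I -> R -> R[i]) (a b : R) :
  (forall i x, a <= x <= b -> cts rc (F i) x) ->
  cI (fun t => \sum_(i <- r) F i t) a b = \sum_(i <- r) cI (F i) a b.
Proof.
move=> cF; elim: r => [|i r IH].
  rewrite big_nil /cI (@eq_cint _ _ _ (fun=> 0 * 0)); last by move=> x _; rewrite big_nil mul0r.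
  rewrite cintZ ?mul0r //; apply: cts_integrable => x _; exact: cts_cst.
rewrite big_cons -IH /cI -cintD //; first by apply: eq_cint => x _; rewrite big_cons.
  by apply: cts_integrable => x xx; exact: cF.
by apply: cts_integrable => x xx; apply: cts_sum => j; exact: cF.
Qed.

Lemma cIZ (f : R -> R[i]) (c : R[i]) (a b : R) : (forall x, a <= x <= b -> cts rc f x) ->
  cI (fun t => c * f t) a b = c * cI f a b.
Proof. by move=> cf; apply: cintZ => //; exact: cts_integrable. Qed.

Lemma cIB (f g : R -> R[i]) (a b : R) : (forall x, a <= x <= b -> cts rc f x) ->
  (forall x, a <= x <= b -> cts rc g x) ->
  cI (fun t => f t - g t) a b = cI f a b - cI g a b.
Proof. by move=> cf cg; apply: cintB => //; exact: cts_integrable. Qed.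

(** [bI] is the Euler-Maclaurin integrand without its constant factor, [fI] the same with the
    Bernoulli polynomial replaced by [M] terms of its Fourier series. *)
Let fI m M s x : R[i] := (fS m M x)%:C * cpw x (- s - m%:R).
Let bI m n s x : R[i] := (Bp m (x - n%:R))%:C * cpw x (- s - m%:R).

Let cts_fI m M s x : 0 < x -> cts rc (fI m M s) x.
Proof.
move=> x0; apply: ctsM; last exact: cts_cpw.
apply: (@cts_near _ _ _ (fun t => \sum_(n <- index_iota 1 M.+1) (fc0 R m / w R n ^+ m)%:C * (sin (w R n * t))%:C) _ _ 1 ltr01).
  by move=> t _; rewrite /fS rmorph_sum /=; apply: eq_bigr => n _; rewrite [RHS]rmorphM.
apply: cts_sum => n; apply: ctsM; first exact: cts_cst.
apply/cts_realP; apply: (@continuous_comp _ _ _ (fun t : R => w R n * t) sin); last exact: continuous_sin.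
by apply: continuousM; [exact: cvg_cst|exact: cvg_id].
Qed.

Let cts_bI m n s x : (0 < m <= 5)%N -> 0 < x -> cts rc (bI m n s) x.
Proof.
move=> m5 x0; apply: ctsM; last exact: cts_cpw.
case: m m5 => [|m] // m5; exact: hasd_cts (hasd_Bp x n%:R m5).
Qed.

Let emT_bI m n s (a b : R) : (0 < m <= 5)%N -> 0 < a -> a <= b ->
  cI (emT m n s) a b = poch s m / m`!%:R * cI (bI m n s) a b.
Proof.
move=> m5 a0 ab; rewrite -cIZ; last by move=> x /andP[ax _]; apply: cts_bI => //; exact: lt_le_trans ax.
apply: eq_cint => x _; rewrite /emT /bI rmorphM /= fmorphV /= rmorph_nat.
by rewrite -[_%:R^-1]/(_%:R^-1); ring.
Qed.

(** Truncating the Fourier series costs at most [20 x / M] on the first cell and [20 / M] on the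
    others. In the strip, [0 < ka < 1], so both are integrable against [x^(- ka - 1)] and the bound
    is uniform in [N]. *)
Lemma feq_approx m s : (m == 3%N) || (m == 5%N) -> 1 - m%:R < cRe s < 2 - m%:R ->
  exists2 C : R, 0 <= C & forall M N, (0 < M)%N -> (0 < N)%N ->
  cabs (- emG m N s - emF m 0 s N%:R^-1 - poch s m / m`!%:R * cI (fI m M s) N%:R^-1 N%:R) <= C / M%:R.
Proof.
move=> m35 /andP[sm1 sm2].
have m5 : (0 < m <= 5)%N by case/orP: m35 => /eqP ->.
have m3 : 3 <= m%:R :> R by rewrite ler_nat; case/orP: m35 => /eqP ->.
have s1 : s != 1 by apply/eqP => E; move: sm2; rewrite E /=; lra.
pose ka := cRe s + m%:R - 1; have ka0 : 0 < ka by rewrite /ka; lra.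
have ka1 : ka < 1 by rewrite /ka; lra.
pose K := poch s m / m`!%:R : R[i].
pose C1 : R := 40 / (1 - ka); pose C2 : R := 40 / ka.
have C10 : 0 <= C1 by rewrite divr_ge0 //; lra.
have C20 : 0 <= C2 by rewrite divr_ge0 //; lra.
exists (cabs K * (C1 + C2)); first by rewrite mulr_ge0 ?cabs_ge0 ?addr_ge0.
move=> M N M0 N0.
have Re_z : cRe (- s - m%:R) = - ka - 1 by rewrite cReD !cReN Re_nat /ka; ring.
have d0 : cabs (cI (bI m 0 s) N%:R^-1 1 - cI (fI m M s) N%:R^-1 1) <= C1 / M%:R.
  have n0 : 0 < N%:R^-1 :> R by rewrite invr_gt0 ltr0n.
  have n1 : N%:R^-1 <= 1 :> R by rewrite invf_le1 ?ltr0n // ler1n.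
  have pos x : N%:R^-1 <= x <= 1 -> 0 < x by move=> /andP[h _]; exact: lt_le_trans h.
  rewrite -cIB; last 2 first.
  - by move=> x /pos x0; exact: cts_bI.
  - by move=> x /pos x0; exact: cts_fI.
  have := @cI_pow_le R (fun t => bI m 0 s t - fI m M s t) (20 / M%:R) N%:R^-1 1 (1 - ka) n0 n1.
  move=> /(_ _ _ _ _) h; apply: (le_trans (h _ _ _ _)).
  - by apply/eqP; lra.
  - by rewrite divr_ge0.
  - by move=> x /pos x0; apply: ctsB; [exact: cts_bI|exact: cts_fI].
  - move=> x xx; have x0 := pos x xx; rewrite /bI /fI -mulrBl -rmorphB /= cabsM cabs_real cabs_cpw Re_z.
    rewrite subr0 (_ : 1 - ka - 1 = 1 + (- ka - 1)); last ring.
    rewrite (rpwD x 1) rpwx1 // mulrA ler_wpM2r ?rpw_ge0 //; apply: fourier_Bp => //; lra.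
  - rewrite rpw1; have := rpw_ge0 (N%:R^-1 : R) (1 - ka) => h0.
    have -> : C1 / M%:R = 2 * (20 / M%:R) / (1 - ka) * 1.
      by rewrite /C1; field; rewrite ?pnatr_eq0 -?lt0n ?M0 ?andbT /=; apply/eqP; lra.
    rewrite ler_wpM2l; [by []| |lra].
    by rewrite mulr_ge0 ?mulr_ge0 ?invr_ge0 //; lra.
have d1 : cabs (\sum_(1 <= n < N) cI (bI m n s) n%:R n.+1%:R - cI (fI m M s) 1 N%:R) <= C2 / M%:R.
  suff : cabs (\sum_(1 <= n < N) cI (bI m n s) n%:R n.+1%:R - cI (fI m M s) 1 N%:R) <=
      C2 / M%:R * (1 - rpw N%:R (- ka)).
    move=> /le_trans; apply; rewrite ler_piMr ?mulr_ge0 ?invr_ge0 ?(ltW ka0) //.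
    by rewrite gerBl rpw_ge0.
  elim: N N0 {d0} => // -[_ _|N IH _].
    by rewrite big_geq // cI_point subrr cabs0 rpw1 subrr mulr0.
  have n0 : 0 < N.+1%:R :> R by rewrite ltr0n.
  have n1 : N.+1%:R <= N.+2%:R :> R by rewrite ler_nat.
  have pos x : N.+1%:R <= x <= N.+2%:R -> 0 < x by move=> /andP[h _]; exact: lt_le_trans h.
  rewrite big_nat_recr //= (@cI_split _ _ 1 N.+1%:R N.+2%:R); last 2 first.
  - by rewrite n1 ler1n.
  - apply: cts_integrable => x /andP[h _]; apply: cts_fI; exact: lt_le_trans h.
  have -> : \sum_(1 <= n < N.+1) cI (bI m n s) n%:R n.+1%:R + cI (bI m N.+1 s) N.+1%:R N.+2%:R -
     (cI (fI m M s) 1 N.+1%:R + cI (fI m M s) N.+1%:R N.+2%:R) =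
     (\sum_(1 <= n < N.+1) cI (bI m n s) n%:R n.+1%:R - cI (fI m M s) 1 N.+1%:R) +
     (cI (bI m N.+1 s) N.+1%:R N.+2%:R - cI (fI m M s) N.+1%:R N.+2%:R) by ring.
  apply: (le_trans (cabsD _ _)).
  suff h : cabs (cI (bI m N.+1 s) N.+1%:R N.+2%:R - cI (fI m M s) N.+1%:R N.+2%:R) <=
    C2 / M%:R * (rpw N.+1%:R (- ka) - rpw N.+2%:R (- ka)).
    by have := IH isT; move: h; move: (C2 / M%:R) => c; lra.
  rewrite -cIB; last 2 first.
  - by move=> x /pos x0; exact: cts_bI.
  - by move=> x /pos x0; exact: cts_fI.
  have := @cI_pow_le R (fun t => bI m N.+1 s t - fI m M s t) (20 / M%:R) N.+1%:R N.+2%:R (- ka) n0 n1.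
  move=> /(_ _ _ _ _) h; apply: (le_trans (h _ _ _ _)).
  - by apply/eqP; lra.
  - by rewrite divr_ge0.
  - by move=> x /pos x0; apply: ctsB; [exact: cts_bI|exact: cts_fI].
  - move=> x xx; have x0 := pos x xx; rewrite /bI /fI -mulrBl -rmorphB /= cabsM cabs_real cabs_cpw Re_z.
    by rewrite ler_wpM2r ?rpw_ge0 //; apply: fourier_Bp_per.
  - rewrite le_eqVlt; apply/orP; left; apply/eqP; rewrite /C2.
    by field; rewrite ?pnatr_eq0 -?lt0n ?M0 ?andbT /=; apply/eqP; lra.
have E : - emG m N s - emF m 0 s N%:R^-1 =
   K * (cI (bI m 0 s) N%:R^-1 1 + \sum_(1 <= n < N) cI (bI m n s) n%:R n.+1%:R).
  have n0 : 0 < N%:R^-1 :> R by rewrite invr_gt0 ltr0n.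
  have n1 : N%:R^-1 <= 1 :> R by rewrite invf_le1 ?ltr0n // ler1n.
  rewrite mulrDr -emT_bI // emT_int //; last by case/andP: m5.
  have -> : K * \sum_(1 <= n < N) cI (bI m n s) n%:R n.+1%:R = emG m 1 s - emG m N s.
    rewrite mulr_sumr; elim: N N0 {d0 d1 n0 n1} => // -[_ _|N IH _]; first by rewrite big_geq // subrr.
    rewrite big_nat_recr //= IH // -emT_bI ?ltr0n ?ler_nat //.
    have := @emG_step R m N.+1 s isT m5 s1; move=> /(congr1 -%R); rewrite opprK => <-; ring.
  rewrite emG1; last by case/andP: m5.
  by ring.
rewrite E (@cI_split _ _ N%:R^-1 1 N%:R); last 2 first.
- by rewrite invf_le1 ?ltr0n // !ler1n N0.
- apply: cts_integrable => x /andP[h _]; apply: cts_fI; apply: lt_le_trans h.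
  by rewrite invr_gt0 ltr0n.
rewrite -/K -mulrBr cabsM -mulrA ler_wpM2l ?cabs_ge0 //.
have -> : cI (bI m 0 s) N%:R^-1 1 + \sum_(1 <= n < N) cI (bI m n s) n%:R n.+1%:R -
  (cI (fI m M s) N%:R^-1 1 + cI (fI m M s) 1 N%:R) =
  (cI (bI m 0 s) N%:R^-1 1 - cI (fI m M s) N%:R^-1 1) +
  (\sum_(1 <= n < N) cI (bI m n s) n%:R n.+1%:R - cI (fI m M s) 1 N%:R) by ring.
by apply: (le_trans (cabsD _ _)); rewrite mulrDl lerD.
Qed.

(** The substitution [u = w n x] reduces every frequency to the same sine integral with rescaled
    bounds and brings out [(w n)^(s - 1)]. *)
Lemma fI_int m M s N : (0 < N)%N -> cI (fI m M s) N%:R^-1 N%:R =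
  \sum_(1 <= n < M.+1) (fc0 R m)%:C * cpw (w R n) (s - 1) *
     sW (- s - m%:R) (w R n / N%:R) (w R n * N%:R).
Proof.
move=> N0; have n0 : 0 < N%:R^-1 :> R by rewrite invr_gt0 ltr0n.
have n1 : N%:R^-1 <= N%:R :> R.
  by apply: (@le_trans _ _ 1); [rewrite invf_le1 ?ltr0n // ler1n|rewrite ler1n].
have pos x : N%:R^-1 <= x <= N%:R -> 0 < x by move=> /andP[h _]; exact: lt_le_trans h.
set z := - s - m%:R.
pose F n x : R[i] := if n == 0%N then 0 else
  (fc0 R m / w R n ^+ m)%:C * cpw (w R n) (- z) * ((sin (w R n * x))%:C * cpw (w R n * x) z).
rewrite /cI (@eq_cint _ _ _ (fun x => \sum_(n <- index_iota 1 M.+1) F n x)); last first.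
  move=> x /=; rewrite in_itv /= => /pos x0.
  rewrite /fI /fS rmorph_sum /= mulr_suml; apply: eq_big_nat => n /andP[n0' _].
  rewrite /F eqn0Ngt n0' /= cpwM ?w_gt0 // -/z rmorphM /=.
  have h : cpw (w R n) (- z) * cpw (w R n) z = 1 by rewrite cpwN mulVf ?cpw_neq0.
  by rewrite -[LHS]mulr1 -h; ring.
rewrite -/(cI _ _ _) cI_sum; last first.
  move=> n x /pos x0; rewrite /F; case: eqVneq => [_|nn]; first exact: cts_cst.
  apply: ctsM; first exact: cts_cst.
  have wn : 0 < w R n by rewrite w_gt0 // lt0n.
  by apply: (@cts_scale R (fun u => (sin u)%:C * cpw u z) (w R n) x wn); apply: cts_sinpw; rewrite mulr_gt0.
apply: eq_big_nat => n /andP[n0' _]; have wn : 0 < w R n by rewrite w_gt0.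
rewrite /cI (@eq_cint _ _ _ (fun x => ((fc0 R m / w R n ^+ m)%:C * cpw (w R n) (- z)) *
  ((sin (w R n * x))%:C * cpw (w R n * x) z))); last by move=> x _; rewrite /F eqn0Ngt n0'.
rewrite -/(cI _ _ _) cIZ; last first.
  by move=> x /pos x0; apply: (@cts_scale R (fun u => (sin u)%:C * cpw u z) (w R n) x wn); apply: cts_sinpw; rewrite mulr_gt0.
rewrite (@cI_scale R (fun u => (sin u)%:C * cpw u z)) //; last by move=> u; exact: cts_sinpw.
rewrite -/(sW _ _ _) mulrA; congr (_ * _).
have -> : - z = (s - 1) + m.+1%:R by rewrite /z -natr1; ring.
rewrite cpw_natS //.
have h : (fc0 R m / w R n ^+ m)%:C * (w R n ^+ m.+1)%:C * ((w R n)^-1)%:C = (fc0 R m)%:C :> R[i].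
  by rewrite -!rmorphM /= exprSr mulrA divfK ?expf_neq0 ?gt_eqF // mulfK ?gt_eqF.
by rewrite -h; ring.
Qed.

Variable zeta : R[i]^o -> R[i]^o.
Hypothesis zP : is_riemann_zeta zeta.

(** For fixed [M] let [N] tend to infinity: all sine integrals tend to [Mz]. Then let [M] tend to
    infinity: the powers [n^(s - 1)] sum to [zeta (1 - s)], as [Re (1 - s) > 1] in the strip. *)
Lemma feq m s Mz : (m == 3%N) || (m == 5%N) -> 1 - m%:R < cRe s < 2 - m%:R ->
  (forall c : R, 1 <= c -> cseq (fun N => sW (- s - m%:R) (c / N%:R) (c * N%:R)) Mz) ->
  - zeta s = poch s m / m`!%:R * (fc0 R m)%:C * cpw (2 * pi) (s - 1) * Mz * zeta (1 - s).
Proof.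
move=> m35 sm HM; have [C C0 H] := feq_approx m35 sm; have /andP[sm1 sm2] := sm.
have m5 : (0 < m <= 5)%N by case/orP: m35 => /eqP ->.
have m3 : 3 <= m%:R :> R by rewrite ler_nat; case/orP: m35 => /eqP ->.
have s1 : s != 1 by apply/eqP => E; move: sm2; rewrite E /=; lra.
set K := poch s m / m`!%:R.
pose P M : R[i] := \sum_(1 <= n < M.+1) (fc0 R m)%:C * cpw (w R n) (s - 1) * Mz.
have h1 M : (0 < M)%N -> cabs (- zeta s - K * P M) <= C / M%:R.
  move=> M0; have cs : cseq (fun N => - emG m N s - emF m 0 s N%:R^-1 - K * cI (fI m M s) N%:R^-1 N%:R)
     (- zeta s - 0 - K * P M).
    apply: cseqB; first apply: cseqB.
    - by apply: cseqN; exact: zeta_emG.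
    - exact: emF_small.
    - apply: cseqZ; apply: (@eq_cseq _ (fun N => \sum_(n <- index_iota 1 M.+1) if (n == 0)%N then 0 else
        (fc0 R m)%:C * cpw (w R n) (s - 1) * sW (- s - m%:R) (w R n / N%:R) (w R n * N%:R))).
        exists 1%N => N N1; rewrite fI_int //; apply: eq_big_nat => n /andP[n0 _].
        by rewrite eqn0Ngt n0.
      have -> : P M = \sum_(n <- index_iota 1 M.+1) if (n == 0)%N then 0 else (fc0 R m)%:C * cpw (w R n) (s - 1) * Mz.
        by apply: eq_big_nat => n /andP[n0 _]; rewrite eqn0Ngt n0.
      apply: cseq_sum => n; have [_|n0] := eqVneq n 0%N; first exact: cseq_cst.
      apply: cseqZ; apply: HM; rewrite /w; have := pi_ge2 R.
      have : 1 <= n%:R :> R by rewrite ler1n lt0n.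
      by nra.
  rewrite -[- zeta s](subr0 (- zeta s : R[i])); apply: (cseq_le cs); exists 1%N => N N1; exact: H.
have h2 : cseq (fun M => - zeta s - K * P M) (- zeta s - K * (fc0 R m)%:C * cpw (2 * pi) (s - 1) * Mz * zeta (1 - s)).
  apply: cseqB; first exact: cseq_cst.
  have h := @zeta_cseq R zeta zP (1 - s); rewrite cReD cReN /= in h.
  have {}h := cseqZ (K * (fc0 R m)%:C * cpw (2 * pi) (s - 1) * Mz) (h ltac:(lra)).
  apply: eq_cseq h; exists 0%N => M _; rewrite /P !mulr_sumr; apply: eq_big_nat => n /andP[n0 _].
  rewrite /w (@cpwM _ (2 * pi) n%:R) ?mulr_gt0 ?pi_gt0 ?ltr0n // opprB; ring.
have h3 : cseq (fun M => - zeta s - K * P M) 0.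
  move=> e e0; exists (Num.truncn (C / e)).+1 => M hM.
  have M1 : C / e < M%:R by apply: lt_le_trans (truncnS_gt _) _; rewrite ler_nat.
  have M0 : (0 < M)%N by exact: leq_trans hM.
  rewrite subr0; apply: (le_trans (h1 M M0)); rewrite ler_pdivrMr ?ltr0n //.
  by move: M1; rewrite ltr_pdivrMr // mulrC => /ltW.
by have := cseq_uniq h2 h3 => /eqP; rewrite subr_eq0 => /eqP.
Qed.

(** For [s] with [m = 5] and for [s + 2] with [m = 3] the sine integral has the same exponent
    [- s - 5]. Cross-multiplying the two equations removes it. *)
Let feq_strip s : -4 < cRe s < -3 ->
  ((2 * pi) ^+ 2)%:C * (zeta s * zeta (-1 - s)) + s * (s + 1) * (zeta (s + 2) * zeta (1 - s)) = 0.
Proof.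
move=> sr; have [|Mz HM] := @sW_lim R (- s - 5%:R).
  by rewrite cReD !cReN Re_nat; lra.
have E5 := @feq 5 s Mz isT; have E3 := @feq 3 (s + 2) Mz isT.
have {}E5 : zeta s = - (poch s 5 / 5`!%:R * (fc0 R 5)%:C * cpw (2 * pi) (s - 1) * Mz * zeta (1 - s)).
  by rewrite -E5 ?opprK //; lra.
have {}E3 : zeta (s + 2) = - (poch (s + 2) 3 / 3`!%:R * (fc0 R 3)%:C * cpw (2 * pi) (s + 2 - 1) * Mz * zeta (1 - (s + 2))).
  rewrite -E3 ?opprK //; first by rewrite cReD (Re_nat _ 2); lra.
  by rewrite (_ : - (s + 2) - 3%:R = - s - 5%:R) //; ring.
rewrite E5 E3 (_ : 1 - (s + 2) = -1 - s); last ring.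
rewrite (_ : s + 2 - 1 = s - 1 + 2%:R); last ring.
rewrite cpw_natS ?mulr_gt0 ?pi_gt0 //.
have -> : poch s 5 = s * (s + 1) * poch (s + 2) 3.
  by rewrite /poch !big_ord_recl !big_ord0 /= /bump /=; ring.
rewrite /fc0 /= (_ : (12 : R)%:C = 12); last by rewrite (rmorph_nat (real_complex R)).
rewrite (_ : (- 240 : R)%:C = - 240); last by rewrite rmorphN /= (rmorph_nat (real_complex R)).
rewrite (_ : 5`!%:R = 120 :> R[i]) // (_ : 3`!%:R = 6 :> R[i]) //.
by field.
Qed.

(** The identity of [feq_strip] is continued along the horizontal line of [s], on which no argument
    of zeta meets the pole because [Im s] is nonzero. *)
Theorem functional_equation s : cIm s != 0 ->
  ((2 * pi) ^+ 2)%:C * (zeta s * zeta (-1 - s)) = - (s * (s + 1) * (zeta (s + 2) * zeta (1 - s))).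
Proof.
move=> si; apply/eqP; rewrite -subr_eq0 opprK; apply/eqP.
pose D z := ((2 * pi) ^+ 2)%:C * (zeta z * zeta (-1 - z)) + z * (z + 1) * (zeta (z + 2) * zeta (1 - z)).
pose y := cIm s; pose B := `|cRe s| + 10.
have yn : 0 < `|y| by rewrite normr_gt0.
have := @identity_strip R D (- B) B y (`|y| / 2) (-7 / 2).
have Es : s = cRe s +i* cIm s by case: (s).
move=> h; rewrite [X in X = 0](_ : _ = D (cRe s +i* y)); last by rewrite /D /y -Es.
apply: h; rewrite /B.
- by rewrite divr_gt0.
- move=> z _ zy; have zi : cIm z != 0.
    by apply/eqP => zi; move: zy; rewrite zi sub0r normrN; lra.
  have dz := @dble_zeta R zeta zP.
  apply: dbleD; apply: dbleM.
  + exact: dble_cst.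
  + apply: dbleM; first by apply: dz; exact: Im_neq1.
    apply: (@dble_comp R zeta (fun z => -1 - z)); last by apply: dbleB; [exact: dble_cst|exact: dble_id].
    by apply: dz; apply: Im_neq1; rewrite cImD cImN /= cImN /= oppr0 add0r oppr_eq0.
  + by apply: dbleM; [exact: dble_id|apply: dbleD; [exact: dble_id|exact: dble_cst]].
  + apply: dbleM.
      apply: (@dble_comp R zeta (fun z => z + 2)); last by apply: dbleD; [exact: dble_id|exact: dble_cst].
      by apply: dz; apply: Im_neq1; rewrite cImD -(rmorph_nat (real_complex R) 2) /= addr0.
    apply: (@dble_comp R zeta (fun z => 1 - z)); last by apply: dbleB; [exact: dble_cst|exact: dble_id].
    by apply: dz; apply: Im_neq1; rewrite cImD cImN /= add0r oppr_eq0.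
- by have := normr_ge0 (cRe s); lra.
- exists (1 / 2) => [|z zz]; first by rewrite divr_gt0.
  by apply: feq_strip; have := Re_le_cabs (z - (-7 / 2 +i* y)); rewrite cReD cReN /= ler_norml; lra.
- by have := ler_norm (cRe s); have := ler_norm (- cRe s); rewrite normrN; lra.
Qed.

End FunctionalEquation.

(** * Bounds for zeta away from the critical line *)

Section ZetaBounds.
Variable R : realType.
Implicit Types (x t : R) (s z : R[i]) (m n N M j : nat).

Lemma hasd_uniq (f : R[i] -> R[i]) z a b : hasd id f z a -> hasd id f z b -> a = b.
Proof.
move=> [p [cp <-] Ep] [q [cq <-] Eq]; apply: (cts_eq_seq cp cq) => e e0.
exists (z + (e / 2)%:C); rewrite addrC addKr cabs_real gtr0_norm ?divr_gt0 //; split; first lra.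
have h : (e / 2)%:C != 0 :> R[i] by rewrite -cabs_eq0 cabs_real gtr0_norm ?gt_eqF ?divr_gt0.
by have := Ep (z + (e / 2)%:C); rewrite Eq /= [z + _]addrC addrK => /addrI /(mulIf h) ->; rewrite addrC.
Qed.

Lemma hasd_conj (f : R[i] -> R[i]) z d : hasd id f z d -> hasd id (fun w => (f w^*)^*) z^* d^*.
Proof.
move=> /hasdP h; apply/hasdP => e /h[r r0 H]; exists r => // w hw.
have E : w = (w^*)^* by rewrite conjcK.
have hw' : cabs (w^* - z) < r by rewrite -cabsJ rmorphB /= conjcK.
have := H _ hw'; rewrite -cabsJ -(cabsJ (w^* - z)) !rmorphB /= rmorphM /= !rmorphB /= !conjcK.
by [].
Qed.

(** For consecutive square roots [b^2 = a^2 + 1], so [1 / a - 1 / b = 1 / (a b (a + b)) >= 1 / (2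
    b^3)] and the sum telescopes. *)
Lemma sqrt_tail n : (0 < n)%N -> \sum_(2 <= k < n.+1) rpw k%:R (- (3 / 2)) <= 2 * (1 - (Num.sqrt n%:R)^-1) :> R.
Proof.
elim: n => // -[_ _|n IH _]; first by rewrite big_geq // sqrtr1 invr1 subrr mulr0.
rewrite big_nat_recr //=; have h := IH isT.
have r k : (0 < k)%N -> rpw (k%:R : R) (- (3 / 2)) = (Num.sqrt k%:R)^-1 ^+ 3.
  move=> k0; have k0' : 0 < k%:R :> R by rewrite ltr0n.
  rewrite rpwN exprVn; congr (_^-1).
  have -> : Num.sqrt k%:R = rpw (k%:R : R) (1 / 2).
    have -> : k%:R = rpw (k%:R : R) (1 / 2) ^+ 2 :> R.
      by rewrite expr2 -rpwD (_ : 1 / 2 + 1 / 2 = 1) ?rpwx1 //; field.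
    by rewrite sqrtr_sqr ger0_norm ?rpw_ge0 //; rewrite expr2 -rpwD (_ : 1 / 2 + 1 / 2 = 1) ?rpwx1 //; field.
  by rewrite !exprS expr0 mulr1 -!rpwD; congr rpw; field.
rewrite r //; pose a := Num.sqrt (n.+1%:R : R); pose b := Num.sqrt (n.+2%:R : R).
rewrite -/a in h; rewrite -/b.
have a0 : 0 < a by rewrite sqrtr_gt0 ltr0n.
have b0 : 0 < b by rewrite sqrtr_gt0 ltr0n.
have ab : a <= b by rewrite ler_sqrt // ler_nat.
have E : b ^+ 2 = a ^+ 2 + 1 by rewrite !sqr_sqrtr // -natr1.
suff : b^-1 ^+ 3 <= 2 * (a^-1 - b^-1) by lra.
have -> : a^-1 - b^-1 = (b - a) / (a * b) by field; rewrite !gt_eqF.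
have -> : b - a = (a + b)^-1.
  apply: (mulIf (lt0r_neq0 (addr_gt0 a0 b0))); rewrite mulVf ?gt_eqF ?addr_gt0 //.
  by rewrite [a + b]addrC -subr_sqr E addrC addKr.
rewrite exprVn mulrA ler_pdivlMr ?mulr_gt0 // mulrC ler_pdivrMr ?exprn_gt0 // mulrAC ler_pdivlMr ?addr_gt0 //.
by rewrite !exprS expr0; nra.
Qed.

Variable zeta : R[i]^o -> R[i]^o.
Hypothesis zP : is_riemann_zeta zeta.

Lemma zeta_le3 s : 3 / 2 <= cRe s -> cabs (zeta s) <= 3.
Proof.
move=> sr; have s1 : 1 < cRe s by lra.
apply: (cseq_le (zeta_cseq zP s1)); exists 1%N => N N1.
apply: (le_trans (cabs_sum _ _ _)); rewrite big_ltn ?ltnS // cpw1 cabs1.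
have h := sqrt_tail N1; have : 0 <= (Num.sqrt (N%:R : R))^-1 by rewrite invr_ge0 sqrtr_ge0.
suff : \sum_(2 <= n < N.+1) cabs (cpw (n%:R : R) (- s)) <= \sum_(2 <= k < N.+1) rpw (k%:R : R) (- (3 / 2)) by lra.
rewrite big_nat [leRHS]big_nat; apply: ler_sum => k /andP[k2 _].
by rewrite cabs_cpw cReN; apply: rpw_leW; [rewrite ler1n (leq_trans _ k2)|lra].
Qed.

(** The terms after the first contribute at most [1/4] for [n = 2] and [1/2] in total for
    [n >= 3]. *)
Lemma zeta_ge s : 2 <= cRe s -> 1 / 4 <= cabs (zeta s).
Proof.
move=> sr; have s1 : 1 < cRe s by lra.
have h : cabs (zeta s - 1) <= 3 / 4.
  apply: (cseq_le (cseqB (zeta_cseq zP s1) (cseq_cst 1))); exists 2%N => N N2.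
  rewrite big_ltn ?ltnS ?(leq_trans _ N2) // cpw1 addrAC subrr add0r.
  apply: (le_trans (cabs_sum _ _ _)).
  apply: (@le_trans _ _ (\sum_(2 <= k < N.+1) (k%:R ^- 2 : R))).
    rewrite big_nat [leRHS]big_nat; apply: ler_sum => k /andP[k2 _].
    have k0 : 0 < k%:R :> R by rewrite ltr0n (leq_trans _ k2).
    rewrite cabs_cpw cReN -(rpw_nat 2 k0) -rpwN; apply: rpw_leW; first by rewrite ler1n (leq_trans _ k2).
    by lra.
  rewrite big_ltn ?ltnS //; have := @inv_sqr_tail R 2 N isT N2.
  have : 0 <= N%:R^-1 :> R by rewrite invr_ge0.
  have -> : (2%:R ^- 2 : R) = 1 / 4 by rewrite expr2; field.
  by lra.
have h' : cabs (1 - zeta s) <= 3 / 4 by rewrite cabsBC.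
by have := cabs_sub_ge 1 (1 - zeta s); rewrite cabs1 subKr; lra.
Qed.

Let pb s j : (j <= 5)%N -> cabs (poch s j) <= (cabs s + 5) ^+ 5.
Proof.
move=> j5; apply: (le_trans (poch_le _ _)); have c0 := cabs_ge0 s.
apply: (@le_trans _ _ ((cabs s + 5) ^+ j)).
  by rewrite lerXn2r ?nnegrE ?addr_ge0 // lerD2l ler_nat.
by rewrite ler_weXn2l //; lra.
Qed.

(** Euler-Maclaurin of order 5 at [N = 1] isolates the polar part [1 / (s - 1)]; the other boundary
    terms and the tail are polynomial in [|s|]. *)
Let zeta_near1 s : s != 1 -> -3 <= cRe s ->
  cabs ((s - 1) * zeta s - 1) <= cabs (s - 1) * (8 * (cabs s + 5) ^+ 5).
Proof.
move=> s1 sr; have h := @zeta_emG_dist R zeta zP 5 s isT s1; set u := (cabs s + 5) ^+ 5.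
have u1 : 1 <= u by rewrite exprn_ege1 //; have := cabs_ge0 s; lra.
have {}h : cabs (zeta s - emG 5 1 s) <= 2 * u.
  have q1 : 1 <= cRe s + 5%:R - 1 by lra.
  apply: (le_trans (h _)); first by lra.
  rewrite ler_pdivrMr; last by lra.
  by have := @pb s 5 isT; rewrite -/u; have := cabs_ge0 (poch s 5); nra.
pose T : R[i] := \sum_(j < 5) (Bp j.+1 (0 : R) / j.+1`!%:R)%:C * poch s j.
have ET : emG 5 1 s = 1 - (1 - s)^-1 + T.
  rewrite /emG big_nat1 cpw1 /emF cpw1 div1r opprB addrA addrAC; congr (_ - _ + _).
  by apply: eq_bigr => j _; rewrite /emU subrr cpw1 mulr1.
have hT : cabs T <= 5 * u.
  apply: (le_trans (cabs_sum _ _ _)); apply: (@le_trans _ _ (\sum_(j < 5) u)); last first.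
    by rewrite sumr_const card_ord mulr_natl lexx.
  apply: ler_sum => j _; rewrite cabsM -[leRHS]mul1r; apply: ler_pM; rewrite ?cabs_ge0 //.
    rewrite cabs_real normrM normfV normr_nat ler_pdivrMr ?ltr0n ?fact_gt0 // mul1r.
    by apply: (@le_trans _ _ 1); [apply: Bp_le; lra|rewrite ler1n fact_gt0].
  by apply: pb; exact: ltnW.
have s1' : 1 - s != 0 by rewrite subr_eq0 eq_sym.
have -> : (s - 1) * zeta s - 1 = (s - 1) * ((zeta s - emG 5 1 s) + (1 + T)).
  have gen (a b c d : R[i]) : a * d = -1 -> a * b - 1 = a * (b - (1 - d + c) + (1 + c)).
    by move=> had; transitivity (a * b + a * d); [rewrite had|ring].
  by rewrite ET; apply: gen; rewrite -opprB mulNr mulfV.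
rewrite cabsM ler_wpM2l ?cabs_ge0 //; apply: (le_trans (cabsD _ _)).
by have := cabsD 1 T; rewrite cabs1; lra.
Qed.

Lemma zeta_pole : limat (fun s => (s - 1) * zeta s) 1 1.
Proof.
move=> e e0; pose K : R := 8 * 7 ^+ 5.
exists (Num.min 1 (e / K / 2)); first by rewrite lt_min ltr01 !divr_gt0 // mulr_gt0 // exprn_gt0.
move=> s s1; rewrite lt_min => /andP[h1 h2].
have s2 : cabs s <= 2 by have := cabsD (s - 1) 1; rewrite subrK cabs1; lra.
have sr : -3 <= cRe s by have := Re_le_cabs s; rewrite ler_norml; lra.
apply: (le_lt_trans (zeta_near1 s1 sr)).
have hK : 8 * (cabs s + 5) ^+ 5 <= K.
  rewrite /K ler_pM2l // lerXn2r ?nnegrE //; have := cabs_ge0 s; lra.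
have K0 : 0 < K by rewrite /K mulr_gt0 // exprn_gt0.
apply: (@le_lt_trans _ _ (e / K / 2 * K)).
  by apply: ler_pM; rewrite ?cabs_ge0 ?(ltW h2) ?mulr_ge0 ?exprn_ge0 ?addr_ge0 ?cabs_ge0.
by rewrite mulrAC divfK ?gt_eqF //; lra.
Qed.

(** The exponent 6 counts five factors from [poch] and one from [s - 1]; multiplying by [s - 1]
    removes the pole, so that the bound covers small ordinates too. *)
Lemma zeta_crude : exists2 C : R, 1 <= C & forall s, s != 1 -> -3 <= cRe s <= 7 ->
  cabs ((s - 1) * zeta s) <= C * (1 + `|cIm s|) ^+ 6.
Proof.
exists (9 * 12 ^+ 6); first by rewrite mulr_ege1 // ?exprn_ege1 //; lra.
move=> s s1 sr; have h := zeta_near1 s1; set u := cabs s + 5 in h.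
have c0 := cabs_ge0 s; have t0 := normr_ge0 (cIm s).
have u5 : 5 <= u by rewrite /u; lra.
have sr' : `|cRe s| <= 7 by rewrite ler_norml; lra.
have ut : u <= 12 * (1 + `|cIm s|) by rewrite /u; have := cabs_le_ReIm s; lra.
have s1u : cabs (s - 1) <= u by rewrite /u; have := cabsB s 1; rewrite cabs1; lra.
have u6 : u ^+ 6 <= (12 * (1 + `|cIm s|)) ^+ 6 by rewrite lerXn2r ?nnegrE //; lra.
have v1 : 1 <= u ^+ 6 by rewrite exprn_ege1 //; lra.
have b : cabs ((s - 1) * zeta s - 1) <= 8 * u ^+ 6.
  apply: (le_trans (h _)); first by lra.
  rewrite [u ^+ 6]exprS mulrCA ler_pM2l // ler_wpM2r // exprn_ge0 //; lra.
have := cabsD ((s - 1) * zeta s - 1) 1; rewrite subrK cabs1 => b2.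
by move: u6; rewrite exprMn; move: (12 ^+ 6) ((1 + _) ^+ 6) (u ^+ 6) v1 b b2 => p q r; rewrite -[9 * p * q]mulrA; lra.
Qed.

Lemma conj_re_im s : s^* = cRe s +i* (- cIm s).
Proof. by case: s. Qed.

Lemma zeta_conj s : cIm s != 0 -> zeta s^* = (zeta s)^*.
Proof.
move=> si; apply: (canRL (@conjcK _)); apply/eqP; rewrite -subr_eq0; apply/eqP.
pose D z : R[i] := (zeta z^*)^* - zeta z.
pose y := cIm s; pose B := `|cRe s| + 10.
have yn : 0 < `|y| by rewrite normr_gt0.
have Es : s = cRe s +i* cIm s by case: (s).
rewrite [X in X = 0](_ : _ = D (cRe s +i* y)); last by rewrite /D /y -Es.
apply: (@identity_strip R D (- B) B y (`|y| / 2) 3); rewrite /B.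
- by rewrite divr_gt0.
- move=> z _ zy; have zi : cIm z != 0.
    by apply/eqP => zi; move: zy; rewrite zi sub0r normrN; lra.
  apply: dbleB; last by apply: dble_zeta => //; exact: Im_neq1.
  have z1 : z^* != 1 by apply: Im_neq1; rewrite conj_re_im /= oppr_eq0.
  have := hasd_conj (hasd_zeta zP z1); rewrite conjcK => h; eexists; exact: h.
- by have := normr_ge0 (cRe s); lra.
- exists 1 => // z zz; have zr : 1 < cRe z.
    by have := Re_le_cabs (z - (3 +i* y)); rewrite cReD cReN /= ler_norml; lra.
  rewrite /D; apply/eqP; rewrite subr_eq0; apply/eqP; apply: (@cseq_uniq _ _ _ _ _ (zeta_cseq zP zr)).
  have zr' : 1 < cRe z^* by rewrite conj_re_im.
  have h := zeta_cseq zP zr' => e /h[N0 H]; exists N0 => N /H.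
  have Ecp n : (cpw (n%:R : R) (- z^*))^* = cpw n%:R (- z).
    by rewrite -cpwJ; congr cpw; rewrite rmorphN /= conjcK.
  rewrite -cabsJ rmorphB rmorph_sum [X in cabs (X - _)](eq_bigr (fun n => cpw n%:R (- z))) //.
  by move=> n _; exact: Ecp.
- by have := ler_norm (cRe s); have := ler_norm (- cRe s); rewrite normrN; lra.
Qed.

Lemma derive_zeta_conj s : cIm s != 0 -> derive1 zeta s^* = (derive1 zeta s)^*.
Proof.
move=> si.
have si' : cIm s^* != 0 by rewrite conj_re_im /= oppr_eq0.
apply: (hasd_uniq (hasd_zeta zP (Im_neq1 si'))).
have h := hasd_conj (hasd_zeta zP (Im_neq1 si)).
have y0 : 0 < `|cIm s^*| by rewrite normr_gt0.
apply: (hasd_near y0 _ h) => z zz /=.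
have zi : cIm z != 0.
  apply/eqP => zi; move: zz; have := Im_le_cabs (z - s^*); rewrite cImD cImN zi sub0r normrN.
  by rewrite leNgt => /negbTE; move=> + h2; rewrite h2.
by rewrite zeta_conj ?conjcK.
Qed.

Lemma cabs_zeta_conj (a t : R) : t != 0 -> cabs (zeta (a +i* (- t))) = cabs (zeta (a +i* t)).
Proof.
by move=> t0; rewrite -(cabsJ (zeta (a +i* t))) -zeta_conj //.
Qed.

Lemma FE_abs (a t : R) : t != 0 ->
  (2 * pi) ^+ 2 * (cabs (zeta (a +i* t)) * cabs (zeta ((-1 - a) +i* t))) =
  cabs (a +i* t) * cabs ((a + 1) +i* t) * (cabs (zeta ((a + 2) +i* t)) * cabs (zeta ((1 - a) +i* t))).
Proof.
move=> t0; have := @functional_equation R zeta zP (a +i* t) t0 => /(congr1 (@cabs R)).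
rewrite cabsN !cabsM cabs_real ger0_norm ?exprn_ge0 ?mulr_ge0 ?pi_ge0 //.
have -> : -1 - (a +i* t) = (-1 - a) +i* (- t) :> R[i] by apply: complexP; rewrite ?cReD ?cImD ?cReN ?cImN /= ?oppr0 ?add0r.
have -> : (a +i* t) + 1 = (a + 1) +i* t :> R[i] by apply: complexP; rewrite ?cReD ?cImD /= ?addr0.
have -> : (a +i* t) + 2 = (a + 2) +i* t :> R[i].
  by rewrite -[2 in LHS](rmorph_nat (real_complex R) 2); apply: complexP; rewrite ?cReD ?cImD /= ?addr0.
have -> : 1 - (a +i* t) = (1 - a) +i* (- t) :> R[i] by apply: complexP; rewrite ?cReD ?cImD ?cReN ?cImN /= ?add0r.
by rewrite !cabs_zeta_conj.
Qed.

(** On [Re s = -1/2] the point [-1 - s] is the conjugate of [s], and [s + 2], [1 - s] are conjugate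
    on [Re = 3/2]. In modulus the functional equation is an equality of squares. *)
Lemma zeta_m12 t : t != 0 -> 2 * pi * cabs (zeta (- (1 / 2) +i* t)) =
  cabs ((1 / 2) +i* t) * cabs (zeta ((3 / 2) +i* t)).
Proof.
move=> t0; have := @FE_abs (- (1 / 2)) t t0.
rewrite (_ : -1 - - (1 / 2) = - (1 / 2) :> R); last by field.
rewrite (_ : - (1 / 2) + 1 = 1 / 2 :> R); last by field.
rewrite (_ : - (1 / 2) + 2 = 3 / 2 :> R); last by field.
rewrite (_ : 1 - - (1 / 2) = 3 / 2 :> R); last by field.
have -> : cabs (- (1 / 2) +i* t) = cabs ((1 / 2) +i* t) by rewrite !cabsE /= sqrrN.
move=> h; apply/eqP; rewrite -(@eqrXn2 _ 2) //; first by rewrite !exprMn !expr2 in h *; apply/eqP; lra.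
- by rewrite !mulr_ge0 ?pi_ge0 ?cabs_ge0.
- by rewrite mulr_ge0 ?cabs_ge0.
Qed.

Lemma zeta_m12_le t : t != 0 -> cabs (zeta (- (1 / 2) +i* t)) <= cabs ((1 / 2) +i* t).
Proof.
move=> t0; have h := zeta_m12 t0; have h3 : cabs (zeta ((3 / 2) +i* t)) <= 3 by apply: zeta_le3.
have p2 := pi_ge2 R; have := cabs_ge0 (zeta (- (1 / 2) +i* t)); have := cabs_ge0 ((1 / 2) +i* t).
nra.
Qed.

Hypotheses (RH : riemann_hypothesis zeta) (simple : simple_zeros zeta).

Lemma nontriv s : zeta s = 0 -> s != 1 -> -2 < cRe s -> nontrivial_zero zeta s.
Proof.
move=> s0 s1 sr; split => // n; apply/eqP => E; move: sr; rewrite E cReN Re_nat.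
by have : (2 <= (2 * n.+1)%N%:R :> R); [rewrite ler_nat mulnS|lra].
Qed.

Lemma zeta_neq0 s : -2 < cRe s -> cRe s != 1 / 2 -> s != 1 -> zeta s != 0.
Proof.
move=> sr s2 s1; apply/eqP => s0; move: s2; rewrite (RH (nontriv s0 s1 sr)).
by rewrite div1r eqxx.
Qed.

(** On [Re s = -3/2] both sides contain [|zeta (1/2 + i t)|], which cancels unless it is 0. At a
    zero the identity follows by continuity along the critical line, simple zeros being isolated. *)
Lemma zeta_m32 t : t != 0 -> (2 * pi) ^+ 2 * cabs (zeta (- (3 / 2) +i* t)) =
  cabs (- (3 / 2) +i* t) * cabs (- (1 / 2) +i* t) * cabs (zeta ((5 / 2) +i* t)).
Proof.
move=> t0; have h u : u != 0 -> zeta ((1 / 2) +i* u) != 0 -> (2 * pi) ^+ 2 * cabs (zeta (- (3 / 2) +i* u)) =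
  cabs (- (3 / 2) +i* u) * cabs (- (1 / 2) +i* u) * cabs (zeta ((5 / 2) +i* u)).
  move=> u0 z0; have := @FE_abs (- (3 / 2)) u u0.
  rewrite (_ : -1 - - (3 / 2) = 1 / 2 :> R); last by field.
  rewrite (_ : - (3 / 2) + 1 = - (1 / 2) :> R); last by field.
  rewrite (_ : - (3 / 2) + 2 = 1 / 2 :> R); last by field.
  rewrite (_ : 1 - - (3 / 2) = 5 / 2 :> R); last by field.
  have c0 : cabs (zeta ((1 / 2) +i* u)) != 0 by rewrite cabs_eq0.
  by move=> E; apply: (mulIf c0); rewrite -[LHS]mulrA E; ring.
have [z0|z0] := eqVneq (zeta ((1 / 2) +i* t)) 0; last exact: h.
pose P z : R[i] := ((2 * pi) ^+ 2)%:C * (cabs (zeta (z - 2)))%:C.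
pose Q z : R[i] := (cabs (z - 2))%:C * (cabs (z - 1))%:C * (cabs (zeta (z + 2)))%:C.
set s := (1 / 2) +i* t.
have re2 : (2 : R[i]) = 2 +i* 0 by rewrite -(rmorph_nat (real_complex R) 2).
have P_ (v : R[i]) : v - 2 = (cRe v - 2) +i* cIm v.
  by rewrite re2; apply: complexP; rewrite ?cReD ?cImD ?cReN ?cImN /= ?oppr0 ?addr0.
have P1 (v : R[i]) : v - 1 = (cRe v - 1) +i* cIm v.
  by apply: complexP; rewrite ?cReD ?cImD ?cReN ?cImN /= ?oppr0 ?addr0.
have P2 (v : R[i]) : v + 2 = (cRe v + 2) +i* cIm v.
  by rewrite re2; apply: complexP; rewrite ?cReD ?cImD ?cReN ?cImN /= ?addr0.
have e1 : 1 / 2 - 2 = - (3 / 2) :> R by field.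
have e2 : 1 / 2 - 1 = - (1 / 2) :> R by field.
have e3 : 1 / 2 + 2 = 5 / 2 :> R by field.
suff : P s = Q s.
  rewrite /P /Q P_ P1 P2 /= e1 e2 e3 -!rmorphM /= => E.
  exact: (congr1 (@complex.Re R) E).
apply: cts_eq_seq.
- apply: ctsM; first exact: cts_cst.
  apply: cts_cabs; apply: dble_cts; apply: (@dble_comp R zeta (fun z => z - 2)).
    by apply: dble_zeta => //; apply: Im_neq1; rewrite P_.
  by apply: dbleB; [exact: dble_id|exact: dble_cst].
- apply: ctsM; first by apply: ctsM; apply: cts_cabs; exact: cts_subC.
  apply: cts_cabs; apply: dble_cts; apply: (@dble_comp R zeta (fun z => z + 2)).
    by apply: dble_zeta => //; apply: Im_neq1; rewrite P2.
  by apply: dbleD; [exact: dble_id|exact: dble_cst].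
- move=> e e0; have s1 : s != 1 by exact: Im_neq1.
  have nz : nontrivial_zero zeta s by apply: nontriv => //=; lra.
  have d0 := simple nz.
  have := (hasdP _ _ _ _).1 (hasd_zeta zP s1) (cabs (derive1 zeta s) / 2).
  rewrite divr_gt0 ?cabs_gt0 // => /(_ isT)[d dd0 Hd].
  pose r := Num.min (e / 2) (Num.min (d / 2) (`|t| / 2)).
  have r0 : 0 < r by rewrite !lt_min !divr_gt0 // normr_gt0.
  have re_ : r <= e / 2 by rewrite ge_min lexx.
  have rd : r <= d / 2 by rewrite !ge_min lexx orbT.
  have rt : r <= `|t| / 2 by rewrite !ge_min lexx !orbT.
  pose v : R[i] := (1 / 2) +i* (t + r).
  have Ev : v - s = 0 +i* r by apply: complexP; rewrite ?cReD ?cImD ?cReN ?cImN /=; ring.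
  have cv : cabs (v - s) = r by rewrite Ev cabsE /= expr0n add0r sqrtr_sqr gtr0_norm.
  exists v; split; first by rewrite cv; lra.
  have tr0 : t + r != 0.
    by apply/eqP => E; move: rt; rewrite (_ : t = - r) ?normrN ?gtr0_norm //; lra.
  have zv : zeta v != 0.
    apply/eqP => zv; have := Hd v; rewrite cv z0 zv subrr sub0r cabsN cabsM cv.
    move=> /(_ ltac:(lra)); rewrite ler_pM2r //.
    by have : 0 < cabs (derive1 zeta s); [rewrite cabs_gt0|lra].
  have := h _ tr0 zv; rewrite /P /Q P_ P1 P2 /= e1 e2 e3 -!rmorphM /= => ->.
  by [].
Qed.

(** Here the functional equation also involves [Re = -1/2], which [zeta_m12] converts into
    [Re = 3/2], and the value on that line cancels. *)
Lemma zeta_m52 t : t != 0 -> (2 * pi) ^+ 3 * cabs (zeta (- (5 / 2) +i* t)) =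
  cabs (- (5 / 2) +i* t) * cabs (- (3 / 2) +i* t) * cabs ((1 / 2) +i* t) * cabs (zeta ((7 / 2) +i* t)).
Proof.
move=> t0; have h := zeta_m12 t0; have := @FE_abs (- (5 / 2)) t t0.
rewrite (_ : -1 - - (5 / 2) = 3 / 2 :> R); last by field.
rewrite (_ : - (5 / 2) + 1 = - (3 / 2) :> R); last by field.
rewrite (_ : - (5 / 2) + 2 = - (1 / 2) :> R); last by field.
rewrite (_ : 1 - - (5 / 2) = 7 / 2 :> R); last by field.
move=> E; have c0 : cabs (zeta ((3 / 2) +i* t)) != 0.
  rewrite cabs_eq0; apply: zeta_neq0 => /=; [lra|by apply/eqP; lra|].
  exact: Im_neq1.
apply: (mulIf c0); move: E h; rewrite !exprS expr0.
move: (cabs (zeta (- (5 / 2) +i* t))) (cabs (zeta (3 / 2 +i* t))) (cabs (zeta (- (1 / 2) +i* t)))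
  (cabs (zeta (7 / 2 +i* t))) (cabs (- (5 / 2) +i* t)) (cabs (- (3 / 2) +i* t)) (cabs (1 / 2 +i* t)) (pi : R).
move=> z5 z3 z1 z7 a b c p E h.
transitivity (2 * p * (2 * p * (2 * p * 1) * (z5 * z3))); first by ring.
rewrite -mulrA in E *; rewrite E.
transitivity (a * b * z7 * (2 * p * z1)); first by ring.
by rewrite h; ring.
Qed.

(** This is [zeta (s - 1) / zeta s] on the left edge [Re s = -3/2] of the contour. Comparing
    [zeta_m52] with [zeta_m32] leaves zeta at [7/2 + i t] and [5/2 + i t], where it is at most 3 and
    at least [1/4] in modulus. *)
Lemma left_line t : t != 0 -> cabs (zeta (- (5 / 2) +i* t) / zeta (- (3 / 2) +i* t)) <=
  12 * cabs (- (5 / 2) +i* t).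
Proof.
move=> t0; have h5 := zeta_m52 t0; have h3 := zeta_m32 t0.
have z0 : zeta (- (3 / 2) +i* t) != 0.
  apply: zeta_neq0 => /=; [lra|by apply/eqP; lra|].
  exact: Im_neq1.
rewrite cabsM cabsV ler_pdivrMr ?cabs_gt0 //.
have E : cabs (- (1 / 2) +i* t) = cabs ((1 / 2) +i* t) by rewrite !cabsE /= sqrrN.
rewrite E in h3.
have b7 : cabs (zeta ((7 / 2) +i* t)) <= 3 by apply: zeta_le3 => /=; lra.
have b5 : 1 / 4 <= cabs (zeta ((5 / 2) +i* t)) by apply: zeta_ge => /=; lra.
have p2 := pi_ge2 R; have P0 : 0 < (2 * pi) ^+ 3 :> R by rewrite exprn_gt0 // mulr_gt0 ?pi_gt0.
rewrite -(ler_pM2l P0) h5.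
have -> : (2 * pi) ^+ 3 * (12 * cabs (- (5 / 2) +i* t) * cabs (zeta (- (3 / 2) +i* t))) =
  12 * (2 * pi) * cabs (- (5 / 2) +i* t) * ((2 * pi) ^+ 2 * cabs (zeta (- (3 / 2) +i* t))) by ring.
rewrite h3; have := cabs_ge0 (- (5 / 2) +i* t); have := cabs_ge0 (- (3 / 2) +i* t); have := cabs_ge0 ((1 / 2) +i* t).
move: (cabs (- (5 / 2) +i* t)) (cabs (- (3 / 2) +i* t)) (cabs (1 / 2 +i* t)) => a b c c0 b0 a0.
have abc : 0 <= a * b * c by rewrite !mulr_ge0.
have -> : 12 * (2 * pi) * a * (b * c * cabs (zeta (5 / 2 +i* t))) = (a * b * c) * (12 * (2 * pi) * cabs (zeta (5 / 2 +i* t))) by ring.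
rewrite ler_wpM2l //; apply: (le_trans b7); nra.
Qed.

End ZetaBounds.

Local Notation inbox T h := (ininterior (-3) 7 (T - h) (T + h)).

(** * Counting zeros and choosing heights *)

Section Zeros.
Variable R : realType.
Implicit Types (x t T : R) (s z : R[i]) (n N : nat).

Lemma ln_le_sqrt (x : R) : 0 < x -> ln x <= 2 * Num.sqrt x.
Proof.
move=> x0; have q0 : 0 < Num.sqrt x by rewrite sqrtr_gt0.
have -> : ln x = 2 * ln (Num.sqrt x).
  by rewrite -{1}(sqr_sqrtr (ltW x0)) expr2 lnM ?posrE //; ring.
have h : ln (1 + (Num.sqrt x - 1)) <= Num.sqrt x - 1 by apply: le_ln1Dx; lra.
by rewrite ler_pM2l //; move: h; rewrite (_ : 1 + (Num.sqrt x - 1) = Num.sqrt x); [lra|ring].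
Qed.

Lemma dble_prod (r : seq R[i]) z : dble (fun z => \prod_(p <- r) (z - p)) z.
Proof.
elim: r => [|p r IH].
  by rewrite (_ : (fun z => _) = fun=> 1); [exact: dble_cst|apply/funext => w; rewrite big_nil].
rewrite (_ : (fun z => _) = fun z => (z - p) * \prod_(q <- r) (z - q)); last first.
  by apply/funext => w; rewrite big_cons.
by apply: dbleM => //; apply: dbleB; [exact: dble_id|exact: dble_cst].
Qed.

Lemma prodC_neq0 (r : seq R[i]) z : z \notin r -> \prod_(p <- r) (z - p) != 0.
Proof.
by move=> zr; rewrite prodf_seq_neq0; apply/allP => p pr /=; rewrite subr_eq0; apply: contraNneq zr => ->.
Qed.

Lemma prod_ge (r : seq R[i]) z (d : R) : 0 <= d -> (forall p, p \in r -> d <= cabs (z - p)) ->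
  d ^+ size r <= cabs (\prod_(p <- r) (z - p)).
Proof.
move=> d0; elim: r => [|p r IH] H; first by rewrite big_nil cabs1.
rewrite big_cons cabsM exprS; apply: ler_pM; rewrite ?exprn_ge0 //.
  by apply: H; rewrite mem_head.
by apply: IH => q qr; apply: H; rewrite inE qr orbT.
Qed.

Lemma prod_le (r : seq R[i]) z (d : R) : (forall p, p \in r -> cabs (z - p) <= d) ->
  cabs (\prod_(p <- r) (z - p)) <= d ^+ size r.
Proof.
elim: r => [|p r IH] H; first by rewrite big_nil cabs1.
rewrite big_cons cabsM exprS; apply: ler_pM; rewrite ?cabs_ge0 //.
  by apply: H; rewrite mem_head.
by apply: IH => q qr; apply: H; rewrite inE qr orbT.
Qed.

Variable zeta : R[i]^o -> R[i]^o.
Hypothesis zP : is_riemann_zeta zeta.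
Hypotheses (RH : riemann_hypothesis zeta) (simple : simple_zeros zeta).

Definition nzero z := nontrivial_zero zeta z.

Lemma nzero_Re z : nzero z -> cRe z = 1 / 2.
Proof. by move=> /RH ->; rewrite div1r. Qed.

(* [(s - 1) zeta s] divided by its zeros in [r] is holomorphic, up to removable singularities. *)
Definition zq (r : seq R[i]) z : R[i] := (z - 1) * zeta z / \prod_(p <- r) (z - p).

Lemma dble_zq r z : z \notin 1 :: r -> dble (zq r) z.
Proof.
rewrite inE negb_or => /andP[z1 zr]; apply: dble_div; first exact: prodC_neq0.
  apply: dbleM; last exact: dble_zeta.
  by apply: dbleB; [exact: dble_id|exact: dble_cst].
exact: dble_prod.
Qed.

Lemma limat_quot (f : R[i] -> R[i]) p d : f p = 0 -> hasd id f p d -> limat (fun z => f z / (z - p)) p d.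
Proof.
move=> fp [phi [cphi <-] E]; apply: limat_near (limat_cts cphi); first exact: ltr01.
by move=> z zp _; rewrite (E z) fp add0r mulfK // subr_eq0.
Qed.

(** The limit is nonzero at a zero because the zero is simple, and at 1 because the pole is.
    Nonvanishing is what later permits a logarithm of the quotient. *)
Lemma zq_lim r p : uniq r -> (forall q, q \in r -> nzero q) -> p \in 1 :: r ->
  exists l, limat (zq r) p l /\ l != 0.
Proof.
move=> ur hr; rewrite inE => /orP[/eqP ->|pr].
  have r1 : 1 \notin r by apply/negP => /hr[]; rewrite eqxx.
  exists (1 * (\prod_(q <- r) (1 - q))^-1); split; last first.
    by rewrite mul1r invr_eq0 prodC_neq0.
  apply: (@limat_mul_cts _ _ (fun z => (\prod_(q <- r) (z - q))^-1)); first exact: zeta_pole.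
  by apply: ctsV; [exact: prodC_neq0|exact/dble_cts/dble_prod].
have [p1 p0 _] := hr p pr.
have L := limat_quot p0 (hasd_zeta zP p1).
pose r' := rem p r.
have pr' : p \notin r' by rewrite mem_rem_uniqF.
pose h z : R[i] := (z - 1) / \prod_(q <- r') (z - q).
have ch : cts id h p.
  apply: ctsM; first exact: cts_subC.
  by apply: ctsV; [exact: prodC_neq0|exact/dble_cts/dble_prod].
exists (derive1 zeta p * h p); split.
  apply: limat_near (limat_mul_cts L ch); first exact: ltr01.
  move=> z zp _; rewrite /h /zq (perm_big _ (perm_to_rem pr)) big_cons invfM -/r'.
  by move: (\prod_(q <- r') (z - q))^-1 (z - p)^-1 => a b; ring.
apply: mulf_neq0; first by apply: simple; apply: hr.
by apply: mulf_neq0; [rewrite subr_eq0|rewrite invr_eq0 prodC_neq0].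
Qed.

(** Maximum principle on the box: on its boundary each zero in [r] is at distance at least [d], so
    dividing it out gains a factor [d] over the polynomial bound for zeta. The condition [|T| != h]
    keeps the pole 1 off the boundary. *)
Lemma zq_bound : exists2 C : R, 1 <= C & forall T (h : R) (r : seq R[i]) z, 1 < h -> h <= 7 -> uniq r ->
  (forall q, q \in r -> nzero q /\ `|cIm q - T| <= h - 1) ->
  forall d : R, 1 <= d -> d <= 3 -> d <= h - 1 -> (forall q, q \in r -> `|cIm q - T| <= h - d) ->
  inbox T h z -> z \notin 1 :: r -> `|T| != h ->
  cabs (zq r z) <= C * (1 + `|T|) ^+ 6 / d ^+ size r.
Proof.
have [C C1 HC] := zeta_crude zP; exists (C * 8 ^+ 6); first by rewrite mulr_ege1 // exprn_ege1 //; lra.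
move=> T h r z h1 h7 ur hr d d1 d3 dh hd iz zr Th.
have inS q : q \in r -> inbox T h q.
  move=> qr; have [nq _] := hr q qr; have := hd q qr.
  by rewrite /ininterior (nzero_Re nq) ler_norml; lra.
have bd1 w : onbd (-3) 7 (T - h) (T + h) w -> w != 1.
  move=> bw; apply/eqP => w1; move: bw; rewrite w1 /onbd /inrect /=.
  move=> /andP[_ /or4P[] /eqP]; try (by clear -zP RH simple; lra); move=> E; move: Th => /eqP; apply.
  - by rewrite (_ : T = h) ?ger0_norm //; clear -zP RH simple E h1; lra.
  - by rewrite (_ : T = - h) ?normrN ?ger0_norm //; clear -zP RH simple E h1; lra.
have bd w : onbd (-3) 7 (T - h) (T + h) w -> cabs (zq r w) <= C * 8 ^+ 6 * (1 + `|T|) ^+ 6 / d ^+ size r.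
  move=> bw; rewrite /zq cabsM cabsV.
  have dist q : q \in r -> d <= cabs (w - q).
    move=> qr; have [nq _] := hr q qr; have hq := hd q qr; have Rq := nzero_Re nq.
    have := Re_le_cabs (w - q); have := Im_le_cabs (w - q); rewrite cReD cReN cImD cImN Rq.
    move: hq bw; rewrite /onbd /inrect !ler_norml => hq /andP[/andP[wr wi] /or4P[] /eqP E]; clear -zP RH simple hq E wr wi d3 dh h7; lra.
  have P := prod_ge (le_trans ler01 d1) dist.
  have d0 : 0 < d ^+ size r by rewrite exprn_gt0 //; clear -zP RH simple d1; lra.
  apply: ler_pM; rewrite ?cabs_ge0 ?invr_ge0 ?cabs_ge0 //; last first.
    by rewrite lef_pV2 ?posrE // (lt_le_trans d0).
  have wr : -3 <= cRe w <= 7 by case/andP: bw => /andP[].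
  have wi : T - h <= cIm w <= T + h by case/andP: bw => /andP[].
  apply: (le_trans (HC _ (bd1 w bw) wr)); rewrite -mulrA ler_pM2l; last by clear -zP RH simple C1; lra.
  rewrite -exprMn lerXn2r ?nnegrE ?addr_ge0 ?mulr_ge0 ?addr_ge0 //.
  have : `|cIm w| <= `|T| + h.
    by have := ler_norm T; have := ler_norm (- T); rewrite normrN ler_norml; clear -zP RH simple wi; lra.
  by have := normr_ge0 T; clear -zP RH simple h7 h1; lra.
(* The pole 1 is listed among the removable points only when it lies inside the box. *)
have [i1|S1] := boolP (inbox T h (1 : R[i])).
  apply: (@max_modulus R (-3) 7 (T - h) (T + h) (1 :: r)) => //.
  - by rewrite /= ur andbT; apply/negP => /hr[[]]; rewrite eqxx.
  - by move=> p; rewrite inE => /orP[/eqP ->|/inS].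
  - by move=> w _; exact: dble_zq.
  - by move=> p /zq_lim h'; have [|l [hl _]] := h' ur; [by move=> q /hr[]|exists l].
apply: (@max_modulus R (-3) 7 (T - h) (T + h) r) => //.
- move=> w iw wr; apply: dble_zq; rewrite inE negb_or wr andbT; apply/eqP => w1.
  have [bw|] := boolP (onbd (-3) 7 (T - h) (T + h) w); first by have := bd1 w bw; rewrite w1 eqxx.
  move: S1 iw; rewrite w1 /onbd /inrect /ininterior /=.
  move=> /negP S1 iw; rewrite iw /= => /norP[_ /norP[_ /norP[/eqP a /eqP b]]]; apply: S1.
  move/andP: iw => [_ /andP[i2 i3]]; rewrite !lt_neqAle i2 i3 !andbT.
  by apply/andP; split; [by clear -zP RH simple; lra|apply/andP; split; apply/eqP; [exact/nesym|exact: b]].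
- move=> p pr; have := @zq_lim r p ur; rewrite inE pr orbT => h'.
  by have [| |l [hl _]] := h'; [by move=> q /hr[]| |exists l].
- by move: zr; rewrite inE negb_or => /andP[].
Qed.

Lemma zeta_line2_ge T : 1 / 4 <= cabs ((2 +i* T - 1) * zeta (2 +i* T)).
Proof.
have e1 : 1 <= cabs (2 +i* T - 1).
  have := Re_le_cabs (2 +i* T - 1); have := ler_norm (cRe (2 +i* T - 1)).
  by rewrite cReD cReN /=; lra.
have e2 : 1 / 4 <= cabs (zeta (2 +i* T)) by apply: zeta_ge => //=; lra.
by rewrite cabsM; have := cabs_ge0 (zeta (2 +i* T)); nra.
Qed.

Lemma prod_line2_le T (c d : R) (r : seq R[i]) : 3 / 2 + c <= d ->
  (forall q, q \in r -> nzero q /\ `|cIm q - T| <= c) -> cabs (\prod_(p <- r) (2 +i* T - p)) <= d ^+ size r.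
Proof.
move=> cd hr; apply: prod_le => p /hr[np hp]; apply: (le_trans (cabs_le_ReIm _)).
rewrite cReD cReN cImD cImN (nzero_Re np) /= (ger0_norm (_ : 0 <= 2 - 1 / 2)); last lra.
by rewrite -normrN opprB; lra.
Qed.

(* Comparing the maximum principle on the box with the value at [2 + iT]. *)
Lemma zero_count : exists2 C : R, 1 <= C & forall T (r : seq R[i]), uniq r ->
  (forall q, q \in r -> nzero q /\ `|cIm q - T| <= 1 / 2) ->
  (size r)%:R <= C * Num.sqrt (1 + `|T|).
Proof.
have [C C1 HC] := zq_bound.
have l0 : 0 < ln (3 / 2) :> R by rewrite ln_gt0 //; lra.
pose K := (ln (4 * C) + 12) / ln (3 / 2).
have lC : 0 <= ln (4 * C) by rewrite ln_ge0 //; lra.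
exists (K + 1); first by rewrite lerDr divr_ge0 ?(ltW l0) // addr_ge0.
(* Two candidates for the half height, so that one of them differs from [|T|]. *)
move=> T r ur hr; pose h : R := if `|T| == 5 then 6 else 5.
have h5 : 5 <= h <= 6 by rewrite /h; case: ifP => _; lra.
have Th : `|T| != h by rewrite /h; have [->|] := eqVneq `|T| 5 => //; apply/eqP; lra.
pose a : R[i] := 2 +i* T.
have a1 : a != 1 by apply: neq_Re => /=; lra.
have ar : a \notin r.
  by apply/negP => /hr[na _]; have := nzero_Re na; rewrite /=; lra.
have := HC T h r a; move=> /(_ _ _ ur _ 3) H.
have {H} H : cabs (zq r a) <= C * (1 + `|T|) ^+ 6 / 3 ^+ size r.
  apply: H => //; try (by clear -zP RH simple h5; lra).
  - by move=> q /hr[nq hq]; split=> //; clear -zP RH simple hq h5; lra.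
  - by move=> q /hr[_]; clear -zP RH simple h5; lra.
  - by rewrite /ininterior /=; clear -zP RH simple h5; lra.
  - by rewrite inE negb_or a1.
have P : cabs (\prod_(p <- r) (a - p)) <= 2 ^+ size r.
  by apply: (@prod_line2_le _ (1 / 2)) hr; clear -zP RH simple; lra.
have z4 : 1 / 4 <= cabs ((a - 1) * zeta a) by exact: zeta_line2_ge.
(* The zeros are at distance at least 3 from the boundary and at most 2 from [2 + i T], so each
   contributes a factor [3/2]. Their number is thus logarithmic in [T], and [ln_le_sqrt] weakens
   this to a square root. *)
have E : (3 / 2) ^+ size r <= 4 * C * (1 + `|T|) ^+ 6.
  have p0 : 0 < cabs (\prod_(p <- r) (a - p)) by rewrite cabs_gt0 prodC_neq0.
  move: H; rewrite /zq cabsM cabsV ler_pdivrMr // => H.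
  have t3 : 0 < 3 ^+ size r :> R by rewrite exprn_gt0.
  have t2 : 0 < 2 ^+ size r :> R by rewrite exprn_gt0.
  have : 1 / 4 <= C * (1 + `|T|) ^+ 6 / 3 ^+ size r * 2 ^+ size r.
    apply: (le_trans z4); apply: (le_trans H); rewrite ler_wpM2l //.
    by rewrite divr_ge0 ?(ltW t3) // mulr_ge0 ?exprn_ge0 ?addr_ge0 //; clear -zP RH simple C1; lra.
  move=> h'; rewrite expr_div_n ler_pdivrMr //; move: h'; rewrite mulrAC ler_pdivlMr //.
  by rewrite -[4 * C * _]mulrA; move: (C * _) => c; clear -zP RH simple; lra.
have T0 := normr_ge0 T; have T1 : 0 < 1 + `|T| by clear -zP RH simple T0; lra.
have := E; rewrite -ler_ln ?posrE ?exprn_gt0 ?mulr_gt0 ?exprn_gt0 ?divr_gt0 //; last by clear -zP RH simple C1; lra.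
rewrite lnM ?posrE ?mulr_gt0 ?exprn_gt0 //; last by clear -zP RH simple C1; lra.
rewrite !lnXn ?divr_gt0 // -(mulr_natl _ (size r)) -(mulr_natl _ 6) => L.
have sq := ln_le_sqrt T1; have sq1 : 1 <= Num.sqrt (1 + `|T|) by rewrite -{1}sqrtr1 ler_sqrt //; clear -zP RH simple T0; lra.
have : (size r)%:R <= K * Num.sqrt (1 + `|T|).
  rewrite /K mulrAC ler_pdivlMr // (mulr_natl _ (size r)); apply: (le_trans L).
  by move: (ln (4 * C)) lC => u u0; move: (Num.sqrt _) sq sq1 => v; clear -zP RH simple u0; nra.
by move: (Num.sqrt _) sq1 => v; clear -zP RH simple; lra.
Qed.

(** Lists of distinct zeros in the window have bounded length, so extending a list must stop, and
    then it contains all of them. *)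
Lemma zeros_window : exists2 C : R, 1 <= C & forall T, exists r : seq R[i],
  [/\ uniq r, (forall q, nzero q /\ `|cIm q - T| <= 1 / 2 <-> q \in r) &
      (size r)%:R <= C * Num.sqrt (1 + `|T|)].
Proof.
have [C C1 HC] := zero_count; exists C => // T.
pose P (r : seq R[i]) := uniq r /\ (forall q, q \in r -> nzero q /\ `|cIm q - T| <= 1 / 2).
pose B := Num.truncn (C * Num.sqrt (1 + `|T|)).
have bd r : P r -> (size r <= B)%N.
  by move=> [ur hr]; rewrite truncn_ge_nat ?HC // mulr_ge0 ?sqrtr_ge0 //; lra.
have main k r : P r -> (B - size r <= k)%N ->
    exists r', P r' /\ (forall q, nzero q -> `|cIm q - T| <= 1 / 2 -> q \in r').
  elim: k r => [|k IH] r Pr hk.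
    exists r; split => // q nq hq; apply/negPn/negP => qr.
    have : P (q :: r).
      case: Pr => ur hr; split; first by rewrite /= qr.
      by move=> p; rewrite inE => /orP[/eqP ->|/hr].
    by move=> /bd /=; move: hk (bd _ Pr); rewrite leqn0 subn_eq0 => h1 h2; rewrite ltnNge h1.
  have [[q [nq hq qr]]|H] := pselect (exists q, [/\ nzero q, `|cIm q - T| <= 1 / 2 & q \notin r]); last first.
    exists r; split => // q nq hq; apply/negPn/negP => qr; apply: H; by exists q.
  apply: (IH (q :: r)).
    case: Pr => ur hr; split; first by rewrite /= qr.
    by move=> p; rewrite inE => /orP[/eqP ->|/hr].
  by rewrite /= subnS; move: hk; case: (B - size r)%N.
have [|//|r [[ur hr] Hr]] := main B [::]; first by split.
  by rewrite subn0.
exists r; split => //; last exact: HC.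
by move=> q; split=> [[nq hq]|/hr //]; exact: Hr.
Qed.

Lemma zeros_interval (a b : R) : exists2 r : seq R[i], uniq r &
  forall q, nzero q /\ a <= cIm q <= b <-> q \in r.
Proof.
have [C C1 HC] := zeros_window.
have main n : exists2 r : seq R[i], uniq r & forall q, nzero q /\ a <= cIm q <= a + n%:R <-> q \in r.
  elim: n => [|n [r ur Hr]].
    have [r [ur Hr _]] := HC a; exists [seq q <- r | cIm q == a]; first exact: filter_uniq.
    move=> q; rewrite mem_filter addr0; split=> [[nq hq]|/andP[/eqP E /Hr[nq _]]].
      have E : cIm q = a by lra.
      by rewrite E eqxx /=; apply/Hr; split => //; rewrite E subrr normr0.
    by split => //; rewrite E lexx.
  have [r2 [ur2 Hr2 _]] := HC (a + n%:R + 1 / 2).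
  exists (undup (r ++ r2)); first exact: undup_uniq.
  have [r3 [ur3 Hr3 _]] := HC a.
  move=> q; rewrite mem_undup mem_cat -natr1; split.
    move=> [nq hq]; apply/orP; have [h|h] := leP (cIm q) (a + n%:R).
      by left; apply/Hr; split => //; lra.
    by right; apply/Hr2; split => //; rewrite ler_norml; lra.
  move=> /orP[/Hr[nq hq]|/Hr2[nq]]; first by split => //; lra.
  have n0 : 0 <= n%:R :> R by [].
  by rewrite ler_norml => hq; split => //; lra.
have [r ur Hr] := main (Num.truncn (b - a)).+1.
exists [seq q <- r | cIm q <= b]; first exact: filter_uniq.
move=> q; rewrite mem_filter; split.
  move=> [nq /andP[h1 h2]]; rewrite h2 /=; apply/Hr; split => //.
  by have := truncnS_gt (b - a); lra.
by move=> /andP[h /Hr[nq hq]]; split => //; lra.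
Qed.

(** Eleven unit windows cover the interval; moving the centre by at most 5 multiplies the square
    root by at most 3. *)
Lemma zeros_count_interval : exists2 C : R, 1 <= C & forall T (r : seq R[i]), uniq r ->
  (forall q, q \in r -> nzero q /\ `|cIm q - T| <= 11 / 2) ->
  (size r)%:R <= C * Num.sqrt (1 + `|T|).
Proof.
have [C C1 HC] := zero_count; exists (33 * C); first by lra.
move=> T r ur hr.
have T0 := normr_ge0 T.
pose w j := [seq q <- r | `|cIm q - (T - 5 + j%:R)| <= 1 / 2].
have sz j : (j < 11)%N -> (size (w j))%:R <= C * (3 * Num.sqrt (1 + `|T|)).
  move=> j11; have j10 : j%:R <= 10 :> R by rewrite ler_nat.
  have j0 : 0 <= j%:R :> R by [].
  apply: (le_trans (HC (T - 5 + j%:R) _ (filter_uniq _ ur) _)).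
    by move=> q; rewrite mem_filter => /andP[h /hr[nq _]].
  rewrite ler_pM2l; last by lra.
  have -> : 3 * Num.sqrt (1 + `|T|) = Num.sqrt (3 ^+ 2 * (1 + `|T|)).
    by rewrite sqrtrM ?exprn_ge0 // sqrtr_sqr (ger0_norm (_ : 0 <= 3)).
  rewrite ler_sqrt; last by rewrite mulr_ge0 ?exprn_ge0 //; lra.
  have : `|T - 5 + j%:R| <= `|T| + 5.
    by have := ler_norm T; have := ler_norm (- T); rewrite normrN ler_norml; lra.
  by rewrite expr2; lra.
have cov q : q \in r -> exists2 j, (j < 11)%N & q \in w j.
  move=> qr; have [_] := hr q qr; rewrite ler_norml => hq.
  pose u := cIm q - T + 11 / 2.
  have u0 : 0 <= u by rewrite /u; lra.
  have [u11|u11] := ltP u 11.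
    exists (Num.truncn u); first by rewrite truncn_lt_nat.
    rewrite mem_filter qr andbT; have /andP[] := truncn_itv u0; rewrite -natr1 ler_norml /u; lra.
  exists 10%N => //; rewrite mem_filter qr andbT ler_norml; rewrite /u in u11; lra.
have : (size r <= \sum_(j < 11) size (w j))%N.
  have -> : (\sum_(j < 11) size (w j) = size (flatten [seq w j | j <- iota 0 11]))%N.
    by rewrite -(big_mkord xpredT (fun j => size (w j))) size_flatten /shape -map_comp sumnE big_map.
  apply: uniq_leq_size => // q /cov[j j11 qj]; apply/flattenP; exists (w j) => //.
  by apply/mapP; exists j => //; rewrite mem_iota.
rewrite -(ler_nat R) natr_sum => /le_trans; apply.
apply: (@le_trans _ _ (\sum_(j < 11) C * (3 * Num.sqrt (1 + `|T|)))).
  by apply: ler_sum => j _; exact: sz.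
by rewrite sumr_const card_ord -mulr_natl; have := sqrtr_ge0 (1 + `|T|); nra.
Qed.

(** Pigeonhole: the [n + 1] candidates [c j] are [2 d] apart, so a zero is within [d] of at most one
    of them and some candidate is free. *)
Lemma good_height T (r : seq R[i]) : exists2 T', T <= T' <= T + 1 &
  forall q, q \in r -> (2 * ((size r)%:R + 1))^-1 <= `|cIm q - T'|.
Proof.
pose n := size r; pose d : R := (2 * (n%:R + 1))^-1.
have n0 : 0 <= n%:R :> R by [].
have d0 : 0 < d by rewrite invr_gt0; lra.
have dn : d * (2 * (n%:R + 1)) = 1 by rewrite mulVf // gt_eqF //; lra.
pose c (j : nat) : R := T + d + 2 * d * j%:R.
have [/existsP[j /allP H]|H] := boolP [exists j : 'I_n.+1, all (fun q => d <= `|cIm q - c j|) r].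
  exists (c j); last exact: H.
  have jn : j%:R <= n%:R :> R by rewrite ler_nat -ltnS.
  have j0 : 0 <= j%:R :> R by [].
  by rewrite /c; nra.
have bad (j : 'I_n.+1) : exists2 q, q \in r & `|cIm q - c j| < d.
  move: H; rewrite negb_exists => /forallP/(_ j)/allPn[q qr]; rewrite -ltNge => h.
  by exists q.
have bad' (j : 'I_n.+1) : exists q, (q \in r) && (`|cIm q - c j| < d).
  by have [q qr h] := bad j; exists q; rewrite qr.
pose g (j : 'I_n.+1) : R[i] := xchoose (bad' j).
have gP j : g j \in r /\ `|cIm (g j) - c j| < d by have /andP[] := xchooseP (bad' j).
have ginj : injective g.
  move=> i j E; have [_ hi] := gP i; have [_ hj] := gP j; rewrite E in hi.
  apply: val_inj => /=; apply/eqP; rewrite eqn_leq; apply/andP; split; rewrite leqNgt; apply/negP => lt.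
    have : j.+1%:R <= i%:R :> R by rewrite ler_nat.
    by move: hi hj; rewrite /c -natr1 !ltr_norml; nra.
  have : i.+1%:R <= j%:R :> R by rewrite ler_nat.
  by move: hi hj; rewrite /c -natr1 !ltr_norml; nra.
have : (size (map g (enum 'I_n.+1)) <= n)%N.
  apply: uniq_leq_size; first by rewrite map_inj_uniq ?enum_uniq.
  by move=> q /mapP[j _ ->]; case: (gP j).
by rewrite size_map size_enum_ord ltnn.
Qed.

End Zeros.

(** * A bound for 1 / zeta on horizontal segments *)

Section Horizontal.
Variable R : realType.
Implicit Types (x t T : R) (s z : R[i]) (n N : nat).

Lemma punctured (S : seq R[i]) p : exists2 d : R, 0 < d & forall z, z != p -> cabs (z - p) < d -> z \notin S.
Proof.
elim: S => [|q S [d d0 H]]; first by exists 1.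
have [->|qp] := eqVneq q p.
  by exists d => // z zp zd; rewrite inE negb_or zp H.
exists (Num.min d (cabs (q - p))); first by rewrite lt_min d0 cabs_gt0 subr_eq0.
move=> z zp; rewrite lt_min => /andP[h1 h2]; rewrite inE negb_or H // andbT.
by apply/eqP => E; move: h2; rewrite E ltxx.
Qed.

Lemma horizontal_exponent (m t c v A : R) : m <= m ^+ 2 -> m ^+ 2 <= v * (3 * t) -> c <= c * t ->
  1 <= t -> A = 4 + (c + 6 * (1 + t)) + 8 * m ->
  3 + t + 2 * (m + 1) * m + (4 + 8 * m + 14 * A) <= (300 + 14 * c + 372 * v) * t.
Proof.
move=> h1 h2 h3 h4 ->; have -> : 2 * (m + 1) * m = 2 * m ^+ 2 + 2 * m by ring.
by move: (m ^+ 2) h1 h2 => u h1 h2; lra.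
Qed.

Lemma limat_uniq (f : R[i] -> R[i]) p a b : limat f p a -> limat f p b -> a = b.
Proof.
move=> ha hb; apply/eqP; rewrite -subr_eq0 -cabs_eq0 eq_le cabs_ge0 andbT.
apply/ler_addgt0Pr => e e0; rewrite add0r; have e2 : 0 < e / 2 by rewrite divr_gt0.
have [d d0 H] := ha _ e2; have [d' d0' H'] := hb _ e2.
pose r := Num.min d d' / 2; have r0 : 0 < r by rewrite divr_gt0 // lt_min d0.
have rd : r < d by rewrite /r ltr_pdivrMr // gt_min; apply/orP; left; lra.
have rd' : r < d' by rewrite /r ltr_pdivrMr // gt_min; apply/orP; right; lra.
have zp : p + r%:C != p by rewrite -subr_eq0 addrC addKr -cabs_eq0 cabs_real gtr0_norm ?gt_eqF.
have cr : cabs (p + r%:C - p) = r by rewrite addrC addKr cabs_real gtr0_norm.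
have h1 := H _ zp; have h2 := H' _ zp; rewrite cr in h1 h2.
have -> : a - b = (f (p + r%:C) - b) - (f (p + r%:C) - a) by ring.
by have := cabsB (f (p + r%:C) - b) (f (p + r%:C) - a); have := h1 rd; have := h2 rd'; lra.
Qed.

Variable zeta : R[i]^o -> R[i]^o.
Hypothesis zP : is_riemann_zeta zeta.
Hypotheses (RH : riemann_hypothesis zeta) (simple : simple_zeros zeta).

Lemma nontriv_im s : zeta s = 0 -> cIm s != 0 -> nzero zeta s.
Proof.
move=> s0 si; split => //; first by apply/eqP => E; move: si; rewrite E eqxx.
by move=> n; apply/eqP => E; move: si; rewrite E cImN -(rmorph_nat (real_complex R)) /= oppr0 eqxx.
Qed.

Lemma x_le_expR (x : R) : x <= expR x.
Proof. by have := expR_ge1Dx x; lra. Qed.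

(** Divide zeta by its nearby zeros, take a logarithm of the zero-free quotient, and let
    Borel-Caratheodory turn an upper bound into a lower one. The distances to the [n] zeros cost
    [e^(2 n (n + 1))], which is [e^(O(T))] because [n^2] is O(T). *)
Lemma horizontal_bound : exists2 C : R, 1 <= C & forall T0, 10 <= T0 ->
  exists2 T, T0 <= T <= T0 + 1 & forall x, - (3 / 2) <= x <= 4 ->
    zeta (x +i* T) != 0 /\ (cabs (zeta (x +i* T)))^-1 <= expR (C * T).
Proof.
have [C C1 HC] := zq_bound zP RH simple.
have [C2 C21 HC2] := zeros_count_interval zP RH simple.
exists (300 + 14 * C + 372 * C2 ^+ 2).
  by have := sqr_ge0 C2; lra.
move=> T0 T10.
have [r ur Hr] := zeros_interval zP RH simple (T0 - 5) (T0 + 6).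
have [T TT HT] := good_height T0 r; exists T => //.
pose n := size r; rewrite -/n in HT.
have n0 : 0 <= n%:R :> R by [].
have nb : n%:R <= C2 * Num.sqrt (1 + (T0 + 1 / 2)).
  have := HC2 (T0 + 1 / 2) r ur; rewrite ger0_norm; last lra.
  by apply => q /Hr[nq hq]; split => //; rewrite ler_norml; lra.
have rP q : q \in r -> nzero zeta q /\ `|cIm q - T| <= 6.
  by move=> /Hr[nq hq]; split => //; rewrite ler_norml; clear -zP RH simple TT hq; lra.
have T1 : 10 <= T by lra.
have nn : n%:R <= n%:R ^+ 2 :> R by rewrite -natrX ler_nat; case: (n) => // k; rewrite -mulnn leq_pmulr.
have n2 : n%:R ^+ 2 <= C2 ^+ 2 * (3 * T).
  apply: (@le_trans _ _ ((C2 * Num.sqrt (1 + (T0 + 1 / 2))) ^+ 2)).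
    by rewrite lerXn2r ?nnegrE ?mulr_ge0 ?sqrtr_ge0 //; lra.
  rewrite exprMn sqr_sqrtr; last lra.
  by rewrite ler_wpM2l ?sqr_ge0 //; clear -zP RH simple TT T10; lra.
have tl : 1 <= T by apply: le_trans T1; rewrite ler1n.
have Tn : `|T| = T by rewrite ger0_norm // (le_trans _ tl).
pose K := C * (1 + T) ^+ 6.
have K0 : 0 < K by rewrite mulr_gt0 ?exprn_gt0 //; clear -zP RH simple C1 T1; lra.
have zqK z : inbox T 7 z -> z \notin r -> cabs (zq zeta r z) <= K.
  move=> iz zr; have := HC T 7 r z; rewrite Tn => h.
  have := h _ _ ur _ 1 _ _ _ _ iz; rewrite expr1n divr1; apply; try (by clear -zP RH simple T1; lra).
  - by move=> q /rP[nq hq]; split => //; clear -zP RH simple hq; lra.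
  - by move=> q /rP[_]; clear -zP RH simple; lra.
  - rewrite inE negb_or zr andbT; apply/eqP => z1; move: iz; rewrite z1 /ininterior /=; clear -zP RH simple T1; lra.
have inS q : q \in r -> inbox T 7 q.
  by move=> /rP[nq]; rewrite /ininterior (nzero_Re RH nq) ler_norml; clear -zP RH simple; lra.
have i1 z : inrect (-3) 7 (T - 7) (T + 7) z -> z != 1.
  by move=> iz; apply/eqP => z1; move: iz; rewrite z1 /inrect /=; clear -zP RH simple T1; lra.
have [||||g [g' [gE gd g'd]]] := @removable R (-3) 7 (T - 7) (T + 7) r (zq zeta r) _ _ ur inS; try (by clear -zP RH simple; lra).
- by move=> z iz zr; apply: dble_zq => //; rewrite inE negb_or zr i1.
- move=> p pr; have [|l [hl _]] := @zq_lim R zeta zP simple r p ur (fun q h => (rP q h).1); first by rewrite inE pr orbT.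
  have cz : cts id (fun z : R[i] => z - p) p by exact: cts_subC.
  have := limat_mul_cts hl cz; rewrite subrr mulr0; apply: eq_limat => z _; exact: mulrC.
have gl p : inbox T 7 p -> forall l, limat (zq zeta r) p l -> g p = l.
  move=> ip l hl; apply: (limat_uniq (limat_cts (hasd_cts (gd p ip)))).
  have [d d0 Hd] := punctured r p; have [e e0 He] := near_interior ip.
  have de : 0 < Num.min d e by rewrite lt_min d0.
  apply: (limat_near de _ hl) => z zp; rewrite lt_min => /andP[h1 h2].
  by rewrite gE ?He ?Hd.
have gK z : inbox T 7 z -> cabs (g z) <= K.
  move=> iz; have [zr|zr] := boolP (z \in r); last by rewrite gE ?zqK.
  apply/ler_addgt0Pr => e e0; have [d d0 Hd] := hasd_cts (gd z iz) e0.
  have [d1 d10 Hd1] := punctured r z; have [d2 d20 Hd2] := near_interior iz.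
  pose m := Num.min d (Num.min d1 d2) / 2.
  have mm : 0 < Num.min d (Num.min d1 d2) by rewrite !lt_min d0 d10.
  have m0 : 0 < m by rewrite divr_gt0.
  have mlt : m < Num.min d (Num.min d1 d2) by rewrite /m; clear -zP RH simple mm; lra.
  move: mlt; rewrite !lt_min => /and3P[m1 m2 m3].
  have cr : cabs (z + m%:C - z) = m by rewrite addrC addKr cabs_real gtr0_norm.
  have zm : z + m%:C != z by rewrite -subr_eq0 -cabs_eq0 cr gt_eqF.
  have q1 : cabs (g (z + m%:C) - g z) < e by apply: Hd; rewrite cr.
  have q2 : cabs (g (z + m%:C)) <= K.
    by rewrite gE ?Hd2 ?Hd1 ?cr // zqK ?Hd2 ?Hd1 ?cr.
  have := cabsB (g (z + m%:C)) (g (z + m%:C) - g z).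
  by rewrite opprB addrCA subrr addr0; clear -zP RH simple q1 q2; lra.
(* Every zero in this box is listed in [r], since [T - 9/2 >= T0 - 5] and [T + 9/2 <= T0 + 6]; so
   [g] has no zero here. *)
pose x0 : R := - (5 / 2); pose x1 : R := 13 / 2; pose y0 := T - 9 / 2; pose y1 := T + 9 / 2.
have sub z : inrect x0 x1 y0 y1 z -> inbox T 7 z.
  by rewrite /inrect /ininterior /x0 /x1 /y0 /y1; clear -zP RH simple; lra.
have g0 z : inrect x0 x1 y0 y1 z -> g z != 0.
  move=> iz; have iz' := sub z iz; have [zr|zr] := boolP (z \in r).
    have [|l [hl l0]] := @zq_lim R zeta zP simple r z ur (fun q h => (rP q h).1); first by rewrite inE zr orbT.
    by rewrite (gl z iz' l hl).
  rewrite gE // /zq mulf_neq0 ?invr_eq0 ?prodC_neq0 // mulf_neq0 //.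
    by rewrite subr_eq0 i1 // interior_inrect.
  apply: contraNneq zr => z0; apply/Hr.
  have zi : y0 <= cIm z <= y1 by case/andP: iz.
  rewrite /y0 /y1 in zi; split; last by clear -zP RH simple zi TT; lra.
  by apply: nontriv_im => //; apply/eqP; clear -zP RH simple zi T1; lra.
pose a : R[i] := 2 +i* T.
have ia : ininterior x0 x1 y0 y1 a by rewrite /ininterior /x0 /x1 /y0 /y1 /=; clear -zP RH simple; lra.
have [|||L [dL La EL]] := @log_exists R g g' x0 x1 y0 y1 a _ _ _ ia.
- by move=> z /sub; exact: gd.
- by move=> z /sub; exact: g'd.
- exact: g0.
have ia' := interior_inrect ia.
have ar : a \notin r by apply/negP => /rP[na _]; have := nzero_Re RH na; rewrite /=; clear -zP RH simple; lra.
have z4 : 1 / 4 <= cabs ((a - 1) * zeta a) by exact: zeta_line2_ge.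
have P8 : cabs (\prod_(p <- r) (a - p)) <= 8 ^+ n.
  by apply: (prod_line2_le RH _ rP); clear -zP RH simple; lra.
have Pa0 : 0 < cabs (\prod_(p <- r) (a - p)) by rewrite cabs_gt0 prodC_neq0.
have ga : 1 <= 4 * 8 ^+ n * cabs (g a).
  rewrite gE ?sub // /zq cabsM cabsV.
  set P := cabs (\prod_(p <- r) _) in P8 Pa0 *; set Z := cabs _ in z4 *.
  have -> : 4 * 8 ^+ n * (Z / P) = 4 * Z * (8 ^+ n / P) by ring.
  have q : 1 <= 8 ^+ n / P by rewrite ler_pdivlMr // mul1r.
  by move: (8 ^+ n / P) q => v; clear -zP RH simple z4; nra.
have ga0 : 0 < cabs (g a) by rewrite cabs_gt0 g0.
(* [e^A] majorises [K / |g a|]: a factor 4 for the lower bound of zeta at [a], [8^n] for the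
   distances from [a] to the zeros, and the polynomial bound [K]. *)
pose A : R := 4 + (C + 6 * (1 + T)) + 8 * n%:R.
have A0 : 0 < A by rewrite /A; clear -zP RH simple n0 C1 T1; lra.
have e8 : 8 ^+ n <= expR (8 * n%:R) :> R.
  rewrite mulrC expRM_natl lerXn2r ?nnegrE ?expR_ge0 //; exact: x_le_expR.
have eK : K <= expR (C + 6 * (1 + T)).
  rewrite expRD; apply: ler_pM; [by clear -zP RH simple C1; lra|by rewrite exprn_ge0 //; clear -zP RH simple T1; lra|exact: x_le_expR|].
  rewrite expRM_natl lerXn2r ?nnegrE ?expR_ge0 ?x_le_expR //; clear -zP RH simple T1; lra.
have eA : 4 * 8 ^+ n * K <= expR A.
  have -> : expR A = expR 4 * expR (8 * n%:R) * expR (C + 6 * (1 + T)).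
    by rewrite -!expRD; congr expR; rewrite /A; ring.
  apply: ler_pM; [by rewrite mulr_ge0 ?exprn_ge0|exact: ltW| |exact: eK].
  by apply: ler_pM; rewrite ?exprn_ge0 ?x_le_expR.
have sq z : inrect (cRe a - 4) (cRe a + 4) (cIm a - 4) (cIm a + 4) z ->
   ininterior x0 x1 y0 y1 z.
  by rewrite /inrect /ininterior /x0 /x1 /y0 /y1 /a /=; clear -zP RH simple; lra.
have ReL z : ininterior x0 x1 y0 y1 z -> cabs (g z) = cabs (g a) * expR (cRe (L z)).
  by move=> iz; rewrite EL // cabsM cabs_cexp.
have LA z : ininterior x0 x1 y0 y1 z -> cRe (L z) <= A.
  move=> iz; rewrite -ler_expR; apply: le_trans eA.
  have h1 := ReL z iz; have h2 := gK z (sub z (interior_inrect iz)); rewrite h1 in h2.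
  have E0 := expR_ge0 (cRe (L z)).
  apply: (@le_trans _ _ (4 * 8 ^+ n * cabs (g a) * expR (cRe (L z)))).
    by rewrite ler_peMl.
  by rewrite -mulrA ler_wpM2l // mulr_ge0 // exprn_ge0.
move=> x xx; pose b : R[i] := x +i* T.
have ib : ininterior x0 x1 y0 y1 b by rewrite /ininterior /x0 /x1 /y0 /y1 /=; clear -zP RH simple xx; lra.
have cb : cabs (b - a) <= 7 / 8 * 4.
  apply: (le_trans (cabs_le_ReIm _)); rewrite cReD cReN cImD cImN /= subrr normr0 addr0 ler_norml; clear -zP RH simple xx; lra.
(* Half side 4 with ratio [7/8] reaches from the centre [2 + i T] to [Re s = -3/2]. *)
have LB : cabs (L b) <= 14 * A.
  have := @borel_caratheodory R L a 4 A (7 / 8) b ltac:(by []) A0 ltac:(clear -zP RH simple; lra).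
  move=> /(_ (fun z h => dL z (sq z h)) La (fun z h => LA z (sq z h)) cb).
  by rewrite (_ : 2 * A * (7 / 8) / (1 - 7 / 8) = 14 * A) //; field.
have ReLB : - (14 * A) <= cRe (L b) by have := Re_le_cabs (L b); rewrite ler_norml; clear -zP RH simple LB; lra.
have dist q : q \in r -> (2 * (n%:R + 1))^-1 <= cabs (b - q).
  move=> qr; apply: (le_trans (HT q qr)); have := Im_le_cabs (b - q).
  by rewrite cImD cImN /= distrC.
have d0 : 0 < (2 * (n%:R + 1))^-1 :> R by rewrite invr_gt0; clear -zP RH simple n0; lra.
have br : b \notin r.
  by apply/negP => /dist; rewrite subrr cabs0; clear -zP RH simple d0; lra.
have Pb := prod_ge (ltW d0) dist.
have iB := interior_inrect ib.
have zb : zeta b != 0.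
  have := g0 b iB; rewrite gE ?sub // /zq; apply: contra => /eqP ->.
  by rewrite mulr0 mul0r.
split => //; rewrite -/b.
have b1 : cabs (b - 1) <= 3 + T.
  apply: (le_trans (cabs_le_ReIm _)); rewrite cReD cReN cImD cImN /= oppr0 addr0 Tn.
  have : `|x - 1| <= 3 by rewrite ler_norml; clear -zP RH simple xx; lra.
  by clear -zP RH simple; lra.
have b10 : 0 < cabs (b - 1) by rewrite cabs_gt0 subr_eq0 i1 // interior_inrect // sub.
have gb := ReL b ib; rewrite gE ?sub // /zq !cabsM cabsV in gb.
set Zb := cabs (zeta b) in gb *; set P := cabs (\prod_(p <- r) (b - p)) in gb Pb.
have P0 : 0 < P by rewrite /P cabs_gt0 prodC_neq0.
have Zb0 : 0 < Zb by rewrite cabs_gt0.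
have Einv : Zb^-1 = cabs (b - 1) / P / (cabs (g a) * expR (cRe (L b))).
  by rewrite -gb; field; rewrite !gt_eqF.
have f1 : (cabs (g a))^-1 <= 4 * 8 ^+ n.
  by rewrite -[leLHS]mul1r ler_pdivrMr.
have f2 : (expR (cRe (L b)))^-1 <= expR (14 * A) by rewrite -expRN ler_expR lerNl.
have f3 : P^-1 <= expR ((2 * (n%:R + 1)) * n%:R).
  rewrite mulrC expRM_natl; apply: (@le_trans _ _ ((2 * (n%:R + 1)) ^+ n)).
    rewrite -[leRHS]invrK lef_pV2 ?posrE ?invr_gt0 ?exprn_gt0 -?exprVn //; clear -zP RH simple n0; lra.
  by rewrite lerXn2r ?nnegrE ?expR_ge0 ?x_le_expR //; clear -zP RH simple n0; lra.
rewrite Einv invfM.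
have F : cabs (b - 1) / P * ((cabs (g a))^-1 / expR (cRe (L b))) <=
    expR (3 + T) * expR ((2 * (n%:R + 1)) * n%:R) * (expR 4 * expR (8 * n%:R) * expR (14 * A)).
  apply: ler_pM; rewrite ?mulr_ge0 ?invr_ge0 ?cabs_ge0 ?expR_ge0 ?(ltW P0) //.
    by apply: ler_pM; rewrite ?invr_ge0 ?cabs_ge0 ?(ltW P0) // (le_trans b1) // x_le_expR.
  apply: ler_pM; rewrite ?invr_ge0 ?cabs_ge0 ?expR_ge0 //.
  by apply: (le_trans f1); apply: ler_pM; rewrite ?exprn_ge0 // x_le_expR.
apply: (le_trans F); rewrite -!expRD ler_expR.
have CT : C <= C * T := ler_peMr (le_trans ler01 C1) tl.
apply: (le_trans _ (horizontal_exponent nn n2 CT tl (erefl A))).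
by first [exact: lexx | rewrite le_eqVlt; apply/orP; left; apply/eqP; ring].
Qed.

End Horizontal.

(** * The Dirichlet series of the totient *)

Section Dirichlet.
Variable R : realType.
Implicit Types (x v : R) (s z : R[i]) (n N a b : nat).

Lemma sum_multiples (V : nmodType) a N (F : nat -> V) : (0 < a)%N ->
  \sum_(1 <= n < N.+1 | (a %| n)%N) F n = \sum_(1 <= b < (N %/ a).+1) F (a * b)%N.
Proof.
move=> a0; elim: N => [|N IH]; first by rewrite div0n !big_geq.
rewrite big_mkcond big_nat_recr //= -big_mkcond IH divnS //.
have [aN|aN] := boolP (a %| N.+1)%N; last by rewrite addr0 add0n.
rewrite add1n [RHS]big_nat_recr //=; congr (_ + F _).
by move: (divnS N a0); rewrite aN add1n => <-; rewrite mulnC divnK.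
Qed.

Definition totD N s : R[i] := \sum_(1 <= n < N.+1) (totient n)%:R * cpw n%:R (- s).

(** Gauss's identity writes [n] as the sum of [phi(a)] over [a | n]; then the summations are
    exchanged with [n = a b]. *)
Lemma totD_conv N s : \sum_(1 <= n < N.+1) n%:R * cpw (n%:R : R) (- s) =
  \sum_(1 <= a < N.+1) (totient a)%:R * cpw a%:R (- s) * \sum_(1 <= b < (N %/ a).+1) cpw b%:R (- s).
Proof.
transitivity (\sum_(1 <= n < N.+1) \sum_(1 <= a < N.+1 | (a %| n)%N) (totient a)%:R * cpw (n%:R : R) (- s)).
  apply: eq_big_nat => n /andP[n0 nN].
  rewrite -mulr_suml -natr_sum; congr (_%:R * _).
  rewrite -{1}(sum_totient_dvd n) -(big_mkord (fun d => (d %| n)%N) totient).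
  rewrite big_ltn_cond // dvd0n eqn0Ngt n0 /=.
  rewrite (@big_cat_nat _ _ _ n.+1 1 N.+1) //= [X in _ = (_ + X)%N]big1_seq ?addn0 // => a /andP[an].
  rewrite mem_index_iota => /andP[na _]; move: (dvdn_leq n0 an); by rewrite leqNgt na.
rewrite (exchange_big_dep_nat xpredT) //=; apply: eq_big_nat => a /andP[a0 _].
rewrite -mulr_sumr sum_multiples // mulrAC -mulrA; congr (_ * _).
rewrite mulr_suml; apply: eq_big_nat => b /andP[b0 _].
by rewrite natrM cpwM ?ltr0n // mulrC.
Qed.

Variable zeta : R[i]^o -> R[i]^o.
Hypothesis zP : is_riemann_zeta zeta.

Let cabs_pw n s : (0 < n)%N -> 4 <= cRe s -> cabs (cpw (n%:R : R) (- s)) <= n%:R ^- 4.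
Proof.
move=> n0 sr; have n0' : 0 < n%:R :> R by rewrite ltr0n.
by rewrite cabs_cpw cReN -(rpw_nat 4 n0') -rpwN; apply: rpw_leW; [rewrite ler1n|lra].
Qed.

Lemma zeta_partial N s : (0 < N)%N -> 2 <= cRe s ->
  cabs (\sum_(1 <= n < N.+1) cpw (n%:R : R) (- s) - zeta s) <= N%:R^-1.
Proof.
move=> N0 sr; have s1 : 1 < cRe s by lra.
rewrite cabsBC; apply: (cseq_le (cseqB (zeta_cseq zP s1) (cseq_cst _))).
exists N => M NM; rewrite (@big_cat_nat _ _ _ N.+1 1 M.+1) //= addrAC subrr add0r.
apply: (le_trans (cabs_sum _ _ _)).
apply: (@le_trans _ _ (\sum_(N.+1 <= k < M.+1) (k%:R ^- 2 : R))).
  rewrite big_nat [leRHS]big_nat; apply: ler_sum => k /andP[k2 _].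
  have k0 : 0 < k%:R :> R by rewrite ltr0n (leq_trans _ k2).
  rewrite cabs_cpw cReN -(rpw_nat 2 k0) -rpwN; apply: rpw_leW; first by rewrite ler1n (leq_trans _ k2).
  by lra.
by apply: (le_trans (inv_sqr_tail _ N0 NM)); rewrite gerBl invr_ge0.
Qed.

Let tot_le n : (totient n <= n)%N.
Proof. by rewrite -{2}(sum_totient_dvd n) (bigD1 ord_max) //= leq_addr. Qed.

Lemma sum_sq N : \sum_(1 <= n < N.+1) (n%:R ^- 2 : R) <= 2.
Proof.
case: N => [|N]; first by rewrite big_geq.
rewrite big_ltn //; have h : 0 <= N.+1%:R^-1 :> R by rewrite invr_ge0.
apply: (@le_trans _ _ (1 + (1 - N.+1%:R^-1))); last by move: (N.+1%:R^-1) h => x x0; lra.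
apply: lerD; first by rewrite expr1n invr1.
by apply: (le_trans (@inv_sqr_tail R 1 N.+1 isT isT)); rewrite invr1.
Qed.

Lemma totD_term n s : (0 < n)%N -> 4 <= cRe s ->
  cabs ((totient n)%:R * cpw (n%:R : R) (- s)) <= n%:R ^- 3.
Proof.
move=> n0 sr; rewrite cabsM cabs_nat; have n0' : 0 < n%:R :> R by rewrite ltr0n.
apply: (@le_trans _ _ (n%:R * n%:R ^- 4)).
  by apply: ler_pM; rewrite ?cabs_ge0 // ?ler_nat ?tot_le ?cabs_pw.
by rewrite [_ ^+ 4]exprS invfM mulrA mulfV ?mul1r ?gt_eqF.
Qed.

Lemma totD_tail N M s : (0 < N)%N -> (N <= M)%N -> 4 <= cRe s ->
  cabs (totD M s - totD N s) <= N%:R^-1.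
Proof.
move=> N0 NM sr; rewrite /totD (@big_cat_nat _ _ _ N.+1 1 M.+1) //= addrAC subrr add0r.
apply: (le_trans (cabs_sum _ _ _)).
apply: (@le_trans _ _ (\sum_(N.+1 <= k < M.+1) (k%:R ^- 2 : R))).
  rewrite big_nat [leRHS]big_nat; apply: ler_sum => k /andP[k2 _].
  have k0 : (0 < k)%N by exact: leq_trans k2.
  apply: (le_trans (totD_term k0 sr)); rewrite lef_pV2 ?posrE ?exprn_gt0 ?ltr0n //.
  by rewrite ler_weXn2l // ler1n.
by apply: (le_trans (inv_sqr_tail _ N0 NM)); rewrite gerBl invr_ge0.
Qed.

(** In the finite convolution the inner zeta sum stops at [N / a]; its error O(a / N) is summable
    against the bound [a^(-3)] for the outer terms. *)
Lemma totD_lim s : 4 <= cRe s -> cseq (totD ^~ s) (zeta (s - 1) / zeta s).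
Proof.
move=> sr; have z0 : zeta s != 0.
  by rewrite -cabs_gt0; apply: (@lt_le_trans _ _ (1 / 4)); [lra|apply: zeta_ge => //; lra].
have h1 : cseq (fun N => \sum_(1 <= n < N.+1) n%:R * cpw (n%:R : R) (- s)) (zeta (s - 1)).
  have sr1 : 1 < cRe (s - 1) by rewrite cReD cReN /=; lra.
  apply: eq_cseq (zeta_cseq zP sr1); exists 0%N => N _; apply: eq_big_nat => n /andP[n0 _].
  have n0' : 0 < n%:R :> R by rewrite ltr0n.
  by rewrite opprB addrC cpwD cpwx1 // mulrC (rmorph_nat (real_complex R)).
have h2 : cseq (fun N => \sum_(1 <= n < N.+1) n%:R * cpw (n%:R : R) (- s) - zeta s * totD N s) 0.
  move=> e e0; exists (Num.truncn (4 / e)).+1 => N hN; rewrite subr0.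
  have N1 : 4 / e < N%:R by apply: lt_le_trans (truncnS_gt _) _; rewrite ler_nat.
  have N0 : (0 < N)%N by exact: leq_trans hN.
  have n0 : 0 < N%:R :> R by rewrite ltr0n.
  rewrite totD_conv /totD mulr_sumr -sumrB; apply: (le_trans (cabs_sum _ _ _)).
  apply: (@le_trans _ _ (\sum_(1 <= a < N.+1) a%:R ^- 2 * (2 / N%:R))); last first.
    rewrite -mulr_suml; have h := sum_sq N; apply: (@le_trans _ _ (2 * (2 / N%:R))).
      by rewrite ler_wpM2r // divr_ge0.
    by rewrite mulrA ler_pdivrMr //; move: N1; rewrite ltr_pdivrMr //; lra.
  rewrite big_nat [leRHS]big_nat; apply: ler_sum => a /andP[a0 aN].
  have Na : (0 < N %/ a)%N by rewrite divn_gt0.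
  rewrite mulrC -mulrBl mulrC -/(zeta s) -[X in cabs (_ * (X - _))]/(\sum_(1 <= b < (N %/ a).+1) cpw b%:R (- s)).
  rewrite cabsM; have t1 := totD_term a0 sr; have t2 := @zeta_partial (N %/ a) s Na ltac:(lra).
  apply: (le_trans (ler_pM (cabs_ge0 _) (cabs_ge0 _) t1 t2)).
  have a0' : 0 < a%:R :> R by rewrite ltr0n.
  (* The factor 2 pays for rounding down the quotient. *)
  have q : (N %/ a)%:R^-1 <= 2 * a%:R / N%:R :> R.
    rewrite ler_pdivlMr // mulrC ler_pdivrMr ?ltr0n // -!natrM ler_nat.
    by have := divn_eq N a; have := ltn_pmod N a0; nia.
  apply: (@le_trans _ _ (a%:R ^- 3 * (2 * a%:R / N%:R))).
    by rewrite ler_wpM2l // invr_ge0 exprn_ge0.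
  by rewrite le_eqVlt; apply/orP; left; apply/eqP; field; rewrite !gt_eqF.
have h3 := cseqZ (zeta s)^-1 (cseqB h1 h2); rewrite subr0 in h3.
rewrite mulrC; apply: eq_cseq h3; exists 0%N => N _.
by rewrite opprB addrC subrK mulKf.
Qed.

Lemma totD_dist N s : (0 < N)%N -> 4 <= cRe s ->
  cabs (zeta (s - 1) / zeta s - totD N s) <= N%:R^-1.
Proof.
move=> N0 sr; apply: (cseq_le (cseqB (totD_lim sr) (cseq_cst _))); exists N => M NM.
exact: totD_tail.
Qed.

End Dirichlet.

(** * Perron's formula *)

Section Perron.
Variable R : realType.
Implicit Types (x v T : R) (s z : R[i]) (n N k : nat).

Definition pk v k s : R[i] := cexp (v%:C * s) / s ^+ k.

Lemma hasd_pk v k s : s != 0 -> hasd id (pk v k) s (v%:C * pk v k s - k%:R * pk v k.+1 s).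
Proof.
move=> s0; have hx := @hasdX R _ id id s 1 k (hasd_id id s).
have he := hasd_cexp_comp (hasdZ v%:C (hasd_id id s)).
have sk : s ^+ k != 0 by rewrite expf_neq0.
have := @hasd_div R _ id (fun t => cexp (v%:C * t)) (fun t => t ^+ k) s _ _ sk he hx; rewrite /pk.
rewrite (_ : _ - _ = v%:C * (cexp (v%:C * s) / s ^+ k) - k%:R * (cexp (v%:C * s) / s ^+ k.+1)) //.
rewrite !mulr1; case: k hx sk => [|k] hx sk.
  by rewrite !mul0r !expr0 !mulr0 !mul0r invr1 !mulr1 mulrC.
by rewrite /= !exprS; move: (s ^+ k) (cexp _) (expf_neq0 k s0) => u c u0; field; rewrite u0 s0.
Qed.

Lemma dble_pk v k s : s != 0 -> dble (pk v k) s.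
Proof. by move=> s0; eexists; exact: hasd_pk. Qed.

(** By [hasd_pk] the combination [v pk v k.+1 - k.+1 pk v k.+2] is a derivative and integrates to 0.
    This recursion raises the order of the pole, starting from the simple one, given by Cauchy's
    formula. *)
Lemma RI_pk v k (x0 x1 y0 y1 : R) : ininterior x0 x1 y0 y1 (0 : R[i]) ->
  RI (pk v k.+1) x0 x1 y0 y1 = (2 * pi)%:C * ii * (v ^+ k / k`!%:R)%:C.
Proof.
move=> i0; have [x01 y01] := interior_le i0.
have nz z : onbd x0 x1 y0 y1 z -> z != 0 by exact: bd_neq.
elim: k => [|k IH].
  rewrite expr0 fact0 divr1 mulr1.
  have := @cauchy_formula R x0 x1 y0 y1 [::] (fun s => cexp (v%:C * s)) isT.
  move=> /(_ _ _ 0 _ i0 isT) h; rewrite mulr0 cexp0 mulr1 in h.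
  rewrite -h //; last by move=> z _ _; eexists; exact: hasd_cexp_comp (hasdZ v%:C (hasd_id id z)).
  by apply: eq_RI => // z _; rewrite /pk expr1 subr0.
have E : RI (fun s => v%:C * pk v k.+1 s - k.+1%:R * pk v k.+2 s) x0 x1 y0 y1 = 0.
  apply: (@RI_primitive R x0 x1 y0 y1 x01 y01 _ (pk v k.+1)) => z /nz z0; last exact: hasd_pk.
  by apply: ctsB; (apply: ctsM; [exact: cts_cst|exact/dble_cts/dble_pk]).
have c1 z : onbd x0 x1 y0 y1 z -> cts id (pk v k.+1) z by move=> /nz z0; exact/dble_cts/dble_pk.
have c2 z : onbd x0 x1 y0 y1 z -> cts id (pk v k.+2) z by move=> /nz z0; exact/dble_cts/dble_pk.
move: E; rewrite RIB //; last 2 first.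
- by move=> z bz; apply: ctsM; [exact: cts_cst|exact: c1].
- by move=> z bz; apply: ctsM; [exact: cts_cst|exact: c2].
rewrite !RIZ // IH => /eqP; rewrite subr_eq0 => /eqP E.
have k0 : k.+1%:R != 0 :> R[i] by rewrite pnatr_eq0.
apply: (mulfI k0); rewrite -E.
have -> : k.+1%:R = (k.+1%:R : R)%:C :> R[i] by rewrite (rmorph_nat (real_complex R)).
rewrite mulrCA [RHS]mulrCA; congr (_ * _); rewrite -!rmorphM /=; congr (_%:C).
have f0 : (k`!%:R : R) != 0 by rewrite pnatr_eq0 -lt0n fact_gt0.
have k0' : (k.+1%:R : R) != 0 by rewrite pnatr_eq0.
rewrite factS natrM exprS; move: (k.+1%:R : R) (k`!%:R : R) (v ^+ k) k0' f0 => a b c a0 b0.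
by field; rewrite a0 b0.
Qed.

(** The weight of the term [n] in [F], as a function of [v = log x - log n], cut off below 0. *)
Definition vpos v k : R := if 0 <= v then v ^+ k / k`!%:R else 0.

Lemma cabs_pk_le v k s T : 1 <= T -> T <= cabs s -> (2 <= k)%N ->
  cabs (pk v k s) <= expR (v * cRe s) / T ^+ 2.
Proof.
move=> T1 Ts k2; rewrite /pk cabsM cabsV cabsX cabs_cexp cReM /= mul0r subr0.
rewrite ler_wpM2l ?expR_ge0 // lef_pV2 ?posrE ?exprn_gt0 //; try lra.
apply: (@le_trans _ _ (cabs s ^+ 2)); first by rewrite lerXn2r ?nnegrE //; lra.
by rewrite ler_weXn2l //; lra.
Qed.

Let perron_aux (A B D q a b c T : R) : 0 <= q -> 0 <= T -> a <= 5 * T -> b <= 5 * T -> c <= 2 * T ->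
  A <= 2 * q * a -> B <= 2 * q * b -> D <= 2 * q * c -> A + B + D <= 40 * (q * T).
Proof.
move=> q0 T0 ha hb hc hA hB hD.
have := ler_wpM2l q0 ha; have := ler_wpM2l q0 hb; have := ler_wpM2l q0 hc.
have := mulr_ge0 q0 T0; rewrite -!mulrA in hA hB hD; rewrite !(mulrCA q).
lra.
Qed.

Let fin0 (b t l r : R[i]) : b - t + ii * (l - r) = 0 -> cabs r <= cabs b + cabs t + cabs l.
Proof.
have i0 : ii != 0 :> R[i] by rewrite -cabs_eq0 cabs_i oner_eq0.
move=> E; have -> : r = l + (b - t) / ii.
  by apply: (mulfI i0); rewrite mulrDr mulrCA mulfV // mulr1 -[LHS]addr0 -E; ring.
apply: (le_trans (cabsD _ _)); rewrite cabsM cabsV cabs_i invr1 mulr1.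
by have := cabsB b t; lra.
Qed.

(** For [v >= 0] the segment is closed by a rectangle reaching left to [- T], which contains the
    pole; for [v < 0] by one reaching right to [T + 4], which does not. On all other sides the
    integrand is at most [e^(4 v) / T^2], over a length O(T). *)
Lemma perron v k T : (1 <= k)%N -> 1 <= T ->
  cabs (cI (fun t => pk v k.+1 (4 +i* t)) (- T) T - (2 * pi * vpos v k)%:C) <= 40 * expR (v * 4) / T.
Proof.
move=> k1 T1; have T0 : 0 < T by lra.
have TT : - T <= T by lra.
have E0 := expR_ge0 (v * 4).
have Tn : `|T| = T by rewrite ger0_norm //; lra.
have ImT (a b : R) : T <= `|b| -> T <= cabs (a +i* b).
  by move=> h; apply: (le_trans h); exact: (Im_le_cabs (a +i* b)).
have hor (a b y : R) : a <= b -> T <= `|y| -> (forall x, a <= x <= b -> v * x <= v * 4) ->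
    cabs (cI (fun t => pk v k.+1 (t +i* y)) a b) <= 2 * (expR (v * 4) / T ^+ 2) * (b - a).
  move=> ab Ty vx; have nz x : x +i* y != 0 :> R[i].
    by rewrite -cabs_gt0 (lt_le_trans T0) // ImT.
  apply: cI_le => //; first by apply: cts_integrable => x _; apply: cts_hor; exact/dble_cts/dble_pk.
  move=> x xx; apply: (le_trans (@cabs_pk_le v k.+1 (x +i* y) T T1 (ImT x y Ty) k1)).
  by rewrite ler_wpM2r ?invr_ge0 ?exprn_ge0 ?(ltW T0) // ler_expR /= vx.
have ver (x : R) : T <= `|x| -> v * x <= v * 4 ->
    cabs (cI (fun t => pk v k.+1 (x +i* t)) (- T) T) <= 2 * (expR (v * 4) / T ^+ 2) * (T - - T).
  move=> Tx vx; have Tx' t : T <= cabs (x +i* t) by apply: (le_trans Tx); exact: (Re_le_cabs (x +i* t)).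
  apply: cI_le => //.
    apply: cts_integrable => t _; apply: cts_ver; apply/dble_cts/dble_pk.
    by rewrite -cabs_gt0 (lt_le_trans T0).
  move=> t _; apply: (le_trans (@cabs_pk_le v k.+1 (x +i* t) T T1 (Tx' t) k1)).
  by rewrite ler_wpM2r ?invr_ge0 ?exprn_ge0 ?(ltW T0) // ler_expR.
have TT2 : T / T ^+ 2 = T^-1 by rewrite expr2 invfM mulrA mulfV ?mul1r ?gt_eqF.
have fin (A B C D r : R[i]) : (A - B + ii * (r - D) = C) ->
   cabs (r - (C / ii)) <= cabs A + cabs B + cabs D.
  move=> <-; have i0 : ii != 0 :> R[i] by rewrite -cabs_eq0 cabs_i oner_eq0.
  have -> : r - (A - B + ii * (r - D)) / ii = D - (A - B) / ii by field.
  apply: (le_trans (cabsB _ _)); rewrite cabsM cabsV cabs_i invr1 mulr1.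
  by have := cabsB A B; lra.
have i0 : ii != 0 :> R[i] by rewrite -cabs_eq0 cabs_i oner_eq0.
have NT : T <= `|- T| by rewrite normrN Tn.
have PT : T <= `|T| by rewrite Tn.
rewrite /vpos; have [v0|v0] := leP 0 v.
  have I0 : ininterior (- T) 4 (- T) T (0 : R[i]) by rewrite /ininterior /=; lra.
  have := fin _ _ _ _ _ (RI_pk v k I0).
  have -> : (2 * pi)%:C * ii * (v ^+ k / k`!%:R)%:C / ii = (2 * pi * (v ^+ k / k`!%:R))%:C :> R[i].
    by rewrite mulrAC mulfK // -rmorphM.
  move=> /le_trans; apply.
  have hx x : - T <= x <= 4 -> v * x <= v * 4 by move=> /andP[_ h]; rewrite ler_wpM2l.
  have hm : - T <= - T <= 4 by rewrite lexx /=; lra.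
  have hT4 : - T <= 4 by lra.
  have b1 := hor (- T) 4 (- T) hT4 NT hx; have b2 := hor (- T) 4 T hT4 PT hx.
  have b3 := ver (- T) NT (hx (- T) hm).
  have -> : 40 * expR (v * 4) / T = 40 * (expR (v * 4) / T ^+ 2 * T) by rewrite -TT2; ring.
  have q0 : 0 <= expR (v * 4) / T ^+ 2 by rewrite divr_ge0 // exprn_ge0 // ltW.
  by apply: (perron_aux q0 (ltW T0) _ _ _ b1 b2 b3); move: T1; clear; lra.
have I0 : RI (pk v k.+1) 4 (T + 4) (- T) T = 0.
  apply: goursat => //; first by lra.
  move=> z iz; apply: dble_pk; apply/eqP => z0; move: iz; rewrite z0 /inrect /=; lra.
have hx x : 4 <= x <= T + 4 -> v * x <= v * 4 by move=> /andP[h _]; rewrite ler_wnM2l // ltW.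
have hT4 : 4 <= T + 4 by lra.
have hT5 : 4 <= T + 4 <= T + 4 by rewrite hT4 lexx.
have hT6 : T <= `|T + 4| by rewrite ger0_norm; lra.
have b1 := hor 4 (T + 4) (- T) hT4 NT hx; have b2 := hor 4 (T + 4) T hT4 PT hx.
have b3 : cabs (cI (fun t => pk v k.+1 ((T + 4) +i* t)) (- T) T) <= 2 * (expR (v * 4) / T ^+ 2) * (T - - T).
  by apply: ver => //; exact: hx.
rewrite mulr0 subr0; move: I0; rewrite /RI => I0.
have h := fin0 I0.
apply: (le_trans h).
have -> : 40 * expR (v * 4) / T = 40 * (expR (v * 4) / T ^+ 2 * T) by rewrite -TT2; ring.
have q0 : 0 <= expR (v * 4) / T ^+ 2 by rewrite divr_ge0 // exprn_ge0 // ltW.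
by apply: (perron_aux q0 (ltW T0) _ _ _ b1 b2 b3); move: T1; clear; lra.
Qed.

Variable zeta : R[i]^o -> R[i]^o.
Hypothesis zP : is_riemann_zeta zeta.

Definition Qz s : R[i] := zeta (s - 1) / zeta s.

(** Terms with [n > e^y] have weight 0, so the range of summation can be enlarged to any common
    [N]. *)
Lemma F_vpos k y : (1 <= k)%N -> forall N, (Num.truncn (expR y) <= N)%N ->
  F k (expR y) = \sum_(1 <= n < N.+1) (totient n)%:R * vpos (y - ln n%:R) k.
Proof.
move=> k1 N hN; rewrite /F (@big_cat_nat _ _ _ (Num.truncn (expR y)).+1 1 N.+1) //=.
rewrite [X in _ = _ + X]big1_seq ?addr0; last first.
  move=> n /andP[_]; rewrite mem_index_iota => /andP[h _].
  have n0 : 0 < n%:R :> R by rewrite ltr0n (leq_trans _ h).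
  rewrite /vpos leNgt subr_lt0.
  have -> : y < ln n%:R by rewrite -ltr_expR lnK // -truncn_lt_nat ?expR_ge0.
  by rewrite mulr0.
rewrite mulr_sumr; apply: eq_big_nat => n /andP[n0 h]; rewrite ltnS in h.
have n0' : 0 < n%:R :> R by rewrite ltr0n.
have hn : ln n%:R <= y by rewrite -ler_expR lnK // -truncn_ge_nat ?expR_ge0.
rewrite /vpos subr_ge0 hn lnM ?posrE ?expR_gt0 ?invr_gt0 // expRK lnV ?posrE //.
by rewrite mulrCA [_^-1 * _]mulrC.
Qed.

(** The series is truncated at an [N] whose tail costs an arbitrary [e]. The Perron error of the
    [n]-th term carries [e^(4 (y - ln n)) = e^(4 y) / n^4], hence remains summable against
    [phi(n) <= n]. *)
Lemma perron_F k (y T : R) : (1 <= k)%N -> 1 <= T ->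
  cabs (cI (fun t => Qz (4 +i* t) * pk y k.+1 (4 +i* t)) (- T) T - (2 * pi * F k (expR y))%:C) <=
  80 * expR (y * 4) / T.
Proof.
move=> k1 T1; have T0 : 0 < T by lra.
have TT : - T <= T by lra.
have nz (t : R) : 4 +i* t != 0 :> R[i] by apply: neq_Re => /=; lra.
have cp (t : R) : cts rc (fun t => pk y k.+1 (4 +i* t)) t by apply: cts_ver; exact/dble_cts/dble_pk.
have z0 (t : R) : zeta (4 +i* t) != 0.
  by rewrite -cabs_gt0; apply: (@lt_le_trans _ _ (1 / 4)); [lra|apply: zeta_ge => //=; lra].
have cQ (t : R) : cts rc (fun t => Qz (4 +i* t)) t.
  apply: cts_ver; apply: dble_cts; apply: dble_div => //.
    apply: (@dble_comp R zeta (fun z => z - 1)); last by apply: dbleB; [exact: dble_id|exact: dble_cst].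
    by apply: dble_zeta => //; apply: neq_Re; rewrite cReD cReN /=; lra.
  by apply: dble_zeta => //; apply: neq_Re => /=; lra.
have cD N (t : R) : cts rc (fun t => totD N (4 +i* t)) t.
  apply: cts_ver; apply: dble_cts; apply: dble_sum => n; apply: dbleM; first exact: dble_cst.
  apply: (@dble_comp R (cpw _)); first exact: dble_cpw.
  by apply: dbleN; exact: dble_id.
apply/ler_addgt0Pr => e e0.
pose B := expR (y * 4).
have B0 : 0 < B by exact: expR_gt0.
pose N := maxn (Num.truncn (expR y)) (Num.truncn (2 * B * (T + T) / e)).+1.
have N0 : (0 < N)%N by rewrite leq_max orbT.
have N1 : 2 * B * (T + T) / e < N%:R.
  by apply: lt_le_trans (truncnS_gt _) _; rewrite ler_nat leq_maxr.
have a1 : cabs (cI (fun t => Qz (4 +i* t) * pk y k.+1 (4 +i* t)) (- T) T -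
    cI (fun t => totD N (4 +i* t) * pk y k.+1 (4 +i* t)) (- T) T) <= e.
  rewrite -cIB; last 2 first.
  - by move=> t _; apply: ctsM.
  - by move=> t _; apply: ctsM.
  apply: (@le_trans _ _ (2 * (N%:R^-1 * B) * (T - - T))).
    apply: cI_le => //.
      by apply: cts_integrable => t _; apply: ctsB; apply: ctsM.
    move=> t _; rewrite -mulrBl cabsM; apply: ler_pM; rewrite ?cabs_ge0 //.
      by apply: totD_dist => //=; lra.
    have : cabs (pk y k.+1 (4 +i* t)) <= expR (y * cRe (4 +i* t)) / 1 ^+ 2.
      by apply: cabs_pk_le => //; have := Re_le_cabs (4 +i* t); rewrite /= ger0_norm; lra.
    by rewrite expr1n divr1.
  rewrite opprK (_ : 2 * (N%:R^-1 * B) * (T + T) = 2 * B * (T + T) / N%:R); last ring.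
  by rewrite ler_pdivrMr ?ltr0n // [e * _]mulrC; apply/ltW; rewrite -ltr_pdivrMr.
have a2 : cI (fun t => totD N (4 +i* t) * pk y k.+1 (4 +i* t)) (- T) T =
   \sum_(1 <= n < N.+1) (totient n)%:R * cI (fun t => pk (y - ln n%:R) k.+1 (4 +i* t)) (- T) T.
  pose G n (t : R) : R[i] := (totient n)%:R * pk (y - ln n%:R) k.+1 (4 +i* t).
  rewrite /cI (@eq_cint _ _ _ (fun t => \sum_(n <- index_iota 1 N.+1) G n t)); last first.
    move=> t _; rewrite /totD mulr_suml; apply: eq_bigr => n _; rewrite /G /pk -mulrA; congr (_ * _).
    by rewrite mulrA -cexpD rmorphB /=; congr (cexp _ / _); ring.
  rewrite -/(cI _ _ _) cI_sum; last first.
    by move=> n t _; apply: ctsM; [exact: cts_cst|apply: cts_ver; exact/dble_cts/dble_pk].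
  apply: eq_bigr => n _; apply: cIZ => t _; apply: cts_ver; exact/dble_cts/dble_pk.
have a3 : cabs (\sum_(1 <= n < N.+1) (totient n)%:R * cI (fun t => pk (y - ln n%:R) k.+1 (4 +i* t)) (- T) T
    - (2 * pi * F k (expR y))%:C) <= 80 * B / T.
  rewrite (F_vpos k1 (leq_maxl _ _ : (_ <= N)%N)) mulr_sumr rmorph_sum -sumrB.
  apply: (le_trans (cabs_sum _ _ _)).
  apply: (@le_trans _ _ (\sum_(1 <= n < N.+1) n%:R ^- 2 * (40 * B / T))).
    rewrite big_nat [leRHS]big_nat; apply: ler_sum => n /andP[n0 _].
    have n0' : 0 < n%:R :> R by rewrite ltr0n.
    rewrite [X in cabs (_ - X)](_ : _ = (totient n)%:R * (2 * pi * vpos (y - ln n%:R) k)%:C); last first.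
      rewrite -[(totient n)%:R in RHS](rmorph_nat (real_complex R)) -rmorphM /=; congr (_%:C); ring.
    rewrite -mulrBr cabsM cabs_nat.
    have h := perron (y - ln n%:R) k1 T1.
    have tn : (totient n)%:R <= n%:R :> R.
      by rewrite ler_nat -{2}(sum_totient_dvd n) (bigD1 ord_max) //= leq_addr.
    apply: (le_trans (ler_pM _ (cabs_ge0 _) tn h)) => //.
    have -> : expR ((y - ln n%:R) * 4) = B * n%:R ^- 4.
      by rewrite mulrBl expRD expRN [ln _ * 4]mulrC expRM_natl lnK.
    have -> : n%:R * (40 * (B / n%:R ^+ 4) / T) = n%:R ^- 3 * (40 * B / T).
      by field; rewrite !gt_eqF.
    rewrite ler_wpM2r ?divr_ge0 ?mulr_ge0 ?(ltW B0) ?(ltW T0) // lef_pV2 ?posrE ?exprn_gt0 //.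
    by rewrite ler_weXn2l // ler1n.
  rewrite -mulr_suml.
  have s2 : \sum_(1 <= n < N.+1) (n%:R ^- 2 : R) <= 2.
    exact: (@sum_sq R N).
  apply: (@le_trans _ _ (2 * (40 * B / T))).
    by rewrite ler_wpM2r // divr_ge0 ?mulr_ge0 ?(ltW B0) ?(ltW T0).
  by rewrite !mulrA -natrM.
rewrite -a2 in a3; have := cabsD (cI (fun t => Qz (4 +i* t) * pk y k.+1 (4 +i* t)) (- T) T -
    cI (fun t => totD N (4 +i* t) * pk y k.+1 (4 +i* t)) (- T) T)
  (cI (fun t => totD N (4 +i* t) * pk y k.+1 (4 +i* t)) (- T) T - (2 * pi * F k (expR y))%:C).
rewrite addrA subrK => h; apply: (le_trans h); rewrite -/B; lra.
Qed.

End Perron.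

(** * Moving the contour and collecting residues *)

Section Contour.
Variable R : realType.
Implicit Types (x v T d y : R) (s z : R[i]) (n N : nat).

Lemma limat_fill (f : R[i] -> R[i]) p c : limat f p c -> cts id (fun z => if z == p then c else f z) p.
Proof.
move=> h e e0; have [d d0 H] := h _ e0; exists d => // z zd; rewrite eqxx.
by case: eqVneq => [_|zp]; [rewrite subrr cabs0|exact: H].
Qed.

Lemma limatV (f : R[i] -> R[i]) p a : a != 0 -> limat f p a -> limat (fun z => (f z)^-1) p a^-1.
Proof.
move=> a0 /limat_fill hf; have := @limat_cts R _ p (ctsV _ hf); rewrite eqxx => /(_ a0).
by apply: limat_near ltr01 _ => z zp _; rewrite (negbTE zp).
Qed.

Lemma limat_shift (f : R[i] -> R[i]) p q c : limat f p c -> limat (fun z => f (z - q)) (p + q) c.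
Proof.
move=> h e /h[d d0 H]; exists d => // z zp zd; apply: H; first by rewrite subr_eq.
by rewrite -addrA -opprD [q + p]addrC.
Qed.

(** Three rectangle identities: the main one, to the right of [Re s = 1/4], and one above and one
    below the detour around 0. The vertical pieces [m1] and [m2] they share are eliminated. *)
Lemma contour_alg (b1 t1 b3 t2 h1 h2 m l1 l2 r m1 m2 S P : R[i]) :
  b1 - t1 + ii * (r - (m1 + m + m2)) = P * ii * S ->
  h2 - t2 + ii * (m2 - l1) = 0 -> b3 - h1 + ii * (m1 - l2) = 0 ->
  cabs (r - P * S) <= cabs b1 + cabs t1 + cabs b3 + cabs t2 + (cabs h1 + cabs h2 + cabs m) +
    (cabs l1 + cabs l2).
Proof.
move=> R1 R2 R3; have i0 : ii != 0 :> R[i] by rewrite -cabs_eq0 cabs_i oner_eq0.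
have ii2 : ii * ii = -1 :> R[i] by apply: complexP; rewrite ?cReM ?cImM /=; ring.
have -> : r - P * S = ii * (b1 - t1 + (b3 - t2) + (h2 - h1)) + m + (l1 + l2).
  apply: (mulfI i0); transitivity (ii * r - P * ii * S); first by ring.
  have -> : ii * (ii * (b1 - t1 + (b3 - t2) + (h2 - h1)) + m + (l1 + l2)) =
     (ii * ii) * (b1 - t1 + (b3 - t2) + (h2 - h1)) + ii * m + ii * (l1 + l2) by ring.
  rewrite ii2 -R1 -[RHS]addr0 -{1}R2 -[RHS]addr0 -{1}R3; ring.
apply: (le_trans (cabsD _ _)); apply: lerD; last exact: cabsD.
apply: (le_trans (cabsD _ _)); rewrite cabsM cabs_i mul1r.
have q1 := cabsD (b1 - t1 + (b3 - t2)) (h2 - h1); have q2 := cabsD (b1 - t1) (b3 - t2).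
have q3 := cabsB b1 t1; have q4 := cabsB b3 t2; have q5 := cabsB h2 h1.
lra.
Qed.

(** An entire damping factor: at height [T] its modulus is about [e^(- d^2 T^2 / 2)], while at a
    fixed point it tends to 1 with [d]. *)
Definition gA d s : R[i] := cexp ((d ^+ 2 / 2)%:C * s ^+ 2).

Lemma dble_gA d s : dble (gA d) s.
Proof.
have h := hasd_cexp_comp (hasdZ (d ^+ 2 / 2)%:C (@hasdX R _ id id s 1 2 (hasd_id id s))).
by eexists; exact: h.
Qed.

Lemma cabs_gA d (a b : R) : cabs (gA d (a +i* b)) = expR (d ^+ 2 / 2 * (a ^+ 2 - b ^+ 2)).
Proof.
rewrite /gA cabs_cexp cReM /= mul0r subr0; congr (expR (_ * _)).
Qed.

Variable zeta : R[i]^o -> R[i]^o.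
Hypothesis zP : is_riemann_zeta zeta.
Hypotheses (RH : riemann_hypothesis zeta) (simple : simple_zeros zeta).
Variable j : nat.
Hypothesis j1 : (1 <= j)%N.

Definition Hd d y s : R[i] := Qz zeta s * pk y j.+1 s * gA d s.

Lemma dble_shift1 s : s != 2 -> dble (fun z => zeta (z - 1) : R[i]) s.
Proof.
move=> s2; apply: (@dble_comp R zeta (fun z => z - 1)); last by apply: dbleB; [exact: dble_id|exact: dble_cst].
by apply: dble_zeta => //; rewrite subr_eq -[1 + 1]/(2%:R).
Qed.

Lemma dble_Qz s : zeta s != 0 -> s != 1 -> s != 2 -> dble (Qz zeta) s.
Proof.
move=> z0 s1 s2; apply: dble_div => //; [exact: dble_shift1|exact: dble_zeta].
Qed.

Lemma dble_Hd d y s : zeta s != 0 -> s != 0 -> s != 1 -> s != 2 -> dble (Hd d y) s.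
Proof.
move=> z0 s0 s1 s2; apply: dbleM; last exact: dble_gA.
by apply: dbleM; [exact: dble_Qz|exact: dble_pk].
Qed.

Lemma zeta2 : zeta 2 = (pi ^+ 2 / 6)%:C :> R[i].
Proof.
have s1 : 1 < cRe (2 : R[i]) by rewrite (Re_nat R 2); lra.
apply: (cseq_uniq (zeta_cseq zP s1)) => e e0.
have [N0 _ H] := (cvgrPdist_le _ _).1 (@basel R) _ e0.
exists N0 => N hN; have := H N hN; rewrite /= distrC -cabs_real rmorphB rmorph_sum /=.
rewrite (_ : \sum_(_ <= _ < _) _ = \sum_(1 <= n < N.+1) cpw (n%:R : R) (- (2 : R[i]))) //.
apply: eq_big_nat => n /andP[n0 _]; rewrite cpwN -[2](add0r (2%:R : R[i])) cpw_natS ?ltr0n //.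
by rewrite cpwx0 mul1r fmorphV.
Qed.

(** The residue of [Qz s / s^(j + 1)] at a simple zero; the factors [e^(y p)] and [gA d p] are kept
    apart. *)
Definition cz p : R[i] := zeta (p - 1) / (derive1 zeta p * p ^+ j.+1).

Lemma res_zero d y p : nzero zeta p ->
  limat (fun z => (z - p) * Hd d y z) p (cz p * cexp (y%:C * p) * gA d p).
Proof.
move=> np; have [p1 p0 _] := np; have Rp := nzero_Re RH np.
have pn0 : p != 0 by apply/eqP => E; move: Rp; rewrite E /=; lra.
have p2 : p != 2 by apply/eqP => E; move: Rp; rewrite E (Re_nat R 2); lra.
have L := limatV (simple np) (limat_quot p0 (hasd_zeta zP p1)).
pose g z : R[i] := zeta (z - 1) * pk y j.+1 z * gA d z.
have cg : cts id g p.
  apply: dble_cts; apply: dbleM; last exact: dble_gA.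
  by apply: dbleM; [exact: dble_shift1|exact: dble_pk].
have := limat_mul_cts L cg.
have -> : (derive1 zeta p)^-1 * g p = cz p * cexp (y%:C * p) * gA d p.
  by rewrite /g /cz /pk invfM; ring.
apply: limat_near ltr01 _ => z zp _; have zp0 : z - p != 0 by rewrite subr_eq0.
rewrite /Hd /Qz /g invfM invrK.
by move: (pk y j.+1 z) (gA d z) (zeta (z - 1) : R[i]) (zeta z : R[i])^-1 => a b c e; ring.
Qed.

(** The pole of zeta at 1 makes [1 / zeta] vanish there, so the point leaves no residue. *)
Lemma res_one d y : limat (fun z => (z - 1) * Hd d y z) 1 0.
Proof.
have L := limatV (oner_neq0 _) (zeta_pole zP).
pose g z : R[i] := (z - 1) ^+ 2 * (zeta (z - 1) * pk y j.+1 z * gA d z).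
have cg : cts id g 1.
  apply: dble_cts; apply: dbleM.
    by eexists; apply: hasdX; exact: hasd_subC.
  apply: dbleM; last exact: dble_gA.
  apply: dbleM; last by apply: dble_pk; exact: oner_neq0.
  by apply: dble_shift1; apply: neq_Re; rewrite (Re_nat R 2) /=; lra.
have := limat_mul_cts L cg; rewrite {2}/g subrr expr0n /= mul0r mulr0.
apply: limat_near ltr01 _ => z z1 _; have z0 : z - 1 != 0 by rewrite subr_eq0.
rewrite /Hd /Qz /g invfM.
move: (pk y j.+1 z) (gA d z) (zeta (z - 1) : R[i]) ((zeta z : R[i])^-1) => a b c e.
by rewrite expr2; field.
Qed.

(** The residue at 2, caused by the pole of [zeta (s - 1)]. Without the damping factor it is the
    main term [3 / (2^j pi^2) e^(2 y)], by [zeta2]. *)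
Definition c2 d y : R[i] := ((pi ^+ 2 / 6)%:C)^-1 * pk y j.+1 2 * gA d 2.

Lemma res_two d y : limat (fun z => (z - 2) * Hd d y z) 2 (c2 d y).
Proof.
have L := @limat_shift _ 1 1 1 (zeta_pole zP).
have n2 : (2 : R[i]) != 0 by apply: neq_Re; rewrite (Re_nat R 2) /=; lra.
have n21 : (2 : R[i]) != 1 by apply: neq_Re; rewrite (Re_nat R 2) /=; lra.
have z2 : zeta 2 != 0 :> R[i].
  by rewrite -cabs_gt0; apply: (@lt_le_trans _ _ (1 / 4)); [lra|apply: zeta_ge => //; rewrite (Re_nat R 2); lra].
pose g z : R[i] := (zeta z)^-1 * pk y j.+1 z * gA d z.
have cg : cts id g 2.
  apply: ctsM; last exact/dble_cts/dble_gA.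
  apply: ctsM; last exact/dble_cts/dble_pk.
  by apply: ctsV => //; exact/dble_cts/dble_zeta.
have := limat_mul_cts L cg; rewrite mul1r {2}/g zeta2 -/(c2 d y).
apply: limat_near ltr01 _ => z _ _; rewrite /Hd /Qz /g.
rewrite (_ : z - 1 - 1 = z - 2); last by ring.
by move: (pk y j.+1 z) (gA d z) (zeta (z - 1) : R[i]) ((zeta z : R[i])^-1) => a b c e; ring.
Qed.

Lemma zeta_neq0_im s : cIm s != 0 -> cRe s != 1 / 2 -> zeta s != 0.
Proof.
move=> si sr; apply/eqP => s0; move: sr; rewrite (nzero_Re RH (nontriv_im s0 si)).
by rewrite eqxx.
Qed.

(* The left edge is pushed to [Re s = -3/2], except near the pole [s = 0], which is avoided. *)
Lemma contour d y T (zs : seq R[i]) : 1 < T -> uniq zs ->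
  (forall q, nzero zeta q /\ - T <= cIm q <= T <-> q \in zs) ->
  zeta ((1 / 2) +i* T) != 0 ->
  cabs (cI (fun t => Hd d y (4 +i* t)) (- T) T -
        (2 * pi)%:C * (c2 d y + \sum_(p <- zs) cz p * cexp (y%:C * p) * gA d p)) <=
  cabs (cI (fun t => Hd d y (t +i* (- T))) (1 / 4) 4) + cabs (cI (fun t => Hd d y (t +i* T)) (1 / 4) 4) +
  cabs (cI (fun t => Hd d y (t +i* (- T))) (- (3 / 2)) (1 / 4)) + cabs (cI (fun t => Hd d y (t +i* T)) (- (3 / 2)) (1 / 4)) +
  (cabs (cI (fun t => Hd d y (t +i* (- 1))) (- (3 / 2)) (1 / 4)) + cabs (cI (fun t => Hd d y (t +i* 1)) (- (3 / 2)) (1 / 4)) +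
   cabs (cI (fun t => Hd d y ((1 / 4) +i* t)) (- 1) 1)) +
  (cabs (cI (fun t => Hd d y (- (3 / 2) +i* t)) 1 T) + cabs (cI (fun t => Hd d y (- (3 / 2) +i* t)) (- T) (- 1))).
Proof.
move=> T1 uz Hz zT.
have re2 : (2 : R[i]) = 2 +i* 0 by rewrite -(rmorph_nat (real_complex R) 2).
have im_ne (s p : R[i]) : cIm s != 0 -> cIm p = 0 -> s != p.
  by move=> si p0; apply/eqP => E; move: si; rewrite E p0 eqxx.
have zmT : zeta ((1 / 2) +i* (- T)) != 0.
  rewrite -cabs_eq0 cabs_zeta_conj ?cabs_eq0 //; apply/eqP; lra.
have zI q : q \in zs -> - T < cIm q < T.
  move=> qz; have /Hz[nq /andP[h1 h2]] := qz; have Rq := nzero_Re RH nq; have [_ q0 _] := nq.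
  have Eq : q = (1 / 2) +i* cIm q by rewrite -Rq; case: (q).
  rewrite !lt_neqAle h1 h2 !andbT; apply/andP; split; apply/eqP => E.
    by move: zmT; rewrite E -Eq q0 eqxx.
  by move: zT; rewrite -E -Eq q0 eqxx.
pose c p : R[i] := if p == 2 then c2 d y else if p == 1 then 0 else cz p * cexp (y%:C * p) * gA d p.
have n1 : 1 \notin zs by apply/negP => /Hz[[]]; rewrite eqxx.
have n2 : 2 \notin zs by apply/negP => /Hz[/(nzero_Re RH)]; rewrite re2 /=; lra.
have n21 : (2 : R[i]) != 1 by rewrite re2; apply: neq_Re => /=; lra.
have ne12 p : p \in zs -> (p == 2) = false /\ (p == 1) = false.
  by move=> pz; split; apply/negbTE; [apply: contraNneq n2 => <-|apply: contraNneq n1 => <-].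
have R1 : RI (Hd d y) (1 / 4) 4 (- T) T = (2 * pi)%:C * ii * \sum_(p <- 2 :: 1 :: zs) c p.
  apply: residue_thm; try lra.
  - by rewrite /= inE negb_or n21 n2 n1.
  - move=> p; rewrite !inE => /or3P[/eqP ->|/eqP ->|pz]; rewrite /ininterior ?re2 /=; try lra.
    by have := zI p pz; have /Hz[/(nzero_Re RH) -> _] := pz; lra.
  - move=> z iz; rewrite !inE !negb_or => /and3P[z2 z1 zz].
    have zr : 1 / 4 <= cRe z <= 4 by case/andP: iz.
    have zi : - T <= cIm z <= T by case/andP: iz.
    apply: dble_Hd => //; last by apply/eqP => E; move: zr; rewrite E /=; lra.
    apply: contraNneq zz => z0; apply/Hz; split => //; apply: nontriv => //; lra.
  - move=> p; rewrite /c !inE => /or3P[/eqP ->|/eqP ->|pz].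
    + by rewrite eqxx; exact: res_two.
    + by rewrite eq_sym (negbTE n21) eqxx; exact: res_one.
    + by have [-> ->] := ne12 p pz; apply: res_zero; case/Hz: pz.
have Sc : \sum_(p <- 2 :: 1 :: zs) c p = c2 d y + \sum_(p <- zs) cz p * cexp (y%:C * p) * gA d p.
  rewrite !big_cons /c eqxx [1 == 2]eq_sym (negbTE n21) eqxx add0r; congr (_ + _).
  by apply: eq_big_seq => p pz; have [-> ->] := ne12 p pz.
have dH z : cIm z != 0 -> cRe z != 1 / 2 -> dble (Hd d y) z.
  by move=> zi zr; apply: dble_Hd; [exact: zeta_neq0_im|exact: im_ne|exact: im_ne|rewrite re2; exact: im_ne].
have R2 : RI (Hd d y) (- (3 / 2)) (1 / 4) 1 T = 0.
  apply: goursat; try lra.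
  by move=> z /andP[zr zi]; apply: dH; apply/eqP; lra.
have R3 : RI (Hd d y) (- (3 / 2)) (1 / 4) (- T) (- 1) = 0.
  apply: goursat; try lra.
  by move=> z /andP[zr zi]; apply: dH; apply/eqP; lra.
have c14 t : cts rc (fun t => Hd d y ((1 / 4) +i* t)) t.
  apply: cts_ver; apply: dble_cts; apply: dble_Hd.
  - apply: (zeta_neq0 RH) => /=; [lra|apply/eqP; lra|].
    by apply: neq_Re => /=; lra.
  - by apply: neq_Re => /=; lra.
  - by apply: neq_Re => /=; lra.
  - by rewrite re2; apply: neq_Re => /=; lra.
have S1 : cI (fun t => Hd d y ((1 / 4) +i* t)) (- T) T = cI (fun t => Hd d y ((1 / 4) +i* t)) (- T) (- 1) +
    cI (fun t => Hd d y ((1 / 4) +i* t)) (- 1) 1 + cI (fun t => Hd d y ((1 / 4) +i* t)) 1 T.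
  rewrite (@cI_split R _ (- T) (- 1) T); [|lra|by apply: cts_integrable].
  rewrite (@cI_split R _ (- 1) 1 T); [|lra|by apply: cts_integrable].
  by rewrite addrA.
move: R1; rewrite Sc /RI S1 => R1; exact: (contour_alg R1 R2 R3).
Qed.

End Contour.

(** * Estimates on the sides of the contour *)

Section Estimates.
Variable R : realType.
Implicit Types (x t T d y : R) (s z : R[i]) (n N : nat).

(** The difference is the integral of [z e^(u z)] over [0 <= u <= 1]. The condition on [Re z] is
    one-sided to suit Gaussian exponents, whose real part is bounded above but not below. *)
Lemma cexp_sub1 z : cRe z <= 8 -> cabs (cexp z - 1) <= 2 * expR 8 * cabs z.
Proof.
move=> zr; have h (u : R) : hasd rc (fun u => cexp (z * u%:C)) u (cexp (z * u%:C) * (z * 1)).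
  by apply: hasd_cexp_comp; apply: hasdZ; exact: hasd_id.
have cf (u : R) : cts rc (fun u => cexp (z * u%:C) * (z * 1)) u.
  by apply: ctsM; [exact: hasd_cts (h u)|exact: cts_cst].
have E := @cI_FTC R (fun u => cexp (z * u%:C)) (fun u => cexp (z * u%:C) * (z * 1)) 0 1 ler01 (fun u _ => cf u) (fun u _ => h u).
rewrite mulr1 mulr0 cexp0 in E; rewrite mulr1 in cf; rewrite -E.
apply: (@le_trans _ _ (2 * (expR 8 * cabs z) * (1 - 0))); last by rewrite subr0 mulr1 mulrA.
apply: cI_le => //; first by apply: cts_integrable => u _.
move=> u /andP[u0 u1]; rewrite cabsM cabs_cexp ler_wpM2r ?cabs_ge0 // ler_expR cReM /= mulr0 subr0.
by have [r0|r0] := leP 0 (cRe z); nra.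
Qed.

Lemma cI_pow_neg (f : R -> R[i]) (K a b q : R) : 0 < a -> a <= b -> q != 0 -> 0 <= K ->
  (forall u, a <= u <= b -> cts rc f (- u)) ->
  (forall u, a <= u <= b -> cabs (f (- u)) <= K * rpw u (q - 1)) ->
  cabs (cI f (- b) (- a)) <= 2 * K / q * (rpw b q - rpw a q).
Proof.
move=> a0 ab q0 K0 cf fK.
have -> : 2 * K / q * (rpw b q - rpw a q) = 2 * (- (K / q) * rpw (- (- a)) q - - (K / q) * rpw (- (- b)) q).
  by rewrite !opprK; ring.
have pos u : - b <= u <= - a -> a <= - u <= b by lra.
have hopp (P : R -> R[i]) (x : R) e : hasd rc P (- x) e -> hasd rc (fun t => P (- t)) x (- e).
  move=> [phi [cphi <-] E]; exists (fun t => - phi (- t)); first split => //.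
    apply: ctsN => eps /cphi[r r0 Hr]; exists r => // t; rewrite -rmorphB /= cabs_real => tr; apply: Hr.
    by rewrite -rmorphB /= cabs_real -opprD normrN.
  by move=> t; rewrite E !rmorphN /=; ring.
apply: (cI_le_prim (g := fun u => K * rpw (- u) (q - 1)) (G := fun u => - (K / q) * rpw (- u) q)).
- by lra.
- by move=> u /pos h; rewrite -[u]opprK; exact: cf.
- move=> u /pos /andP[h _]; have u0 : 0 < - u by exact: lt_le_trans h.
  apply: (@cts_near _ _ _ (fun t => K%:C * (rpw (- t) (q - 1))%:C) _ _ 1 ltr01).
    by move=> t _; rewrite -rmorphM.
  apply: ctsM; first exact: cts_cst.
  exact: hasd_cts (hopp (fun t => (rpw t (q - 1))%:C) u _ (hasd_rpw (q - 1) u0)).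
- move=> u /pos /andP[h _]; have u0 : 0 < - u by exact: lt_le_trans h.
  have := hasdZ (- (K / q))%:C (hopp (fun t => (rpw t q)%:C) u _ (hasd_rpw q u0)).
  rewrite -rmorphN -rmorphM /= (_ : - (K / q) * - (q * rpw (- u) (q - 1)) = K * rpw (- u) (q - 1)); last by field.
  by move=> h'; apply: (@hasd_near _ _ _ _ _ _ _ 1 ltr01 _ h') => t _ /=; rewrite -rmorphM.
- by move=> u /pos h; rewrite -{1}[u]opprK; exact: fK.
Qed.

Lemma rpw_ge1 (x a : R) : 1 <= x -> 0 <= a -> 1 <= rpw x a.
Proof. by move=> x1 a0; have := rpw_leW x1 a0; rewrite rpwx0. Qed.

Lemma rpw_le1 (x a : R) : 1 <= x -> a <= 0 -> rpw x a <= 1.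
Proof. by move=> x1 a0; have := rpw_leW x1 a0; rewrite rpwx0. Qed.

Lemma rpw_anti (x y a : R) : 0 < x -> x <= y -> a <= 0 -> rpw y a <= rpw x a.
Proof.
move=> x0 xy a0; rewrite ler_expR ler_wnM2l // ler_ln ?posrE //; exact: lt_le_trans xy.
Qed.

(** Three pieces of size [4 K]: the middle one by its length, the two tails by the primitive of
    [t^(-3/2)]. *)
Lemma line_int (f : R -> R[i]) (K T : R) : 1 <= T -> 0 <= K -> (forall t, cts rc f t) ->
  (forall t, `|t| <= 1 -> cabs (f t) <= K) ->
  (forall t, 1 <= `|t| -> cabs (f t) <= K * rpw `|t| (- (3 / 2))) -> cabs (cI f (- T) T) <= 12 * K.
Proof.
move=> T1 K0 cf f1 f2; have q : - (1 / 2) - 1 = - (3 / 2) :> R by field.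
have q0 : - (1 / 2) != 0 :> R by apply/eqP; lra.
rewrite (@cI_split R _ (- T) (- 1) T); [|lra|by apply: cts_integrable].
rewrite (@cI_split R _ (- 1) 1 T); [|lra|by apply: cts_integrable].
have h1 : cabs (cI f (- 1) 1) <= 2 * K * (1 - - 1).
  apply: cI_le; [lra|by apply: cts_integrable|].
  by move=> t tt; apply: f1; rewrite ler_norml.
have fin : 2 * K / (- (1 / 2)) * (rpw T (- (1 / 2)) - rpw 1 (- (1 / 2))) <= 4 * K.
  rewrite rpw1; have := rpw_ge0 T (- (1 / 2)); move: (rpw T _) => r r0.
  have -> : 2 * K / (- (1 / 2)) * (r - 1) = 4 * K * (1 - r) by field.
  by nra.
have h2 : cabs (cI f 1 T) <= 4 * K.
  apply: le_trans fin; apply: cI_pow_le => // u /andP[u1 _].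
  by rewrite q; have := f2 u; rewrite ger0_norm; [apply|lra].
have h3 : cabs (cI f (- T) (- 1)) <= 4 * K.
  apply: le_trans fin; apply: cI_pow_neg => // u /andP[u1 _].
  by rewrite q; have := f2 (- u); rewrite normrN ger0_norm; [apply|by clear -u1; lra].
have := cabsD (cI f (- T) (- 1)) (cI f (- 1) 1 + cI f 1 T).
have := cabsD (cI f (- 1) 1) (cI f 1 T); clear -h1 h2 h3; move: (cI f _ _) (cI f _ _) (cI f _ _) h1 h2 h3 => a b c; lra.
Qed.

(** With [u = d |s|] the difference is O(u^2) for [u <= 1] and bounded otherwise, hence O(u^(1/2)).
    The exponent [1/2] is small enough for [|s|^(1/2 - 2)] to be integrable on the line. *)
Lemma gA_sub1 d t : 0 < d <= 1 ->
  cabs (gA d (4 +i* t) - 1) <= 2 * expR 8 * rpw (d * cabs (4 +i* t)) (1 / 2).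
Proof.
move=> /andP[d0 d1]; set s := 4 +i* t; set u := d * cabs s.
have s4 : 4 <= cabs s by have := Re_le_cabs s; rewrite /= ger0_norm; lra.
have u0 : 0 < u by rewrite mulr_gt0 //; lra.
have d2 : d ^+ 2 <= 1 by rewrite expr_le1 // ltW.
have d20 : 0 <= d ^+ 2 by rewrite sqr_ge0.
have rz : cRe ((d ^+ 2 / 2)%:C * s ^+ 2) <= 8.
  have -> : cRe ((d ^+ 2 / 2)%:C * s ^+ 2) = d ^+ 2 / 2 * (4 ^+ 2 - t ^+ 2).
    by rewrite cReM /= mul0r subr0; congr (_ * _).
  have := sqr_ge0 t; move: (t ^+ 2) (d ^+ 2) d2 d20 => t2 w w1 w0 t20.
  by rewrite expr2; nra.
have E8 : 1 <= expR 8 :> R by rewrite -expR0 ler_expR.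
have [u1|u1] := leP u 1.
  apply: (le_trans (cexp_sub1 rz)); rewrite ler_pM2l; last by lra.
  rewrite cabsM cabsX cabs_real ger0_norm ?divr_ge0 //.
  apply: (@le_trans _ _ (rpw u 2)); last by apply: rpw_le1W; [rewrite u0|lra].
  rewrite (rpw_nat 2 u0) /u exprMn; have := sqr_ge0 (cabs s); nra.
have h1 : 1 <= rpw u (1 / 2).
  by apply: rpw_ge1; [exact: ltW|lra].
have := cabsB (gA d s) 1; rewrite cabs1 /s cabs_gA -/s => h2.
have : expR (d ^+ 2 / 2 * (4 ^+ 2 - t ^+ 2)) <= expR 8.
  rewrite ler_expR; have := sqr_ge0 t; move: (t ^+ 2) (d ^+ 2) d2 d20 => t2 w w1 w0 t20.
  by rewrite expr2; nra.
by move: (rpw u _) (expR 8) h1 E8 => p q p1 q1; move: (expR _) (cabs _) h2 => a b; nra.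
Qed.

(** The Gaussian is spent on a small negative power: on the left edge [|t|^(-1/8)] makes the
    borderline [1 / |t|] integrable, at the price [d^(-1/8)]. *)
Lemma gauss_le (u : R) : 0 < u -> expR (- (u ^+ 2 / 2)) <= rpw u (- (1 / 8)).
Proof.
move=> u0; have [u1|u1] := leP u 1.
  apply: (@le_trans _ _ 1).
    by rewrite -expR0 ler_expR oppr_le0 divr_ge0 // sqr_ge0.
  have h : rpw u 0 <= rpw u (- (1 / 8)) by apply: rpw_le1W; [rewrite u0|lra].
  by rewrite rpwx0 in h.
apply: (@le_trans _ _ (rpw u (- 1))); last by apply: rpw_leW; [exact: ltW|lra].
rewrite rpwN rpwx1 // expRN lef_pV2 ?posrE ?expR_gt0 //.
by have := expR_ge1Dx (u ^+ 2 / 2); have := sqr_ge0 (u - 1); rewrite !expr2; lra.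
Qed.

Lemma cabs_pk_eq v k s : cabs (pk v k s) = expR (v * cRe s) / cabs s ^+ k.
Proof. by rewrite /pk cabsM cabsV cabsX cabs_cexp cReM /= mul0r subr0. Qed.

Variable zeta : R[i]^o -> R[i]^o.
Hypothesis zP : is_riemann_zeta zeta.
Hypotheses (RH : riemann_hypothesis zeta) (simple : simple_zeros zeta).
Variable j : nat.
Hypothesis j1 : (1 <= j)%N.

Lemma complex2E : (2 : R[i]) = 2 +i* 0.
Proof. by rewrite -(rmorph_nat (real_complex R) 2). Qed.

Lemma complex_sub1 (a b : R) : a +i* b - 1 = (a - 1) +i* b.
Proof. by apply: complexP; rewrite ?cReD ?cImD ?cReN ?cImN /= ?oppr0 ?addr0. Qed.

Lemma cabs_pk_le2 y s : 1 <= cabs s -> cabs (pk y j.+1 s) <= expR (y * cRe s) / cabs s ^+ 2.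
Proof.
move=> s1; rewrite cabs_pk_eq ler_wpM2l ?expR_ge0 // lef_pV2 ?posrE ?exprn_gt0 //; try lra.
by rewrite ler_weXn2l.
Qed.

Lemma dble_Qz4 t : dble (Qz zeta) (4 +i* t).
Proof.
apply: dble_Qz => //.
- by rewrite -cabs_gt0; apply: (@lt_le_trans _ _ (1 / 4)); [lra|apply: zeta_ge => //=; lra].
- by apply: neq_Re => /=; lra.
- by rewrite complex2E; apply: neq_Re => /=; lra.
Qed.

Lemma complex4_neq0 t : 4 +i* t != 0 :> R[i].
Proof. by apply: neq_Re => /=; lra. Qed.

Lemma right_error d y T : 0 < d <= 1 -> 1 <= T ->
  cabs (cI (fun t => Hd zeta j d y (4 +i* t)) (- T) T -
        cI (fun t => Qz zeta (4 +i* t) * pk y j.+1 (4 +i* t)) (- T) T) <=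
  12 * (24 * expR 8 * expR (y * 4) * rpw d (1 / 2)).
Proof.
move=> d01 T1; have /andP[d0 d1] := d01.
have cQ t : cts rc (fun t => Qz zeta (4 +i* t)) t by apply: cts_ver; exact/dble_cts/dble_Qz4.
have cp t : cts rc (fun t => pk y j.+1 (4 +i* t)) t by apply: cts_ver; exact/dble_cts/dble_pk/complex4_neq0.
have cA t : cts rc (fun t => gA d (4 +i* t)) t by apply: cts_ver; exact/dble_cts/dble_gA.
rewrite -cIB; last 2 first.
- by move=> t _; apply: ctsM => //; apply: ctsM.
- by move=> t _; apply: ctsM.
set K := 24 * expR 8 * expR (y * 4) * rpw d (1 / 2).
have K0 : 0 <= K by rewrite !mulr_ge0 ?expR_ge0 ?rpw_ge0.
have b t : cabs (Hd zeta j d y (4 +i* t) - Qz zeta (4 +i* t) * pk y j.+1 (4 +i* t)) <=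
    K * rpw (cabs (4 +i* t)) (- (3 / 2)).
  rewrite /Hd -{2}[_ * pk _ _ _]mulr1 -mulrBr 2!cabsM.
  set s := 4 +i* t; have s4 : 4 <= cabs s by have := Re_le_cabs s; rewrite /= ger0_norm; lra.
  have s0 : 0 < cabs s by lra.
  have bQ : cabs (Qz zeta s) <= 12.
    rewrite /Qz cabsM cabsV; have h1 : cabs (zeta (s - 1)) <= 3 by rewrite complex_sub1; apply: zeta_le3 => //=; lra.
    have h2 : 1 / 4 <= cabs (zeta s) by apply: zeta_ge => //=; lra.
    by rewrite ler_pdivrMr; lra.
  have bp := @cabs_pk_le2 y s ltac:(lra); rewrite [cRe s]/= in bp.
  have bA := gA_sub1 t d01; rewrite -/s in bA.
  apply: (@le_trans _ _ (12 * (expR (y * 4) / cabs s ^+ 2) * (2 * expR 8 * rpw (d * cabs s) (1 / 2)))).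
    by apply: ler_pM; rewrite ?mulr_ge0 ?cabs_ge0 //; apply: ler_pM; rewrite ?cabs_ge0.
  have -> : rpw (d * cabs s) (1 / 2) = rpw d (1 / 2) * rpw (cabs s) (1 / 2).
    by rewrite /rpw lnM ?posrE // mulrDr expRD.
  have -> : rpw (cabs s) (- (3 / 2)) = rpw (cabs s) (1 / 2) / cabs s ^+ 2.
    by rewrite -(rpw_nat 2 s0) -rpwN -rpwD; congr rpw; field.
  by rewrite le_eqVlt; apply/orP; left; apply/eqP; rewrite /K; field; rewrite gt_eqF.
apply: line_int => //.
- by move=> t; apply: ctsB; apply: ctsM => //; apply: ctsM.
- move=> t _; apply: (le_trans (b t)); rewrite -[leRHS]mulr1 ler_wpM2l //.
  by apply: rpw_le1; [have := Re_le_cabs (4 +i* t); rewrite /= ger0_norm|]; lra.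
- move=> t t1; apply: (le_trans (b t)); rewrite ler_wpM2l //; apply: rpw_anti; [lra| |lra].
  exact: (Im_le_cabs (4 +i* t)).
Qed.

(** [Qz] grows like [|s|] by [left_line] and [pk] decays like [|s|^(-2)]; the remaining [1 / |s|] is
    completed by [gauss_le]. *)
Lemma cabs_Hd_left d y t : 0 < d <= 1 -> 1 <= `|t| -> cabs (Hd zeta j d y (- (3 / 2) +i* t)) <=
  24 * expR 2 * expR (- (y * (3 / 2))) * rpw d (- (1 / 8)) * rpw `|t| (- (1 / 8) - 1).
Proof.
move=> /andP[d0 d1] t1; have t0 : t != 0 by rewrite -normr_gt0; lra.
set s := - (3 / 2) +i* t; have tp : 0 < `|t| by lra.
have ts : `|t| <= cabs s by exact: (Im_le_cabs s).
have sp : 3 / 2 <= cabs s by have := Re_le_cabs s; rewrite /= normrN ger0_norm; lra.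
have s0 : 0 < cabs s by lra.
have bQ : cabs (Qz zeta s) <= 24 * cabs s.
  rewrite /Qz complex_sub1 (_ : - (3 / 2) - 1 = - (5 / 2) :> R); last by field.
  apply: (le_trans (left_line zP RH simple t0)).
  have : cabs (- (5 / 2) +i* t) <= 2 * cabs s.
    have -> : - (5 / 2) +i* t = s + (- 1) :> R[i] by apply: complexP; rewrite ?cReD ?cImD ?cReN ?cImN /=; field.
    by have := cabsD s (- 1); rewrite cabsN cabs1; lra.
  by lra.
have s1 : 1 <= cabs s by lra.
have bp := @cabs_pk_le2 y s s1; rewrite [cRe s]/= mulrN in bp.
have bA : cabs (gA d s) <= expR 2 * (rpw d (- (1 / 8)) * rpw `|t| (- (1 / 8))).
  have -> : rpw d (- (1 / 8)) * rpw `|t| (- (1 / 8)) = rpw (d * `|t|) (- (1 / 8)).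
    by rewrite /rpw lnM ?posrE // mulrDr expRD.
  rewrite /s cabs_gA.
  have -> : d ^+ 2 / 2 * ((- (3 / 2)) ^+ 2 - t ^+ 2) = d ^+ 2 * (9 / 8) + - ((d * `|t|) ^+ 2 / 2).
    by rewrite exprMn real_normK ?num_real //; field.
  rewrite expRD; apply: ler_pM; rewrite ?expR_ge0 //; last by apply: gauss_le; rewrite mulr_gt0.
  have d2 : d ^+ 2 <= 1 by rewrite expr_le1 // ltW.
  by rewrite ler_expR; lra.
rewrite /Hd 2!cabsM.
apply: (@le_trans _ _ (24 * cabs s * (expR (- (y * (3 / 2))) / cabs s ^+ 2) *
   (expR 2 * (rpw d (- (1 / 8)) * rpw `|t| (- (1 / 8)))))).
  by apply: ler_pM; rewrite ?mulr_ge0 ?cabs_ge0 //; apply: ler_pM; rewrite ?cabs_ge0.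
have -> : 24 * cabs s * (expR (- (y * (3 / 2))) / cabs s ^+ 2) * (expR 2 * (rpw d (- (1 / 8)) * rpw `|t| (- (1 / 8)))) =
  24 * expR 2 * expR (- (y * (3 / 2))) * rpw d (- (1 / 8)) * (rpw `|t| (- (1 / 8)) * (cabs s)^-1).
  by field; rewrite gt_eqF.
rewrite ler_wpM2l ?mulr_ge0 ?expR_ge0 ?rpw_ge0 // rpwD ler_wpM2l ?rpw_ge0 // rpwN rpwx1 //.
by rewrite lef_pV2 ?posrE.
Qed.

Lemma dble_Hd_im d y z : cIm z != 0 -> cRe z != 1 / 2 -> dble (Hd zeta j d y) z.
Proof.
by move=> zi zr; apply: dble_Hd => //; [exact: zeta_neq0_im|exact: Im_neq|exact: Im_neq|rewrite complex2E; exact: Im_neq].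
Qed.

Lemma left_error d y T : 0 < d <= 1 -> 1 <= T ->
  cabs (cI (fun t => Hd zeta j d y (- (3 / 2) +i* t)) 1 T) +
  cabs (cI (fun t => Hd zeta j d y (- (3 / 2) +i* t)) (- T) (- 1)) <=
  32 * (24 * expR 2 * expR (- (y * (3 / 2))) * rpw d (- (1 / 8))).
Proof.
move=> d01 T1; set K := 24 * _ * _ * _.
have K0 : 0 <= K by rewrite !mulr_ge0 ?expR_ge0 ?rpw_ge0.
have q0 : - (1 / 8) != 0 :> R by apply/eqP; lra.
have fin : 2 * K / (- (1 / 8)) * (rpw T (- (1 / 8)) - rpw 1 (- (1 / 8))) <= 16 * K.
  rewrite rpw1; have := rpw_ge0 T (- (1 / 8)); move: (rpw T _) => r r0.
  have -> : 2 * K / (- (1 / 8)) * (r - 1) = 16 * K * (1 - r) by field.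
  by nra.
have cH t : t != 0 -> cts rc (fun t => Hd zeta j d y (- (3 / 2) +i* t)) t.
  by move=> t0; apply: cts_ver; apply: dble_cts; apply: dble_Hd_im => //=; apply/eqP; lra.
have h2 : cabs (cI (fun t => Hd zeta j d y (- (3 / 2) +i* t)) 1 T) <= 16 * K.
  apply: le_trans fin; apply: cI_pow_le => // u /andP[u1 _]; first by apply: cH; apply/eqP; lra.
  by have := @cabs_Hd_left d y u d01; rewrite ger0_norm; [apply|lra].
have h3 : cabs (cI (fun t => Hd zeta j d y (- (3 / 2) +i* t)) (- T) (- 1)) <= 16 * K.
  apply: le_trans fin; apply: cI_pow_neg => // u /andP[u1 _]; first by apply: cH; apply/eqP; lra.
  by have := @cabs_Hd_left d y (- u) d01; rewrite normrN ger0_norm; [apply|lra].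
lra.
Qed.

(** The boolean selects the upper or the lower side; the lower one has the same modulus of zeta by
    conjugation. Polynomial factors are absorbed into [e^(6 T)]. *)
Lemma hor_pt : exists2 C : R, 1 <= C & forall B T d y x (b : bool), 1 <= T -> 0 < d <= 1 -> 0 <= y ->
  - (3 / 2) <= x <= 4 -> zeta (x +i* T) != 0 -> (cabs (zeta (x +i* T)))^-1 <= expR (B * T) ->
  cabs (Hd zeta j d y (x +i* (if b then T else - T))) <=
  C * expR ((B + 6) * T + y * 4 + 8 - d ^+ 2 / 2 * T ^+ 2).
Proof.
have [C C1 HC] := zeta_crude zP; exists (C * expR 6).
  by rewrite mulr_ege1 // -expR0 ler_expR.
move=> B T d y x b T1 /andP[d0 d1] y0 xx zT bT; set t := if b then T else - T.
have tn : `|t| = T by rewrite /t; case: (b); rewrite ?normrN ger0_norm //; lra.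
have t0 : t != 0 by rewrite -normr_gt0 tn; lra.
have t2 : t ^+ 2 = T ^+ 2 by rewrite -(real_normK (num_real t)) tn.
have cz : cabs (zeta (x +i* t)) = cabs (zeta (x +i* T)).
  by rewrite /t; case: (b) => //; rewrite cabs_zeta_conj //; apply/eqP; lra.
set s := x +i* t; have Ts : T <= cabs s by rewrite -tn; exact: (Im_le_cabs s).
have s1 : 1 <= cabs s by lra.
have bz : cabs (zeta (s - 1)) <= C * (1 + T) ^+ 6.
  have s11 : s - 1 != 1 by rewrite complex_sub1; apply: Im_neq.
  have := HC (s - 1) s11; rewrite {1}complex_sub1 /= => h; have {h} := h ltac:(clear -zP RH simple j1 xx; lra).
  rewrite subr0 tn cabsM; have h1 : 1 <= cabs (s - 1 - 1).
    by apply: (le_trans T1); rewrite -tn; have := Im_le_cabs (s - 1 - 1); rewrite /s 2!complex_sub1.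
  have := cabs_ge0 (zeta (s - 1)); clear -zP RH simple j1 h1; nra.
have bp : cabs (pk y j.+1 s) <= expR (y * 4).
  apply: (le_trans (@cabs_pk_le2 y s s1)); rewrite -[leRHS]mulr1; apply: ler_pM; rewrite ?expR_ge0 ?invr_ge0 ?exprn_ge0 ?cabs_ge0 //.
    by rewrite ler_expR /= ler_wpM2l //; case/andP: xx.
  by rewrite invf_le1 ?exprn_ege1 // exprn_gt0 //; clear -zP RH simple j1 s1; lra.
have bA : cabs (gA d s) <= expR (8 - d ^+ 2 / 2 * T ^+ 2).
  rewrite /s cabs_gA t2 ler_expR; have d2 : d ^+ 2 <= 1 by rewrite expr_le1 // ltW.
  have d20 : 0 <= d ^+ 2 by rewrite sqr_ge0.
  have x2 : x ^+ 2 <= 16 by rewrite expr2; clear -zP RH simple j1 xx; nra.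
  have x20 : 0 <= x ^+ 2 by rewrite sqr_ge0.
  move: (T ^+ 2) (x ^+ 2) (d ^+ 2) d2 d20 x2 x20 => u v w; clear -zP RH simple j1; nra.
have e6 : (1 + T) ^+ 6 <= expR 6 * expR (6 * T).
  rewrite -expRD (_ : 6 + 6 * T = 6 * (1 + T)); last ring.
  rewrite expRM_natl lerXn2r ?nnegrE ?expR_ge0 //; first by clear -zP RH simple j1 T1; lra.
  by have := expR_ge1Dx (1 + T); clear -zP RH simple j1 T1; lra.
rewrite /Hd /Qz 2!cabsM (cabsM (zeta _)) cabsV cz.
have -> : C * expR 6 * expR ((B + 6) * T + y * 4 + 8 - d ^+ 2 / 2 * T ^+ 2) =
   C * (expR 6 * expR (6 * T)) * expR (B * T) * expR (y * 4) * expR (8 - d ^+ 2 / 2 * T ^+ 2).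
  have -> : (B + 6) * T + y * 4 + 8 - d ^+ 2 / 2 * T ^+ 2 = 6 * T + B * T + y * 4 + (8 - d ^+ 2 / 2 * T ^+ 2) by ring.
  by rewrite !(expRD (6 * T + B * T + y * 4)) (expRD (6 * T + B * T)) (expRD (6 * T)); ring.
apply: ler_pM; rewrite ?mulr_ge0 ?invr_ge0 ?cabs_ge0 //; apply: ler_pM; rewrite ?mulr_ge0 ?invr_ge0 ?cabs_ge0 //.
apply: ler_pM; rewrite ?invr_ge0 ?cabs_ge0 //.
by apply: (le_trans bz); rewrite ler_wpM2l //; clear -zP RH simple j1 C1; lra.
Qed.

Lemma hor_error : exists2 C : R, 1 <= C & forall B T d y, 1 <= T -> 0 < d <= 1 -> 0 <= y ->
  (forall x, - (3 / 2) <= x <= 4 -> zeta (x +i* T) != 0 /\ (cabs (zeta (x +i* T)))^-1 <= expR (B * T)) ->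
  cabs (cI (fun t => Hd zeta j d y (t +i* (- T))) (1 / 4) 4) + cabs (cI (fun t => Hd zeta j d y (t +i* T)) (1 / 4) 4) +
  cabs (cI (fun t => Hd zeta j d y (t +i* (- T))) (- (3 / 2)) (1 / 4)) +
  cabs (cI (fun t => Hd zeta j d y (t +i* T)) (- (3 / 2)) (1 / 4)) <=
  C * expR ((B + 6) * T + y * 4 + 8 - d ^+ 2 / 2 * T ^+ 2).
Proof.
have i1 : - (3 / 2) <= 1 / 4 :> R by lra.
have i2 : 1 / 4 <= 4 :> R by lra.
have [C C1 HC] := hor_pt; exists (22 * C); first lra.
move=> B T d y T1 d01 y0 Hz; set E := expR _.
have E0 : 0 <= E by exact: expR_ge0.
have sg (a b : R) (c : bool) : - (3 / 2) <= a -> a <= b -> b <= 4 ->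
    cabs (cI (fun t => Hd zeta j d y (t +i* (if c then T else - T))) a b) <= 2 * (C * E) * (b - a).
  move=> a0 ab b4; have zn x : a <= x <= b -> zeta (x +i* (if c then T else - T)) != 0.
    move=> xx; have [|z0 _] := Hz x; first lra.
    by case: c; rewrite // -cabs_eq0 cabs_zeta_conj ?cabs_eq0 //; apply/eqP; lra.
  have tn : (if c then T else - T) != 0 by case: c {zn}; apply/eqP; lra.
  apply: cI_le => //.
    apply: cts_integrable => x xx; apply: cts_hor; apply: dble_cts; apply: dble_Hd => //; first exact: zn.
    - exact: Im_neq.
    - exact: Im_neq.
    - by rewrite complex2E; exact: Im_neq.
  by move=> x xx; have [|z0 zb] := Hz x; [by clear -zP RH simple j1 xx a0 b4; lra|apply: HC => //; clear -zP RH simple j1 xx a0 b4; lra].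
have h1 := sg _ _ false i1 i2 (lexx 4).
have h2 := sg _ _ true i1 i2 (lexx 4).
have h3 := sg _ _ false (lexx _) i1 i2.
have h4 := sg _ _ true (lexx _) i1 i2.
rewrite /= in h1 h2 h3 h4; rewrite -[22 * C * E]mulrA.
by move: (C * E) h1 h2 h3 h4 => q; move: (cabs _) (cabs _) (cabs _) (cabs _) => a b c e; clear -zP RH simple j1; lra.
Qed.

(** The path around 0 is fixed, so [Qz s / s^(j + 1)] is bounded on it by continuity; its largest
    abscissa [1/4] determines the growth [e^(y / 4)]. *)
Lemma detour_error : exists2 C : R, 0 <= C & forall d y, 0 < d <= 1 -> 0 <= y ->
  cabs (cI (fun t => Hd zeta j d y (t +i* (- 1))) (- (3 / 2)) (1 / 4)) +
  cabs (cI (fun t => Hd zeta j d y (t +i* 1)) (- (3 / 2)) (1 / 4)) +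
  cabs (cI (fun t => Hd zeta j d y ((1 / 4) +i* t)) (- 1) 1) <= C * expR (y / 4).
Proof.
pose q s : R[i] := Qz zeta s / s ^+ j.+1.
have EH d y s : Hd zeta j d y s = q s * (cexp (y%:C * s) * gA d s).
  by rewrite /Hd /q /pk; ring.
have dq s : zeta s != 0 -> s != 0 -> s != 1 -> s != 2 -> dble q s.
  move=> z0 s0 s1 s2; apply: dble_div; [by rewrite expf_neq0|exact: dble_Qz|].
  by eexists; apply: hasdX; exact: hasd_id.
have cE d y s : cts id (fun s => cexp (y%:C * s) * gA d s) s.
  apply: ctsM; last exact/dble_cts/dble_gA.
  exact: hasd_cts (hasd_cexp_comp (hasdZ y%:C (hasd_id id s))).
have bE d y (a b : R) : 0 < d <= 1 -> 0 <= y -> - (3 / 2) <= a <= 1 / 4 ->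
    cabs (cexp (y%:C * (a +i* b)) * gA d (a +i* b)) <= expR (y / 4) * expR 2.
  move=> /andP[d0 d1] y0 aa; rewrite cabsM cabs_cexp cabs_gA cReM /= mul0r subr0.
  apply: ler_pM; rewrite ?expR_ge0 // ler_expR; first by nra.
  have d2 : d ^+ 2 <= 1 by rewrite expr_le1 // ltW.
  have a2 : a ^+ 2 <= 4 by rewrite expr2; nra.
  have := sqr_ge0 a; have := sqr_ge0 b; have := sqr_ge0 d.
  by move: (a ^+ 2) (b ^+ 2) (d ^+ 2) a2 d2 => u v w; nra.
have dqi s : cIm s != 0 -> cRe s != 1 / 2 -> dble q s.
  move=> zi zr; apply: dq; [exact: zeta_neq0_im|exact: Im_neq|exact: Im_neq|rewrite complex2E; exact: Im_neq].
have ch (c : R) x : c != 0 -> - (3 / 2) <= x <= 1 / 4 -> cts rc (fun t => q (t +i* c)) x.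
  by move=> c0 xx; apply: cts_hor; apply: dble_cts; apply: dqi => //=; apply/eqP; lra.
have cv t : cts rc (fun t => q ((1 / 4) +i* t)) t.
  apply: cts_ver; apply: dble_cts; apply: dq.
  - apply: (zeta_neq0 RH) => /=; [lra|apply/eqP; lra|].
    by apply: neq_Re => /=; lra.
  - by apply: neq_Re => /=; lra.
  - by apply: neq_Re => /=; lra.
  - by rewrite complex2E; apply: neq_Re => /=; lra.
have x34 : - (3 / 2) <= 1 / 4 :> R by lra.
have n11 : (- 1 : R) != 0 by apply/eqP; lra.
have n12 : (1 : R) != 0 by apply/eqP; lra.
have [M1 H1] := @cts_bounded R (fun t => q (t +i* (- 1))) (- (3 / 2)) (1 / 4) x34 (fun x xx => ch _ x n11 xx).
have [M2 H2] := @cts_bounded R (fun t => q (t +i* 1)) (- (3 / 2)) (1 / 4) x34 (fun x xx => ch _ x n12 xx).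
have m11 : - 1 <= 1 :> R by lra.
have [M3 H3] := @cts_bounded R (fun t => q ((1 / 4) +i* t)) (- 1) 1 m11 (fun x _ => cv x).
have M10 : 0 <= M1 by apply: le_trans (cabs_ge0 _) (H1 0 _); lra.
have M20 : 0 <= M2 by apply: le_trans (cabs_ge0 _) (H2 0 _); lra.
have M30 : 0 <= M3 by apply: le_trans (cabs_ge0 _) (H3 0 _); lra.
exists (4 * expR 2 * (M1 + M2 + M3)); first by rewrite !mulr_ge0 ?expR_ge0 // !addr_ge0.
move=> d y d01 y0; set E := expR (y / 4) * expR 2.
have E0 : 0 <= E by rewrite mulr_ge0 ?expR_ge0.
have hor (c M : R) : c != 0 -> 0 <= M -> (forall x, - (3 / 2) <= x <= 1 / 4 -> cabs (q (x +i* c)) <= M) ->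
    cabs (cI (fun t => Hd zeta j d y (t +i* c)) (- (3 / 2)) (1 / 4)) <= 2 * (M * E) * (1 / 4 - - (3 / 2)).
  move=> c0 M0 HM; apply: cI_le => //.
    by apply: cts_integrable => x xx; apply: cts_hor; apply: dble_cts; apply: dble_Hd_im => //=; apply/eqP; clear -zP RH simple j1 xx; lra.
  move=> x xx; rewrite EH cabsM; apply: ler_pM; rewrite ?cabs_ge0 //; [exact: HM|exact: bE].
have b1 := hor _ _ n11 M10 H1; have b2 := hor _ _ n12 M20 H2.
have b3 : cabs (cI (fun t => Hd zeta j d y ((1 / 4) +i* t)) (- 1) 1) <= 2 * (M3 * E) * (1 - - 1).
  apply: cI_le => //.
    apply: cts_integrable => t _; rewrite (_ : (fun t => _) = fun t => q ((1 / 4) +i* t) * (cexp (y%:C * ((1 / 4) +i* t)) * gA d ((1 / 4) +i* t))); last by apply/funext => u; exact: EH.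
    by apply: ctsM; [exact: cv|apply: (@cts_ver R (fun s => cexp (y%:C * s) * gA d s)); exact: cE].
  move=> t tt; rewrite EH cabsM; apply: ler_pM; rewrite ?cabs_ge0 //; [exact: H3|apply: bE => //; clear -zP RH simple j1; lra].
have -> : 4 * expR 2 * (M1 + M2 + M3) * expR (y / 4) = 4 * (M1 * E) + 4 * (M2 * E) + 4 * (M3 * E).
  by rewrite /E; ring.
have := mulr_ge0 M10 E0; have := mulr_ge0 M20 E0; have := mulr_ge0 M30 E0.
move: (M1 * E) (M2 * E) (M3 * E) b1 b2 b3 => u v w.
by move: (cabs _) (cabs _) (cabs _) => a b c; clear -zP RH simple j1; lra.
Qed.

End Estimates.

(** * The explicit formula on unit intervals *)

Section Explicit.
Variable R : realType.
Implicit Types (x t T d y : R) (s z : R[i]) (n N : nat).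

(** For [d = e^(-8 y0)] the right edge contributes [e^(4 y) d^(1/2) = e^(4 y - 4 y0)], the left edge
    [e^(- 3 y / 2 + y0)], the main term [e^(2 y - 16 y0)]; terms decaying in [T] are made small by
    taking [T] large in terms of [y0]. After the factor [e^(- y / 2)], the detour [e^(y / 4)] is the
    worst and dictates the rate [e^(- y0 / 4)]. *)
Lemma weight_bounds (y0 y T B Ch Cd : R) : 1 <= y0 -> y0 <= y <= y0 + 1 -> 1 <= T -> 0 <= Cd -> 1 <= Ch ->
  let d := expR (- (8 * y0)) in let E := expR (- (y0 / 4)) in
  80 * expR (5 * y0 + 4) <= T -> 2 * (B + 7) / d ^+ 2 <= T -> Ch + 5 * y0 + 12 <= T ->
  [/\ expR (- (y / 2)) * (80 * expR (y * 4) / T) <= E,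
      expR (- (y / 2)) * (12 * (24 * expR 8 * expR (y * 4) * rpw d (1 / 2))) <= 288 * expR 12 * E,
      expR (- (y / 2)) * (Ch * expR ((B + 6) * T + y * 4 + 8 - d ^+ 2 / 2 * T ^+ 2)) <= E,
      expR (- (y / 2)) * (Cd * expR (y / 4)) <= Cd * E &
      expR (- (y / 2)) * (32 * (24 * expR 2 * expR (- (y * (3 / 2))) * rpw d (- (1 / 8)))) <= 768 * expR 2 * E] /\
  expR (- (y / 2)) * (4 * expR 8 * (expR (2 * y) * d ^+ 2)) <= 4 * expR 10 * E.
Proof.
move=> y01 yy T1' Cd0 Ch1 d E tA1 tA2 tA3; have y00 : 0 <= y by lra.
have d2 : 0 < d ^+ 2 by rewrite exprn_gt0 // expR_gt0.
have v0 := expR_ge0 (- (y / 2)).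
have r1 : rpw d (1 / 2) = expR (- (4 * y0)) by rewrite /rpw expRK; congr expR; field.
have r2 : rpw d (- (1 / 8)) = expR y0 by rewrite /rpw expRK; congr expR; field.
have r3 : d ^+ 2 = expR (- (16 * y0)).
  by rewrite -expRM_natl; congr expR; ring.
have v1 : expR (- (y / 2)) <= 1 by rewrite -[leRHS]expR0 ler_expR; lra.
split; first split.
- apply: (@le_trans _ _ (80 * expR (y * 4) / T)).
    by rewrite ler_piMl // divr_ge0 ?mulr_ge0 ?expR_ge0 //; lra.
  rewrite ler_pdivrMr; last lra.
  apply: (@le_trans _ _ (E * (80 * expR (5 * y0 + 4)))); last by rewrite ler_wpM2l ?expR_ge0.
  rewrite mulrCA ler_pM2l // /E -expRD ler_expR; lra.
- rewrite r1; have -> : expR (- (y / 2)) * (12 * (24 * expR 8 * expR (y * 4) * expR (- (4 * y0)))) =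
     288 * (expR (- (y / 2)) * expR 8 * expR (y * 4) * expR (- (4 * y0))) by ring.
  by rewrite -[leRHS]mulrA; apply: ler_wpM2l; [exact: ler0n|rewrite /E -!expRD ler_expR; lra].
- apply: (@le_trans _ _ (Ch * expR ((B + 6) * T + y * 4 + 8 - d ^+ 2 / 2 * T ^+ 2))).
    by rewrite ler_piMl // mulr_ge0 ?expR_ge0 //; lra.
  apply: (@le_trans _ _ (expR Ch * expR (- Ch - y0))); last by rewrite /E -expRD ler_expR; lra.
  apply: ler_pM; rewrite ?expR_ge0 //; [lra|exact: x_le_expR|].
  rewrite ler_expR; have q : (B + 7) * T <= d ^+ 2 / 2 * T ^+ 2.
    have -> : d ^+ 2 / 2 * T ^+ 2 = d ^+ 2 / 2 * T * T by ring.
    rewrite ler_wpM2r; [by []|lra|].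
    by move: tA2; rewrite ler_pdivrMr //; move: (d ^+ 2) => w; lra.
  by move: (d ^+ 2 / 2 * T ^+ 2) q => w q; lra.
- by rewrite mulrCA ler_wpM2l // -expRD ler_expR; lra.

- rewrite r2; have -> : expR (- (y / 2)) * (32 * (24 * expR 2 * expR (- (y * (3 / 2))) * expR y0)) =
     768 * (expR (- (y / 2)) * expR 2 * expR (- (y * (3 / 2))) * expR y0) by ring.
  by rewrite -[leRHS]mulrA; apply: ler_wpM2l; [exact: ler0n|rewrite /E -!expRD ler_expR; lra].
- rewrite r3; have -> : expR (- (y / 2)) * (4 * expR 8 * (expR (2 * y) * expR (- (16 * y0)))) =
     4 * (expR (- (y / 2)) * expR 8 * expR (2 * y) * expR (- (16 * y0))) by ring.
  by rewrite -[leRHS]mulrA; apply: ler_wpM2l; [exact: ler0n|rewrite /E -!expRD ler_expR; lra].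
Qed.

Variable zeta : R[i]^o -> R[i]^o.
Hypothesis zP : is_riemann_zeta zeta.
Hypotheses (RH : riemann_hypothesis zeta) (simple : simple_zeros zeta).
Variable j : nat.
Hypothesis j1 : (1 <= j)%N.

Lemma main_term d y : 0 < d <= 1 ->
  cabs (c2 j d y - (3 / (2 ^+ j * pi ^+ 2) * expR y ^+ 2)%:C) <= 4 * expR 8 * (expR (2 * y) * d ^+ 2).
Proof.
move=> /andP[d0 d1]; have p2 := pi_ge2 R; have p0 := pi_gt0 R.
have d20 : 0 <= d ^+ 2 by rewrite sqr_ge0.
have d21 : d ^+ 2 <= 1 by rewrite expr_le1 // ltW.
pose M : R := 3 / (2 ^+ j * pi ^+ 2) * expR y ^+ 2.
have t0 : 0 < 2 ^+ j :> R by rewrite exprn_gt0.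
have pp : 0 < pi ^+ 2 :> R by rewrite exprn_gt0.
have E2 : expR y ^+ 2 = expR (2 * y) by rewrite expRM_natl.
have EM : c2 j d y = M%:C * gA d 2.
  rewrite /c2 /pk /M; congr (_ * _).
  rewrite (_ : y%:C * 2 = (2 * y)%:C); last by rewrite rmorphM /= (rmorph_nat (real_complex R)) mulrC.
  rewrite cexp_real -(rmorph_nat (real_complex R) 2) -rmorphXn -!fmorphV -!rmorphM /=; congr (_%:C).
  rewrite E2 [2 ^+ j.+1]exprS; move: (2 ^+ j) (pi ^+ 2) (expR _) t0 pp => a b c a0 b0.
  by field; rewrite !gt_eqF.
have -> : c2 j d y - M%:C = M%:C * (gA d 2 - 1) by rewrite EM; ring.
have M0 : 0 <= M.
  by apply: mulr_ge0; [apply: divr_ge0 => //; apply: mulr_ge0; exact: ltW|exact: sqr_ge0].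
have Mle : M <= expR (2 * y).
  rewrite /M E2 ler_piMl ?expR_ge0 // ler_pdivrMr ?mulr_gt0 // mul1r.
  have h1 : 2 <= 2 ^+ j :> R by rewrite -(prednK j1) exprS ler_peMr // exprn_ege1 // ler1n.
  have h2 : 4 <= pi ^+ 2 :> R by rewrite expr2; nra.
  by move: (2 ^+ j) (pi ^+ 2) h1 h2 => a b; nra.
have complex2E : (2 : R[i]) = 2%:C by rewrite (rmorph_nat (real_complex R)).
have ez : (d ^+ 2 / 2)%:C * (2 : R[i]) ^+ 2 = (2 * d ^+ 2)%:C.
  by rewrite complex2E -rmorphXn -rmorphM /=; congr (_%:C); rewrite [2 ^+ 2]expr2; field.
rewrite cabsM cabs_real ger0_norm //.
have hA : cabs (gA d 2 - 1) <= 4 * expR 8 * d ^+ 2.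
  rewrite /gA ez; apply: (le_trans (cexp_sub1 _)); first by rewrite /=; lra.
  by rewrite cabs_real ger0_norm ?mulr_ge0 //; have := expR_ge0 (8 : R); nra.
apply: (le_trans (ler_pM M0 (cabs_ge0 _) Mle hA)).
by rewrite le_eqVlt; apply/orP; left; apply/eqP; ring.
Qed.

(** Everything carries the factor [2 pi] of Perron's formula: it is at least 1, so it may be dropped
    on the left, and at most 8, which multiplies [e]. *)
Lemma combine (X X0 c S P : R[i]) (Fr M a b h e : R) : P = (2 * pi)%:C ->
  cabs (X0 - (2 * pi * Fr)%:C) <= a -> cabs (X - X0) <= b -> cabs (X - P * (c + S)) <= h ->
  cabs (c - M%:C) <= e -> cabs ((Fr - M)%:C - S) <= a + b + h + 8 * e.
Proof.
move=> -> ha hb hh he; have p2 := pi_ge2 R; have p4 := pihalf_lt2 R.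
have E : (2 * pi)%:C * ((Fr - M)%:C - S) =
   - (X0 - (2 * pi * Fr)%:C) - (X - X0) + (X - (2 * pi)%:C * (c + S)) + (2 * pi)%:C * (c - M%:C).
  by rewrite rmorphB /= [(_ * Fr)%:C]rmorphM /=; ring.
have h1 : cabs ((Fr - M)%:C - S) <= cabs ((2 * pi)%:C * ((Fr - M)%:C - S)).
  rewrite cabsM cabs_real ger0_norm; last lra.
  by have := cabs_ge0 ((Fr - M)%:C - S); nra.
apply: (le_trans h1); rewrite E.
have q1 := cabsD (- (X0 - (2 * pi * Fr)%:C) - (X - X0) + (X - (2 * pi)%:C * (c + S))) ((2 * pi)%:C * (c - M%:C)).
have q2 := cabsD (- (X0 - (2 * pi * Fr)%:C) - (X - X0)) (X - (2 * pi)%:C * (c + S)).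
have q3 := cabsB (- (X0 - (2 * pi * Fr)%:C)) (X - X0); rewrite cabsN in q3.
have q4 : cabs ((2 * pi)%:C * (c - M%:C)) <= 8 * e.
  rewrite cabsM cabs_real ger0_norm; last lra.
  by have := cabs_ge0 (c - M%:C); nra.
apply: (le_trans q1); apply: lerD => //; apply: (le_trans q2); apply: lerD => //.
by apply: (le_trans q3); exact: lerD.
Qed.

Lemma weigh (v E X1 X2 X3 X4 X5 X6 a2 a4 a5 a6 : R) : v * X1 <= E -> v * X2 <= a2 * E ->
  v * X3 <= E -> v * X4 <= a4 * E -> v * X5 <= a5 * E -> v * X6 <= a6 * E ->
  v * (X1 + X2 + (X3 + X4 + X5) + 8 * X6) <= (1 + a2 + (1 + a4 + a5) + 8 * a6) * E.
Proof. by move=> *; lra. Qed.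

(** On the critical line [e^(y p)] has modulus [e^(y / 2)], so the normalisation leaves pure
    oscillations. As [T] can be pushed beyond any [T0], a prescribed finite range of zeros is always
    included, while the damping depends on [y0] alone. *)
Theorem explicit_formula : exists2 C : R, 0 <= C & forall y0, 1 <= y0 -> forall T0,
  exists T (zs : seq R[i]), [/\ T0 <= T, uniq zs,
    (forall q, nzero zeta q /\ - T <= cIm q <= T <-> q \in zs) &
    forall y, y0 <= y <= y0 + 1 ->
      cabs ((expR (- (y / 2)) * Rem j (expR y))%:C -
        \sum_(p <- zs) cz zeta j p * gA (expR (- (8 * y0))) p * cexp ((cIm p * y)%:C * ii))
      <= C * expR (- (y0 / 4))].
Proof.
have [Ch Ch1 Hh] := hor_error zP j1.
have [B B1 HB] := horizontal_bound zP RH simple.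
have [Cd Cd0 Hdt] := detour_error zP RH j.
pose C : R := 1 + 288 * expR 12 + (1 + Cd + 768 * expR 2) + 8 * (4 * expR 10).
exists C; first by rewrite /C; have := expR_ge0 (12 : R); have := expR_ge0 (2 : R); have := expR_ge0 (10 : R); lra.
move=> y0 y01 T0; pose d := expR (- (8 * y0)).
have d0 : 0 < d by exact: expR_gt0.
have d1 : d <= 1 by rewrite -expR0 ler_expR; lra.
have d01 : 0 < d <= 1 by rewrite d0.
have d2 : 0 < d ^+ 2 by rewrite exprn_gt0.
(* [A1] is for the truncation in Perron's formula, [A2] lets the Gaussian beat [e^((B + 6) T)] on
   the horizontal sides, [A3] absorbs the constants left there. *)
pose A1 := 80 * expR (5 * y0 + 4); pose A2 := 2 * (B + 7) / d ^+ 2; pose A3 := Ch + 5 * y0 + 12.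
pose T1 := Num.max (Num.max T0 10) (Num.max A1 (Num.max A2 A3)).
have tm : [/\ T0 <= T1, 10 <= T1, A1 <= T1, A2 <= T1 & A3 <= T1].
  by rewrite /T1; split; rewrite !le_max lexx ?orbT.
have [t0 t10 tA1 tA2 tA3] := tm.
have [T /andP[TT _] HT] := HB T1 t10.
have {t0 t10 tA1 tA2 tA3 tm} [t0 t10 tA1 tA2 tA3] : [/\ T0 <= T, 10 <= T, A1 <= T, A2 <= T & A3 <= T].
  by split; apply: le_trans TT.
have [zs uz Hz] := zeros_interval zP RH simple (- T) T.
exists T, zs; split => // y yy.
have T1' : 1 <= T by apply: le_trans t10; rewrite ler1n.
have y00 : 0 <= y by case/andP: yy => /(le_trans (le_trans ler01 y01)).
have T1lt : 1 < T by apply: lt_le_trans t10; rewrite ltr1n.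
have zT : zeta ((1 / 2) +i* T) != 0 by have [|h _] := HT (1 / 2); [lra|].
have v0 := expR_ge0 (- (y / 2)).
have [[k1 k2 k3 k4 k5] k6] := weight_bounds y01 yy T1' Cd0 Ch1 tA1 tA2 tA3.
have a := perron_F zP y j1 T1'.
have b := right_error zP j1 y d01 T1'.
have c := contour zP RH simple j d y T1lt uz Hz zT.
have e := main_term y d01.
have h1 := Hh B T d y T1' d01 y00 HT.
have h2 := Hdt d y d01 y00.
have h3 := left_error zP RH simple j1 y d01 T1'.
have {}c := le_trans c (lerD (lerD h1 h2) h3).
have := combine erefl a b c e; set S := \sum_(p <- zs) _ => main.
have ES : \sum_(p <- zs) cz zeta j p * gA d p * cexp ((cIm p * y)%:C * ii) = (expR (- (y / 2)))%:C * S.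
  rewrite mulr_sumr; apply: eq_big_seq => p pz; have /Hz[np _] := pz; have Rp := nzero_Re RH np.
  have -> : cexp ((cIm p * y)%:C * ii) = (expR (- (y / 2)))%:C * cexp (y%:C * p).
    by rewrite -cexp_real -cexpD; congr cexp; apply: complexP; rewrite ?cReD ?cImD ?cReM ?cImM /= ?Rp; field.
  by ring.
rewrite -/d ES rmorphM /= -mulrBr cabsM cabs_real ger0_norm ?expR_ge0 //.
apply: (le_trans (ler_wpM2l v0 main)); exact: weigh k1 k2 k3 k4 k5 k6.
Qed.

End Explicit.

(** * Mean squares of exponential sums *)

Section MeanSquare.
Variable R : realType.
Implicit Types (x t T d y : R) (s z : R[i]) (n N : nat).

Lemma is_trig1 (a w f : R) : is_trig (fun y => a * cos (w * y + f)).
Proof. by exists [:: (a, w, f)] => y; rewrite /trigp big_seq1. Qed.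

Lemma is_trig_sum (I : Type) (r : seq I) (p : I -> R -> R) : (forall i, is_trig (p i)) ->
  is_trig (fun y => \sum_(i <- r) p i y).
Proof.
move=> H; elim: r => [|i r IH].
  by exists [::] => y; rewrite /trigp !big_nil.
have -> : (fun y => \sum_(i <- i :: r) p i y) = (fun y => p i y + \sum_(i <- r) p i y).
  by apply/funext => y; rewrite big_cons.
exact: is_trigD.
Qed.

Lemma rI_sum (I : Type) (r : seq I) (h : I -> R -> R) (a b : R) : (forall i, continuous (h i)) ->
  continuous (fun y => \sum_(i <- r) h i y) /\
  rI (fun y => \sum_(i <- r) h i y) a b = \sum_(i <- r) rI (h i) a b.
Proof.
move=> H; elim: r => [|i r [IH1 IH2]].
  have E : (fun y : R => \sum_(i <- [::]) h i y) = (fun y => 0 * cos y).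
    by apply/funext => y; rewrite big_nil mul0r.
  rewrite E; have cc : continuous (@cos R) by exact: continuous_cos.
  by split; [apply: contM => //; exact: cont_cst|rewrite big_nil rIZ // mul0r].
have -> : (fun y => \sum_(i <- i :: r) h i y) = (fun y => h i y + \sum_(i <- r) h i y).
  by apply/funext => y; rewrite big_cons.
by split; [exact: contD|rewrite big_cons rID // IH2].
Qed.

Lemma cis_re (b : R[i]) (g y : R) : cRe (b * cexp ((g * y)%:C * ii)) =
  cRe b * cos (g * y + 0) + cIm b * cos (g * y + pi / 2).
Proof.
have E : (g * y)%:C * ii = 0 +i* (g * y) :> R[i] by apply: complexP; rewrite ?cReM ?cImM /=; ring.
by rewrite E cosDpihalf addr0 cReM /cexp /= expR0 !mul1r; ring.
Qed.

Lemma is_trig_cis (b : R[i]) (g : R) : is_trig (fun y => cRe (b * cexp ((g * y)%:C * ii))).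
Proof.
have -> : (fun y => cRe (b * cexp ((g * y)%:C * ii))) =
   (fun y => cRe b * cos (g * y + 0) + cIm b * cos (g * y + pi / 2)).
  by apply/funext => y; rewrite cis_re.
by apply: is_trigD; exact: is_trig1.
Qed.

(** A weight used on [[-1, 1]]: it vanishes to second order at both ends, whence the inverse square
    decay of its cosine transform, and it is at least [9/16] on [[-1/2, 1/2]]. *)
Definition hat (u : R) : R := (1 - u ^+ 2) ^+ 2.

Lemma affine_der (a f x : R) : is_derive x 1 (fun y => a * y + f) a.
Proof. have -> : (fun y => a * y + f) = (fun y => a *: y + f) by [].
by apply: is_derive_eq; rewrite /GRing.scale /= mulr1 addr0. Qed.

Lemma cos_affine_der (a f x : R) : is_derive x 1 (fun y => cos (a * y + f)) (- (a * sin (a * x + f))).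
Proof.
have := @is_derive1_comp _ (@cos R) (fun t => a * t + f) x _ _ (is_derive_cos _) (affine_der a f x).
by move=> h; apply: (is_derive_eq h); ring.
Qed.

Lemma sin_affine_der (a f x : R) : is_derive x 1 (fun y => sin (a * y + f)) (a * cos (a * x + f)).
Proof.
have := @is_derive1_comp _ (@sin R) (fun t => a * t + f) x _ _ (is_derive_sin _) (affine_der a f x).
by move=> h; apply: (is_derive_eq h); ring.
Qed.

Lemma derM (f g : R -> R) (x a b : R) : is_derive x 1 f a -> is_derive x 1 g b ->
  is_derive x 1 (fun y => f y * g y) (a * g x + f x * b).
Proof.
move=> fa gb; apply: (is_derive_eq (is_deriveM fa gb)).
by rewrite /GRing.scale /=; ring.
Qed.

Lemma der_cont (f : R -> R) (f' : R -> R) : (forall x, is_derive x 1 f (f' x)) -> continuous f.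
Proof. by move=> H x; have [dd _] := H x; exact/differentiable_continuous/derivable1_diffP. Qed.

Lemma hat_der c x : is_derive x 1 (fun y => hat (y - c)) (- (4 * (x - c) * (1 - (x - c) ^+ 2))).
Proof.
have d1 : is_derive x 1 (fun y => y - c) 1.
  by have := affine_der 1 (- c) x; under eq_fun do rewrite mul1r.
have d2 : is_derive x 1 (fun y => 1 - (y - c) * (y - c)) (- (2 * (x - c))).
  have := is_deriveB (is_derive_cst (1 : R) x 1) (derM d1 d1).
  by move=> h; apply: (is_derive_eq h); ring.
have := derM d2 d2; move=> h; rewrite /hat.
have -> : (fun y => (1 - (y - c) ^+ 2) ^+ 2) = (fun y => (1 - (y - c) * (y - c)) * (1 - (y - c) * (y - c))).
  by apply/funext => y; rewrite !expr2.
by apply: (is_derive_eq h); ring.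
Qed.

Lemma hat'_der c x : is_derive x 1 (fun y => - (4 * (y - c) * (1 - (y - c) ^+ 2))) (12 * (x - c) ^+ 2 - 4).
Proof.
have d1 : is_derive x 1 (fun y => y - c) 1.
  by have := affine_der 1 (- c) x; under eq_fun do rewrite mul1r.
have d2 : is_derive x 1 (fun y => 1 - (y - c) * (y - c)) (- (2 * (x - c))).
  have := is_deriveB (is_derive_cst (1 : R) x 1) (derM d1 d1).
  by move=> h; apply: (is_derive_eq h); ring.
have := derM (is_derive_cst (- 4 : R) x 1) (derM d1 d2); move=> h.
have -> : (fun y => - (4 * (y - c) * (1 - (y - c) ^+ 2))) = (fun y => - 4 * ((y - c) * (1 - (y - c) * (y - c)))).
  by apply/funext => y; rewrite expr2; ring.
by apply: (is_derive_eq h); rewrite /cst /=; ring.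
Qed.

Lemma hat_cont c : continuous (fun y => hat (y - c)).
Proof. by apply: der_cont => x; exact: hat_der. Qed.

Lemma cos_affine_cont a f : continuous (fun y : R => cos (a * y + f)).
Proof. by apply: der_cont => x; exact: cos_affine_der. Qed.

(* [(a w sin + w' cos)' = a^2 w cos + w'' cos], and [w], [w'] vanish at the end points *)
Lemma hat_fourier a f c :
  `|rI (fun y => hat (y - c) * cos (a * y + f)) (c - 1) (c + 1)| <= 18 / (1 + a ^+ 2).
Proof.
set I := rI _ _ _.
have cb : continuous (fun y => hat (y - c)) by exact: hat_cont.
have cf : continuous (fun y : R => cos (a * y + f)) by exact: cos_affine_cont.
have cbf : continuous (fun y => hat (y - c) * cos (a * y + f)) by apply: contM.
pose w2 y := 12 * (y - c) ^+ 2 - 4.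
have cw : continuous w2.
  have -> : w2 = (fun y => 12 * ((y - c) * (y - c)) - 4) by apply/funext => y; rewrite /w2 expr2.
  have cy : continuous (fun y : R => y - c).
    by apply: contB; [move=> y; exact: cvg_id|exact: cont_cst].
  by apply: contB; [apply: contM; [exact: cont_cst|exact: contM]|exact: cont_cst].
have cwf : continuous (fun y => w2 y * cos (a * y + f)) by apply: contM.
pose J := rI (fun y => w2 y * cos (a * y + f)) (c - 1) (c + 1).
have cle : c - 1 <= c + 1 by lra.
have cosb (u : R) : `|cos u| <= 1 by rewrite ler_norml cos_geN1 cos_le1.
have bI : `|I| <= 2.
  apply: (le_trans (rI_norm _ _ cbf)); apply: (@le_trans _ _ (rI (fun=> 1) (c - 1) (c + 1))); last by rewrite rI_cst //; lra.
  apply: rI_le; [exact: continuous_abs|exact: cont_cst|] => y yy; rewrite normrM -[leRHS]mulr1.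
  apply: ler_pM => //; rewrite /hat ger0_norm ?sqr_ge0 //.
  have : (y - c) ^+ 2 <= 1 by rewrite expr2; nra.
  have := sqr_ge0 (y - c); move: ((y - c) ^+ 2) => v v0 v1; rewrite expr2; nra.
have bJ : `|J| <= 16.
  apply: (le_trans (rI_norm _ _ cwf)); apply: (@le_trans _ _ (rI (fun=> 8) (c - 1) (c + 1))); last by rewrite rI_cst //; lra.
  apply: rI_le; [exact: continuous_abs|exact: cont_cst|] => y yy; rewrite normrM -[leRHS]mulr1.
  apply: ler_pM => //; rewrite /w2 ler_norml.
  have : (y - c) ^+ 2 <= 1 by rewrite expr2; nra.
  by have := sqr_ge0 (y - c); move: ((y - c) ^+ 2) => v v0 v1; lra.
have E : a ^+ 2 * I + J = 0.
  rewrite /I /J -rIZ // -rID //; last by apply: contM => //; exact: cont_cst.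
  pose H y := a * hat (y - c) * sin (a * y + f) + (- (4 * (y - c) * (1 - (y - c) ^+ 2))) * cos (a * y + f).
  pose h x := a ^+ 2 * (hat (x - c) * cos (a * x + f)) + w2 x * cos (a * x + f).
  have ch : continuous h by apply: contD => //; apply: contM => //; exact: cont_cst.
  have dH x : is_derive x 1 H (h x).
    rewrite /H; have h1 := derM (derM (is_derive_cst a x 1) (hat_der c x)) (sin_affine_der a f x).
    have h2 := derM (hat'_der c x) (cos_affine_der a f x).
    apply: (is_derive_eq (is_deriveD h1 h2)); rewrite /h /w2 /hat /cst /=.
    by move: (sin _) (cos _) => s1 c1; ring.
  rewrite (rI_FTC cle ch dH) /H /hat (_ : c + 1 - c = 1); last ring.
  by rewrite (_ : c - 1 - c = - 1); last ring; ring.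
have a0 := sqr_ge0 a; rewrite ler_pdivlMr; last lra.
have : `|a ^+ 2 * I| <= 16 by rewrite (_ : a ^+ 2 * I = - J) ?normrN //; lra.
by rewrite normrM (ger0_norm a0); move: (a ^+ 2) `|I| bI => u v; lra.
Qed.

Lemma cabs_sum_sqr (r : seq R[i]) (b : R[i] -> R[i]) y :
  cabs (\sum_(p <- r) b p * cexp ((cIm p * y)%:C * ii)) ^+ 2 =
  \sum_(p <- r) \sum_(q <- r)
     cRe (b p * conjc (b q) * cexp (((cIm p - cIm q) * y)%:C * ii)).
Proof.
pose Z (p : R[i]) : R[i] := b p * cexp ((cIm p * y)%:C * ii).
have E p q : cRe (b p * conjc (b q) * cexp (((cIm p - cIm q) * y)%:C * ii)) =
    cRe (Z p) * cRe (Z q) + cIm (Z p) * cIm (Z q).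
  have -> : b p * conjc (b q) * cexp (((cIm p - cIm q) * y)%:C * ii) = Z p * conjc (Z q).
    have -> : ((cIm p - cIm q) * y)%:C * ii =
       (cIm p * y)%:C * ii + conjc ((cIm q * y)%:C * ii) :> R[i].
      by apply: complexP; rewrite ?cReD ?cImD ?conj_re_im ?cReM ?cImM /=; ring.
    by rewrite /Z cexpD cexpJ mulrACA; congr (_ * _); symmetry; exact: (rmorphM (@conjc R)).
  by rewrite cReM (conj_re_im (Z q)) /=; ring.
have ER : cRe (\sum_(p <- r) Z p) = \sum_(p <- r) cRe (Z p).
  by apply: (big_morph (@complex.Re R)) => // u v; rewrite cReD.
have EI : cIm (\sum_(p <- r) Z p) = \sum_(p <- r) cIm (Z p).
  by apply: (big_morph (@complex.Im R)) => // u v; rewrite cImD.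
rewrite sqr_cabs ER EI !expr2 !mulr_suml -big_split; apply: eq_bigr => p _ /=.
by rewrite !mulr_sumr -big_split; apply: eq_bigr => q _ /=; rewrite E.
Qed.

Lemma is_trig_sqr (r : seq R[i]) (b : R[i] -> R[i]) :
  is_trig (fun y => cabs (\sum_(p <- r) b p * cexp ((cIm p * y)%:C * ii)) ^+ 2).
Proof.
under eq_fun do rewrite cabs_sum_sqr.
by apply: is_trig_sum => p; apply: is_trig_sum => q; exact: is_trig_cis.
Qed.

(** The unit interval lies under the middle of the weight, at the cost [16/9]. After expansion,
    [2 |b p b q| <= |b p|^2 + |b q|^2] reduces the double sum to row sums of the kernel
    [1 / (1 + (gamma - gamma')^2)]: Schur's test, with [64 = (16/9) 36]. *)
Lemma mean_square (r : seq R[i]) (b : R[i] -> R[i]) (W : R[i] -> R) y0 :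
  (forall p, p \in r -> \sum_(q <- r) (1 + (cIm p - cIm q) ^+ 2)^-1 <= W p) ->
  rI (fun y => cabs (\sum_(p <- r) b p * cexp ((cIm p * y)%:C * ii)) ^+ 2) y0 (y0 + 1) <=
  64 * \sum_(p <- r) cabs (b p) ^+ 2 * W p.
Proof.
move=> HW; set P := (fun y => _ ^+ 2).
have cP : continuous P by apply: is_trig_cont; exact: is_trig_sqr.
have P0 y : 0 <= P y by exact: sqr_ge0.
pose c := y0 + 1 / 2.
have cb : continuous (fun y => hat (y - c)) by exact: hat_cont.
have cbP : continuous (fun y => hat (y - c) * P y) by apply: contM.
have bP0 y : 0 <= hat (y - c) * P y by rewrite mulr_ge0 // sqr_ge0.
have s1 : rI P y0 (y0 + 1) <= 16 / 9 * rI (fun y => hat (y - c) * P y) y0 (y0 + 1).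
  rewrite -rIZ //; apply: rI_le => // [|y yy]; first by apply: contM => //; exact: cont_cst.
  rewrite mulrA ler_peMl //.
  have : (y - c) ^+ 2 <= 1 / 4 by rewrite expr2 /c; nra.
  by rewrite /hat; move: ((y - c) ^+ 2) => v v1; rewrite expr2; nra.
have s2 : rI (fun y => hat (y - c) * P y) y0 (y0 + 1) <= rI (fun y => hat (y - c) * P y) (c - 1) (c + 1).
  have h1 : c - 1 <= y0 by rewrite /c; lra.
  have h2 : y0 <= y0 + 1 by lra.
  have h3 : y0 + 1 <= c + 1 by rewrite /c; lra.
  rewrite (@rI_split _ _ (c - 1) y0 (c + 1)) ?(@rI_split _ _ y0 (y0 + 1) (c + 1)) //; last lra.
  have i1 : 0 <= rI (fun y => hat (y - c) * P y) (c - 1) y0 by apply: rI_ge0.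
  have i2 : 0 <= rI (fun y => hat (y - c) * P y) (y0 + 1) (c + 1) by apply: rI_ge0.
  by move: (rI _ _ _) (rI _ _ _) (rI _ _ _) i1 i2 => A B D; lra.
pose tm p q y := hat (y - c) * cRe (b p * conjc (b q) * cexp (((cIm p - cIm q) * y)%:C * ii)).
have ct p q : continuous (tm p q) by apply: contM => //; apply: is_trig_cont; exact: is_trig_cis.
have cts p : continuous (fun y => \sum_(q <- r) tm p q y) by have [] := rI_sum r 0 0 (ct p).
have s3 : rI (fun y => hat (y - c) * P y) (c - 1) (c + 1) =
   \sum_(p <- r) \sum_(q <- r) rI (tm p q) (c - 1) (c + 1).
  rewrite (@eq_rI _ _ (fun y => \sum_(p <- r) \sum_(q <- r) tm p q y)); last first.
    by move=> y; rewrite /P cabs_sum_sqr mulr_sumr; apply: eq_bigr => p _; rewrite mulr_sumr.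
  by rewrite (rI_sum r (c - 1) (c + 1) cts).2; apply: eq_bigr => p _; rewrite (rI_sum r _ _ (ct p)).2.
pose k p q := (1 + (cIm p - cIm q) ^+ 2)^-1 : R.
have k0 p q : 0 <= k p q by rewrite invr_ge0 addr_ge0 ?sqr_ge0.
have kC p q : k p q = k q p by rewrite /k -sqrrN opprB.
have s4 p q : rI (tm p q) (c - 1) (c + 1) <= 18 * (cabs (b p) ^+ 2 + cabs (b q) ^+ 2) * k p q.
  pose be := b p * conjc (b q); pose a := cIm p - cIm q.
  have c1 f : continuous (fun y => hat (y - c) * cos (a * y + f)) by apply: contM => //; exact: cos_affine_cont.
  rewrite (@eq_rI _ _ (fun y => cRe be * (hat (y - c) * cos (a * y + 0)) +
       cIm be * (hat (y - c) * cos (a * y + pi / 2)))); last first.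
    by move=> y; rewrite /tm cis_re -/be -/a; ring.
  rewrite rID ?rIZ //; [|by apply: contM => //; exact: cont_cst|by apply: contM => //; exact: cont_cst].
  have h1 := hat_fourier a 0 c; have h2 := hat_fourier a (pi / 2) c.
  have l1 := Re_le_cabs be; have l2 := Im_le_cabs be.
  have lb : cabs be = cabs (b p) * cabs (b q) by rewrite /be cabsM cabsJ.
  have kk : 18 / (1 + a ^+ 2) = 18 * k p q by [].
  rewrite kk in h1 h2; apply: (le_trans (ler_norm _)); apply: (le_trans (ler_normD _ _)); rewrite !normrM.
  have m1 := ler_pM (normr_ge0 _) (normr_ge0 _) l1 h1.
  have m2 := ler_pM (normr_ge0 _) (normr_ge0 _) l2 h2.
  apply: (le_trans (lerD m1 m2)); rewrite lb.
  have := k0 p q; move: (cabs (b p)) (cabs (b q)) (k p q) => u v w w0.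
  have : 0 <= (u - v) ^+ 2 * w by rewrite mulr_ge0 ?sqr_ge0.
  by rewrite !expr2; lra.
have s5 : \sum_(p <- r) \sum_(q <- r) rI (tm p q) (c - 1) (c + 1) <=
    36 * \sum_(p <- r) cabs (b p) ^+ 2 * (\sum_(q <- r) k p q).
  apply: (@le_trans _ _ (\sum_(p <- r) \sum_(q <- r) (18 * (cabs (b p) ^+ 2 * k p q) + 18 * (cabs (b q) ^+ 2 * k q p)))).
    apply: ler_sum => p _; apply: ler_sum => q _; apply: (le_trans (s4 p q)).
    by rewrite (kC q p) le_eqVlt; apply/orP; left; apply/eqP; ring.
  under eq_bigr do rewrite big_split /=.
  rewrite big_split /= [X in _ + X]exchange_big /=.
  have E : \sum_(p <- r) \sum_(q <- r) 18 * (cabs (b p) ^+ 2 * k p q) = 18 * \sum_(p <- r) cabs (b p) ^+ 2 * (\sum_(q <- r) k p q).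
    by rewrite mulr_sumr; apply: eq_bigr => p _; rewrite !mulr_sumr.
  by rewrite E le_eqVlt; apply/orP; left; apply/eqP; move: (\sum_(p <- r) _) => u; ring.
have s6 : \sum_(p <- r) cabs (b p) ^+ 2 * (\sum_(q <- r) k p q) <= \sum_(p <- r) cabs (b p) ^+ 2 * W p.
  rewrite big_seq [leRHS]big_seq; apply: ler_sum => p pr; apply: ler_wpM2l; first exact: sqr_ge0.
  exact: HW.
rewrite s3 in s2; move: s1 s2 s5 s6.
by move: (rI _ _ _) (rI P _ _) (\sum_(p <- r) _) (\sum_(p <- r) _) (\sum_(p <- r) _) => A B D E G; lra.
Qed.

(** Regrouping by levels. The number of levels may be left unspecified because the bounds used on
    the levels have bounded sums. *)
Lemma sum_by_nat (I : eqType) (r : seq I) (m : I -> nat) (f : I -> R) :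
  exists N, \sum_(q <- r) f q = \sum_(k < N) \sum_(q <- r | m q == k) f q.
Proof.
exists (\max_(q <- r) m q).+1.
under [RHS]eq_bigr do rewrite big_mkcond.
rewrite exchange_big /=; apply: eq_big_seq => q qr.
have lt : (m q < (\max_(q <- r) m q).+1)%N by rewrite ltnS (@leq_bigmax_seq _ _ xpredT).
rewrite -big_mkcond (big_pred1 (Ordinal lt)) //.
Qed.

Lemma sum_le_size (I : eqType) (r : seq I) (f : I -> R) (g : R) : (forall q, q \in r -> f q <= g) ->
  \sum_(q <- r) f q <= (size r)%:R * g.
Proof.
move=> H; rewrite big_seq; apply: (@le_trans _ _ (\sum_(q <- r | q \in r) g)).
  by apply: ler_sum => q /H.
by rewrite -big_seq big_const_seq count_predT iter_addr_0 mulr_natl.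
Qed.

Lemma sum_inv_sqrt3 N : \sum_(k < N) (Num.sqrt k.+1%:R)^-1 ^+ 3 <= 3 :> R.
Proof.
case: N => [|N]; first by rewrite big_ord0.
apply: (@le_trans _ _ (3 - 2 * (Num.sqrt N.+1%:R)^-1)); last first.
  by rewrite gerBl mulr_ge0 // invr_ge0 sqrtr_ge0.
elim: N => [|N IH]; first by rewrite big_ord1 sqrtr1 invr1 expr1n; lra.
rewrite big_ord_recr /=; apply: (le_trans (lerD IH (lexx _))).
have a0 : 0 < Num.sqrt N.+1%:R :> R by rewrite sqrtr_gt0 ltr0n.
have b0 : 0 < Num.sqrt N.+2%:R :> R by rewrite sqrtr_gt0 ltr0n.
have a2 : Num.sqrt N.+1%:R ^+ 2 = N.+1%:R :> R by rewrite sqr_sqrtr.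
have b2 : Num.sqrt N.+2%:R ^+ 2 = N.+1%:R + 1 :> R by rewrite sqr_sqrtr // -[N.+2]addn1 natrD.
have ab : Num.sqrt N.+1%:R <= Num.sqrt N.+2%:R :> R by rewrite ler_sqrt ?ltr0n // ler_nat.
move: (N.+1%:R : R) (Num.sqrt (N.+1%:R : R)) (Num.sqrt (N.+2%:R : R)) a0 b0 a2 b2 ab => n a b a0 b0 a2 b2 ab.
have num : 0 <= 2 * b ^+ 2 * (b - a) - a.
  have -> : 2 * b ^+ 2 * (b - a) - a = (b - a) * (2 * b ^+ 2 - a ^+ 2 - a * b) + a * (b ^+ 2 - a ^+ 2 - 1) by ring.
  have -> : b ^+ 2 - a ^+ 2 - 1 = 0 by rewrite a2 b2; ring.
  by rewrite mulr0 addr0 mulr_ge0 ?subr_ge0 // !expr2; nra.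
rewrite -subr_ge0.
have -> : 3 - 2 * b^-1 - (3 - 2 * a^-1 + b^-1 ^+ 3) = (2 * b ^+ 2 * (b - a) - a) / (a * b ^+ 3).
  by field; rewrite !gt_eqF.
by rewrite divr_ge0 // mulr_ge0 ?exprn_ge0 ?ltW.
Qed.

Lemma sum_half N : \sum_(k < N) 2^-1 ^+ k <= 2 :> R.
Proof.
have -> : \sum_(k < N) 2^-1 ^+ k = 2 - 2 * 2^-1 ^+ N :> R.
  elim: N => [|N IH]; first by rewrite big_ord0 expr0; ring.
  by rewrite big_ord_recr /= IH exprS; move: (2^-1 ^+ N) => u; field.
by rewrite gerBl mulr_ge0 ?exprn_ge0.
Qed.

End MeanSquare.

(** * The contribution of high zeros *)

Section Tail.
Variable R : realType.
Implicit Types (x t T d y : R) (s z : R[i]) (n N : nat).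

Variable zeta : R[i]^o -> R[i]^o.
Hypothesis zP : is_riemann_zeta zeta.
Hypotheses (RH : riemann_hypothesis zeta) (simple : simple_zeros zeta).
Hypothesis J_bound : exists C : R, forall T : R, 2 <= T -> (Jm1 zeta T <= (C * T)%:E)%E.

(** Group the zeros by the integer part [k] of their distance to [g]. Each group lies in two unit
    windows, so it has O(sqrt ((1 + |g|) (k + 1))) members of weight at most [1 / (1 + k^2)], and
    the sum over [k] converges. *)
Lemma window_sum : exists2 C : R, 0 <= C & forall (r : seq R[i]), uniq r ->
  (forall q, q \in r -> nzero zeta q) -> forall g : R,
  \sum_(q <- r) (1 + (g - cIm q) ^+ 2)^-1 <= C * Num.sqrt (1 + `|g|).
Proof.
have [C C1 HC] := zero_count zP RH simple.
exists (24 * C); first lra.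
move=> r ur Hr g; pose m (q : R[i]) := Num.truncn `|g - cIm q|.
have [N ->] := sum_by_nat r m (fun q => (1 + (g - cIm q) ^+ 2)^-1).
have g0 := normr_ge0 g; set G := Num.sqrt (1 + `|g|).
have G0 : 0 <= G by exact: sqrtr_ge0.
have cnt (T : R) (P : pred R[i]) (k : nat) : `|T| <= `|g| + k%:R + 1 / 2 ->
    (forall q, q \in r -> P q -> `|cIm q - T| <= 1 / 2) ->
    (size [seq q <- r | P q])%:R <= C * (G * Num.sqrt (2 * k.+1%:R)).
  move=> hT hP; apply: (le_trans (HC T _ (filter_uniq _ ur) _)).
    by move=> q; rewrite mem_filter => /andP[Pq qr]; split; [exact: Hr|exact: hP].
  rewrite ler_wpM2l; [|lra|]; first by [].
  rewrite /G -sqrtrM; last lra.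
  rewrite ler_wsqrtr //; have k0 : 0 <= k%:R :> R by [].
  by rewrite -[k.+1]addn1 natrD; nra.
apply: (@le_trans _ _ (\sum_(k < N) 8 * C * G * (Num.sqrt k.+1%:R)^-1 ^+ 3)); last first.
  rewrite -mulr_sumr; have := sum_inv_sqrt3 R N; move: (\sum_(k < N) _) => u u3.
  have : 0 <= C * G by rewrite mulr_ge0 //; lra.
  by nra.
apply: ler_sum => -[k kN] _ /=; rewrite -big_filter.
have k0 : 0 <= k%:R :> R by [].
have D q : m q == k -> k%:R <= `|g - cIm q| <= k%:R + 1.
  move=> /eqP <-; have /andP[h1 h2] := truncn_itv (normr_ge0 (g - cIm q)).
  by rewrite h1 /= natr1; exact: ltW.
have b1 q : q \in [seq q <- r | m q == k] -> (1 + (g - cIm q) ^+ 2)^-1 <= (1 + k%:R ^+ 2)^-1.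
  rewrite mem_filter => /andP[/D /andP[h _] _].
  rewrite lef_pV2 ?posrE ?ltr_wpDr ?sqr_ge0 // lerD2l -[leRHS]real_normK ?num_real //.
  by rewrite lerXn2r ?nnegrE.
apply: (le_trans (sum_le_size b1)).
have b2 : (size [seq q <- r | m q == k])%:R <= 2 * (C * (G * Num.sqrt (2 * k.+1%:R))).
  have e : size [seq q <- r | m q == k] = (size [seq q <- r | (m q == k) && (cIm q <= g)%R] +
     size [seq q <- r | (m q == k) && ~~ (cIm q <= g)%R])%N.
    by elim: (r) => //= x s IH; case: (m x == k) => //=; case: (cIm x <= g) => /=; rewrite IH ?addnS ?addSn.
  rewrite e natrD mulr_natl mulr2n; apply: lerD.
    apply: (cnt (g - k%:R - 1 / 2)).
      by have := ler_normB g (k%:R + 1 / 2); rewrite opprD addrA (ger0_norm (x := k%:R + 1 / 2)); lra.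
    move=> q _ /andP[/D h1 h2]; move: h1; rewrite ger0_norm ?ler_norml; lra.
  apply: (cnt (g + k%:R + 1 / 2)).
    by have := ler_normD g (k%:R + 1 / 2); rewrite addrA (ger0_norm (x := k%:R + 1 / 2)); lra.
  move=> q _ /andP[/D h1 h2]; rewrite -ltNge in h2.
  by move: h1; rewrite ltr0_norm ?ler_norml; lra.
have k2 : 0 < 1 + k%:R ^+ 2 :> R by rewrite ltr_wpDr ?sqr_ge0.
apply: (le_trans (ler_wpM2r _ b2)); first by rewrite invr_ge0 ltW.
rewrite ler_pdivrMr //.
have s0 : 0 < Num.sqrt k.+1%:R :> R by rewrite sqrtr_gt0 ltr0n.
have s2 : Num.sqrt k.+1%:R ^+ 2 = k%:R + 1 :> R by rewrite sqr_sqrtr // natr1.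
have le2 : Num.sqrt (2 * k.+1%:R) <= 2 * Num.sqrt k.+1%:R :> R.
  rewrite sqrtrM // ler_wpM2r ?(ltW s0) //.
  have h := sqr_sqrtr (ler0n R 2); have h0 := sqrtr_ge0 (2 : R).
  by move: (Num.sqrt (2 : R)) h h0 => v; rewrite expr2; nra.
have CG : 0 <= C * G by rewrite mulr_ge0 //; lra.
apply: (@le_trans _ _ (4 * (C * G) * Num.sqrt k.+1%:R)).
  have := ler_wpM2l CG le2; move: (Num.sqrt (2 * _)) => u; move: (Num.sqrt (k.+1%:R : R)) => v.
  by move=> h; clear - h; lra.
have -> : 8 * C * G * (Num.sqrt k.+1%:R)^-1 ^+ 3 * (1 + k%:R ^+ 2) =
  4 * (C * G) * (2 * (1 + k%:R ^+ 2) * (Num.sqrt k.+1%:R)^-1 ^+ 3) by ring.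
apply: ler_wpM2l; first by rewrite mulr_ge0.
move: (Num.sqrt _) s0 s2 => s s0 s2; rewrite exprVn ler_pdivlMr ?exprn_gt0 //.
have -> : s * s ^+ 3 = (s ^+ 2) ^+ 2 by ring.
by rewrite s2; have := sqr_ge0 (k%:R - 1 : R); rewrite !expr2; lra.
Qed.

Lemma nzero_im q : nzero zeta q -> `|cIm q| > 0 -> nzero zeta q^*.
Proof.
rewrite normr_gt0 => -[q1 q0 _] qi; have z0 : zeta q^* = 0 by rewrite zeta_conj // q0 rmorph0.
have Im0 (s : R[i]) : cIm s != 0 -> s != 1 by move=> h; apply/eqP => E; rewrite E eqxx in h.
apply: nontriv => //; first by apply: Im0; rewrite conj_re_im /= oppr_eq0.
have := nzero_Re RH (_ : nzero zeta q); rewrite conj_re_im /= => -> //; first lra.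
split=> // n; apply/eqP => E; move: qi; rewrite E cImN.
by rewrite -(rmorph_nat (real_complex R)) /= oppr0 eqxx.
Qed.

(** An unordered sum of nonnegative terms dominates each of its finite partial sums. *)
Lemma J_list : exists2 C : R, 0 <= C & forall T (r : seq R[i]), 2 <= T -> uniq r ->
  (forall q, q \in r -> nzero zeta q /\ 0 < cIm q <= T) ->
  \sum_(q <- r) cabs (derive1 zeta q) ^- 2 <= C * T.
Proof.
have [C HC] := J_bound; exists `|C| => // T r T2 ur Hr.
apply: (@le_trans _ _ (C * T)); last by rewrite ler_wpM2r ?ler_norm //; lra.
rewrite -lee_fin; apply: le_trans (HC T T2); apply: esum_ge.
exists [set` (r : seq R[i]^o)].
  split; first exact: finite_seq.
  by move=> q /= /Hr.
by rewrite -fsbig_seq // sumEFin.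
Qed.

(** Zeros below the real axis are conjugate to zeros above it, with conjugate derivatives, so they
    merely double the constant. *)
Lemma J_list2 : exists2 C : R, 0 <= C & forall T (r : seq R[i]), 2 <= T -> uniq r ->
  (forall q, q \in r -> nzero zeta q /\ 0 < `|cIm q| <= T) ->
  \sum_(q <- r) cabs (derive1 zeta q) ^- 2 <= C * T.
Proof.
have [C C0 HC] := J_list; exists (2 * C); first by rewrite mulr_ge0.
move=> T r T2 ur Hr; rewrite (bigID (fun q : R[i] => 0 < cIm q)) /=.
rewrite -[X in X + _ <= _]big_filter -[X in _ + X <= _]big_filter -mulrA mulr_natl mulr2n; apply: lerD.
  apply: HC => //; first exact: filter_uniq.
  move=> q; rewrite mem_filter => /andP[q0 /Hr[nq /andP[_ qT]]]; split => //.
  by rewrite q0 (le_trans (ler_norm _)).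
set s := [seq _ <- r | _].
have E : \sum_(q <- s) cabs (derive1 zeta q) ^- 2 = \sum_(q <- [seq q^* | q <- s]) cabs (derive1 zeta q) ^- 2.
  rewrite big_map; apply: eq_big_seq => q; rewrite mem_filter => /andP[_ /Hr[_ /andP[q0 _]]].
  by rewrite derive_zeta_conj -?normr_gt0 // cabsJ.
rewrite E; apply: HC => //.
  by rewrite map_inj_uniq ?filter_uniq //; exact: (can_inj (@conjcK R)).
move=> q /mapP[p]; rewrite mem_filter -leNgt => /andP[p0 /Hr[np /andP[pi pT]]] ->; split.
  exact: nzero_im.
rewrite conj_re_im /=; move: pi pT; rewrite ler0_norm // => -> ->; exact: isT.
Qed.

Variable j : nat.
Hypothesis j1 : (1 <= j)%N.

(** By [zeta_m12_le], [|zeta (p - 1)| <= |p|], which cancels one power of [p] in the denominator; of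
    the remaining [j >= 1] powers one is kept as [1 / |gamma|]. *)
Lemma cz_le p : nzero zeta p -> 1 <= `|cIm p| ->
  cabs (cz zeta j p) ^+ 2 <= cabs (derive1 zeta p) ^- 2 / cIm p ^+ 2.
Proof.
move=> np pi; have pr := nzero_Re RH np; have p0 : cIm p != 0 by rewrite -normr_gt0; lra.
have ep : p = (1 / 2) +i* cIm p by rewrite -pr; case: (p).
have ep1 : p - 1 = (- (1 / 2)) +i* cIm p.
  by apply: complexP; rewrite ?cReD ?cImD ?cReN ?cImN /= ?pr; lra.
have hz : cabs (zeta (p - 1)) <= cabs p by rewrite ep1 {2}ep; exact: zeta_m12_le.
have pI : `|cIm p| <= cabs p by exact: Im_le_cabs.
have D0 : 0 < cabs (derive1 zeta p) by rewrite cabs_gt0; exact: simple.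
have P0 : 0 < cabs p by lra.
have h : cabs (cz zeta j p) <= (cabs (derive1 zeta p))^-1 / `|cIm p|.
  rewrite /cz cabsM cabsV cabsM cabsX exprS invfM mulrCA.
  apply: ler_wpM2l; first by rewrite invr_ge0 ltW.
  rewrite ler_pdivrMr ?mulr_gt0 ?exprn_gt0 // (le_trans hz) // mulrCA ler_peMr ?(ltW P0) //.
  rewrite mulrC ler_pdivlMr; last lra.
  rewrite mul1r (le_trans pI) // -[leLHS]expr1 ler_weXn2l //; lra.
apply: (@le_trans _ _ (((cabs (derive1 zeta p))^-1 / `|cIm p|) ^+ 2)).
  by rewrite lerXn2r ?nnegrE ?cabs_ge0 // (le_trans _ h) // cabs_ge0.
by rewrite exprMn !exprVn real_normK ?num_real.
Qed.

(** On the block [4^k <= |gamma| <= 4^(k + 1)] the bound on inverse derivatives gives O(4^k), the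
    square root O(2^k) and the factor [1 / gamma^2] at most [16^(-k)]: altogether O(2^(-k)). Base 4
    makes the square roots powers of 2. *)
Lemma tail_bound : exists2 C : R, 0 <= C & forall n0 (r : seq R[i]), uniq r ->
  (forall q, q \in r -> nzero zeta q /\ 4 ^+ n0 <= `|cIm q|) ->
  \sum_(q <- r) cabs (cz zeta j q) ^+ 2 * Num.sqrt (1 + `|cIm q|) <= C * 2^-1 ^+ n0.
Proof.
have [C C0 HC] := J_list2; exists (24 * C); first by rewrite mulr_ge0.
move=> n0 r ur Hr.
pose l (q : R[i]) := trunc_log 4 (Num.truncn `|cIm q|).
have lP q : q \in r -> (n0 <= l q)%N /\ 4 ^+ l q <= `|cIm q| <= 4 ^+ (l q).+1.
  move=> /Hr[_ h]; have n1 : (4 ^ n0 <= Num.truncn `|cIm q|)%N.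
    by rewrite truncn_ge_nat // natrX.
  split; first exact: trunc_log_max.
  have t0 : (0 < Num.truncn `|cIm q|)%N by apply: leq_trans n1; rewrite expn_gt0.
  have /andP[h1 h2] := trunc_log_bounds (isT : (1 < 4)%N) t0.
  have /andP[h3 h4] := truncn_itv (normr_ge0 (cIm q)).
  apply/andP; split.
    by apply: le_trans h3; rewrite -natrX ler_nat.
  by apply: (le_trans (ltW h4)); rewrite -natrX ler_nat.
have [N ->] := sum_by_nat r (fun q => l q - n0)%N (fun q => cabs (cz zeta j q) ^+ 2 * Num.sqrt (1 + `|cIm q|)).
apply: (@le_trans _ _ (\sum_(k < N) 12 * C * 2^-1 ^+ n0 * 2^-1 ^+ k)); last first.
  rewrite -mulr_sumr; have := sum_half R N; move: (\sum_(k < N) _) => u u2.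
  have : 0 <= C * 2^-1 ^+ n0 by rewrite mulr_ge0 ?exprn_ge0.
  by rewrite -(mulrA 12) -(mulrA 24); move: (C * _) => v v0; nra.
apply: ler_sum => -[k kN] _ /=; rewrite -big_filter; set s := [seq _ <- r | _].
have sP q : q \in s -> nzero zeta q /\ 4 ^+ (n0 + k) <= `|cIm q| <= 4 ^+ (n0 + k).+1.
  rewrite mem_filter => /andP[/eqP lk qr]; have [nq _] := Hr q qr; have [h1 h2] := lP q qr.
  by split => //; rewrite -lk subnKC.
set a : R := 4 ^+ (n0 + k) in sP *.
have a1 : 1 <= a by rewrite exprn_ege1 // ler1n.
have sJ : \sum_(q <- s) cabs (derive1 zeta q) ^- 2 <= C * (4 * a).
  apply: HC => [||q /sP[nq /andP[h1 h2]]]; [by lra|exact: filter_uniq|].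
  by split => //; rewrite /a -exprS h2 andbT; lra.
pose w : R := 2 ^+ (n0 + k).
have w1 : 1 <= w by rewrite exprn_ege1 // ler1n.
have aw : a = w ^+ 2 by rewrite /a /w -exprM mulnC exprM expr2; congr (_ ^+ _); ring.
have tq q : q \in s -> cabs (cz zeta j q) ^+ 2 * Num.sqrt (1 + `|cIm q|) <=
    3 / w ^+ 3 * cabs (derive1 zeta q) ^- 2.
  move=> /sP[nq]; rewrite exprS -/a => /andP[h1 h2].
  have i0 : 0 < cIm q ^+ 2 by rewrite -[_ ^+ 2]real_normK ?num_real // exprn_gt0; lra.
  have hs : Num.sqrt (1 + `|cIm q|) <= 3 * w.
    rewrite -[leRHS]ger0_norm; last lra.
    by rewrite -(sqrtr_sqr (3 * w)) ler_wsqrtr // exprMn -aw expr2; lra.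
  have hi : (cIm q ^+ 2)^-1 <= (w ^+ 4)^-1.
    have w4 : 0 < w ^+ 4 by rewrite exprn_gt0 //; lra.
    rewrite lef_pV2 ?posrE //.
    have -> : w ^+ 4 = a ^+ 2 by rewrite aw -exprM.
    by rewrite -[leRHS]real_normK ?num_real // lerXn2r ?nnegrE //; lra.
  have c2 : 0 <= cabs (derive1 zeta q) ^- 2 by rewrite invr_ge0 exprn_ge0 ?cabs_ge0.
  have hc := cz_le nq (le_trans a1 h1).
  apply: (le_trans (ler_pM (sqr_ge0 _) (sqrtr_ge0 _) (le_trans hc (ler_wpM2l c2 hi)) hs)).
  rewrite le_eqVlt; apply/orP; left; apply/eqP.
  by move: (cabs _ ^- 2) => u; field; rewrite gt_eqF //; lra.
rewrite big_seq; apply: (@le_trans _ _ (\sum_(q <- s | q \in s) 3 / w ^+ 3 * cabs (derive1 zeta q) ^- 2)).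
  by apply: ler_sum => q; exact: tq.
rewrite -big_seq -mulr_sumr.
apply: (@le_trans _ _ (3 / w ^+ 3 * (C * (4 * a)))).
  by rewrite ler_wpM2l // divr_ge0 // exprn_ge0 //; lra.
rewrite -!mulrA -exprD exprVn -/w aw le_eqVlt; apply/orP; left; apply/eqP.
by field; rewrite gt_eqF //; lra.
Qed.

End Tail.

(** * Approximation of the normalised remainder by trigonometric polynomials *)

Section Distribution.
Variable R : realType.
Implicit Types (x t T d y : R) (s z : R[i]) (n N : nat).

Variable zeta : R[i]^o -> R[i]^o.
Hypothesis zP : is_riemann_zeta zeta.
Hypotheses (RH : riemann_hypothesis zeta) (simple : simple_zeros zeta).
Hypothesis J_bound : exists C : R, forall T : R, 2 <= T -> (Jm1 zeta T <= (C * T)%:E)%E.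
Variable j : nat.
Hypothesis j1 : (1 <= j)%N.

Lemma contX (h : R -> R) n : continuous h -> continuous (fun x => h x ^+ n).
Proof.
move=> ch; elim: n => [|n IH].
  have -> : (fun x => h x ^+ 0) = fun=> 1 by apply/funext => x; rewrite expr0.
  exact: cont_cst.
have -> : (fun x => h x ^+ n.+1) = (fun x => h x * h x ^+ n) by apply/funext => x; rewrite exprS.
exact: contM.
Qed.

(** For [j >= 1] the cut-off power is [((v + |v|) / 2)^j / j!], without a jump at 0. *)
Lemma vpos_cont (c : R) : continuous (fun v => vpos (v - c) j).
Proof.
have E (v : R) : vpos v j = ((v + `|v|) / 2) ^+ j * (j`!%:R)^-1.
  rewrite /vpos; case: (lerP 0 v) => v0.
    by rewrite ger0_norm // (_ : (v + v) / 2 = v) //; field.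
  by rewrite ltr0_norm // subrr mul0r expr0n eqn0Ngt j1 mul0r.
have -> : (fun v => vpos (v - c) j) = (fun v => ((v - c + `|v - c|) * 2^-1) ^+ j * (j`!%:R)^-1).
  by apply/funext => v; rewrite E.
have c1 : continuous (fun v : R => v - c) by apply: contB; [move=> y; exact: cvg_id|exact: cont_cst].
apply: contM; last exact: cont_cst.
apply: contX; apply: contM; last exact: cont_cst.
by apply: contD => //; exact: continuous_abs.
Qed.

(** Near [y] the truncation can be frozen at [e^(y + 1)], the additional terms having weight 0; what
    remains is a fixed finite sum of continuous functions. *)
Lemma F_cont : continuous (fun y : R => F j (expR y)).
Proof.
move=> y; pose N := Num.truncn (expR (y + 1)).
pose h t : R := \sum_(1 <= n < N.+1) (totient n)%:R * vpos (t - ln n%:R) j.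
have ch : continuous h.
  have [] // := @rI_sum R nat (index_iota 1 N.+1) (fun n t => (totient n)%:R * vpos (t - ln n%:R) j) 0 0.
  by move=> n; apply: contM; [exact: cont_cst|exact: vpos_cont].
have hN t : t <= y + 1 -> F j (expR t) = h t.
  by move=> ty; apply: F_vpos => //; apply: le_truncn; rewrite ler_expR.
apply/cvgrPdist_lt => e e0; have /cvgrPdist_lt/(_ e e0) H := ch y.
near=> t; have ty : t <= y + 1.
  near: t; apply/nbhs_ballP; exists 1 => //= t; rewrite /ball /= ltr_norml; lra.
rewrite !hN //; last lra.
by near: t; exact: H.
Unshelve. all: end_near. Qed.

Lemma Rem_cont : continuous (fun y : R => expR (- (y / 2)) * Rem j (expR y)).
Proof.
have ce : continuous (@expR R) by exact: continuous_expR.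
have c2 : continuous (fun y : R => - (y / 2)).
  have -> : (fun y : R => - (y / 2)) = (fun y => - 2^-1 * y) by apply/funext => y; field.
  by apply: (@contM R (fun=> - 2^-1) (fun y => y)) => y; [exact: cvg_cst|exact: cvg_id].
apply: contM.
  by move=> y; apply: (@continuous_comp _ _ _ (fun y : R => - (y / 2)) expR); [exact: c2|exact: ce].
apply: contB; first exact: F_cont.
by apply: contM; [exact: cont_cst|exact: contX].
Qed.

(** This takes the place of the Cauchy-Schwarz inequality in passing from a mean square to a mean of
    the modulus. *)
Lemma le_add_sqr_div (v h : R) : 0 <= v -> 0 < h -> v <= h + h^-1 * v ^+ 2.
Proof.
move=> v0 h0; have [vh|hv] := leP v h.
  by apply: (le_trans vh); rewrite lerDl mulr_ge0 ?sqr_ge0 // invr_ge0 ltW.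
apply: (@le_trans _ _ (h^-1 * v ^+ 2)); last by rewrite lerDr ltW.
by rewrite mulrC ler_pdivlMr // expr2 ler_wpM2l // ltW.
Qed.

Lemma gA_le d q : nzero zeta q -> 0 < d <= 1 -> cabs (gA d q) <= expR 1.
Proof.
move=> nq /andP[d0 d1]; have qr := nzero_Re RH nq.
have -> : q = (1 / 2) +i* cIm q by rewrite -qr; case: (q).
rewrite cabs_gA ler_expR; have := sqr_ge0 (cIm q); move: (cIm q ^+ 2) => v v0.
have d2 : 0 <= d ^+ 2 <= 1 by rewrite sqr_ge0 expr_le1 // ltW.
move: (d ^+ 2) d2 => w /andP[w0 w1]; have h : w / 2 * v >= 0 by rewrite !mulr_ge0.
by move: h; rewrite expr2; lra.
Qed.

(** The factor [d] tends to 0 as [y0] grows, so the damping disappears from any fixed finite set of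
    zeros. *)
Lemma gA_near1 d q : nzero zeta q -> 0 < d <= 1 -> cabs (gA d q - 1) <= expR 8 * cabs q ^+ 2 * d.
Proof.
move=> nq /andP[d0 d1]; have qr := nzero_Re RH nq.
have d2 : d ^+ 2 <= d by rewrite expr2 ler_piMr // ltW.
have e0 := expR_ge0 (8 : R).
rewrite /gA; apply: (le_trans (cexp_sub1 _)).
  rewrite cReM /= mul0r subr0 expr2 cReM qr.
  have := sqr_ge0 (cIm q); rewrite expr2; move: (_ * cIm q) => v v0.
  have h : 0 <= d ^+ 2 * v by rewrite mulr_ge0 ?sqr_ge0.
  by lra.
rewrite cabsM cabsX cabs_real ger0_norm ?divr_ge0 ?sqr_ge0 //.
have h : 0 <= expR 8 * cabs q ^+ 2 by rewrite mulr_ge0 ?sqr_ge0.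
have -> : 2 * expR 8 * (d ^+ 2 / 2 * cabs q ^+ 2) = expR 8 * cabs q ^+ 2 * d ^+ 2 by field.
exact: ler_wpM2l.
Qed.

(** The approximating polynomial is the undamped sum over [|gamma| <= L], hence the same for all
    [y0]. The rest depends on [y0] through [T] and [d], but its mean square is bounded uniformly in
    both. *)
Theorem Rem_AP : AP (fun y : R => expR (- (y / 2)) * Rem j (expR y)).
Proof.
split; first exact: Rem_cont.
move=> e e0; pose g y : R := expR (- (y / 2)) * Rem j (expR y).
have [C1 C10 HT] := tail_bound zP RH simple J_bound j1.
have [W W0 HW] := window_sum zP RH simple.
have [C C0 HE] := explicit_formula zP RH simple j1.
pose E := expR 1 ^+ 2 : R; have E0 : 0 <= E by exact: sqr_ge0.
pose D := 64 * (E * (W * C1)); have D0 : 0 <= D by rewrite !mulr_ge0.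
(* The mean square of the tail is made at most [(e / 4)^2], so that [le_add_sqr_div] with
   [h = e / 4] costs [e / 4] twice. *)
have [n0 hn0] : exists n0, D * 2^-1 ^+ n0 <= e / 4 * (e / 4).
  have ee : 0 < e / 4 * (e / 4) by rewrite mulr_gt0 // divr_gt0.
  have [n hn] := exp2_unbounded (D / (e / 4 * (e / 4))).
  exists n; rewrite exprVn ler_pdivrMr ?exprn_gt0 //.
  by move: hn; rewrite ltr_pdivrMr // => /ltW; rewrite mulrC.
pose L : R := 4 ^+ n0; have L1 : 1 <= L by rewrite exprn_ege1 // ler1n.
have [zl ul Hl] := zeros_interval zP RH simple (- L) L.
pose c q := cz zeta j q; pose w q y := cexp ((cIm q * y)%:C * ii) : R[i].
have cw q y : cabs (w q y) = 1.
  by rewrite /w cabs_cexp cReM /= mul0r mulr0 subrr expR0.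
pose p y := cRe (\sum_(q <- zl) c q * w q y).
have tp : is_trig p.
  have -> : p = (fun y => \sum_(q <- zl) cRe (c q * cexp ((cIm q * y)%:C * ii))).
    by apply/funext => y; apply: (big_morph (@complex.Re R)) => // u v; rewrite cReD.
  by apply: is_trig_sum => q; exact: is_trig_cis.
exists p; split => //.
pose B := \sum_(q <- zl) cabs (c q) * (expR 8 * cabs q ^+ 2).
have B0 : 0 <= B by apply: sumr_ge0 => q _; rewrite !mulr_ge0 ?cabs_ge0 ?expR_ge0 ?sqr_ge0.
have CB : 0 <= 8 * (C + B) / e by rewrite divr_ge0 ?(ltW e0) // mulr_ge0 // addr_ge0.
(* Beyond this point [(C + B) e^(- y0 / 4) <= e / 2], because [e^u >= 1 + u]. *)
exists (1 + 8 * (C + B) / e); first lra.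
move=> y0 hy0; have y01 : 1 <= y0 by lra.
have [T [zs [LT us Hs HS]]] := HE y0 y01 L.
pose d := expR (- (8 * y0)); pose b q := c q * gA d q.
have d01 : 0 < d <= 1 by rewrite expR_gt0 /= -expR0 ler_expR; lra.
pose zh := [seq q <- zs | ~~ (`|cIm q| <= L)].
have zhP q : q \in zh -> nzero zeta q /\ L <= `|cIm q|.
  by rewrite mem_filter -ltNge => /andP[/ltW h /Hs[nq _]].
pose Sh y := \sum_(q <- zh) b q * w q y.
have spl y : \sum_(q <- zs) b q * w q y = \sum_(q <- zl) b q * w q y + Sh y.
  rewrite (bigID (fun q : R[i] => `|cIm q| <= L)) /= /Sh; congr (_ + _); last by rewrite -big_filter.
  rewrite -big_filter; apply: perm_big; apply: uniq_perm => //; first exact: filter_uniq.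
  move=> q; rewrite mem_filter; apply/andP/idP => [[]|/Hl[nq qi]].
    by rewrite ler_norml => qi /Hs[nq _]; apply/Hl.
  by rewrite ler_norml qi; split => //; apply/Hs; split => //; move: qi LT; lra.
pose E4 : R := expR (- (y0 / 4)).
have dE : d <= E4 by rewrite ler_expR; lra.
have dE0 : 0 <= E4 by exact: expR_ge0.
have ptw y : y0 <= y <= y0 + 1 -> `|g y - p y| <= (C + B) * E4 + cabs (Sh y).
  move=> yy; have h := HS y yy; rewrite -/d -/(g y) in h.
  have -> : g y - p y = cRe ((g y)%:C - \sum_(q <- zl) c q * w q y) by rewrite cReD cReN.
  apply: (le_trans (Re_le_cabs _)).
  have -> : (g y)%:C - \sum_(q <- zl) c q * w q y =
     ((g y)%:C - \sum_(q <- zs) b q * w q y) + (\sum_(q <- zl) c q * (gA d q - 1) * w q y + Sh y).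
    have -> : \sum_(q <- zl) c q * (gA d q - 1) * w q y = \sum_(q <- zl) b q * w q y - \sum_(q <- zl) c q * w q y.
      by rewrite -sumrB; apply: eq_bigr => q _; rewrite /b; ring.
    by rewrite spl; ring.
  apply: (le_trans (cabsD _ _)); rewrite mulrDl -addrA; apply: lerD; first exact: h.
  apply: (le_trans (cabsD _ _)); rewrite lerD2r; apply: (le_trans (cabs_sum _ _ _)).
  rewrite /B mulr_suml big_seq [leRHS]big_seq; apply: ler_sum => q /Hl[nq _].
  rewrite cabsM cw mulr1 cabsM -mulrA ler_wpM2l ?cabs_ge0 //.
  apply: (le_trans (gA_near1 nq d01)); apply: ler_wpM2l => //.
  by rewrite mulr_ge0 ?expR_ge0 ?sqr_ge0.
have tS := is_trig_sqr zh b; have cS := is_trig_cont tS.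
have Shi : rI (fun y => cabs (Sh y) ^+ 2) y0 (y0 + 1) <= e / 4 * (e / 4).
  apply: le_trans hn0.
  have uh : uniq zh by exact: filter_uniq.
  have hW q : q \in zh -> \sum_(q' <- zh) (1 + (cIm q - cIm q') ^+ 2)^-1 <= W * Num.sqrt (1 + `|cIm q|).
    by move=> _; apply: HW => // q' /zhP[].
  apply: (le_trans (mean_square b y0 hW)); rewrite /D -(mulrA 64 (E * (W * C1))) ler_pM2l //.
  apply: (@le_trans _ _ (E * (W * \sum_(q <- zh) cabs (c q) ^+ 2 * Num.sqrt (1 + `|cIm q|)))); last first.
    by rewrite -(mulrA E (W * C1)) -(mulrA W C1) !ler_wpM2l // HT.
  rewrite !mulr_sumr big_seq [leRHS]big_seq; apply: ler_sum => q /zhP[nq _].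
  rewrite /b cabsM exprMn.
  have h : cabs (gA d q) ^+ 2 <= E by rewrite lerXn2r ?nnegrE ?cabs_ge0 ?expR_ge0 // gA_le.
  have k : 0 <= cabs (c q) ^+ 2 * (W * Num.sqrt (1 + `|cIm q|)) by exact: mulr_ge0 (sqr_ge0 _) (mulr_ge0 W0 (sqrtr_ge0 _)).
  have -> : cabs (c q) ^+ 2 * cabs (gA d q) ^+ 2 * (W * Num.sqrt (1 + `|cIm q|)) =
     cabs (gA d q) ^+ 2 * (cabs (c q) ^+ 2 * (W * Num.sqrt (1 + `|cIm q|))) by ring.
  have -> : E * (W * (cabs (c q) ^+ 2 * Num.sqrt (1 + `|cIm q|))) =
     E * (cabs (c q) ^+ 2 * (W * Num.sqrt (1 + `|cIm q|))) by ring.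
  exact: ler_wpM2r.
pose eta := e / 4; have eta0 : 0 < eta by rewrite divr_gt0.
have cp := is_trig_cont tp; have cg : continuous g by exact: Rem_cont.
have cgp : continuous (fun x => `|g x - p x|) by apply/continuous_abs/contB.
apply: (@le_trans _ _ (rI (fun y => ((C + B) * E4 + eta) + eta^-1 * cabs (Sh y) ^+ 2) y0 (y0 + 1))).
  apply: rI_le.
  - exact: cgp.
  - by apply: contD; [exact: cont_cst|apply: contM => //; exact: cont_cst].
  - move=> y yy; apply: (le_trans (ptw y yy)); rewrite -addrA lerD2l.
    by apply: le_add_sqr_div => //; exact: cabs_ge0.
have yl : y0 <= y0 + 1 by rewrite lerDl.
rewrite rID; [|exact: cont_cst|by apply: contM => //; exact: cont_cst].
rewrite rI_cst // rIZ // (_ : y0 + 1 - y0 = 1); last ring.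
have k2 : (C + B) * E4 <= e / 2.
  rewrite /E4 expRN ler_pdivrMr ?expR_gt0 //.
  have h1 := expR_ge1Dx (y0 / 4).
  have h2 : 8 * (C + B) / e <= y0 by lra.
  rewrite ler_pdivrMr // in h2.
  have h3 : e / 2 * (1 + y0 / 4) <= e / 2 * expR (y0 / 4) by rewrite ler_wpM2l // divr_ge0 // ltW.
  by move: (expR (y0 / 4)) h1 h3 => v h1 h3; lra.
have k1 : eta^-1 * rI (fun y => cabs (Sh y) ^+ 2) y0 (y0 + 1) <= e / 4.
  by rewrite mulrC ler_pdivrMr //; exact: Shi.
rewrite mulr1; apply: (@le_trans _ _ (e / 2 + eta + e / 4)).
  by apply: lerD => //; rewrite lerD2r.
by rewrite le_eqVlt; apply/orP; left; apply/eqP; rewrite /eta; field.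
Qed.

End Distribution.

Theorem theorem1p1 (R : realType) (zeta : R[i]^o -> R[i]^o)
    (zetaP : is_riemann_zeta zeta) (k : nat) (k_ge2 : (2 <= k)%N)
    (RH : riemann_hypothesis zeta) (simple : simple_zeros zeta)
    (J_bound : exists C : R,
      forall T : R, 2 <= T -> (Jm1 zeta T <= (C * T)%:E)%E)
    (zeta'_bound : exists eps : R, 0 < eps /\ exists C : R,
      forall rho : R[i]^o, nontrivial_zero zeta rho ->
        (cabs (derive1 zeta rho))^-1 <= C * cabs rho `^ (2^-1 - eps)) :
  exists mu : probability (measurableTypeR R) R,
    forall f : R -> R, continuous f ->
      (exists M : R, forall x, `|f x| <= M) ->
      Y^-1 * (\int[@lebesgue_measure R]_(y in `[0, Y])
                f (expR (- (y / 2)) * Rem (k - 1) (expR y)))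
        @[Y --> +oo] --> \int[mu]_x f x.
Proof.
(* The condition [k >= 2] enters here: it makes the weight continuous at its cut-off and gives the
   Perron kernel at least inverse square decay. *)
have j1 : (1 <= k - 1)%N by rewrite subn_gt0.
by exists (limit_law (Rem_AP zetaP RH simple J_bound j1)) => f cf bf; exact: limiting_distribution.
Qed.
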